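(* Let $\alpha$ be an ordinal with a ptime representation $\mathfrak{O}$. Then $\mathrm{TSP}(\mathrm{PA}+\bigcup_{\beta\in\mathcal{O}}\mathrm{TI}(\prec_\beta))=\bigcup_{\beta\in\mathcal{O}}\mathrm{LS}(\preceq_\beta)$ and $\mathrm{TFNP}(\mathrm{PA}+\bigcup_{\beta\in\mathcal{O}}\mathrm{TI}(\prec_\beta))=\bigcup_{\beta\in\mathcal{O}}\mathrm{PLS}(\preceq_\beta)$.
   Context: $\mathcal{L}_{\mathrm{PV}}$ is the language with a function symbol for every polynomial-time algorithm in Cobham's characterization; $\mathrm{PV}$ is Cook's universal theory of polynomial-time functions (first-order form). $|y|$ is the binary length. A ptime representation of an infinite ordinal $\alpha$ closed under $+,\cdot,\beta\mapsto\omega^\beta$ is a tuple $(\mathcal{O},\prec,+,\cdot,\dotminus,d,o,x\mapsto\omega^x,\mathbf{0},\mathbf{1},\omega)$: $\mathcal{O}(x)$, $x\prec y$ quantifier-free $\mathcal{L}_{\mathrm{PV}}$-formulas, $+,\cdot,\dotminus$ (left subtraction), $d$ (left division), $o$ $\mathcal{L}_{\mathrm{PV}}$-terms, $x\mapsto\omega^x$ primitive recursive, $(\mathcal{O},\prec)\cong(\alpha,<)$, with $\mathrm{PV}$ proving basic ordinal arithmetic (discrete total order with minimum $\mathbf{0}$; associativity, left distributivity, neutral elements; strict monotonicity of left addition and of nonzero left multiplication; weak monotonicity on the right; defining properties of $\dotminus$ and $d$; $o$ an order-isomorphism of $\mathbb{N}$ onto the ordinals below $\omega$ with $o(0)=\mathbf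 0,o(1)=\mathbf 1$), and $\mathrm{PRA}$ proving the basic properties of $\omega^x$ (monotone, $\omega^{\mathbf 0}=\mathbf 1$, $\omega^{\mathbf 1}=\omega$, maps addition to multiplication, continuous at limits, Cantor normal forms). Greek-letter variables range over $\mathcal{O}$. $\mathrm{PA}$ is $\mathrm{PV}$ plus induction for all $\mathcal{L}_{\mathrm{PV}}$-formulas; $\mathrm{TI}(\prec_\beta)$ is the scheme $\forall\gamma\prec\beta[\forall\delta\prec\gamma A(\delta)\to A(\gamma)]\to\forall\gamma\prec\beta A(\gamma)$ for all $\mathcal{L}_{\mathrm{PV}}$-formulas $A$. For a theory $T$ over $\mathcal{L}_{\mathrm{PV}}$, $\mathrm{TSP}(T)$ is the class of quantifier-free $\mathcal{L}_{\mathrm{PV}}$-formulas $A(\bar{x},\bar{y})$ with $T\vdash\forall\bar{x}\exists\bar{y}A(\bar{x},\bar{y})$; $\mathrm{TFNP}(T)$ is the subclass of those for which there are polynomials $\bar{r}$ with $\mathrm{PV}\vdash A(\bar{x},\bar{y})\to\bigwedge_i|y_i|\le r_i(|\bar{x}|)$. For $\beta\in\mathcal{O}$ and quantifier-free $A(\bar{x},\bar{y})$, an $\mathrm{LS}(\preceq_\beta)$-program for $A$ consists of a sequence of $\mathcal{L}_{\mathrm{PV}}$-terms $\bar{i}(\bar{x})$, a quantifier-free $\mathcal{L}_{\mathrm{PV}}$-formula $G(\gamma,\bar{x},\bar{z})$, a sequence of terms $\bar{N}(\gamma,\bar{x},\bar{z})$, a term $q(\gamma,\bar{x},\bar{z})$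 and a sequence of terms $\bar{p}(\bar{x},\bar{z})$ such that $\mathrm{PV}\vdash G(\beta,\bar{x},\bar{i}(\bar{x}))$; $\mathrm{PV}\vdash\gamma\neq0\to q(\gamma,\bar{x},\bar{z})\prec\gamma$; $\mathrm{PV}\vdash\gamma\neq0\to[G(\gamma,\bar{x},\bar{z})\to G(q(\gamma,\bar{x},\bar{z}),\bar{x},\bar{N}(\gamma,\bar{x},\bar{z}))]$; $\mathrm{PV}\vdash G(0,\bar{x},\bar{z})\to A(\bar{x},\bar{p}(\bar{x},\bar{z}))$. $\mathrm{LS}(\preceq_\beta)$ is the class of $A$ having such a program; $\mathrm{PLS}(\preceq_\beta)=\mathrm{LS}(\preceq_\beta)\cap\mathrm{TFNP}(\mathrm{Th}(\mathbb{N}))$. *)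

(* Defs.v *)
From Stdlib Require List.
From mathcomp Require Import all_boot.

Set Implicit Arguments.
Unset Strict Implicit.
Unset Printing Implicit Defensive.

Definition scons T n (a : T) (f : 'I_n -> T) : 'I_n.+1 -> T :=
  fun i => oapp f a (unlift ord0 i).

Definition fcat T m n (f : 'I_m -> T) (g : 'I_n -> T) : 'I_(m + n) -> T :=
  fun i => match split i with inl j => f j | inr j => g j end.

(** * First-order logic with equality over a functional signature [S]
    ([S k] is the type of [k]-ary function symbols).  Syntax is well-scoped
    de Bruijn: [formula S n] has its free variables among [0, .., n-1], and
    [fall] binds variable [0] of its body. *)

Inductive term (S : nat -> Type) (n : nat) : Type :=
| tvar of 'I_n
| tapp k of S k & ('I_k -> term S n).
Arguments tvar {S n}.

Inductive formula (S : nat -> Type) : nat -> Type :=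
| fbot n : formula S n
| feq n of term S n & term S n : formula S n
| fimp n of formula S n & formula S n : formula S n
| fall n of formula S n.+1 : formula S n.
Arguments fbot {S n}.

Declare Scope fo_scope.
Delimit Scope fo_scope with fo.
Bind Scope fo_scope with formula.

Section Syntax.
Variable S : nat -> Type.

Definition fneg n (A : formula S n) := fimp A fbot.
Definition ftop n : formula S n := fneg fbot.
Definition fand n (A B : formula S n) := fneg (fimp A (fneg B)).
Definition for_ n (A B : formula S n) := fimp (fneg A) B.
Definition fex n (A : formula S n.+1) : formula S n := fneg (fall (fneg A)).

Fixpoint qf n (A : formula S n) : Prop :=
  match A with
  | fbot _ | feq _ _ _ => True
  | fimp _ A B => qf A /\ qf B
  | fall _ _ => False
  end.

Fixpoint tsubst n m (s : 'I_n -> term S m) (t : term S n) : term S m :=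
  match t with
  | tvar i => s i
  | tapp _ f ts => tapp f (fun j => tsubst s (ts j))
  end.

Definition tshift n : term S n -> term S n.+1 :=
  tsubst (fun i => tvar (lift ord0 i)).

Definition up n m (s : 'I_n -> term S m) : 'I_n.+1 -> term S m.+1 :=
  scons (tvar ord0) (fun i => tshift (s i)).

Fixpoint fsubst n (A : formula S n) : forall m, ('I_n -> term S m) -> formula S m :=
  match A with
  | fbot _ => fun _ _ => fbot
  | feq _ t u => fun _ s => feq (tsubst s t) (tsubst s u)
  | fimp _ A B => fun _ s => fimp (fsubst A s) (fsubst B s)
  | fall _ A => fun _ s => fall (fsubst A (up s))
  end.

Definition fshift n (A : formula S n) : formula S n.+1 :=
  fsubst A (fun i => tvar (lift ord0 i)).

Definition inst n (A : formula S n.+1) (t : term S n) : formula S n :=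
  fsubst A (scons t tvar).

(* [A(x)] becomes [A(t(x))]; the other variables are unchanged. *)
Definition inst_var n (A : formula S n.+1) (t : term S n.+1) : formula S n.+1 :=
  fsubst A (scons t (fun i => tvar (lift ord0 i))).

(* A closed term, resp. sentence, in any context. *)
Definition twk n (t : term S 0) : term S n := tsubst (tnth [tuple]) t.
Definition fwk n (A : formula S 0) : formula S n := fsubst A (tnth [tuple]).

Fixpoint alls n : formula S n -> formula S 0 :=
  match n with
  | 0 => fun A => A
  | n'.+1 => fun A => @alls n' (fall A)
  end.

(* Binds the first [m] variables. *)
Fixpoint exs m n : formula S (m + n) -> formula S n :=
  match m with
  | 0 => fun A => A
  | m'.+1 => fun A => @exs m' n (fex A)
  end.

(* Classical natural deduction: [prov T Gamma A] with [A] and the list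
   [Gamma] of open assumptions in [n] free variables. *)
Inductive prov (T : formula S 0 -> Prop) :
    forall n, seq (formula S n) -> formula S n -> Prop :=
| prov_thy n (Gamma : seq (formula S n)) A : T A -> prov T Gamma (fwk n A)
| prov_hyp n (Gamma : seq (formula S n)) A : List.In A Gamma -> prov T Gamma A
| prov_impI n (Gamma : seq (formula S n)) A B :
    prov T (A :: Gamma) B -> prov T Gamma (fimp A B)
| prov_impE n (Gamma : seq (formula S n)) A B :
    prov T Gamma (fimp A B) -> prov T Gamma A -> prov T Gamma B
| prov_raa n (Gamma : seq (formula S n)) A :
    prov T (fneg A :: Gamma) fbot -> prov T Gamma A
| prov_allI n (Gamma : seq (formula S n)) A :
    prov T (map (@fshift n) Gamma) A -> prov T Gamma (fall A)
| prov_allE n (Gamma : seq (formula S n)) A t :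
    prov T Gamma (fall A) -> prov T Gamma (inst A t)
| prov_refl n (Gamma : seq (formula S n)) t : prov T Gamma (feq t t)
| prov_eq n (Gamma : seq (formula S n)) A t u :
    prov T Gamma (feq t u) -> prov T Gamma (inst A t) -> prov T Gamma (inst A u).

End Syntax.

Arguments ftop {S n}.

Notation "s =~ t" := (feq s t) (at level 32, no associativity) : fo_scope.
Notation "A ==> B" := (fimp A B) : fo_scope.
Notation "~~ A" := (fneg A) : fo_scope.
Notation "A && B" := (fand A B) : fo_scope.
Notation "A || B" := (for_ A B) : fo_scope.
Notation "T |- A" := (prov T [::] A%fo) (at level 90, A at level 89).

Definition v {S n} (k : nat) : term S n.+1 := tvar (inord k).

Definition app0 S n (f : S 0) : term S n := tapp f (tnth [tuple]).
Definition app1 S n (f : S 1) (t : term S n) : term S n := tapp f (tnth [tuple t]).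
Definition app2 S n (f : S 2) (t u : term S n) : term S n :=
  tapp f (tnth [tuple t; u]).
Definition tsubst1 S n (s : term S 1) (t : term S n) := tsubst (tnth [tuple t]) s.
Definition tsubst2 S n (s : term S 2) (t u : term S n) :=
  tsubst (tnth [tuple t; u]) s.
Definition fsubst1 S n (A : formula S 1) (t : term S n) := fsubst A (tnth [tuple t]).
Definition fsubst2 S n (A : formula S 2) (t u : term S n) :=
  fsubst A (tnth [tuple t; u]).

Section ChangeOfSignature.
Variables (S S' : nat -> Type) (e : forall k, S k -> S' k).

Fixpoint tmap n (t : term S n) : term S' n :=
  match t with
  | tvar i => tvar i
  | tapp _ f ts => tapp (e f) (fun j => tmap (ts j))
  end.

Fixpoint fmap n (A : formula S n) : formula S' n :=
  match A with
  | fbot _ => fbot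
  | feq _ t u => feq (tmap t) (tmap u)
  | fimp _ A B => fimp (fmap A) (fmap B)
  | fall _ A => fall (fmap A)
  end.

End ChangeOfSignature.

(** * The language of PV

    [pv_s i] is [x |-> 2x + i]; [pv_msp] is [x, y |-> floor (x / 2^|y|)];
    [pv_smash] is [x, y |-> 2^(|x||y|)]; [pv_leq] is the characteristic
    function of the order.

    [pv_lrn g h k] is the function [f] given by limited recursion on notation:
      [f (0, x) = g x],
      [f (2y + i, x) = h i (y, f (y, x), x)]   when [2y + i <> 0],
    where the limitation is enforced by cutting: a value of the right-hand
    side longer than [k (2y + i, x)] is replaced by [k (2y + i, x)].  When
    [k] does bound the lengths the cut is void; in general it makes every
    [f] so defined polynomial-time without a side condition on symbols. *)

Inductive pvsym : nat -> Type :=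
| pv_zero : pvsym 0
| pv_s of bool : pvsym 1
| pv_half : pvsym 1
| pv_succ : pvsym 1
| pv_len : pvsym 1
| pv_msp : pvsym 2
| pv_add : pvsym 2
| pv_mul : pvsym 2
| pv_smash : pvsym 2
| pv_leq : pvsym 2
| pv_proj n of 'I_n : pvsym n
| pv_comp n k of pvsym k & ('I_k -> pvsym n) : pvsym n
| pv_lrn n of pvsym n & (bool -> pvsym n.+2) & pvsym n.+1 : pvsym n.+1.

Notation pvterm := (term pvsym).
Notation pvform := (formula pvsym).
Notation theory := (pvform 0 -> Prop).

Section PVTerms.
Variable n : nat.
Definition tZ : pvterm n := app0 n pv_zero.
Definition tS i (t : pvterm n) := app1 (pv_s i) t.
Definition tone : pvterm n := tS true tZ.
Definition thalf (t : pvterm n) := app1 pv_half t.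
Definition tsucc (t : pvterm n) := app1 pv_succ t.
Definition tlen (t : pvterm n) := app1 pv_len t.
Definition tmsp (t u : pvterm n) := app2 pv_msp t u.
Definition tadd (t u : pvterm n) := app2 pv_add t u.
Definition tmul (t u : pvterm n) := app2 pv_mul t u.
Definition tsmash (t u : pvterm n) := app2 pv_smash t u.
Definition tleq (t u : pvterm n) := app2 pv_leq t u.
Definition fleq (t u : pvterm n) : pvform n := feq (tleq t u) tone.
Definition fltn (t u : pvterm n) : pvform n := fleq (tsucc t) u.
Definition num (c : nat) : pvterm n := iter c tsucc tZ.
End PVTerms.
Arguments tZ {n}.
Arguments tone {n}.
Arguments num {n}.

(** * The standard model *)

Definition bitlen (x : nat) : nat := up_log 2 x.+1.

(* Recursion on notation; [y] steps always suffice. *)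
Fixpoint notation_rec (fuel : nat) (g : nat) (h : nat -> nat -> nat) (y : nat) :=
  match fuel, y with
  | p.+1, _.+1 => h y (notation_rec p g h y./2)
  | _, _ => g
  end.

Fixpoint pv_eval k (f : pvsym k) : ('I_k -> nat) -> nat :=
  match f with
  | pv_zero => fun _ => 0
  | pv_s i => fun x => (x ord0).*2 + i
  | pv_half => fun x => (x ord0)./2
  | pv_succ => fun x => (x ord0).+1
  | pv_len => fun x => bitlen (x ord0)
  | pv_msp => fun x => x ord0 %/ 2 ^ bitlen (x ord_max)
  | pv_add => fun x => x ord0 + x ord_max
  | pv_mul => fun x => x ord0 * x ord_max
  | pv_smash => fun x => 2 ^ (bitlen (x ord0) * bitlen (x ord_max))
  | pv_leq => fun x => x ord0 <= x ord_max
  | pv_proj _ i => fun x => x i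
  | pv_comp _ _ f g => fun x => pv_eval f (fun j => pv_eval (g j) x)
  | pv_lrn _ g h k => fun yx =>
      let x := fun j => yx (lift ord0 j) in
      notation_rec (yx ord0) (pv_eval g x)
        (fun y r =>
           let a := pv_eval (h (odd y)) (scons y./2 (scons r x)) in
           let b := pv_eval k (scons y x) in
           if bitlen a <= bitlen b then a else b)
        (yx ord0)
  end.

Fixpoint teval n (x : 'I_n -> nat) (t : pvterm n) : nat :=
  match t with
  | tvar i => x i
  | tapp _ f ts => pv_eval f (fun j => teval x (ts j))
  end.

Fixpoint holds n (A : pvform n) : ('I_n -> nat) -> Prop :=
  match A with
  | fbot _ => fun _ => False
  | feq _ t u => fun x => teval x t = teval x u
  | fimp _ A B => fun x => holds A x -> holds B x
  | fall _ A => fun x => forall a, holds A (scons a x)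
  end.

Definition ThN : theory := fun A => holds A (tnth [tuple]).

(** * PV

    The defining axioms are given through all their instances by terms with
    [n] free variables. *)

Section PVDefining.
Local Open Scope fo_scope.

Inductive pv_defining : forall n, pvform n -> Prop :=
| pvd_s0 n : pv_defining (@tS n false tZ =~ tZ)
| pvd_s01 n (t u : pvterm n) : pv_defining (~~ (tS false t =~ tS true u))
| pvd_half n i (t : pvterm n) : pv_defining (thalf (tS i t) =~ t)
| pvd_succ0 n (t : pvterm n) : pv_defining (tsucc (tS false t) =~ tS true t)
| pvd_succ1 n (t : pvterm n) :
    pv_defining (tsucc (tS true t) =~ tS false (tsucc t))
| pvd_len0 n : pv_defining (@tlen n tZ =~ tZ)
| pvd_lenS n i (t : pvterm n) :
    pv_defining (~~ (tS i t =~ tZ) ==> tlen (tS i t) =~ tsucc (tlen t))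
| pvd_msp0 n (t : pvterm n) : pv_defining (tmsp t tZ =~ t)
| pvd_mspS n i (t u : pvterm n) :
    pv_defining (~~ (tS i u =~ tZ) ==> tmsp t (tS i u) =~ thalf (tmsp t u))
| pvd_add0 n (t : pvterm n) : pv_defining (tadd t tZ =~ t)
| pvd_addS n i j (t u : pvterm n) :
    pv_defining (tadd (tS i t) (tS j u) =~
      (if (i && j)%bool then tS false (tsucc (tadd t u))
       else tS (i || j)%bool (tadd t u)))
| pvd_mul0 n (t : pvterm n) : pv_defining (tmul t tZ =~ tZ)
| pvd_mulS n i (t u : pvterm n) :
    pv_defining (tmul t (tS i u) =~
      (if i then tadd (tS false (tmul t u)) t else tS false (tmul t u)))
| pvd_smash0 n (t : pvterm n) : pv_defining (tsmash t tZ =~ tone)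
| pvd_smash01 n : pv_defining (@tsmash n tZ tone =~ tone)
| pvd_smashS1 n i (t : pvterm n) :
    pv_defining (~~ (tS i t =~ tZ) ==>
      tsmash (tS i t) tone =~ tS false (tsmash t tone))
| pvd_smashS n i (t u : pvterm n) :
    pv_defining (~~ (tS i u =~ tZ) ==>
      tsmash t (tS i u) =~ tmul (tsmash t u) (tsmash t tone))
| pvd_leq0 n (u : pvterm n) : pv_defining (tleq tZ u =~ tone)
| pvd_leqS n i j (t u : pvterm n) : (i ==> j)%bool ->
    pv_defining (tleq (tS i t) (tS j u) =~ tleq t u)
| pvd_leqS10 n (t u : pvterm n) :
    pv_defining ((fleq u t ==> tleq (tS true t) (tS false u) =~ tZ) &&
                 (~~ fleq u t ==> tleq (tS true t) (tS false u) =~ tone))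
| pvd_proj n k (i : 'I_k) (ts : 'I_k -> pvterm n) :
    pv_defining (tapp (pv_proj i) ts =~ ts i)
| pvd_comp n k l (f : pvsym l) (g : 'I_l -> pvsym k) (ts : 'I_k -> pvterm n) :
    pv_defining (tapp (pv_comp f g) ts =~ tapp f (fun j => tapp (g j) ts))
| pvd_lrn0 n k (g : pvsym k) h b (ts : 'I_k -> pvterm n) :
    pv_defining (tapp (pv_lrn g h b) (scons tZ ts) =~ tapp g ts)
| pvd_lrnS n k (g : pvsym k) h b i (t : pvterm n) (ts : 'I_k -> pvterm n) :
    let f u := tapp (pv_lrn g h b) (scons u ts) in
    let a := tapp (h i) (scons t (scons (f t) ts)) in
    let c := tapp b (scons (tS i t) ts) in
    pv_defining (~~ (tS i t =~ tZ) ==>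
      ((tmsp a c =~ tZ ==> f (tS i t) =~ a) &&
       (~~ (tmsp a c =~ tZ) ==> f (tS i t) =~ c))).

(* PV is the universal theory of all open formulas derivable from the defining
   axioms by Cook's rule of induction on notation. *)
Inductive PV : pvform 0 -> Prop :=
| PV_def n (A : pvform n) : pv_defining A -> PV (alls A)
| PV_notind n (A : pvform n.+1) : qf A ->
    PV |- inst A tZ ->
    (forall i, PV |- A ==> inst_var A (tS i (tvar ord0))) ->
    PV (alls A).

Inductive PA : pvform 0 -> Prop :=
| PA_PV A : PV A -> PA A
| PA_induct n (A : pvform n.+1) :
    PA (alls (inst A tZ ==>
              fall (A ==> inst_var A (tsucc (tvar ord0))) ==> fall A)).

End PVDefining.

(** * PRA, over PV symbols closed under composition and primitive recursion
    [f (0, x) = g x], [f (y + 1, x) = h (y, f (y, x), x)]. *)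

Inductive prsym : nat -> Type :=
| pr_pv n of pvsym n : prsym n
| pr_comp n k of prsym k & ('I_k -> prsym n) : prsym n
| pr_rec n of prsym n & prsym n.+2 : prsym n.+1.

Notation prterm := (term prsym).
Notation prform := (formula prsym).

Section PRA.
Local Open Scope fo_scope.

Let rZ n : prterm n := app0 n (pr_pv pv_zero).
Let rsucc n (t : prterm n) := app1 (pr_pv pv_succ) t.

Inductive PRA : prform 0 -> Prop :=
| PRA_PV A : PV A -> PRA (fmap pr_pv A)
| PRA_comp n k l (f : prsym l) (g : 'I_l -> prsym k) (ts : 'I_k -> prterm n) :
    PRA (alls (tapp (pr_comp f g) ts =~ tapp f (fun j => tapp (g j) ts)))
| PRA_rec0 n k (g : prsym k) h (ts : 'I_k -> prterm n) :
    PRA (alls (tapp (pr_rec g h) (scons (rZ n) ts) =~ tapp g ts))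
| PRA_recS n k (g : prsym k) h (t : prterm n) (ts : 'I_k -> prterm n) :
    PRA (alls (tapp (pr_rec g h) (scons (rsucc t) ts) =~
               tapp h (scons t (scons (tapp (pr_rec g h) (scons t ts)) ts))))
| PRA_qfind n (A : prform n.+1) : qf A ->
    PRA |- inst A (rZ n) ->
    PRA |- A ==> inst_var A (rsucc (tvar ord0)) ->
    PRA (alls A).

End PRA.

(** * Ordinals, as (representatives of) order types of well-orders *)

Record wellorder : Type := WellOrder {
  wo_sort :> Type;
  wo_lt : wo_sort -> wo_sort -> Prop;
  wo_wf : well_founded wo_lt;
  wo_trans : forall x y z, wo_lt x y -> wo_lt y z -> wo_lt x z;
  wo_total : forall x y, wo_lt x y \/ x = y \/ wo_lt y x
}.

Definition rel_iso (T U : Type) (R : T -> T -> Prop) (Q : U -> U -> Prop) : Prop :=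
  exists2 f : T -> U, bijective f & forall x y, R x y <-> Q (f x) (f y).

Definition seg (alpha : wellorder) (a : alpha) : Type := {x : alpha | wo_lt x a}.
Definition seg_lt (alpha : wellorder) (a : alpha) (x y : seg a) : Prop :=
  wo_lt (sval x) (sval y).

Section OrdinalArithmetic.
Variables (T U : Type) (R : T -> T -> Prop) (Q : U -> U -> Prop).

Definition sum_lt (x y : T + U) : Prop :=
  match x, y with
  | inl a, inl b => R a b
  | inl _, inr _ => True
  | inr _, inl _ => False
  | inr a, inr b => Q a b
  end.

(* Ordinal product [T . U]: [U] copies of [T]. *)
Definition prod_lt (x y : T * U) : Prop :=
  Q x.2 y.2 \/ (x.2 = y.2 /\ R x.1 y.1).

(* [omega ^ T]: finitely supported functions [T -> nat], compared at the
   largest argument where they differ. *)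
Definition omega_exp : Type :=
  {f : T -> nat | exists s : seq T, forall x, f x <> 0 -> List.In x s}.
Definition omega_exp_lt (f g : omega_exp) : Prop :=
  exists2 x, sval f x < sval g x & forall y, R x y -> sval f y = sval g y.

End OrdinalArithmetic.

Definition infinite_ordinal (alpha : wellorder) : Prop :=
  exists f : nat -> alpha, injective f.

Definition closed_ordinal (alpha : wellorder) : Prop :=
  [/\ forall a b : alpha, exists c : alpha,
        rel_iso (sum_lt (@seg_lt _ a) (@seg_lt _ b)) (@seg_lt _ c),
      forall a b : alpha, exists c : alpha,
        rel_iso (prod_lt (@seg_lt _ a) (@seg_lt _ b)) (@seg_lt _ c)
    & forall a : alpha, exists c : alpha,
        rel_iso (omega_exp_lt (@seg_lt _ a)) (@seg_lt _ c)].

(** * Ptime representations *)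

Record ordtuple : Type := OrdTuple {
  o_dom : pvform 1;
  o_lt : pvform 2;
  o_add : pvterm 2;
  o_mul : pvterm 2;
  o_sub : pvterm 2;   (* [x -. y], the [z] with [y + z = x] *)
  o_div : pvterm 2;   (* [d(x, y)], the [z] with [x = y . z + r], [r < y] *)
  o_nat : pvterm 1;
  o_exp : prsym 1;
  o_zero : pvterm 0;
  o_one : pvterm 0;
  o_omega : pvterm 0
}.

Section Representation.
Variables (O : ordtuple).
Local Open Scope fo_scope.

Definition Dom n (t : pvterm n) := fsubst1 (o_dom O) t.
Definition Lt n (t u : pvterm n) := fsubst2 (o_lt O) t u.
Definition Le n (t u : pvterm n) := Lt t u || t =~ u.
Definition Add n (t u : pvterm n) := tsubst2 (o_add O) t u.
Definition Mul n (t u : pvterm n) := tsubst2 (o_mul O) t u.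
Definition Sub n (t u : pvterm n) := tsubst2 (o_sub O) t u.
Definition Div n (t u : pvterm n) := tsubst2 (o_div O) t u.
Definition Nat n (t : pvterm n) := tsubst1 (o_nat O) t.
Definition Zero n : pvterm n := twk n (o_zero O).
Definition One n : pvterm n := twk n (o_one O).
Definition Omega n : pvterm n := twk n (o_omega O).

(* Elements of [O] in the standard model. *)
Definition in_dom (b : nat) : Prop := holds (o_dom O) (tnth [tuple b]).

Definition std_lt (x y : {b : nat | in_dom b}) : Prop :=
  holds (o_lt O) (tnth [tuple sval x; sval y]).

(* In context 3, [b c d] range over ordinals; [x y] over numbers. *)
Let b : pvterm 3 := v 0.
Let c : pvterm 3 := v 1.
Let d : pvterm 3 := v 2.
Let x : pvterm 3 := v 0.
Let y : pvterm 3 := v 1.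
Local Notation PVord A := (PV |- Dom b ==> Dom c ==> Dom d ==> A).

Record PV_ordinal_arithmetic : Prop := {
  dom_zero : PV |- Dom (Zero 0);
  dom_one : PV |- Dom (One 0);
  dom_omega : PV |- Dom (Omega 0);
  dom_add : PVord (Dom (Add b c));
  dom_mul : PVord (Dom (Mul b c));
  dom_sub : PVord (Dom (Sub b c));
  dom_div : PVord (Dom (Div b c));
  lt_irr : PVord (~~ Lt b b);
  lt_tr : PVord (Lt b c ==> Lt c d ==> Lt b d);
  lt_tot : PVord (Lt b c || b =~ c || Lt c b);
  lt_min : PVord (Le (Zero 3) b);
  lt_add1 : PVord (Lt b (Add b (One 3)));
  lt_discrete : PVord (Lt b c ==> Le (Add b (One 3)) c);
  add_assoc : PVord (Add b (Add c d) =~ Add (Add b c) d);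
  mul_assoc : PVord (Mul b (Mul c d) =~ Mul (Mul b c) d);
  mul_add : PVord (Mul b (Add c d) =~ Add (Mul b c) (Mul b d));
  add_zero_l : PVord (Add (Zero 3) b =~ b);
  add_zero_r : PVord (Add b (Zero 3) =~ b);
  mul_one_l : PVord (Mul (One 3) b =~ b);
  mul_one_r : PVord (Mul b (One 3) =~ b);
  add_lt : PVord (Lt c d ==> Lt (Add b c) (Add b d));
  mul_lt : PVord (~~ (b =~ Zero 3) ==> Lt c d ==> Lt (Mul b c) (Mul b d));
  add_le : PVord (Le b c ==> Le (Add b d) (Add c d));
  mul_le : PVord (Le b c ==> Le (Mul b d) (Mul c d));
  sub_le : PVord (Le b c ==> Add b (Sub c b) =~ c);
  sub_zero : PVord (Le c b ==> Sub c b =~ Zero 3);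
  div_spec : PVord (~~ (b =~ Zero 3) ==>
               Le (Mul b (Div c b)) c &&
               Lt c (Mul b (Add (Div c b) (One 3))));
  nat_zero : PV |- Nat (n := 0) tZ =~ Zero 0;
  nat_one : PV |- Nat (n := 0) tone =~ One 0;
  nat_dom : PV |- Dom (Nat x) && Lt (Nat x) (Omega 3);
  nat_lt : PV |- fltn x y ==> Lt (Nat x) (Nat y);
  nat_onto : PV |- Dom b ==> Lt b (Omega 3) ==> fex (Nat (v 0) =~ v 1)
}.

Let pr n (t : pvterm n) : prterm n := tmap pr_pv t.
Let DomR n (t : prterm n) := fsubst1 (fmap pr_pv (o_dom O)) t.
Let LtR n (t u : prterm n) := fsubst2 (fmap pr_pv (o_lt O)) t u.
Let LeR n (t u : prterm n) := LtR t u || t =~ u.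
Let AddR n (t u : prterm n) := tsubst2 (pr (o_add O)) t u.
Let MulR n (t u : prterm n) := tsubst2 (pr (o_mul O)) t u.
Let Exp n (t : prterm n) := app1 (o_exp O) t.
Let zeroR n : prterm n := pr (Zero n).
Let oneR n : prterm n := pr (One n).
Let succR n (t : prterm n) : prterm n := app1 (pr_pv pv_succ) t.
Let ltnR n (t u : prterm n) : prform n :=
  app2 (pr_pv pv_leq) (succR t) u =~ pr tone.

Let b' : prterm 2 := v 0.
Let c' : prterm 2 := v 1.
Let i' : prterm 2 := v 1.

Record PRA_exponentiation : Prop := {
  exp_dom : PRA |- DomR b' ==> DomR (Exp b');
  exp_lt : PRA |- DomR b' ==> DomR c' ==> LtR b' c' ==> LtR (Exp b') (Exp c');
  exp_zero : PRA |- Exp (zeroR 0) =~ oneR 0;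
  exp_one : PRA |- Exp (oneR 0) =~ pr (Omega 0);
  exp_add : PRA |- DomR b' ==> DomR c' ==>
              Exp (AddR b' c') =~ MulR (Exp b') (Exp c');
  (* For a limit [b], every [c < omega^b] is below [omega^x], some [x < b];
     under the inner quantifiers [x] is [v 0], [b] is [v 1], [c] is [v 2]. *)
  exp_limit : PRA |- DomR b' ==> DomR c' ==>
    ~~ (b' =~ zeroR 2) ==>
    fall (DomR (v 0) ==> LtR (v 0) (v 1) ==> LtR (AddR (v 0) (oneR 3)) (v 1)) ==>
    LtR c' (Exp b') ==>
    fex (DomR (v 0) && LtR (v 0) (v 1) && LtR (v 2) (Exp (v 0)));
  (* Cantor normal form: [b] is the sum of [omega^(e (b, i))] for [i < l b],
     with non-increasing exponents; [s (b, i)] is the sum of the first [i]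
     terms. *)
  exp_cnf : exists (l : prsym 1) (e s : prsym 2),
    [/\ PRA |- DomR b' ==> app2 s b' (pr tZ) =~ zeroR 2,
        PRA |- DomR b' ==> ltnR i' (app1 l b') ==>
          DomR (app2 e b' i') &&
          app2 s b' (succR i') =~ AddR (app2 s b' i') (Exp (app2 e b' i')),
        PRA |- DomR b' ==> ltnR (succR i') (app1 l b') ==>
          LeR (app2 e b' (succR i')) (app2 e b' i')
      & PRA |- DomR b' ==> app2 s b' (app1 l b') =~ b']
}.

Record ptime_representation (alpha : wellorder) : Prop := {
  rep_infinite : infinite_ordinal alpha;
  rep_closed : closed_ordinal alpha;
  rep_dom_qf : qf (o_dom O);
  rep_lt_qf : qf (o_lt O);
  rep_iso : rel_iso std_lt (@wo_lt alpha);
  rep_arith : PV_ordinal_arithmetic;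
  rep_exp : PRA_exponentiation
}.

(** * Transfinite induction *)

(* [A(v 0)], with parameters; in the innermost scope the induction variables
   are [delta = v 0] and [gamma = v 1]. *)
Definition ti_formula (beta n : nat) (A : pvform n.+1) : pvform n :=
  fall (Dom (v 0) ==> Lt (v 0) (num beta) ==>
        fall (Dom (v 0) ==> Lt (v 0) (v 1) ==>
              fsubst A (scons (v 0) (fun i => tvar (lift ord0 (lift ord0 i)))))
        ==> A)
  ==> fall (Dom (v 0) ==> Lt (v 0) (num beta) ==> A).

Inductive TI (beta : nat) : pvform 0 -> Prop :=
| TI_ax n (A : pvform n.+1) : TI beta (alls (ti_formula beta A)).

Definition PA_TI : theory :=
  fun A => PA A \/ exists2 beta, in_dom beta & TI beta A.

End Representation.

(** * Total search problems

    A formula [A(x, y)] with [n] inputs [x] and [m] outputs [y] is an element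
    of [pvform (m + n)]: the outputs are the first [m] variables. *)

Definition TSP (T : theory) n m (A : pvform (m + n)) : Prop :=
  qf A /\ (T |- alls (exs A)).

Inductive polynomial (n : nat) : Type :=
| poly_const of nat
| poly_var of 'I_n
| poly_add of polynomial n & polynomial n
| poly_mul of polynomial n & polynomial n.

Fixpoint poly_term n k (x : 'I_n -> pvterm k) (r : polynomial n) : pvterm k :=
  match r with
  | poly_const c => num c
  | poly_var i => x i
  | poly_add r1 r2 => tadd (poly_term x r1) (poly_term x r2)
  | poly_mul r1 r2 => tmul (poly_term x r1) (poly_term x r2)
  end.

Definition TFNP (T : theory) n m (A : pvform (m + n)) : Prop :=
  TSP T A /\
  exists r : 'I_m -> polynomial n,
    PV |- fimp A
      (\big[@fand pvsym (m + n)/ftop]_(j < m)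
         fleq (tlen (tvar (lshift n j)))
              (poly_term (fun i => tlen (tvar (rshift m i))) (r j))).

(** * Local search along a represented ordinal *)

Section LocalSearch.
Variables (O : ordtuple) (beta : nat).
Local Open Scope fo_scope.

(* Variables: [gamma = 0], then the [k] variables [z], then the [n] inputs
   [x]; [p] has variables [z, x]. *)
Record LS_program n m (A : pvform (m + n)) : Type := LSProgram {
  ls_k : nat;
  ls_i : 'I_ls_k -> pvterm n;
  ls_G : pvform (ls_k + n).+1;
  ls_N : 'I_ls_k -> pvterm (ls_k + n).+1;
  ls_q : pvterm (ls_k + n).+1;
  ls_p : 'I_m -> pvterm (ls_k + n);
  ls_G_qf : qf ls_G;
  ls_init : PV |- fsubst ls_G (scons (num beta) (fcat ls_i tvar));
  ls_desc : PV |- Dom O (tvar ord0) ==> ~~ (tvar ord0 =~ Zero O _) ==>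
              Dom O ls_q && Lt O ls_q (tvar ord0);
  ls_step : PV |- Dom O (tvar ord0) ==> ~~ (tvar ord0 =~ Zero O _) ==>
              ls_G ==>
              fsubst ls_G (scons ls_q
                (fcat ls_N (fun i => tvar (lift ord0 (rshift ls_k i)))));
  ls_final : PV |- fsubst ls_G (scons (Zero O _) tvar) ==>
               fsubst A (fcat ls_p (fun i => tvar (rshift ls_k i)))
}.

Definition LS n m (A : pvform (m + n)) : Prop := qf A /\ inhabited (LS_program A).

Definition PLS n m (A : pvform (m + n)) : Prop := LS A /\ TFNP ThN A.

End LocalSearch.

(* Main.v *)
(** The inclusion of TSP in LS.  Derivability in PV is replaced by truth in all
    models of PV, which is legitimate for open formulas because PV is universal.
    Let [K] be the class of models of PV in which every local search problem
    along a standard ordinal is total.  By Herbrand's theorem, applied with an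
    oracle for each of these problems, a search problem that is total in all
    models in [K] is itself a local search problem.  In models in [K] a search
    along a standard ordinal whose steps are only total (not polynomial-time)
    still terminates; hence they admit primitive recursion, satisfy PRA, and
    have [omega ^ x].

    A proof in PA with transfinite induction uses finitely many instances of
    the schemes.  Their quantifiers and inductions are eliminated by finitely
    many oracles: oracle [i] returns, at [s], a [u] minimizing an ordinal
    [d_i (u, s)] that is computed with the oracles of smaller index.  By
    Herbrand's theorem finitely many queries lead to a solution or to some [u]
    that refutes the minimality of an answer.  The oracle of largest index is
    then removed by guessing: its answers are [0] at first, and when one of them
    is refuted it is replaced by the better value [u], and the search resumes
    in the state that asked for it.  A correction lowers the rank [d_n] of the
    answer, so that a search along [g] becomes one along roughly [omega ^ g].

    Conversely, the totality of a local search with invariant [G] is proved by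
    transfinite induction on [g] for [forall z, ~ G g z x].  The statement on
    TFNP follows, because the standard model is in [K]. *)

From mathcomp Require Import all_boot.
From mathcomp Require Import boolp classical_sets.
From mathcomp Require Import zify.
Require Import Defs.

Set Implicit Arguments.
Unset Strict Implicit.
Unset Printing Implicit Defensive.

(** * Structures *)

(** Functions and relations are families indexed by all models, each given by one term or one open
    formula for all of them. Bounds of searches are families of numerals, because [beta] is one; for
    standard b the ordinal omega ^ b is again a numeral, as its value in the standard model
    transfers along an open graph.

    The obstacle in removing an oracle is that omega ^ x is only primitive recursive, so the steps
    of the new search cannot compute the ordinals that they carry. They ask for them instead, by
    queries under the tag [te]. These queries survive all the eliminations and are answered at the
    very end, where searches with steps that are merely total are available in [K].

    The ordinal of a run with guessed answers is essentially a sum of terms E . r, one for each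
    guess, where r is the rank of the answer and E = omega ^ (b3 . g), with g the ordinal of the old
    search at the moment of asking. A correction lowers one r and cuts off all later terms; the
    terms that may follow it anew belong to smaller ordinals g and stay below E together. *)

Record struct (S : nat -> Type) := Struct {
  car :> Type;
  sapp : forall k, S k -> ('I_k -> car) -> car }.

Lemma scons0 T n (a : T) (f : 'I_n -> T) : scons a f ord0 = a.
Proof. by rewrite /scons unlift_none. Qed.

Lemma sconsS T n (a : T) (f : 'I_n -> T) i : scons a f (lift ord0 i) = f i.
Proof. by rewrite /scons liftK. Qed.

Lemma scons_eta T n (x : 'I_n.+1 -> T) :
  scons (x ord0) (fun i => x (lift ord0 i)) = x.
Proof.
by apply/funext => i; case: (unliftP ord0 i) => [j|] ->; rewrite ?sconsS ?scons0.
Qed.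

Lemma scons_comp T U n (h : T -> U) (a : T) (f : 'I_n -> T) :
  (fun i => h (scons a f i)) = scons (h a) (fun i => h (f i)).
Proof.
by apply/funext => i; case: (unliftP ord0 i) => [j|] ->; rewrite ?sconsS ?scons0.
Qed.

Lemma tnth_comp1 T U (h : T -> U) a : (fun i => h (tnth [tuple a] i)) = tnth [tuple h a].
Proof. by apply/funext => i; rewrite -(tnth_map h); congr tnth; apply/val_inj. Qed.

Lemma tnth_comp2 T U (h : T -> U) a b :
  (fun i => h (tnth [tuple a; b] i)) = tnth [tuple h a; h b].
Proof. by apply/funext => i; rewrite -(tnth_map h); congr tnth; apply/val_inj. Qed.

Lemma env1E T (x : 'I_1 -> T) : x = (fun _ => x ord0).
Proof. by apply/funext => i; congr x; apply/val_inj; case: i => [[]]. Qed.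

Lemma env2E T (x : 'I_2 -> T) : x = tnth [tuple x ord0; x ord_max].
Proof.
by apply/funext => i; case: i => [[|[|//]] h]; rewrite (tnth_nth (x ord0)) /=;
  congr x; apply/val_inj.
Qed.

Lemma env0E T (f g : 'I_0 -> T) : f = g.
Proof. by apply/funext; case. Qed.

Lemma fcat0 T n (f : 'I_0 -> T) (g : 'I_n -> T) : fcat f g = g.
Proof.
apply/funext => i; rewrite /fcat; case: splitP => [[]//|j ij].
by congr g; apply/val_inj.
Qed.

Lemma fcatS T m n (y : 'I_m.+1 -> T) (x : 'I_n -> T) :
  fcat y x = scons (y ord0) (fcat (fun j => y (lift ord0 j)) x)
  :> ('I_(m + n).+1 -> T).
Proof.
apply/funext => i; case: (unliftP ord0 i) => [j|] ->; rewrite ?sconsS ?scons0.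
  rewrite /fcat; case: splitP => [a|b]; case: splitP => [a'|b'] /=;
    rewrite /bump /= ?add1n ?addnS => e1 e2.
  - by congr y; apply/val_inj; rewrite /= /bump /= -e2 e1.
  - by have := ltn_ord a; rewrite -e2 e1 ltnS ltnNge leq_addr.
  - by have := ltn_ord a'; rewrite -e1; case: e2 => -> /=; rewrite ltnNge leq_addr.
  - by congr x; apply/val_inj/(@addnI m); rewrite -e1; case: e2 => ->.
rewrite /fcat; case: splitP => [a|b] /= e.
  by congr y; apply/val_inj; rewrite /= -e.
by move: e; rewrite addSn.
Qed.

Section Eval.
Variables (S : nat -> Type) (M : struct S).

Fixpoint ev n (x : 'I_n -> M) (t : term S n) : M :=
  match t with
  | tvar i => x i
  | tapp _ f ts => sapp f (fun j => ev x (ts j))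
  end.

Fixpoint sat n (A : formula S n) : ('I_n -> M) -> Prop :=
  match A with
  | fbot _ => fun _ => False
  | feq _ t u => fun x => ev x t = ev x u
  | fimp _ A B => fun x => sat A x -> sat B x
  | fall _ A => fun x => forall a, sat A (scons a x)
  end.

Lemma ev_tsubst n m (s : 'I_n -> term S m) (x : 'I_m -> M) t :
  ev x (tsubst s t) = ev (fun i => ev x (s i)) t.
Proof. by elim: t => //= k f ts IH; congr sapp; apply/funext. Qed.

Lemma ev_tshift n (x : 'I_n -> M) a t : ev (scons a x) (tshift t) = ev x t.
Proof. by rewrite ev_tsubst; congr ev; apply/funext => i; exact: sconsS. Qed.

Lemma ev_up n m (s : 'I_n -> term S m) x a :
  (fun i => ev (scons a x) (up s i)) = scons a (fun i => ev x (s i)).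
Proof.
rewrite /up scons_comp /= scons0; congr scons.
by apply/funext => i; rewrite ev_tshift.
Qed.

Lemma sat_fsubst n (A : formula S n) m (s : 'I_n -> term S m) x :
  sat (fsubst A s) x <-> sat A (fun i => ev x (s i)).
Proof.
elim: A m s x => {n} [n|n t u|n A IA B IB|n A IA] m s x //=.
- by rewrite !ev_tsubst.
- by split=> H /(IA _ s x)/H/(IB _ s x).
- by split=> H a; have := H a; rewrite IA ev_up.
Qed.

Lemma sat_fshift n (A : formula S n) a x : sat (fshift A) (scons a x) <-> sat A x.
Proof.
rewrite sat_fsubst; suff -> : (fun i => ev (scons a x) (tvar (lift ord0 i))) = x by [].
by apply/funext => i; exact: sconsS.
Qed.

Lemma sat_inst n (A : formula S n.+1) t x : sat (inst A t) x <-> sat A (scons (ev x t) x).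
Proof. by rewrite sat_fsubst scons_comp. Qed.

Lemma sat_inst_var n (A : formula S n.+1) t x a :
  sat (inst_var A t) (scons a x) <-> sat A (scons (ev (scons a x) t) x).
Proof.
rewrite sat_fsubst scons_comp /=.
suff -> : (fun i => scons a x (lift ord0 i)) = x by [].
by apply/funext => i; exact: sconsS.
Qed.

Lemma sat_fwk n (A : formula S 0) (x : 'I_n -> M) y : sat (fwk n A) x <-> sat A y.
Proof. by rewrite sat_fsubst; rewrite (env0E (fun i => _) y). Qed.

Lemma sat_alls n (A : formula S n) y : sat (alls A) y <-> forall x, sat A x.
Proof.
elim: n A y => [|n IH] A y /=.
  by split=> [H x|H]; rewrite ?(env0E x y).
rewrite IH; split=> [H x|H x a]; last exact: H.
by rewrite -(scons_eta x); apply: H.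
Qed.

Lemma sat_imp n (A B : formula S n) x : sat (fimp A B) x -> sat A x -> sat B x.
Proof. by []. Qed.

Lemma sat_neg n (A : formula S n) x : sat (fneg A) x <-> ~ sat A x.
Proof. by []. Qed.

Lemma sat_and n (A B : formula S n) x : sat (fand A B) x <-> sat A x /\ sat B x.
Proof.
rewrite /fand /=; split=> [H|[a b] H]; last exact: H.
by split; apply: contrapT => h; apply: H => // ? ?; apply: h.
Qed.

Lemma sat_or n (A B : formula S n) x : sat (for_ A B) x <-> sat A x \/ sat B x.
Proof.
rewrite /for_ /=; split=> [H|[a|b] H //].
by case: (pselect (sat A x)) => a; [left|right; apply: H].
Qed.

Lemma sat_ex n (A : formula S n.+1) x : sat (fex A) x <-> exists a, sat A (scons a x).
Proof.
rewrite /fex /=; split=> [H|[a h] H]; last exact: (H a).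
by apply: contrapT => h; apply: H => a ha; apply: h; exists a.
Qed.

Lemma sat_exs m n (A : formula S (m + n)) x :
  sat (exs A) x <-> exists y : 'I_m -> M, sat A (fcat y x).
Proof.
elim: m A => [|m IH] A.
  split=> [H|[y]]; last by rewrite fcat0.
  by exists (fun i : 'I_0 => False_rect _ (notF (ltn_ord i))); rewrite fcat0.
rewrite IH; split=> [[y /sat_ex[a H]]|[y H]].
  exists (scons a y); rewrite fcatS scons0.
  by rewrite (_ : (fun j => _) = y) //; apply/funext => j; rewrite sconsS.
exists (fun j => y (lift ord0 j)); apply/sat_ex; exists (y ord0).
by move: H; rewrite fcatS.
Qed.

End Eval.

(* A structural fixpoint: it occurs inside the recursions on the nested
   inductive predicates [PV] and [PRA]. *)
Section Monotonicity.
Variables (S : nat -> Type) (T T' : formula S 0 -> Prop) (sub : forall A, T A -> T' A).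

Fixpoint prov_mono n (G : seq (formula S n)) A (d : prov T G A) : prov T' G A :=
  match d with
  | prov_thy _ G _ t => prov_thy G (sub t)
  | prov_hyp _ _ _ i => prov_hyp T' i
  | prov_impI _ _ _ _ d => prov_impI (prov_mono d)
  | prov_impE _ _ _ _ d d' => prov_impE (prov_mono d) (prov_mono d')
  | prov_raa _ _ _ d => prov_raa (prov_mono d)
  | prov_allI _ _ _ d => prov_allI (prov_mono d)
  | prov_allE _ _ _ t d => prov_allE t (prov_mono d)
  | prov_refl _ G t => prov_refl T' G t
  | prov_eq _ _ _ _ _ d d' => prov_eq (prov_mono d) (prov_mono d')
  end.
End Monotonicity.

(** * Soundness of natural deduction *)

Section Soundness.
Variables (S : nat -> Type) (C : struct S -> Prop) (T : formula S 0 -> Prop).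
Hypothesis TC : forall A, T A -> forall M, C M -> forall x, sat (M := M) A x.

(** The class [C] is a parameter: soundness is applied to all models of PV, to the standard
    structure alone, and to the expansions [prS M] of the models in [K]. *)
Lemma prov_sound n (Gamma : seq (formula S n)) A : prov T Gamma A ->
  forall M, C M -> forall x : 'I_n -> M,
    (forall B, List.In B Gamma -> sat B x) -> sat A x.
Proof.
elim=> {n Gamma A}.
- move=> n Gamma A TA M CM x _.
  exact: (proj2 (sat_fwk A x (fun i : 'I_0 => False_rect _ (notF (ltn_ord i)))) (TC TA CM _)).
- by move=> n Gamma A inA M CM x H; apply: H.
- move=> n Gamma A B _ IH M CM x H a; apply: IH => // X.
  by case=> [<-//|]; apply: H.
- by move=> n Gamma A B _ IH1 _ IH2 M CM x H; apply: (IH1 M CM x H); apply: IH2.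
- move=> n Gamma A _ IH M CM x H; apply: contrapT => a.
  by apply: (IH M CM x) => X; case=> [<-//|]; apply: H.
- move=> n Gamma A _ IH M CM x H a; apply: IH => // X /List.in_map_iff[Y [<- iY]].
  by apply/sat_fshift; apply: H.
- by move=> n Gamma A t _ IH M CM x H; apply/sat_inst; apply: (IH M CM x H).
- by [].
- move=> n Gamma A t u _ IH1 _ IH2 M CM x H; apply/sat_inst.
  have <- : ev x t = ev x u := IH1 M CM x H.
  by apply/sat_inst; apply: IH2.
Qed.
End Soundness.

(** * Syntactic substitution *)

Section Subst.
Variable S : nat -> Type.

Lemma tsubst_comp n m k (s : 'I_n -> term S m) (s' : 'I_m -> term S k) t :
  tsubst s' (tsubst s t) = tsubst (fun i => tsubst s' (s i)) t.
Proof. by elim: t => //= l f ts IH; congr tapp; apply/funext. Qed.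

Lemma tsubst_id n (t : term S n) : tsubst tvar t = t.
Proof. by elim: t => //= l f ts IH; congr tapp; apply/funext. Qed.

Lemma tsubst_tshift n m (s : 'I_n.+1 -> term S m) t :
  tsubst s (tshift t) = tsubst (fun i => s (lift ord0 i)) t.
Proof. by rewrite tsubst_comp. Qed.

Lemma up_comp n m k (s : 'I_n -> term S m) (s' : 'I_m -> term S k) :
  (fun i => tsubst (up s') (up s i)) = up (fun i => tsubst s' (s i)).
Proof.
rewrite /up scons_comp /= scons0; congr scons; apply/funext => i.
rewrite tsubst_tshift /tshift tsubst_comp; congr tsubst; apply/funext => j.
by rewrite sconsS.
Qed.

Lemma fsubst_comp n (A : formula S n) m k (s : 'I_n -> term S m) (s' : 'I_m -> term S k) :
  fsubst (fsubst A s) s' = fsubst A (fun i => tsubst s' (s i)).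
Proof.
elim: A m k s s' => {n} [n|n t u|n A IA B IB|n A IA] m k s s' //=.
- by rewrite !tsubst_comp.
- by rewrite IA IB.
- by rewrite IA up_comp.
Qed.

Lemma up_tvar n : up (tvar (S := S)) = tvar :> ('I_n.+1 -> _).
Proof.
by apply/funext => i; rewrite /up; case: (unliftP ord0 i) => [j|] ->; rewrite ?sconsS ?scons0.
Qed.

Lemma fsubst_id n (A : formula S n) : fsubst A tvar = A.
Proof.
elim: A => {n} [n|n t u|n A IA B IB|n A IA] //=; rewrite ?tsubst_id ?IA ?IB //.
by rewrite up_tvar IA.
Qed.

Lemma inst_up n m (A : formula S n.+1) (s : 'I_n -> term S m) t :
  inst (fsubst A (up s)) t = fsubst A (scons t s).
Proof.
rewrite /inst fsubst_comp; congr fsubst; rewrite /up scons_comp /= scons0.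
congr scons; apply/funext => i; rewrite tsubst_tshift -[RHS]tsubst_id.
by congr tsubst; apply/funext => j; rewrite sconsS.
Qed.

Lemma qf_fsubst n (A : formula S n) m (s : 'I_n -> term S m) : qf A -> qf (fsubst A s).
Proof.
elim: A m s => {n} [n|n t u|n A IA B IB|n A IA] m s //= [a b].
by split; [apply: IA|apply: IB].
Qed.

End Subst.

Section Derivations.
Variables (S : nat -> Type) (T : formula S 0 -> Prop).

Lemma prov_weak n (G G' : seq (formula S n)) A :
  (forall B, List.In B G -> List.In B G') -> prov T G A -> prov T G' A.
Proof.
move=> sub d; elim: d G' sub => {n G A}.
- by move=> n G A TA G' _; apply: prov_thy.
- by move=> n G A iA G' sub; apply: prov_hyp; apply: sub.
- move=> n G A B _ IH G' sub; apply: prov_impI; apply: IH => X [->|/sub]; [by left|by right].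
- by move=> n G A B _ IH1 _ IH2 G' sub; apply: prov_impE (IH1 _ sub) (IH2 _ sub).
- move=> n G A _ IH G' sub; apply: prov_raa; apply: IH => X [->|/sub]; [by left|by right].
- move=> n G A _ IH G' sub; apply: prov_allI; apply: IH => X /List.in_map_iff[Y [<- /sub iY]].
  exact: List.in_map.
- by move=> n G A t _ IH G' sub; apply: prov_allE; apply: IH.
- by move=> n G t G' _; apply: prov_refl.
- by move=> n G A t u _ IH1 _ IH2 G' sub; apply: prov_eq (IH1 _ sub) (IH2 _ sub).
Qed.

Lemma prov_alls n m (A : formula S m) (G : seq (formula S n)) (s : 'I_m -> term S n) :
  prov T G (fwk n (alls A)) -> prov T G (fsubst A s).
Proof.
elim: m A s => [|m IH] A s d; first by rewrite (env0E s (tnth [tuple])).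
have /= d' := IH _ (fun i => s (lift ord0 i)) d.
by have := prov_allE (s ord0) d'; rewrite inst_up scons_eta.
Qed.

Lemma prov_hyp0 n (A : formula S n) G : prov T (A :: G) A.
Proof. by apply: prov_hyp; left. Qed.

Lemma prov_hyp1 n (A B : formula S n) G : prov T (B :: A :: G) A.
Proof. by apply: prov_hyp; right; left. Qed.

Lemma prov_wk n (A B : formula S n) G : prov T G A -> prov T (B :: G) A.
Proof. by apply: prov_weak => X; right. Qed.

Lemma prov_exf n (A : formula S n) G : prov T G fbot -> prov T G A.
Proof. by move=> d; apply: prov_raa; apply: prov_wk. Qed.

End Derivations.

(** * Term models *)

Section Lindenbaum.
Variables (F : Type) (neg : F -> F) (Con : seq F -> Prop).
Hypothesis Con0 : Con [::].
Hypothesis ConS : forall l l', (forall B, List.In B l -> List.In B l') -> Con l' -> Con l.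
Hypothesis ConE : forall A l, Con l -> Con (A :: l) \/ Con (neg A :: l).

(** Consistency is an abstract property of finite lists because two notions are used: irrefutability
    in a theory, and satisfiability while any finitely many candidate witnesses fail. *)
Lemma lindenbaum : exists2 Tr : F -> Prop,
  forall l, (forall B, List.In B l -> Tr B) -> Con l & forall A, Tr A \/ Tr (neg A).
Proof.
pose P : set (set F) := fun D => forall l, (forall B, List.In B l -> D B) -> Con l.
have [|D [PD maxD]] := @Zorn_bigcup _ P.
  move=> H HP tot l; case: (pselect (exists X, H X)) => [[X0 HX0]|nH]; last first.
    case: l => [//|B l] /(_ B (or_introl erefl)) [X HX]; by case: nH; exists X.
  move=> sub; suff [X HX lX] : exists2 X, H X & forall B, List.In B l -> X B by apply: (HP X).
  elim: l sub => [|B l IH] sub; first by exists X0.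
  have [|X HX lX] := IH; first by move=> C iC; apply: sub; right.
  have [Y HY YB] := sub B (or_introl erefl).
  have [XY|YX] := tot _ _ HX HY.
    by exists Y => // C [<-//|/lX/XY].
  by exists X => // C [<-|/lX//]; apply: YX.
exists D => // A; apply: contrapT => /not_orP[nA nnA].
(* By maximality of [D], an excluded formula is inconsistent with finitely many elements of [D]. *)
have key X : ~ D X -> exists l, (forall B, List.In B l -> D B) /\ ~ Con (X :: l).
  move=> nX; have : ~ P (fun B => B = X \/ D B).
    apply: maxD; split=> [C DC|/(_ X)]; first by right.
    by move=> h; apply: nX; apply: h; left.
  move=> /existsNP[l /not_implyP[sub nC]].
  suff [l' l'D ll'] : exists2 l', (forall B, List.In B l' -> D B) &
      forall B, List.In B l -> List.In B (X :: l').
    by exists l'; split=> // h; apply: nC; apply: ConS ll' h.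
  elim: l {nC} sub => [|B l IH] sub; first by exists [::].
  have [|l' l'D ll'] := IH; first by move=> C iC; apply: sub; right.
  have [->|DB] := sub B (or_introl erefl).
    by exists l' => // C [<-|/ll'//]; left.
  exists (B :: l') => [C [<-//|/l'D//]|C [<-|/ll'[<-|]]]; [by right; left|by left|].
  by right; right.
have [l1 [l1D n1]] := key _ nA; have [l2 [l2D n2]] := key _ nnA.
have Cl : Con (l1 ++ l2).
  by apply: PD => B /List.in_app_iff[/l1D|/l2D].
by case: (ConE A Cl) => h; [apply: n1|apply: n2]; apply: ConS h => B [<-|iB];
  rewrite /=; (try by left); right; apply/List.in_app_iff; [left|right].
Qed.
End Lindenbaum.

Section TermModel.
Variables (S : nat -> Type) (n : nat) (Tr : formula S n -> Prop).
Hypothesis Tr_bot : ~ Tr fbot.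
Hypothesis Tr_imp : forall A B, Tr (fimp A B) <-> (Tr A -> Tr B).
Hypothesis Tr_refl : forall t, Tr (feq t t).
Hypothesis Tr_sym : forall t u, Tr (feq t u) -> Tr (feq u t).
Hypothesis Tr_trans : forall t u w, Tr (feq t u) -> Tr (feq u w) -> Tr (feq t w).
Hypothesis Tr_app : forall k (f : S k) ts us, (forall j, Tr (feq (ts j) (us j))) ->
  Tr (feq (tapp f ts) (tapp f us)).

Let ex_rep t : exists u, Tr (feq t u). Proof. by exists t. Qed.
Let rep t : term S n := sval (cid (ex_rep t)).

(** Choice is applied to the predicate of being equal to [t] under [Tr]. Equivalent terms have equal
    predicates by extensionality, so they get the same representative; terms that represent
    themselves then serve as the quotient. *)
Let rep_eq t u : Tr (feq t u) -> rep t = rep u.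
Proof.
move=> tu; rewrite /rep.
have e : (fun w => Tr (feq t w)) = (fun w => Tr (feq u w)).
  by apply/funext => w; apply/propext; split; apply: Tr_trans => //; apply: Tr_sym.
have gen (P Q : term S n -> Prop) (e' : P = Q) (p : exists w, P w) (q : exists w, Q w) :
    sval (cid p) = sval (cid q).
  by case: _ / e' q => q; rewrite (Prop_irrelevance p q).
exact: gen.
Qed.

Let Tr_rep t : Tr (feq t (rep t)). Proof. by rewrite /rep; case: cid. Qed.
Let rep_rep t : rep (rep t) = rep t. Proof. by apply/esym; apply: rep_eq; apply: Tr_rep. Qed.

Definition tm_car : Type := {t : term S n | rep t = t}.
Definition tm_class t : tm_car := exist _ (rep t) (rep_rep t).
Definition term_model : struct S :=
  @Struct S tm_car (fun k f a => tm_class (tapp f (fun j => sval (a j)))).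

Lemma tm_classK (a : term_model) : tm_class (sval a) = a.
Proof. by case: a => t e; apply: eq_exist; exact: e. Qed.

Let class_eq t u : tm_class t = tm_class u <-> Tr (feq t u).
Proof.
split=> [e|/rep_eq e]; last exact: eq_exist.
have {}e : rep t = rep u by exact: (congr1 sval e).
by apply: Tr_trans (Tr_rep t) _; rewrite e; apply: Tr_sym; apply: Tr_rep.
Qed.

Lemma ev_tm m (s : 'I_m -> term S n) t :
  ev (M := term_model) (fun i => tm_class (s i)) t = tm_class (tsubst s t).
Proof.
elim: t => //= k f ts IH; apply/class_eq; apply: Tr_app => j.
by rewrite IH /=; apply: Tr_sym; apply: Tr_rep.
Qed.

Lemma sat_tm m (A : formula S m) (s : 'I_m -> term S n) : qf A ->
  sat (M := term_model) A (fun i => tm_class (s i)) <-> Tr (fsubst A s).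
Proof.
elim: A s => {m} [m|m t u|m A IA B IB|m A IA] s //=.
- by move=> _; rewrite !ev_tm; exact: class_eq.
- by move=> [/(IA s) a /(IB s) b]; rewrite Tr_imp a b.
Qed.

End TermModel.

(* All the properties of a truth set follow from the unsatisfiability of
   finitely many formulas in quantifier-free logic. *)
Section TermModelExists.
Variables (S : nat -> Type) (n : nat) (Con : seq (formula S n) -> Prop).
Hypothesis Con0 : Con [::].
Hypothesis ConS : forall l l', (forall B, List.In B l -> List.In B l') -> Con l' -> Con l.
Hypothesis ConE : forall A l, Con l -> Con (A :: l) \/ Con (fneg A :: l).
Hypothesis ConP : forall l, prov (fun _ => False) l fbot -> ~ Con l.

Lemma term_model_exists : exists M : struct S, exists cl : term S n -> M,
  [/\ forall a, exists t, a = cl t,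
      forall m (s : 'I_m -> term S n) t, ev (fun i => cl (s i)) t = cl (tsubst s t) &
      forall l, (forall B, List.In B l -> qf B /\ sat (M := M) B (fun i => cl (tvar i))) -> Con l].
Proof.
have [Tr TrC TrE] := lindenbaum Con0 ConS ConE.
have ded l A : (forall B, List.In B l -> Tr B) -> prov (fun _ => False) l A -> Tr A.
  move=> lT d; case: (TrE A) => // nA; case: (@ConP (fneg A :: l)).
    by apply: prov_impE (prov_hyp0 _ _ _) _; apply: prov_wk.
  by apply: TrC => B [<-//|/lT].
have in1 (A : formula S n) : Tr A -> forall B, List.In B [:: A] -> Tr B by move=> ? B [<-|[]].
have in2 (A A' : formula S n) : Tr A -> Tr A' -> forall B, List.In B [:: A; A'] -> Tr B.
  by move=> ? ? B [<-|[<-|[]]].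
have Tr_bot : ~ Tr fbot.
  by move=> h; case: (@ConP [:: fbot]); [apply: prov_hyp0|apply: TrC; apply: in1].
have Tr_imp A B : Tr (fimp A B) <-> (Tr A -> Tr B).
  split=> [h a|h].
    apply: (ded [:: fimp A B; A]); first exact: in2.
    by apply: prov_impE (prov_hyp0 _ _ _) (prov_hyp1 _ _ _ _).
  case: (TrE A) => [/h b|nA].
    by apply: (ded [:: B]); [apply: in1|apply: prov_impI; apply: prov_hyp1].
  apply: (ded [:: fneg A]); first exact: in1.
  apply: prov_impI; apply: prov_exf; apply: prov_impE (prov_hyp1 _ _ _ _) (prov_hyp0 _ _ _).
have Tr_refl t : Tr (feq t t) by apply: (ded [::]) => //; apply: prov_refl.
have inst_sh (t u : term S n) : tsubst (scons u tvar) (tshift t) = t.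
  rewrite tsubst_tshift -[RHS]tsubst_id.
  by congr tsubst; apply/funext => i; rewrite sconsS.
have Tr_leib A t u : Tr (feq t u) -> Tr (inst A t) -> Tr (inst A u).
  move=> tu at_; apply: (ded [:: feq t u; inst A t]); first exact: in2.
  by apply: prov_eq (prov_hyp0 _ _ _) (prov_hyp1 _ _ _ _).
have Tr_sym t u : Tr (feq t u) -> Tr (feq u t).
  move=> tu; have := @Tr_leib (feq (tvar ord0) (tshift t)) t u tu.
  by rewrite /inst /= scons0 scons0 !inst_sh; apply.
have Tr_trans t u w : Tr (feq t u) -> Tr (feq u w) -> Tr (feq t w).
  move=> tu uw; have := @Tr_leib (feq (tshift t) (tvar ord0)) u w uw.
  by rewrite /inst /= scons0 scons0 !inst_sh; apply.
have Tr_app k (f : S k) ts us : (forall j, Tr (feq (ts j) (us j))) ->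
    Tr (feq (tapp f ts) (tapp f us)).
  (* Leibniz replacement exchanges one argument at a time: in [mix m] the first [m] arguments are
     already exchanged. *)
  move=> tu; pose mix m (j : 'I_k) := if j < m then us j else ts j.
  suff H m : m <= k -> Tr (feq (tapp f ts) (tapp f (mix m))).
    have := H k (leqnn k); congr (Tr (feq _ (tapp f _))).
    by apply/funext => j; rewrite /mix ltn_ord.
  elim: m => [_|m IH mk].
    rewrite (_ : mix 0 = ts); first exact: Tr_refl.
    by apply/funext => j; rewrite /mix ltn0.
  pose mx (j : 'I_k) := if j == m :> nat then tvar ord0 else tshift (mix m j).
  have := @Tr_leib (feq (tshift (tapp f ts)) (tapp f mx)) _ _ (tu (Ordinal mk)).
  rewrite /inst /=.
  rewrite (_ : (fun j => tsubst (scons (ts _) _) (mx j)) = mix m); last first.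
    apply/funext => j; rewrite /mx; case: eqP => [e|_]; last by rewrite inst_sh.
    by rewrite /= scons0 /mix e ltnn; congr ts; apply/val_inj.
  rewrite (_ : (fun j => tsubst (scons (us _) _) (mx j)) = mix m.+1); last first.
    apply/funext => j; rewrite /mx; case: eqP => [e|ne].
      by rewrite /= scons0 /mix e leqnn; congr us; apply/val_inj.
    rewrite inst_sh /mix ltnS (leq_eqVlt j).
    by case: eqP ne.
  have e : (fun j => tsubst (scons (ts (Ordinal mk)) tvar)
      (tsubst (fun i => tvar (lift ord0 i)) (ts j))) = ts.
    by apply/funext => j; apply: inst_sh.
  have e' : (fun j => tsubst (scons (us (Ordinal mk)) tvar)
      (tsubst (fun i => tvar (lift ord0 i)) (ts j))) = ts.
    by apply/funext => j; apply: inst_sh.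
  by rewrite e e'; apply; apply: IH; apply: ltnW.
exists (term_model Tr_refl Tr_sym Tr_trans), (tm_class Tr_refl Tr_sym Tr_trans); split.
- by move=> a; exists (sval a); rewrite tm_classK.
- by move=> m s t; rewrite ev_tm.
- move=> l lT; apply: TrC => B /lT[qB].
  by rewrite sat_tm // fsubst_id.
Qed.
End TermModelExists.

(** * Completeness for open formulas *)

Definition universal S (T : formula S 0 -> Prop) :=
  forall A, T A -> exists n (B : formula S n), qf B /\ A = alls B.

(** Every element of the term model is the value of a term. So an open axiom holds at all elements
    as soon as its instances by terms do, and these are derivable; this is where universality of [T]
    enters. *)
Lemma qf_completeness S (T : formula S 0 -> Prop) n (A : formula S n) :
  universal T -> qf A ->
  (forall M : struct S, (forall B, T B -> forall x, sat (M := M) B x) ->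
     forall x : 'I_n -> M, sat A x) -> T |- A.
Proof.
move=> uT qA vA; apply: contrapT => nA.
pose Con (l : seq (formula S n)) := ~ prov T (l ++ [:: fneg A]) fbot.
have [||||M [cl [gen evc TrC]]] := @term_model_exists S n Con.
- by move=> h; apply: nA; apply: prov_raa.
- move=> l l' sub c d; apply: c; apply: prov_weak d => B /List.in_app_iff[/sub|] h;
    apply/List.in_app_iff; by [left|right].
- move=> B l c; apply: contrapT => /not_orP[/contrapT h1 /contrapT h2]; apply: c.
  by apply: prov_impE (prov_impI h2) (prov_impI h1).
- move=> l d; apply; apply: (@prov_mono S (fun _ => False)) => //.
  by apply: prov_weak d => B iB; apply/List.in_app_iff; left.
have MT B : T B -> forall x, sat (M := M) B x.
  move=> TB x; have [m [B0 [qB e]]] := uT _ TB; rewrite e; apply/sat_alls => y.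
  have /choice[s ys] := fun i => gen (y i).
  have -> : y = (fun i => ev (fun i => cl (tvar i)) (s i)).
    by apply/funext => i; rewrite evc tsubst_id.
  rewrite -sat_fsubst; apply: contrapT => h.
  have := TrC [:: fneg (fsubst B0 s)]; apply.
    by move=> X [<-|[]]; split=> //; split=> //; apply: qf_fsubst.
  apply: prov_impE (prov_hyp0 _ _ _) _.
  by apply: prov_alls; apply: prov_thy; rewrite -e.
have h := vA M MT (fun i => cl (tvar i)).
have := TrC [:: A]; apply; first by move=> X [<-|[]]; split.
by apply: prov_impE (prov_hyp1 _ _ _ _) (prov_hyp0 _ _ _).
Qed.

(** * Herbrand's theorem with oracle symbols *)

Inductive osym (S : nat -> Type) (I : Type) : nat -> Type :=
| o_base k of S k : osym S I k
| o_orc of I : osym S I 1.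
Arguments o_base {S I k}.
Arguments o_orc {S I}.

Definition ostruct S I (M : struct S) (f : I -> M -> M) : struct (osym S I) :=
  @Struct (osym S I) M (fun k g => match g in osym _ _ k return ('I_k -> M) -> M with
    | o_base _ g => @sapp S M _ g
    | o_orc i => fun a => f i (a ord0) end).

Section Reduct.
Variables (S S' : nat -> Type) (e : forall k, S k -> S' k).

Definition reduct (M : struct S') : struct S := @Struct S M (fun k f => sapp (e f)).

Lemma ev_tmap (M : struct S') n (x : 'I_n -> M) t :
  ev x (tmap e t) = ev (M := reduct M) x t.
Proof. by elim: t => //= k f ts IH; congr sapp; apply/funext. Qed.

Lemma sat_fmap (M : struct S') n (A : formula S n) (x : 'I_n -> M) :
  sat (fmap e A) x <-> sat (M := reduct M) A x.
Proof.
elim: A x => {n} [n|n t u|n A IA B IB|n A IA] x //=.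
- by rewrite !ev_tmap.
- by rewrite IA IB.
- by split=> H a; apply/IA; apply: H.
Qed.

Lemma qf_fmap n (A : formula S n) : qf (fmap e A) <-> qf A.
Proof. by elim: A => {n} [n|n t u|n A IA B IB|n A IA] //=; rewrite IA IB. Qed.
End Reduct.

Lemma ev_obase S I (M : struct S) (f : I -> M -> M) n (x : 'I_n -> M) t :
  ev (M := ostruct f) x (tmap (@o_base S I) t) = ev x t.
Proof. by elim: t => //= k g ts IH; congr sapp; apply/funext. Qed.

Lemma sat_obase S I (M : struct S) (f : I -> M -> M) n (A : formula S n) (x : 'I_n -> M) :
  sat (M := ostruct f) (fmap (@o_base S I) A) x <-> sat A x.
Proof.
elim: A x => {n} [n|n t u|n A IA B IB|n A IA] x //=.
- by rewrite !ev_obase.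
- by rewrite IA IB.
- by split=> H a; apply/IA; apply: H.
Qed.

Definition models S (T : formula S 0 -> Prop) (M : struct S) :=
  forall B, T B -> forall x, sat (M := M) B x.

(* Variable [0] of [psi j] is the witness, variable [1] the input. *)
Lemma herbrand S I J (T : formula S 0 -> Prop) (psi : J -> formula (osym S I) 2) :
  universal T -> (forall j, qf (psi j)) ->
  (forall (M : struct S) (f : I -> M -> M) (x : M), models T M ->
     exists j y, sat (M := ostruct f) (psi j) (tnth [tuple y; x])) ->
  exists l : seq (J * term (osym S I) 1),
    forall (M : struct S) (f : I -> M -> M) (x : M), models T M ->
    exists2 jt, List.In jt l &
      sat (M := ostruct f) (psi jt.1) (tnth [tuple ev (M := ostruct f) (fun _ => x) jt.2; x]).
Proof.
move=> uT qpsi H; apply: contrapT => /forallNP nl.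
(* A list is consistent if it can be satisfied while any prescribed finite set of candidates fails.
   If no finite set of candidates suffices, the empty list is consistent, and the resulting term
   model refutes [psi j] at every term, hence at every element. *)
pose Con (l : seq (formula (osym S I) 1)) := forall L : seq (J * term (osym S I) 1),
  exists (M : struct S) (f : I -> M -> M) (x : M), [/\ models T M,
    forall B, List.In B l -> sat (M := ostruct f) B (fun _ => x) &
    forall jt, List.In jt L -> ~ sat (M := ostruct f) (psi jt.1)
       (tnth [tuple ev (M := ostruct f) (fun _ => x) jt.2; x])].
have [||||M [cl [gen evc TrC]]] := @term_model_exists (osym S I) 1 Con.
- move=> L; have := nl L; move/existsNP=> [M /existsNP[f /existsNP[x /not_implyP[MT h]]]].
  exists M, f, x; split=> // jt jtL s; apply: h; by exists jt.
- move=> l l' sub c L; have [M [f [x [MT h1 h2]]]] := c L.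
  by exists M, f, x; split=> // B /sub/h1.
- move=> A l c; apply: contrapT => /not_orP[/existsNP[L1 h1] /existsNP[L2 h2]].
  have [M [f [x [MT g1 g2]]]] := c (L1 ++ L2).
  case: (pselect (sat (M := ostruct f) A (fun _ => x))) => a; [apply: h1|apply: h2];
    exists M, f, x; split=> //; try (by move=> B [<-//|/g1]);
    by move=> jt i; apply: g2; apply/List.in_app_iff; [left + right].
- move=> l d /(_ [::])[M [f [x [_ h _]]]].
  exact: (prov_sound (C := fun _ => True) (fun A (F : False) => match F with end) d (M := ostruct f) Logic.I h).
(* The term model is split into a structure for [S] and oracle functions; by [evR] and [satR],
   putting them together again changes nothing. *)
pose R : struct S := reduct (@o_base S I) M.
pose f (i : I) (a : R) : R := @sapp _ M _ (o_orc i) (fun _ => a).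
have evR n (y : 'I_n -> M) t : ev (M := ostruct f) y t = ev (M := M) y t.
  elim: t => //= k g ts IH.
  case: g ts IH => [k' g|i] ts IH /=; first by congr sapp; apply/funext.
  by rewrite /f; congr sapp; apply/funext => j; rewrite IH; congr (ev y (ts _)); apply/val_inj; case: j => [[]].
have satR n (A : formula (osym S I) n) (y : 'I_n -> M) :
    sat (M := ostruct f) A y <-> sat (M := M) A y.
  elim: A y => {n} [n|n t u|n A IA B IB|n A IA] y //=.
  - by rewrite !evR.
  - by rewrite IA IB.
  - by split=> h a; apply/IA; apply: h.
have genS m (y : 'I_m -> M) : exists s, y = (fun i => ev (fun i => cl (tvar i)) (s i)).
  have /choice[s ys] := fun i => gen (y i).
  by exists s; apply/funext => i; rewrite evc tsubst_id.
have RT : models T R.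
  move=> B TB x; have [m [B0 [qB e]]] := uT _ TB; rewrite e; apply/sat_alls => y.
  apply/sat_fmap; have [s ->] := genS _ y.
  rewrite -sat_fsubst; apply: contrapT => h.
  have [|N [g [x0 [NT h1 _]]]] := TrC [:: fneg (fsubst (fmap (@o_base S I) B0) s)] _ [::].
    by move=> X [<-|[]]; split=> //; split=> //; apply: qf_fsubst; exact/qf_fmap.
  have /sat_neg h2 := h1 _ (or_introl erefl); apply: h2.
  apply/sat_fsubst/sat_obase.
  by have := NT _ TB; rewrite e => /(_ (tnth [tuple]))/sat_alls; apply.
have [j [y]] := H R f (cl (tvar ord0)) RT; rewrite satR => sj.
have [t yt] := gen y; pose s : 'I_2 -> _ := tnth [tuple t; tvar ord0].
have [|N [g [x [NT h1 h2]]]] := TrC [:: fsubst (psi j) s] _ [:: (j, t)].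
  move=> X [<-|[]]; split; first exact: qf_fsubst.
  apply/sat_fsubst; move: sj; rewrite yt /s (tnth_comp2 (ev (fun i => cl (tvar i)))).
  by rewrite evc tsubst_id.
apply: (h2 _ (or_introl erefl)).
by have := h1 _ (or_introl erefl); rewrite sat_fsubst /s tnth_comp2.
Qed.

(** * Models of PV *)

Lemma PV_universal : universal PV.
Proof.
move=> A [n B dB|n B qB _ _]; last by exists n.+1, B.
by exists n, B; split=> //; case: dB => //= ? [] //= [].
Qed.

Record pvm := Pvm { pstr :> struct pvsym; pvmP : models PV pstr }.

Definition env0 T : 'I_0 -> T := fun i => False_rect _ (notF (ltn_ord i)).

Lemma tnth1E T (a : T) : tnth [tuple a] = scons a (@env0 T).
Proof.
apply/funext => i; case: (unliftP ord0 i) => [j|] ->; last by rewrite scons0.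
by case: j.
Qed.

Lemma tnth2E T (a b : T) : tnth [tuple a; b] = scons a (scons b (@env0 T)).
Proof.
apply/funext => i; case: (unliftP ord0 i) => [j|] ->; last by rewrite scons0.
rewrite sconsS; case: (unliftP ord0 j) => [k|] ->; last by rewrite scons0.
by case: k.
Qed.

Section Functions.
Variable M : pvm.
Definition mZ : M := sapp (s := M) pv_zero (@env0 M).
Definition ap1 (f : pvsym 1) (a : M) : M := sapp f (scons a (@env0 M)).
Definition ap2 (f : pvsym 2) (a b : M) : M := sapp f (scons a (scons b (@env0 M))).
End Functions.
Arguments mZ {M}.
Definition mS i (M : pvm) (a : M) : M := ap1 (pv_s i) a.
Definition half (M : pvm) (a : M) : M := ap1 pv_half a.
Definition msucc (M : pvm) (a : M) : M := ap1 pv_succ a.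
Definition msp (M : pvm) (a b : M) : M := ap2 pv_msp a b.

(** Definability by a single term or formula in all models is what allows Cook's rule, recursion on
    notation and completeness to be applied to such families. *)
Definition Fn n := forall M : pvm, ('I_n -> M) -> M.
Definition Rn n := forall M : pvm, ('I_n -> M) -> Prop.

Definition fd n (F : Fn n) := exists t : pvterm n, forall M x, ev x t = F M x.
Definition pd n (P : Rn n) := exists2 A : pvform n, qf A & forall M x, sat (M := pstr M) A x <-> P M x.

Definition v0 n : 'I_n.+1 := ord0.
Definition v1 n : 'I_n.+2 := lift ord0 ord0.
Definition v2 n : 'I_n.+3 := lift ord0 (lift ord0 ord0).
Definition v3 n : 'I_n.+4 := lift ord0 (lift ord0 (lift ord0 ord0)).

Notation F1 := (forall M : pvm, M -> M).
Notation F2 := (forall M : pvm, M -> M -> M).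
Notation F3 := (forall M : pvm, M -> M -> M -> M).
Notation F4 := (forall M : pvm, M -> M -> M -> M -> M).
Notation R1 := (forall M : pvm, M -> Prop).
Notation R2 := (forall M : pvm, M -> M -> Prop).
Notation R3 := (forall M : pvm, M -> M -> M -> Prop).
Notation R4 := (forall M : pvm, M -> M -> M -> M -> Prop).

Definition def1 (F : F1) := @fd 1 (fun M x => F M (x (v0 _))).
Definition def2 (F : F2) := @fd 2 (fun M x => F M (x (v0 _)) (x (v1 _))).
Definition def3 (F : F3) := @fd 3 (fun M x => F M (x (v0 _)) (x (v1 _)) (x (v2 _))).
Definition def4 (F : F4) := @fd 4 (fun M x => F M (x (v0 _)) (x (v1 _)) (x (v2 _)) (x (v3 _))).
Definition rel1 (P : R1) := @pd 1 (fun M x => P M (x (v0 _))).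
Definition rel2 (P : R2) := @pd 2 (fun M x => P M (x (v0 _)) (x (v1 _))).
Definition rel3 (P : R3) := @pd 3 (fun M x => P M (x (v0 _)) (x (v1 _)) (x (v2 _))).
Definition rel4 (P : R4) := @pd 4 (fun M x => P M (x (v0 _)) (x (v1 _)) (x (v2 _)) (x (v3 _))).

Lemma sc0 T n (a : T) (f : 'I_n -> T) : scons a f (v0 n) = a.
Proof. exact: scons0. Qed.
Lemma sc1 T n (a b : T) (f : 'I_n -> T) : scons a (scons b f) (v1 n) = b.
Proof. by rewrite sconsS scons0. Qed.
Lemma sc2 T n (a b c : T) (f : 'I_n -> T) : scons a (scons b (scons c f)) (v2 n) = c.
Proof. by rewrite !sconsS scons0. Qed.
Lemma sc3 T n (a b c d : T) (f : 'I_n -> T) :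
  scons a (scons b (scons c (scons d f))) (v3 n) = d.
Proof. by rewrite !sconsS scons0. Qed.
Definition scE := (sc0, sc1, sc2, sc3).

Section FdClosure.
Variable n : nat.
Implicit Types (G : Fn n) (P Q : Rn n).

Lemma fd_var i : @fd n (fun M x => x i).
Proof. by exists (tvar i). Qed.

Lemma fd_Z : @fd n (fun M x => mZ).
Proof. by exists tZ => M x; rewrite /tZ /app0 /mZ /=; congr sapp; apply: env0E. Qed.

Lemma fd_app1 (F : F1) G : def1 F -> fd G -> @fd n (fun M x => F M (G M x)).
Proof.
move=> [t tE] [u uE]; exists (tsubst (scons u (@env0 _)) t) => M x.
by rewrite ev_tsubst scons_comp tE scE uE.
Qed.

Lemma fd_app2 (F : F2) G G' : def2 F -> fd G -> fd G' ->
  @fd n (fun M x => F M (G M x) (G' M x)).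
Proof.
move=> [t tE] [u uE] [w wE]; exists (tsubst (scons u (scons w (@env0 _))) t) => M x.
by rewrite ev_tsubst !scons_comp tE !scE uE wE.
Qed.

Lemma fd_app3 (F : F3) G G' G'' : def3 F -> fd G -> fd G' -> fd G'' ->
  @fd n (fun M x => F M (G M x) (G' M x) (G'' M x)).
Proof.
move=> [t tE] [u uE] [w wE] [r rE].
exists (tsubst (scons u (scons w (scons r (@env0 _)))) t) => M x.
by rewrite ev_tsubst !scons_comp tE !scE uE wE rE.
Qed.

Lemma fd_app4 (F : F4) G G' G'' G3 : def4 F -> fd G -> fd G' -> fd G'' -> fd G3 ->
  @fd n (fun M x => F M (G M x) (G' M x) (G'' M x) (G3 M x)).
Proof.
move=> [t tE] [u uE] [w wE] [r rE] [z zE].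
exists (tsubst (scons u (scons w (scons r (scons z (@env0 _))))) t) => M x.
by rewrite ev_tsubst !scons_comp tE !scE uE wE rE zE.
Qed.

Lemma pd_app1 (F : R1) G : rel1 F -> fd G -> @pd n (fun M x => F M (G M x)).
Proof.
move=> [t qt tE] [u uE]; exists (fsubst t (scons u (@env0 _))); first exact: qf_fsubst.
by move=> M x; rewrite sat_fsubst scons_comp tE scE uE.
Qed.

Lemma pd_app2 (F : R2) G G' : rel2 F -> fd G -> fd G' ->
  @pd n (fun M x => F M (G M x) (G' M x)).
Proof.
move=> [t qt tE] [u uE] [w wE]; exists (fsubst t (scons u (scons w (@env0 _)))); first exact: qf_fsubst.
by move=> M x; rewrite sat_fsubst !scons_comp tE !scE uE wE.
Qed.

Lemma pd_app3 (F : R3) G G' G'' : rel3 F -> fd G -> fd G' -> fd G'' ->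
  @pd n (fun M x => F M (G M x) (G' M x) (G'' M x)).
Proof.
move=> [t qt tE] [u uE] [w wE] [r rE].
exists (fsubst t (scons u (scons w (scons r (@env0 _))))); first exact: qf_fsubst.
by move=> M x; rewrite sat_fsubst !scons_comp tE !scE uE wE rE.
Qed.

Lemma pd_app4 (F : R4) G G' G'' G3 : rel4 F -> fd G -> fd G' -> fd G'' -> fd G3 ->
  @pd n (fun M x => F M (G M x) (G' M x) (G'' M x) (G3 M x)).
Proof.
move=> [t qt tE] [u uE] [w wE] [r rE] [z zE].
exists (fsubst t (scons u (scons w (scons r (scons z (@env0 _)))))); first exact: qf_fsubst.
by move=> M x; rewrite sat_fsubst !scons_comp tE !scE uE wE rE zE.
Qed.

Lemma pd_eq G G' : fd G -> fd G' -> @pd n (fun M x => G M x = G' M x).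
Proof. by move=> [t tE] [u uE]; exists (feq t u) => // M x /=; rewrite tE uE. Qed.

Lemma pd_imp P Q : pd P -> pd Q -> @pd n (fun M x => P M x -> Q M x).
Proof. by move=> [A qA AE] [B qB BE]; exists (fimp A B) => // M x /=; rewrite AE BE. Qed.

Lemma pd_False : @pd n (fun M x => False).
Proof. by exists fbot. Qed.

Lemma pd_True : @pd n (fun M x => True).
Proof. by exists ftop => // M x; split=> // _ []. Qed.

Lemma pd_not P : pd P -> @pd n (fun M x => ~ P M x).
Proof. by move=> dP; apply: pd_imp dP pd_False. Qed.

Lemma pd_and P Q : pd P -> pd Q -> @pd n (fun M x => P M x /\ Q M x).
Proof.
move=> [A qA AE] [B qB BE]; exists (fand A B); first by rewrite /= .
by move=> M x; rewrite sat_and AE BE.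
Qed.

Lemma pd_or P Q : pd P -> pd Q -> @pd n (fun M x => P M x \/ Q M x).
Proof.
move=> [A qA AE] [B qB BE]; exists (for_ A B); first by rewrite /= .
by move=> M x; rewrite sat_or AE BE.
Qed.

Lemma fd_ext G G' : (forall M x, G M x = G' M x) -> fd G -> fd G'.
Proof. by move=> e [t tE]; exists t => M x; rewrite tE. Qed.

Lemma pd_ext P Q : (forall M x, P M x <-> Q M x) -> pd P -> pd Q.
Proof. by move=> e [A qA AE]; exists A => // M x; rewrite AE e. Qed.
End FdClosure.

Lemma def_ap1 (f : pvsym 1) : def1 (fun M => @ap1 M f).
Proof.
exists (tapp f tvar) => M x /=; rewrite /ap1; congr sapp.
by rewrite [LHS]env1E; apply/funext => i; rewrite -[i]/(i); case: (unliftP ord0 i) => [[]//|->]; rewrite scons0.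
Qed.

Lemma def_ap2 (f : pvsym 2) : def2 (fun M => @ap2 M f).
Proof.
exists (tapp f tvar) => M x /=; rewrite /ap2; congr sapp.
rewrite -[LHS]scons_eta; congr scons; rewrite -[LHS]scons_eta; congr scons; exact: env0E.
Qed.

Create HintDb fdb.
Lemma def_mS i : def1 (@mS i). Proof. exact: def_ap1. Qed.
Lemma def_half : def1 half. Proof. exact: def_ap1. Qed.
Lemma def_msucc : def1 msucc. Proof. exact: def_ap1. Qed.
Lemma def_msp : def2 msp. Proof. exact: def_ap2. Qed.
#[export] Hint Resolve def_mS def_half def_msucc def_msp : fdb.

Ltac fdc := solve [eassumption | auto 2 with fdb nocore | auto 3 with fdb].

(** ** The laws of PV in a model *)

Lemma pv_ax n (A : pvform n) (M : pvm) (x : 'I_n -> M) : pv_defining A -> sat A x.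
Proof. by move=> /PV_def/(pvmP (p := M))/(_ (@env0 M))/sat_alls; apply. Qed.

Section PVLaws.
Variable M : pvm.
Implicit Types a b c : M.

Let e1 a := scons a (@env0 M).
Let e2 a b := scons a (scons b (@env0 M)).
Local Notation t0 := (tvar ord0 : pvterm 1).
Local Notation u0 := (tvar ord0 : pvterm 2).
Local Notation u1 := (tvar (lift ord0 ord0) : pvterm 2).
Local Ltac cs := cbn [sat fneg fleq].

Let evZ n (x : 'I_n -> M) : ev x tZ = mZ.
Proof. by rewrite /tZ /app0 /mZ /=; congr sapp; apply: env0E. Qed.
Let ev1 n (x : 'I_n -> M) f t : ev x (app1 f t) = ap1 f (ev x t).
Proof. by rewrite /app1 /= tnth_comp1 tnth1E. Qed.
Let ev2 n (x : 'I_n -> M) f t u : ev x (app2 f t u) = ap2 f (ev x t) (ev x u).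
Proof. by rewrite /app2 /= tnth_comp2 tnth2E. Qed.
Let evE := (evZ, ev1, ev2).
Local Ltac ce := rewrite !evE; cbn [ev].

Lemma S00 : mS false (mZ (M := M)) = mZ.
Proof. by have := pv_ax (@env0 M) (pvd_s0 0); cs; rewrite !evE. Qed.
Lemma S01 a b : mS false a <> mS true b.
Proof. by have := pv_ax (e2 a b) (pvd_s01 u0 u1); cs; ce; rewrite /e2 scons0 sconsS scons0. Qed.
Lemma halfS i a : half (mS i a) = a.
Proof. by have := pv_ax (e1 a) (pvd_half i t0); cs; ce; rewrite /e1 scons0. Qed.
Lemma succ0 a : msucc (mS false a) = mS true a.
Proof. by have := pv_ax (e1 a) (pvd_succ0 t0); cs; ce; rewrite /e1 scons0. Qed.
Lemma succ1 a : msucc (mS true a) = mS false (msucc a).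
Proof. by have := pv_ax (e1 a) (pvd_succ1 t0); cs; ce; rewrite /e1 scons0. Qed.
Lemma msp0 a : msp a mZ = a.
Proof. by have := pv_ax (e1 a) (pvd_msp0 t0); cs; ce; rewrite /e1 scons0. Qed.
Lemma mspS i a b : mS i b <> mZ -> msp a (mS i b) = half (msp a b).
Proof. by have := pv_ax (e2 a b) (pvd_mspS i u0 u1); cs; ce; rewrite /e2 scons0 sconsS scons0. Qed.
Lemma ax_len0 : ap1 (M := M) pv_len mZ = mZ.
Proof. by have := pv_ax (@env0 M) (pvd_len0 0); cs; rewrite !evE. Qed.
Lemma ax_lenS i a : mS i a <> mZ -> ap1 pv_len (mS i a) = msucc (ap1 pv_len a).
Proof. by have := pv_ax (e1 a) (pvd_lenS i t0); cs; ce; rewrite /e1 scons0. Qed.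
Lemma ax_add0 a : ap2 pv_add a mZ = a.
Proof. by have := pv_ax (e1 a) (pvd_add0 t0); cs; ce; rewrite /e1 scons0. Qed.
Lemma ax_addS i j a b : ap2 pv_add (mS i a) (mS j b) =
  if i && j then mS false (msucc (ap2 pv_add a b)) else mS (i || j) (ap2 pv_add a b).
Proof.
have := pv_ax (e2 a b) (pvd_addS i j u0 u1); cs.
by case: (i && j); ce; rewrite /e2 scons0 sconsS scons0.
Qed.
Lemma ax_mul0 a : ap2 pv_mul a mZ = mZ.
Proof. by have := pv_ax (e1 a) (pvd_mul0 t0); cs; ce; rewrite /e1 scons0. Qed.
Lemma ax_mulS i a b : ap2 pv_mul a (mS i b) =
  if i then ap2 pv_add (mS false (ap2 pv_mul a b)) a else mS false (ap2 pv_mul a b).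
Proof.
have := pv_ax (e2 a b) (pvd_mulS i u0 u1); cs.
by case: i; ce; rewrite /e2 scons0 sconsS scons0.
Qed.
Lemma ax_smash0 a : ap2 pv_smash a mZ = mS true mZ.
Proof. by have := pv_ax (e1 a) (pvd_smash0 t0); cs; ce; rewrite /e1 scons0. Qed.
Lemma ax_smash01 : ap2 (M := M) pv_smash mZ (mS true mZ) = mS true mZ.
Proof. by have := pv_ax (@env0 M) (pvd_smash01 0); cs; rewrite !evE. Qed.
Lemma ax_smashS1 i a : mS i a <> mZ ->
  ap2 pv_smash (mS i a) (mS true mZ) = mS false (ap2 pv_smash a (mS true mZ)).
Proof. by have := pv_ax (e1 a) (pvd_smashS1 i t0); cs; ce; rewrite /e1 scons0. Qed.
Lemma ax_smashS i a b : mS i b <> mZ ->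
  ap2 pv_smash a (mS i b) = ap2 pv_mul (ap2 pv_smash a b) (ap2 pv_smash a (mS true mZ)).
Proof. by have := pv_ax (e2 a b) (pvd_smashS i u0 u1); cs; ce; rewrite /e2 scons0 sconsS scons0. Qed.
Lemma ax_leq0 a : ap2 pv_leq mZ a = mS true mZ.
Proof. by have := pv_ax (e1 a) (pvd_leq0 t0); cs; ce; rewrite /e1 scons0. Qed.
Lemma ax_leqS (i j : bool) a b : i ==> j ->
  ap2 pv_leq (mS i a) (mS j b) = ap2 pv_leq a b.
Proof.
move=> ij; have := pv_ax (e2 a b) (pvd_leqS u0 u1 ij).
by cs; ce; rewrite /e2 scons0 sconsS scons0.
Qed.
Lemma ax_leqS10 a b :
  (ap2 pv_leq b a = mS true mZ -> ap2 pv_leq (mS true a) (mS false b) = mZ) /\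
  (ap2 pv_leq b a <> mS true mZ -> ap2 pv_leq (mS true a) (mS false b) = mS true mZ).
Proof.
by have /sat_and := pv_ax (e2 a b) (pvd_leqS10 u0 u1);
  cs; ce; rewrite /e2 scons0 sconsS scons0.
Qed.
Lemma ax_proj k (i : 'I_k) (x : 'I_k -> M) : sapp (pv_proj i) x = x i.
Proof. exact: (pv_ax x (pvd_proj i (fun j => tvar j))). Qed.
Lemma ax_comp k l (f : pvsym l) (g : 'I_l -> pvsym k) (x : 'I_k -> M) :
  sapp (pv_comp f g) x = sapp f (fun j => sapp (g j) x).
Proof. exact: (pv_ax x (pvd_comp f g (fun j => tvar j))). Qed.
Lemma ax_lrn0 k (g : pvsym k) h l (x : 'I_k -> M) :
  sapp (pv_lrn g h l) (scons mZ x) = sapp g x.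
Proof.
have := pv_ax x (pvd_lrn0 g h l (fun j => tvar j)).
by cbn [sat ev]; rewrite (scons_comp (ev x)) evZ.
Qed.
Lemma ax_lrnS k (g : pvsym k) h l i y (x : 'I_k -> M) :
  let f u := sapp (pv_lrn g h l) (scons u x) in
  let a := sapp (h i) (scons y (scons (f y) x)) in
  let c := sapp l (scons (mS i y) x) in
  mS i y <> mZ -> (msp a c = mZ -> f (mS i y) = a) /\ (msp a c <> mZ -> f (mS i y) = c).
Proof.
move=> f a c nz.
have := pv_ax (scons y x) (pvd_lrnS g h l i (tvar ord0) (fun j => tvar (lift ord0 j))).
cbn zeta; move/sat_imp=> H.
have nz' : sat (fneg (feq (tS i (tvar ord0)) tZ)) (scons y x).
  by cs; ce; rewrite scons0.
move: {H nz'}(H nz').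
have ex : (fun j => ev (scons y x) (tvar (lift ord0 j))) = x.
  by apply/funext => j /=; rewrite sconsS.
have E f' t : ev (scons y x) (tapp f' (scons t (fun j => tvar (lift ord0 j)))) =
    sapp f' (scons (ev (scons y x) t) x).
  by rewrite /= (scons_comp (ev _)) ex.
have E' f' t u : ev (scons y x) (tapp f' (scons t (scons u (fun j => tvar (lift ord0 j))))) =
    sapp f' (scons (ev (scons y x) t) (scons (ev (scons y x) u) x)).
  by rewrite /= !(scons_comp (ev _)) ex.
move/sat_and; cbn [sat fneg].
have -> : ev (scons y x) (tmsp (tapp (h i) (scons (tvar ord0)
    (scons (tapp (pv_lrn g h l) (scons (tvar ord0) (fun j => tvar (lift ord0 j))))
    (fun j => tvar (lift ord0 j))))) (tapp l (scons (tS i (tvar ord0)) (fun j => tvar (lift ord0 j)))))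
    = msp a c.
  by rewrite ev2 E' !E ev1; cbn [ev]; rewrite scons0.
by rewrite !(E', E); ce; rewrite scons0.
Qed.
End PVLaws.

(** * Induction and recursion on notation, as facts about models *)

Fixpoint tsym n (t : pvterm n) : pvsym n :=
  match t with
  | tvar i => pv_proj i
  | tapp _ f ts => pv_comp f (fun j => tsym (ts j))
  end.

Lemma tsymE n (t : pvterm n) (M : pvm) (x : 'I_n -> M) : sapp (tsym t) x = ev x t.
Proof.
elim: t => [i|k f ts IH] /=; first exact: ax_proj.
by rewrite ax_comp; congr sapp; apply/funext.
Qed.

(** Cook's rule has derivable premises, so base and step are assumed in all models and not only in
    [M]. The restriction is lifted in [rind]. *)
Lemma uind n (P : Rn n.+1) : pd P ->
  (forall M x, P M (scons mZ x)) ->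
  (forall M y i x, P M (scons y x) -> P M (scons (mS i y) x)) ->
  forall M y x, P M (scons y x).
Proof.
move=> [A qA AE] base step M y x; apply/AE.
have H : PV (alls A).
  apply: PV_notind => //.
    apply: qf_completeness => //; [exact: PV_universal|exact: qf_fsubst|].
    move=> N NP z; apply/sat_inst.
    rewrite (_ : ev z tZ = @mZ (Pvm NP)); first exact/(AE (Pvm NP))/base.
    by rewrite /mZ /=; congr sapp; apply: env0E.
  move=> i; apply: qf_completeness => //; [exact: PV_universal| |].
    by split=> //; apply: qf_fsubst.
  move=> N NP z /=; rewrite -(scons_eta z) sat_inst_var => h; apply/(AE (Pvm NP)).
  rewrite (_ : ev _ _ = @mS i (Pvm NP) (z ord0)).
    by apply: step; apply/(AE (Pvm NP)).
  by rewrite /= tnth_comp1 /= scons0 tnth1E.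
by have /sat_alls := pvmP (p := M) H (@env0 M); apply.
Qed.

Lemma uind0 (P : R1) : rel1 P -> (forall M, P M mZ) ->
  (forall M y i, P M y -> P M (mS i y)) -> forall M y, P M y.
Proof.
move=> dP b s M y; have := uind dP _ _ (M := M) y (@env0 M); rewrite scE; apply.
  by move=> N x; rewrite scE; apply: b.
by move=> N z i x; rewrite !scE; apply: s.
Qed.

Lemma uind1 (P : R2) : rel2 P -> (forall M a, P M mZ a) ->
  (forall M y i a, P M y a -> P M (mS i y) a) -> forall M y a, P M y a.
Proof.
move=> dP b s M y a; have := uind dP _ _ (M := M) y (scons a (@env0 M)); rewrite !scE; apply.
  by move=> N x; rewrite scE; apply: b.
by move=> N z i x; rewrite !sc0 /v1 !sconsS; apply: s.
Qed.

Lemma uind2 (P : R3) : rel3 P -> (forall M a b, P M mZ a b) ->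
  (forall M y i a b, P M y a b -> P M (mS i y) a b) -> forall M y a b, P M y a b.
Proof.
move=> dP b s M y a a'.
have := uind dP _ _ (M := M) y (scons a (scons a' (@env0 M))); rewrite !scE; apply.
  by move=> N x; rewrite sc0; apply: b.
by move=> N z i x; rewrite !sc0 /v1 /v2 !sconsS; apply: s.
Qed.

(** The condition [msp h b = mZ] says that [h] is no longer than the bound, in which case the cut
    built into [pv_lrn] is void. The recursor takes symbols, which [tsym] makes out of terms. *)
Lemma lrn n (G : Fn n) (H : bool -> Fn n.+2) (B : Fn n.+1) :
  fd G -> (forall i, fd (H i)) -> fd B ->
  exists F : Fn n.+1, [/\ fd F, forall M x, F M (scons mZ x) = G M x &
    forall M y i x, mS i y <> mZ ->
    let h := H i M (scons y (scons (F M (scons y x)) x)) in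
    msp h (B M (scons (mS i y) x)) = mZ -> F M (scons (mS i y) x) = h].
Proof.
move=> [g gE] /choice[h hE] [b bE].
exists (fun M x => sapp (pv_lrn (tsym g) (fun i => tsym (h i)) (tsym b)) x).
split; first by exists (tapp (pv_lrn (tsym g) (fun i => tsym (h i)) (tsym b)) tvar).
  by move=> M x; rewrite ax_lrn0 tsymE gE.
move=> M y i x nz; rewrite -bE -hE -!tsymE => h0.
by have [+ _] := ax_lrnS (tsym g) (fun i => tsym (h i)) (tsym b) x nz; apply.
Qed.

Lemma lrn1 (G : F1) (H : bool -> F3) (B : F2) : def1 G -> (forall i, def3 (H i)) -> def2 B ->
  exists F : F2, [/\ def2 F, forall M x, F M mZ x = G M x &
    forall M y i x, mS i y <> mZ ->
    msp (H i M y (F M y x) x) (B M (mS i y) x) = mZ -> F M (mS i y) x = H i M y (F M y x) x].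
Proof.
move=> dG dH dB; have [F [dF F0 FS]] := lrn dG dH dB.
exists (fun M y x => F M (scons y (scons x (@env0 M)))); split.
- apply: fd_ext dF => M x; congr F; rewrite -[LHS]scons_eta; congr scons.
  by rewrite -[LHS]scons_eta; congr scons; apply: env0E.
- by move=> M x; rewrite F0 scE.
- by move=> M y i x nz; have := FS M y i (scons x (@env0 M)) nz; rewrite /= !scE.
Qed.

Lemma lrn2 (G : F2) (H : bool -> F4) (B : F3) : def2 G -> (forall i, def4 (H i)) -> def3 B ->
  exists F : F3, [/\ def3 F, forall M x z, F M mZ x z = G M x z &
    forall M y i x z, mS i y <> mZ ->
    msp (H i M y (F M y x z) x z) (B M (mS i y) x z) = mZ ->
    F M (mS i y) x z = H i M y (F M y x z) x z].
Proof.
move=> dG dH dB; have [F [dF F0 FS]] := lrn dG dH dB.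
exists (fun M y x z => F M (scons y (scons x (scons z (@env0 M))))); split.
- apply: fd_ext dF => M x; congr F; rewrite -[LHS]scons_eta; congr scons.
  rewrite -[LHS]scons_eta; congr scons; rewrite -[LHS]scons_eta; congr scons; exact: env0E.
- by move=> M x z; rewrite F0 !scE.
- move=> M y i x z nz; have := FS M y i (scons x (scons z (@env0 M))) nz.
  by rewrite /= !scE.
Qed.

(** * Tactics for definability *)

Definition def0 (c : forall M : pvm, M) := forall n, @fd n (fun M _ => c M).

(** The recursive calls are parameters, [k1] for the head and [k2] for the arguments, so that [fdt0]
    and the later [fdt] share the matching. Two versions exist because [fdt] also treats [ite],
    which rests on [cond], itself obtained with [fdt0]. *)
Ltac fd1 k1 k2 :=
  lazymatch goal with
  | |- @fd _ (fun M x => x _) => exact (fd_var _)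
  | |- @fd _ (fun M x => @mZ M) => exact (@fd_Z _)
  | |- @fd _ (fun M x => ?c M) =>
      let H := fresh in assert (H : def0 c); [k1 tt | exact (H _)]
  | |- @fd _ (fun M x => ?F M (@?a M x)) =>
      apply (@fd_app1 _ F a); [k1 tt | k2 tt]
  | |- @fd _ (fun M x => ?F M (@?a M x) (@?b M x)) =>
      apply (@fd_app2 _ F a b); [k1 tt | k2 tt | k2 tt]
  | |- @fd _ (fun M x => ?F M (@?a M x) (@?b M x) (@?c M x)) =>
      apply (@fd_app3 _ F a b c); [k1 tt | k2 tt | k2 tt | k2 tt]
  | |- @fd _ (fun M x => ?F M (@?a M x) (@?b M x) (@?c M x) (@?d M x)) =>
      apply (@fd_app4 _ F a b c d); [k1 tt | k2 tt | k2 tt | k2 tt | k2 tt]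
  end.

Ltac fdleaf := intros; first [ eassumption | solve [auto with fdb] ].

Ltac fdt0 :=
  cbv beta;
  lazymatch goal with
  | |- forall _, _ => intro; fdt0
  | |- @fd _ _ => fd1 ltac:(fun _ => first [fdleaf | fdt0]) ltac:(fun _ => fdt0)
  | |- def1 _ => unfold def1; fdt0
  | |- def2 _ => unfold def2; fdt0
  | |- def3 _ => unfold def3; fdt0
  | |- def4 _ => unfold def4; fdt0
  end.

Ltac pd1 f k1 k2 :=
  lazymatch goal with
  | |- @pd _ (fun M x => True) => exact (@pd_True _)
  | |- @pd _ (fun M x => False) => exact (@pd_False _)
  | |- @pd _ (fun M x => @?P M x /\ @?Q M x) => apply (@pd_and _ P Q); k2 tt
  | |- @pd _ (fun M x => @?P M x \/ @?Q M x) => apply (@pd_or _ P Q); k2 tt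
  | |- @pd _ (fun M x => ~ @?P M x) => apply (@pd_not _ P); k2 tt
  | |- @pd _ (fun M x => @?P M x -> @?Q M x) => apply (@pd_imp _ P Q); k2 tt
  | |- @pd _ (fun M x => @?P M x = @?Q M x) => apply (@pd_eq _ P Q); f tt
  | |- @pd _ (fun M x => ?F M (@?a M x)) =>
      apply (@pd_app1 _ F a); [k1 tt | f tt]
  | |- @pd _ (fun M x => ?F M (@?a M x) (@?b M x)) =>
      apply (@pd_app2 _ F a b); [k1 tt | f tt | f tt]
  | |- @pd _ (fun M x => ?F M (@?a M x) (@?b M x) (@?c M x)) =>
      apply (@pd_app3 _ F a b c); [k1 tt | f tt | f tt | f tt]
  | |- @pd _ (fun M x => ?F M (@?a M x) (@?b M x) (@?c M x) (@?d M x)) =>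
      apply (@pd_app4 _ F a b c d); [k1 tt | f tt | f tt | f tt | f tt]
  end.

Ltac pdt0 :=
  cbv beta;
  lazymatch goal with
  | |- forall _, _ => intro; pdt0
  | |- @pd _ _ => pd1 ltac:(fun _ => fdt0) ltac:(fun _ => first [fdleaf | pdt0]) ltac:(fun _ => pdt0)
  | |- rel1 _ => unfold rel1; pdt0
  | |- rel2 _ => unfold rel2; pdt0
  | |- rel3 _ => unfold rel3; pdt0
  | |- rel4 _ => unfold rel4; pdt0
  end.

Definition ite (P : Prop) T (a b : T) : T := if `[< P >] then a else b.
Lemma iteT (P : Prop) T (a b : T) : P -> ite P a b = a.
Proof. by rewrite /ite; case: asboolP. Qed.
Lemma iteF (P : Prop) T (a b : T) : ~ P -> ite P a b = b.
Proof. by rewrite /ite; case: asboolP. Qed.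

(** ** Elementary facts about binary strings *)

Section Strings.
Variable M : pvm.
Implicit Types x y z a b c e : M.

Lemma half0 : half (mZ (M := M)) = mZ.
Proof. by rewrite -{1}S00 halfS. Qed.

Lemma S1nz x : mS true x <> mZ.
Proof. by rewrite -S00 => /esym/S01. Qed.

Lemma mS_inj i j x y : mS i x = mS j y -> i = j /\ x = y.
Proof.
move=> e; have xy : x = y by rewrite -(halfS i x) e halfS.
by split=> //; case: i j e => [] [] // e; [case: (S01 (esym e))|case: (S01 e)].
Qed.

Lemma S0nz i x : mS i x = mZ -> i = false /\ x = mZ.
Proof. by rewrite -{1}S00 => /mS_inj. Qed.

Lemma mS_nz i x : x <> mZ -> mS i x <> mZ.
Proof. by move=> nx /S0nz[]. Qed.
End Strings.

Lemma caseS (M : pvm) (y : M) : exists i y', y = mS i y'.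
Proof.
(* Induction is available for open formulas only, so [y'] is named as [half y]. *)
suff [e|e] : mS false (half y) = y \/ mS true (half y) = y by [exists false, (half y)|exists true, (half y)].
move: M y; apply: uind0; first by pdt0.
  by move=> M; left; rewrite half0 S00.
by move=> M y [] _; [right|left]; rewrite halfS.
Qed.

Lemma half_msp (M : pvm) (u t : M) : half (msp t u) = msp (half t) u.
Proof.
move: M u t; apply: uind1; first by pdt0.
  by move=> M t; rewrite !msp0.
move=> M u i t IH; case: (pselect (mS i u = mZ)) => [->|nz]; first by rewrite !msp0.
by rewrite !mspS // IH.
Qed.

Lemma msp0l (M : pvm) (u : M) : msp mZ u = mZ.
Proof.
move: M u; apply: uind0; [by pdt0|by move=> M; rewrite msp0|].
move=> M u i IH; case: (pselect (mS i u = mZ)) => [->|nz]; first by rewrite msp0.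
by rewrite mspS // IH half0.
Qed.

Lemma msp_xx (M : pvm) (x : M) : msp x x = mZ.
Proof.
move: M x; apply: uind0; [by pdt0|by move=> M; rewrite msp0|].
move=> M u i IH; case: (pselect (mS i u = mZ)) => [->|nz]; first by rewrite msp0.
by rewrite mspS // half_msp halfS.
Qed.

(** For inductions on [c] about [msp x (msp y c)]: as [c] gets longer the shift [msp y c] gets
    shorter and one more leading digit of [x] is revealed; at [c = y] the shift is [mZ] and all of
    [x] is seen. In the first disjunct the shift is already exhausted. *)
Lemma msp_step (M : pvm) (y c : M) i : mS i c <> mZ ->
  (msp y c = mZ /\ msp y (mS i c) = mZ) \/
  exists e, [/\ msp y c <> mZ, msp y (mS i c) = e, half (msp y c) = e &
     forall x, half (msp x e) = msp x (msp y c)].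
Proof.
move=> nz; rewrite mspS //; case: (pselect (msp y c = mZ)) => [->|ny]; [left|right].
  by rewrite half0.
have [j [e ee]] := caseS (msp y c); exists e; split=> //; rewrite ?ee ?halfS //.
by move=> x; rewrite mspS // -ee.
Qed.

(** Comparison of lengths: nothing remains of [x] when as many digits are removed as [y] has. *)
Definition ple (M : pvm) (x y : M) := msp x y = mZ.
Lemma rel_ple : rel2 ple. Proof. by rewrite /ple; pdt0. Qed.
#[export] Hint Resolve rel_ple : fdb.

Section Ple.
Variable M : pvm.
Implicit Types x y z : M.

Lemma ple_xx x : ple x x. Proof. exact: msp_xx. Qed.
Lemma ple0 x : ple mZ x. Proof. exact: msp0l. Qed.
Lemma ple_0 x : ple x mZ -> x = mZ. Proof. by rewrite /ple msp0. Qed.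

Lemma ple_S i j x y : ple x y -> mS j y <> mZ -> ple (mS i x) (mS j y).
Proof. by rewrite /ple => xy nz; rewrite mspS // half_msp halfS. Qed.

Lemma ple_half x y : ple x y -> ple (half x) y.
Proof. by rewrite /ple -half_msp => ->; rewrite half0. Qed.

Lemma ple_Sr i x y : ple x y -> ple x (mS i y).
Proof.
case: (pselect (mS i y = mZ)) => [e|nz]; last by rewrite /ple mspS // => ->; rewrite half0.
by have [-> ->] := S0nz e; rewrite S00.
Qed.

Lemma ple_half2 x y : y <> mZ -> ple x y -> ple (half x) (half y).
Proof.
have [i [z ->]] := caseS y => nz; rewrite halfS /ple -half_msp => <-.
by rewrite mspS.
Qed.
End Ple.

Lemma ple_trans (M : pvm) (x y z : M) : ple x y -> ple y z -> ple x z.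
Proof.
suff H : ple x y -> ple (msp x (msp y z)) z.
  by move=> /H + yz; rewrite /ple in yz; rewrite yz msp0.
move: M z x y; apply: uind2; first by pdt0.
  by move=> M x y; rewrite /ple !msp0.
move=> M z i x y IH /IH{}IH; case: (pselect (mS i z = mZ)) => [e|nz].
  by have [_ zz] := S0nz e; rewrite e; rewrite zz in IH.
have [[e1 e2]|[e [ny e1 e2 e3]]] := msp_step y nz.
  by rewrite e2; rewrite e1 in IH; apply: ple_Sr.
have [j [w ew]] := caseS (msp x e); rewrite e1 ew; apply: ple_S => //.
by rewrite -e3 ew halfS in IH.
Qed.

(** ** Definition by cases *)

Lemma ex_cond : exists F : F3, def3 F /\ forall (M : pvm) (c a b : M),
  (c = mZ -> F M c a b = a) /\ (c <> mZ -> F M c a b = b).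
Proof.
have [|||F [dF F0 FS]] := @lrn2 (fun M a b => a) (fun i M y r a b => b) (fun M c a b => b); try fdt0.
exists F; split=> // M c a b; split=> [->|nz]; first exact: F0.
have [i [y cy]] := caseS c; rewrite cy FS ?msp_xx //; by rewrite -cy.
Qed.
Definition cond : F3 := sval (cid ex_cond).
Lemma def_cond : def3 cond. Proof. by rewrite /cond; case: cid => F []. Qed.
Lemma cond0 (M : pvm) (a b : M) : cond mZ a b = a.
Proof. by rewrite /cond; case: cid => F [_ H] /=; exact: (proj1 (H M mZ a b)). Qed.
Lemma cond1 (M : pvm) (c a b : M) : c <> mZ -> cond c a b = b.
Proof. by rewrite /cond; case: cid => F [_ H] /=; exact: (proj2 (H M c a b)). Qed.
#[export] Hint Resolve def_cond : fdb.

Definition one {M : pvm} : M := mS true mZ.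
Lemma def_one : def0 (@one). Proof. by move=> n; rewrite /one; fdt0. Qed.
#[export] Hint Resolve def_one : fdb.
Lemma one_nz (M : pvm) : (one : M) <> mZ. Proof. exact: S1nz. Qed.

Lemma ex_bit : exists F : F1, def1 F /\ forall (M : pvm) i (y : M), F M (mS i y) = if i then one else mZ.
Proof.
have [|[]||F [dF F0 FS]] := @lrn1 (fun M a => mZ) (fun i M y r a => if i then one else mZ)
  (fun M c a => one); try fdt0.
exists (fun M y => F M y mZ); split; first by fdt0.
move=> M i y; case: (pselect (mS i y = mZ)) => [e|nz].
  by have [-> ->] := S0nz e; rewrite S00 F0.
by rewrite FS //; case: i {nz}; rewrite ?msp_xx ?msp0l.
Qed.
Definition bit : F1 := sval (cid ex_bit).
Lemma def_bit : def1 bit. Proof. by rewrite /bit; case: cid => F []. Qed.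
Lemma bitS (M : pvm) i (y : M) : bit (mS i y) = if i then one else mZ.
Proof. by rewrite /bit; case: cid => F []. Qed.
#[export] Hint Resolve def_bit : fdb.

Lemma bit_half_inj (M : pvm) (x y : M) : bit x = bit y -> half x = half y -> x = y.
Proof.
have [i [x' ->]] := caseS x; have [j [y' ->]] := caseS y; rewrite !bitS !halfS => e ->.
by case: i j e => [] [] // e; [case: (one_nz e)|case: (one_nz (esym e))].
Qed.

Lemma bit01 (M : pvm) (x : M) : bit x = mZ \/ bit x = one.
Proof. by have [[] [y ->]] := caseS x; rewrite bitS; [right|left]. Qed.

Definition xnor (M : pvm) (a b : M) := cond a (cond b one mZ) (cond b mZ one).
Lemma def_xnor : def2 xnor. Proof. by rewrite /xnor; fdt0. Qed.
#[export] Hint Resolve def_xnor : fdb.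

Lemma xnor_bit (M : pvm) (x y : M) : xnor (bit x) (bit y) = ite (bit x = bit y) one mZ.
Proof.
have n1 := @one_nz M; rewrite /xnor.
case: (bit01 x) => ->; case: (bit01 y) => ->; rewrite ?cond0 ?(cond1 _ _ n1);
  by [rewrite iteT|rewrite iteF // => /esym|rewrite iteF].
Qed.

(** Compares [x] and [y] digit by digit, starting from the position of the leading digit of [x];
    [half (msp x c)] is the shift to the position that comes next. *)
Lemma ex_eqr : exists F : F3, [/\ def3 F, forall (M : pvm) (x y : M), F M mZ x y = one &
  forall (M : pvm) i (c x y : M), mS i c <> mZ -> F M (mS i c) x y = cond (F M c x y) mZ
    (xnor (bit (msp x (half (msp x c)))) (bit (msp y (half (msp x c)))))].
Proof.
have [|||F [dF F0 FS]] := @lrn2 (fun M a b => one) (fun i M c r x y =>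
   cond r mZ (xnor (bit (msp x (half (msp x c)))) (bit (msp y (half (msp x c))))))
  (fun M c a b => one); try fdt0.
exists F; split=> // M i c x y nz; rewrite FS //.
case: (pselect (F M c x y = mZ)) => [->|n]; first by rewrite cond0 msp0l.
by rewrite (cond1 _ _ n) xnor_bit /ite; case: ifP; rewrite ?msp_xx ?msp0l.
Qed.
Definition eqr : F3 := sval (cid ex_eqr).
Lemma def_eqr : def3 eqr. Proof. by rewrite /eqr; case: cid => F []. Qed.
Lemma eqr0 (M : pvm) (x y : M) : eqr mZ x y = one. Proof. by rewrite /eqr; case: cid => F []. Qed.
Lemma eqrS (M : pvm) i (c x y : M) : mS i c <> mZ -> eqr (mS i c) x y = cond (eqr c x y) mZ
    (xnor (bit (msp x (half (msp x c)))) (bit (msp y (half (msp x c))))).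
Proof. by rewrite /eqr; case: cid => F [] /= _ _; apply. Qed.
#[export] Hint Resolve def_eqr : fdb.

(** Characteristic function of equality, with [mZ] for true. The test of [msp y x] is there because
    [eqr x x y] sees only as many final digits of [y] as [x] has. *)
Definition eqt (M : pvm) (x y : M) := cond (cond (msp y x) (eqr x x y) mZ) one mZ.
Lemma def_eqt : def2 eqt. Proof. by rewrite /eqt; fdt0. Qed.
#[export] Hint Resolve def_eqt : fdb.

Lemma eqtP (M : pvm) (x y : M) : eqt x y = mZ <-> x = y.
Proof.
rewrite /eqt; split; last first.
  move=> <-; rewrite msp_xx cond0 cond1 //.
  suff -> : eqr x x x = one by apply: one_nz.
  suff H : forall c, eqr c x x = one by apply: H.
  move=> c {y}; move: M c x; apply: uind1; [by pdt0|by move=> *; rewrite eqr0|].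
  move=> M c i x IH; case: (pselect (mS i c = mZ)) => [->|nz]; first by rewrite eqr0.
  by rewrite eqrS // IH xnor_bit cond1; [rewrite iteT|apply: one_nz].
case: (pselect (msp y x = mZ)) => [yx|n]; last by rewrite (cond1 _ _ n) cond0 => /one_nz.
rewrite yx cond0; case: (pselect (eqr x x y = mZ)) => [->|n _]; first by rewrite cond0 => /one_nz.
suff H : forall c, msp y x = mZ -> eqr c x y <> mZ -> msp x (msp x c) = msp y (msp x c).
  by have := H x yx n; rewrite msp_xx !msp0.
move=> c {yx n}; move: M c x y; apply: uind2; first by pdt0.
  by move=> M x y yx _; rewrite msp0 msp_xx.
move=> M c i x y IH yx; case: (pselect (mS i c = mZ)) => [e|nz].
  by have [_ cc] := S0nz e; rewrite e; rewrite cc in IH; apply: IH.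
rewrite eqrS //; case: (pselect (eqr c x y = mZ)) => [->|n]; first by rewrite cond0.
have {IH} := IH yx n; rewrite (cond1 _ _ n).
have [[e1 e2]|[e [ny e1 e2 e3]]] := msp_step x nz; first by rewrite e1 e2.
rewrite e2 e1 -!e3 xnor_bit => h; case: (pselect (bit (msp x e) = bit (msp y e))) => b.
  by move=> _; apply: bit_half_inj.
by rewrite iteF.
Qed.

Lemma pd_char n (P : Rn n) : pd P -> exists2 F : Fn n, fd F & forall M x, P M x <-> F M x = mZ.
Proof.
move=> [A qA AE].
suff [F dF FE] : exists2 F : Fn n, fd F & forall M x, sat (M := pstr M) A x <-> F M x = mZ.
  by exists F => // M x; rewrite -AE.
elim: A qA {P AE} => {n} [n|n t u|n A IA B IB|//] /= qA.
- exists (fun M x => one); first by fdt0.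
  by move=> M x; split=> // /one_nz.
- exists (fun M x => eqt (ev x t) (ev x u)); last by move=> M x; rewrite eqtP.
  by apply: fd_app2; [exact: def_eqt|exists t|exists u].
- have [F dF FE] := IA (proj1 qA); have [G dG GE] := IB (proj2 qA).
  exists (fun M x => cond (F M x) (G M x) mZ); first by apply: fd_app3; [exact: def_cond| | |exact: fd_Z].
  move=> M x; rewrite FE GE; case: (pselect (F M x = mZ)) => [e|n']; rewrite ?e ?cond0 ?cond1 //.
    by split=> // h; apply: h.
Qed.

Lemma fd_if n (P : Rn n) (F G : Fn n) : pd P -> fd F -> fd G ->
  @fd n (fun M x => ite (P M x) (F M x) (G M x)).
Proof.
move=> /pd_char[C dC CE] dF dG.
apply: (@fd_ext n (fun M x => cond (C M x) (F M x) (G M x))).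
  move=> M x; case: (pselect (P M x)) => h.
    by rewrite iteT // (proj1 (CE M x) h) cond0.
  by rewrite iteF // cond1 // => /CE.
by apply: fd_app3 => //; exact: def_cond.
Qed.

Ltac fdt :=
  cbv beta;
  lazymatch goal with
  | |- forall _, _ => intro; fdt
  | |- @fd _ (fun M x => @ite (@?P M x) (@?T M x) (@?F M x) (@?G M x)) =>
      apply (@fd_if _ P F G); [pdt | fdt | fdt]
  | |- @fd _ _ => fd1 ltac:(fun _ => first [fdleaf | fdt]) ltac:(fun _ => fdt)
  | |- def1 _ => unfold def1; fdt
  | |- def2 _ => unfold def2; fdt
  | |- def3 _ => unfold def3; fdt
  | |- def4 _ => unfold def4; fdt
  end
with pdt :=
  cbv beta;
  lazymatch goal with
  | |- forall _, _ => intro; pdt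
  | |- @pd _ _ => pd1 ltac:(fun _ => fdt) ltac:(fun _ => first [fdleaf | pdt]) ltac:(fun _ => pdt)
  | |- rel1 _ => unfold rel1; pdt
  | |- rel2 _ => unfold rel2; pdt
  | |- rel3 _ => unfold rel3; pdt
  | |- rel4 _ => unfold rel4; pdt
  end.

(** ** Induction relative to a model *)

(* [H c] is the longest prefix of [c] up to which the predicate is preserved. *)
Lemma rind n (P : Rn n.+1) : pd P -> forall M x, P M (scons mZ x) ->
  (forall y i, P M (scons y x) -> P M (scons (mS i y) x)) -> forall y, P M (scons y x).
Proof.
move=> dP.
have dS i : @pd n.+2 (fun M x => P M (scons (mS i (x (v0 _))) (fun j => x (lift ord0 (lift ord0 j))))).
  have [A qA AE] := dP.
  exists (fsubst A (scons (tS i (tvar ord0)) (fun j => tvar (lift ord0 (lift ord0 j)))));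
    first exact: qf_fsubst.
  move=> M x; rewrite sat_fsubst AE scons_comp.
  by rewrite /tS /app1 /= tnth_comp1 tnth1E.
have [|i||H [dH H0 HS]] := @lrn n (fun M x => mZ) (fun i M x =>
    ite (x (v1 _) = x (v0 _) /\ P M (scons (mS i (x (v0 _))) (fun j => x (lift ord0 (lift ord0 j)))))
    (mS i (x (v0 _))) (x (v1 _))) (fun M x => x (v0 _)).
- exact: fd_Z.
- apply: fd_if; [|by fdt|by fdt]; apply: pd_and (dS i); by pdt.
- by fdt.
have HS' M y i x : mS i y <> mZ -> ple (H M (scons y x)) y -> H M (scons (mS i y) x) =
    ite (H M (scons y x) = y /\ P M (scons (mS i y) x)) (mS i y) (H M (scons y x)).
  have ex : (fun j => scons y (scons (H M (scons y x)) x) (lift ord0 (lift ord0 j))) = x.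
    by apply/funext => j; rewrite !sconsS.
  move=> nz le; rewrite HS //= !scE ex //.
  by rewrite /ite; case: ifP => _; [apply: ple_xx|apply: ple_Sr].
have Hle M y x : ple (H M (scons y x)) y.
  have := @uind n (fun M x => ple (H M x) (x (v0 _))) _ _ _ M y x; rewrite scE; apply.
  - by apply: pd_app2; [exact: rel_ple|exact: dH|exact: fd_var].
  - by move=> N z; rewrite H0; apply: ple0.
  - move=> N z i w; rewrite !scE => IH; case: (pselect (mS i z = mZ)) => [e|nz].
      by have [_ zz] := S0nz e; rewrite e; rewrite zz in IH.
    by rewrite HS' // /ite; case: ifP => _; [apply: ple_xx|apply: ple_Sr].
have dPH i : @pd n.+1 (fun M x => P M (scons (mS i (H M x)) (fun j => x (lift ord0 j)))).
  have [A qA AE] := dP; have [h hE] := dH.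
  exists (fsubst A (scons (tS i h) (fun j => tvar (lift ord0 j)))); first exact: qf_fsubst.
  by move=> M x; rewrite sat_fsubst AE scons_comp /tS /app1 /= tnth_comp1 tnth1E hE.
have dPH0 : @pd n.+1 (fun M x => P M (scons (H M x) (fun j => x (lift ord0 j)))).
  have [A qA AE] := dP; have [h hE] := dH.
  exists (fsubst A (scons h (fun j => tvar (lift ord0 j)))); first exact: qf_fsubst.
  by move=> M x; rewrite sat_fsubst AE scons_comp hE.
have dP0 : @pd n.+1 (fun M x => P M (scons mZ (fun j => x (lift ord0 j)))).
  have [A qA AE] := dP.
  exists (fsubst A (scons tZ (fun j => tvar (lift ord0 j)))); first exact: qf_fsubst.
  move=> M x; rewrite sat_fsubst AE scons_comp; suff -> : ev x tZ = mZ by [].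
  by rewrite /mZ /=; congr sapp; apply: env0E.
(* [H] ends at the whole of [y] or at a prefix with an extension that violates [P]. This is an open
   statement that holds in all models, so [uind] proves it; the hypothesis about the step, known in
   [M] only, then excludes the second case. *)
have key M y x : P M (scons mZ x) -> P M (scons (H M (scons y x)) x) /\
    (H M (scons y x) = y \/ exists i, ~ P M (scons (mS i (H M (scons y x))) x)).
  have lx N (z : N) w : (fun j : 'I_n => scons z w (lift ord0 j)) = w.
    by apply/funext => j; rewrite sconsS.
  suff : P M (scons mZ x) -> P M (scons (H M (scons y x)) x) /\
    (H M (scons y x) = y \/ ~ P M (scons (mS true (H M (scons y x))) x) \/
       ~ P M (scons (mS false (H M (scons y x))) x)).
    move=> h /h[a [b|[b|b]]]; split=> //; by [left|right; exists true|right; exists false].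
  have := @uind n (fun M x => P M (scons mZ (fun j => x (lift ord0 j))) ->
     P M (scons (H M x) (fun j => x (lift ord0 j))) /\
    (H M x = x (v0 _) \/ ~ P M (scons (mS true (H M x)) (fun j => x (lift ord0 j))) \/
       ~ P M (scons (mS false (H M x)) (fun j => x (lift ord0 j))))) _ _ _ M y x.
  rewrite !lx !scE; apply.
  - apply: pd_imp => //; apply: pd_and => //; apply: pd_or; first by apply: pd_eq; [exact: dH|exact: fd_var].
    by apply: pd_or; apply: pd_not.
  - by move=> N z; rewrite lx H0 scE; split=> //; left.
  - move=> N z i w; rewrite !lx !scE => IH /IH{IH}[IH1 IH2].
    case: (pselect (mS i z = mZ)) => [e|nz].
      by have [_ zz] := S0nz e; rewrite e; rewrite zz in IH1 IH2.
    rewrite HS' // /ite; case: asboolP => [[e1 e2]|ne]; first by split=> //; left.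
    split=> //; right; case: IH2 => [e|//]; rewrite e.
    by case: i nz ne => nz ne; [left|right] => h; apply: ne.
move=> M x b s y; have [h1 [<-//|[i ni]]] := key M y x b.
by case: ni; apply: s.
Qed.

Lemma rind1 (P : R2) : rel2 P -> forall M a, P M mZ a ->
  (forall y i, P M y a -> P M (mS i y) a) -> forall y, P M y a.
Proof.
move=> dP M a b s y; have := rind dP (M := M) (x := scons a (@env0 M)) _ _ y.
by rewrite !scE; apply=> // z i; rewrite !scE; apply: s.
Qed.

Lemma rind2 (P : R3) : rel3 P -> forall M a b, P M mZ a b ->
  (forall y i, P M y a b -> P M (mS i y) a b) -> forall y, P M y a b.
Proof.
move=> dP M a a' b s y; have := rind dP (M := M) (x := scons a (scons a' (@env0 M))) _ _ y.
by rewrite !scE; apply=> // z i; rewrite !scE; apply: s.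
Qed.

(** ** Pairs *)

(** [smash t one] is 2^|t|, so this shifts [a] to the left by the length of [t]. *)
Definition pshl (M : pvm) (a t : M) : M := ap2 pv_mul a (ap2 pv_smash t one).
Lemma def_pshl : def2 pshl.
Proof.
rewrite /pshl; apply: (@fd_app2 _ (fun M => @ap2 M pv_mul)); [exact: def_ap2|by fdt|].
by apply: (@fd_app2 _ (fun M => @ap2 M pv_smash)); [exact: def_ap2|by fdt|by fdt].
Qed.
#[export] Hint Resolve def_pshl : fdb.

Lemma add0l (M : pvm) (x : M) : ap2 pv_add mZ x = x.
Proof.
move: M x; apply: uind0.
- apply: pd_eq; last by fdt.
  by apply: (@fd_app2 _ (fun M => @ap2 M pv_add)); [exact: def_ap2|by fdt|by fdt].
- by move=> M; rewrite ax_add0.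
- by move=> M y i IH; rewrite -{1}S00 ax_addS /= IH.
Qed.

Lemma pshl0 (M : pvm) (a : M) : pshl a mZ = a.
Proof. by rewrite /pshl ax_smash01 /one ax_mulS ax_mul0 S00 add0l. Qed.

Lemma pshlS (M : pvm) (a t : M) i : mS i t <> mZ -> pshl a (mS i t) = mS false (pshl a t).
Proof. by move=> nz; rewrite /pshl ax_smashS1 // ax_mulS. Qed.

Lemma pshl_S0 (M : pvm) (t a : M) : pshl (mS false a) t = mS false (pshl a t).
Proof.
move: M t a; apply: uind1; [by pdt|by move=> M a; rewrite !pshl0|].
move=> M t i a IH; case: (pselect (mS i t = mZ)) => [->|nz]; first by rewrite !pshl0.
by rewrite !pshlS // IH.
Qed.

Lemma pshl_nz (M : pvm) (t a : M) : a <> mZ -> pshl a t <> mZ.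
Proof.
move: M t a; apply: uind1; [by pdt|by move=> M a; rewrite pshl0|].
move=> M t i a IH na; case: (pselect (mS i t = mZ)) => [->|nz]; first by rewrite pshl0.
by rewrite pshlS //; apply: mS_nz; apply: IH.
Qed.

(** Has length 2|a| + |b| + 3, and like [pair] grows by two digits with each digit of [a]. *)
Definition pbound (M : pvm) (a b : M) := pshl (pshl (mS true (mS true (mS true b))) a) a.
Lemma def_pbound : def2 pbound. Proof. by rewrite /pbound; fdt. Qed.
#[export] Hint Resolve def_pbound : fdb.

(* Base 4 with digits 2, 3 for the bits of [a], then the digit 1, then [b]. *)
Lemma ex_pair : exists F : F2, [/\ def2 F,
  forall (M : pvm) (b : M), F M mZ b = mS true (mS false b) &
  forall (M : pvm) i (a b : M), mS i a <> mZ -> F M (mS i a) b = mS i (mS true (F M a b))].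
Proof.
have [|||F [dF F0 FS]] := @lrn1 (fun M b => mS true (mS false b))
  (fun i M a r b => mS i (mS true r)) pbound; try fdt.
have nzb (M : pvm) (a b : M) : pbound a b <> mZ by apply: pshl_nz; apply: pshl_nz; apply: S1nz.
have bS (M : pvm) i (a b : M) : mS i a <> mZ -> pbound (mS i a) b = mS false (mS false (pbound a b)).
  by move=> nz; rewrite /pbound !pshlS // pshl_S0.
have st (M : pvm) i (a b : M) : mS i a <> mZ -> ple (F M a b) (pbound a b) ->
    F M (mS i a) b = mS i (mS true (F M a b)).
  move=> nz le; rewrite FS //; rewrite bS //.
  by apply: ple_S; [apply: ple_S => //|]; apply: mS_nz => //; apply: mS_nz.
have le (M : pvm) (a b : M) : ple (F M a b) (pbound a b).
  move: M a b; apply: uind1; first by pdt.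
    move=> M b; rewrite F0 /pbound !pshl0; apply: ple_S; last exact: S1nz.
    by apply: ple_S; [apply: ple_Sr; apply: ple_xx|apply: S1nz].
  move=> M a i b IH; case: (pselect (mS i a = mZ)) => [e|nz].
    by have [_ aa] := S0nz e; rewrite e; rewrite aa in IH.
  rewrite st // bS //.
  by apply: ple_S; [apply: ple_S => //|]; apply: mS_nz => //; apply: mS_nz.
by exists F; split=> // M i a b nz; apply: st.
Qed.
Definition pair : F2 := sval (cid ex_pair).
Lemma def_pair : def2 pair. Proof. by rewrite /pair; case: cid => F []. Qed.
Lemma pair0 (M : pvm) (b : M) : pair mZ b = mS true (mS false b).
Proof. by rewrite /pair; case: cid => F []. Qed.
Lemma pairS (M : pvm) i (a b : M) : mS i a <> mZ -> pair (mS i a) b = mS i (mS true (pair a b)).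
Proof. by rewrite /pair; case: cid => F []/= _ _; apply. Qed.
#[export] Hint Resolve def_pair : fdb.

Lemma pair_nz (M : pvm) (a b : M) : pair a b <> mZ.
Proof.
move: M a b; apply: uind1; [by pdt|by move=> M b; rewrite pair0; apply: S1nz|].
move=> M a i b IH; case: (pselect (mS i a = mZ)) => [->|nz]; first by rewrite pair0; apply: S1nz.
by rewrite pairS //; apply: mS_nz; apply: S1nz.
Qed.

(** The upper bit of a base 4 digit is 1 for the digits 2 and 3 that encode the first component and
    0 for the separator 1, where the stripping stops. So the pair itself is sufficient fuel. *)
Lemma ex_strip : exists F : F2, [/\ def2 F, forall (M : pvm) (p : M), F M mZ p = p,
  forall (M : pvm) (c p : M), ple (F M c p) p &
  forall (M : pvm) i (c p : M), mS i c <> mZ ->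
    F M (mS i c) p = cond (bit (half (F M c p))) (F M c p) (half (half (F M c p)))].
Proof.
have [|||F [dF F0 FS]] := @lrn1 (fun M p => p)
  (fun i M c r p => cond (bit (half r)) r (half (half r))) (fun M c p => p); try fdt.
have bd (M : pvm) (r p : M) : ple r p -> ple (cond (bit (half r)) r (half (half r))) p.
  move=> le; case: (pselect (bit (half r) = mZ)) => [->|n]; rewrite ?cond0 ?cond1 //.
  by do 2!apply: ple_half.
have le (M : pvm) (c p : M) : ple (F M c p) p.
  move: M c p; apply: uind1; [by pdt|by move=> M p; rewrite F0; apply: ple_xx|].
  move=> M c i p IH; case: (pselect (mS i c = mZ)) => [->|nz]; first by rewrite F0; apply: ple_xx.
  by rewrite FS //; apply: bd.
by exists F; split=> // M i c p nz; apply: FS => //; apply: bd.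
Qed.
Definition strip : F2 := sval (cid ex_strip).
Lemma def_strip : def2 strip. Proof. by rewrite /strip; case: cid => F []. Qed.
Lemma strip0 (M : pvm) (p : M) : strip mZ p = p. Proof. by rewrite /strip; case: cid => F []. Qed.
Lemma strip_ple (M : pvm) (c p : M) : ple (strip c p) p.
Proof. by rewrite /strip; case: cid => F []. Qed.
Lemma stripS (M : pvm) i (c p : M) : mS i c <> mZ ->
    strip (mS i c) p = cond (bit (half (strip c p))) (strip c p) (half (half (strip c p))).
Proof. by rewrite /strip; case: cid => F [] /= _ _ _; apply. Qed.
#[export] Hint Resolve def_strip : fdb.

Lemma strip_pair (M : pvm) (c a b : M) : strip c (pair a b) = pair (msp a c) b.
Proof.
move: M c a b; apply: uind2; [by pdt|by move=> M a b; rewrite strip0 msp0|].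
move=> M c i a b IH; case: (pselect (mS i c = mZ)) => [->|nz]; first by rewrite strip0 msp0.
rewrite stripS // IH mspS //; have [j [m em]] := caseS (msp a c); rewrite em.
case: (pselect (mS j m = mZ)) => [e|nm].
  by rewrite e pair0 halfS bitS cond0 half0 pair0.
by rewrite pairS // !halfS bitS cond1 //; apply: one_nz.
Qed.

Definition psnd (M : pvm) (p : M) := half (half (strip p p)).
Lemma def_psnd : def1 psnd. Proof. by rewrite /psnd; fdt. Qed.
#[export] Hint Resolve def_psnd : fdb.

Lemma ple_pair (M : pvm) (a b : M) : ple a (pair a b).
Proof.
move: M a b; apply: uind1; [by pdt|by move=> M b; apply: ple0|].
move=> M a i b IH; case: (pselect (mS i a = mZ)) => [->|nz]; first exact: ple0.
by rewrite pairS //; apply: ple_S; [apply: ple_Sr|apply: mS_nz; apply: S1nz].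
Qed.

Lemma psndE (M : pvm) (a b : M) : psnd (pair a b) = b.
Proof. by rewrite /psnd strip_pair ple_pair pair0 !halfS. Qed.

(** Rebuilds the first component from its leading digit: stripping [half (msp p c)] digits uncovers
    its digits from the top as [c] grows. The bit of [half q] tells whether a digit is left there,
    the bit of [q] is that digit. *)
Lemma ex_fstr : exists F : F2, [/\ def2 F, forall (M : pvm) (p : M), F M mZ p = mZ &
  forall (M : pvm) i (c p : M), mS i c <> mZ -> F M (mS i c) p = 
    cond (msp p c) (F M c p) (let q := strip (half (msp p c)) p in
      cond (bit (half q)) (F M c p) (cond (bit q) (mS false (F M c p)) (mS true (F M c p))))].
Proof.
pose H (i : bool) (M : pvm) (c r p : M) := cond (msp p c) r (let q := strip (half (msp p c)) p in
      cond (bit (half q)) r (cond (bit q) (mS false r) (mS true r))).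
have [||| F [dF F0 FS]] := @lrn1 (fun M p => mZ) H (fun M c p => c); try (rewrite /H; fdt).
have bd (M : pvm) i (c r p : M) : mS i c <> mZ -> ple r c -> ple (H i M c r p) (mS i c).
  move=> nz le; rewrite /H; case: (pselect (msp p c = mZ)) => [->|n].
    by rewrite cond0; apply: ple_Sr.
  rewrite (cond1 _ _ n) /=; set q := strip _ _.
  case: (pselect (bit (half q) = mZ)) => [->|n']; first by rewrite cond0; apply: ple_Sr.
  rewrite (cond1 _ _ n').
  by case: (pselect (bit q = mZ)) => [->|n'']; rewrite ?cond0 ?(cond1 _ _ n''); apply: ple_S.
have le (M : pvm) (c p : M) : ple (F M c p) c.
  move: M c p; apply: uind1; [by pdt|by move=> M p; rewrite F0; apply: ple0|].
  move=> M c i p IH; case: (pselect (mS i c = mZ)) => [->|nz]; first by rewrite F0; apply: ple0.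
  by rewrite FS //; apply: bd.
by exists F; split=> // M i c p nz; rewrite FS //; apply: bd.
Qed.
Definition fstr : F2 := sval (cid ex_fstr).
Lemma def_fstr : def2 fstr. Proof. by rewrite /fstr; case: cid => F []. Qed.
#[export] Hint Resolve def_fstr : fdb.

Definition pfst (M : pvm) (p : M) := fstr p p.
Lemma def_pfst : def1 pfst. Proof. by rewrite /pfst; fdt. Qed.
#[export] Hint Resolve def_pfst : fdb.

Lemma pfstE (M : pvm) (a b : M) : pfst (pair a b) = a.
Proof.
suff H c : fstr c (pair a b) = msp a (msp (pair a b) c) by rewrite /pfst H msp_xx msp0.
move: M c a b; apply: uind2; first by pdt.
  move=> M a b; rewrite msp0 ple_pair /fstr; by case: cid => F [].
move=> M c i a b IH; set p := pair a b in IH *.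
have := IH; rewrite /fstr; case: cid => F [_ F0 FS] /= {}IH.
case: (pselect (mS i c = mZ)) => [->|nz]; first by rewrite F0 msp0 ple_pair.
rewrite FS // IH; have [[-> ->]|[e [n1 -> -> e3]]] := msp_step p nz; first by rewrite cond0.
rewrite (cond1 _ _ n1) strip_pair -e3; have [j [m ->]] := caseS (msp a e); rewrite halfS.
case: (pselect (mS j m = mZ)) => [en|nm].
  by have [-> ->] := S0nz en; rewrite S00 pair0 halfS bitS cond0.
rewrite pairS // !halfS !bitS (cond1 _ _ (@one_nz M)).
by case: (j); rewrite ?cond0 ?(cond1 _ _ (@one_nz M)).
Qed.

Lemma pair_inj (M : pvm) (a b a' b' : M) : pair a b = pair a' b' -> a = a' /\ b = b'.
Proof. by move=> e; rewrite -(pfstE a b) -{2}(psndE a b) e pfstE psndE. Qed.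

Lemma pfst0 (M : pvm) : pfst (mZ : M) = mZ.
Proof. by rewrite /pfst /fstr; case: cid => F []. Qed.

Lemma psnd0 (M : pvm) : psnd (mZ : M) = mZ.
Proof. by rewrite /psnd strip0 !half0. Qed.

Lemma psnd_ple (M : pvm) (p : M) : p <> mZ -> ple (psnd p) (half p).
Proof. by move=> np; apply: ple_half; apply: ple_half2 => //; apply: strip_ple. Qed.

(** ** Lists: [mZ] is the empty list, [pair a l] has tail [l] *)

Lemma ex_drop : exists F : F2, [/\ def2 F, forall (M : pvm) (p : M), F M mZ p = p,
  forall (M : pvm) (c p : M), ple (F M c p) p &
  forall (M : pvm) i (c p : M), mS i c <> mZ -> F M (mS i c) p = psnd (F M c p)].
Proof.
have [|||F [dF F0 FS]] := @lrn1 (fun M p => p) (fun i M c r p => psnd r) (fun M c p => p); try fdt.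
have bd (M : pvm) (r p : M) : ple r p -> ple (psnd r) p.
  by move=> le; do 2!apply: ple_half; apply: ple_trans le; apply: strip_ple.
have le (M : pvm) (c p : M) : ple (F M c p) p.
  move: M c p; apply: uind1; [by pdt|by move=> M p; rewrite F0; apply: ple_xx|].
  move=> M c i p IH; case: (pselect (mS i c = mZ)) => [->|nz]; first by rewrite F0; apply: ple_xx.
  by rewrite FS //; apply: bd.
by exists F; split=> // M i c p nz; apply: FS => //; apply: bd.
Qed.
Definition ldrop : F2 := sval (cid ex_drop).
Lemma def_ldrop : def2 ldrop. Proof. by rewrite /ldrop; case: cid => F []. Qed.
Lemma ldrop0 (M : pvm) (p : M) : ldrop mZ p = p. Proof. by rewrite /ldrop; case: cid => F []. Qed.
Lemma ldrop_ple (M : pvm) (c p : M) : ple (ldrop c p) p.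
Proof. by rewrite /ldrop; case: cid => F []. Qed.
Lemma ldropS (M : pvm) i (c p : M) : mS i c <> mZ -> ldrop (mS i c) p = psnd (ldrop c p).
Proof. by rewrite /ldrop; case: cid => F [] /= _ _ _; apply. Qed.
#[export] Hint Resolve def_ldrop : fdb.

(** Each tail of a nonempty list is shorter than the list by at least one digit; hence a list is
    sufficient fuel for running through itself. *)
Lemma ldrop_ple_msp (M : pvm) (c l : M) : ple (ldrop c l) (msp l c).
Proof.
move: M c l; apply: uind1; [by pdt|by move=> M l; rewrite ldrop0 msp0; apply: ple_xx|].
move=> M c i l IH; case: (pselect (mS i c = mZ)) => [->|nz].
  by rewrite ldrop0 msp0; apply: ple_xx.
rewrite ldropS // mspS //; case: (pselect (ldrop c l = mZ)) => [->|n].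
  by rewrite psnd0; apply: ple0.
apply: ple_trans (psnd_ple n) _; apply: ple_half2 => // e.
by rewrite e in IH; apply: n; apply: ple_0.
Qed.

Lemma ldrop_all (M : pvm) (l : M) : ldrop l l = mZ.
Proof. by apply: ple_0; have := ldrop_ple_msp l l; rewrite msp_xx. Qed.

(** The final segment [ldrop (msp l c) l] grows from [mZ] to [l] as [c] runs through the prefixes of
    [l], so this is induction on notation on [c]. As with [rind], the premises concern [M] alone. *)
Lemma list_ind2 (P : R3) : rel3 P -> forall M a b, P M mZ a b ->
  (forall l, l <> mZ -> P M (psnd l) a b -> P M l a b) -> forall l, P M l a b.
Proof.
move=> dP M a b P0 PS l.
have := @rind2 (fun M c x b => P M (ldrop (msp (pfst x) c) (pfst x)) (psnd x) b) _ M (pair l a) b _ _ l.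
rewrite pfstE psndE msp_xx ldrop0; apply.
- by pdt.
- by rewrite msp0 ldrop_all.
- move=> c i IH; case: (pselect (mS i c = mZ)) => [e|nz].
    by have [_ cc] := S0nz e; rewrite e; rewrite cc in IH.
  have [[e1 e2]|[e [n1 e1 e2 e3]]] := msp_step l nz; first by rewrite e2; rewrite e1 in IH.
  rewrite e1; case: (pselect (ldrop e l = mZ)) => [-> //|nd]; apply: PS => //.
  have [j [m em]] := caseS (msp l c); rewrite em in IH n1 e2.
  by rewrite ldropS // in IH; rewrite halfS in e2; rewrite -e2.
Qed.

(* [lastof Q l x] is the shortest nonempty final segment [u] of [l] with [Q u x], and [mZ] if there is none. *)

Section LastOf.
Variable Q : R2.
Hypothesis dQ : rel2 Q.

Lemma ex_lastr : exists F : F3, [/\ def3 F, forall (M : pvm) (l x : M), F M mZ l x = mZ &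
  forall (M : pvm) i (c l x : M), mS i c <> mZ -> F M (mS i c) l x =
    ite (ldrop c l <> mZ /\ Q (ldrop c l) x) (ldrop c l) (F M c l x)].
Proof.
have [|||F [dF F0 FS]] := @lrn2 (fun M l x => mZ)
  (fun i M c r l x => ite (ldrop c l <> mZ /\ Q (ldrop c l) x) (ldrop c l) r) (fun M c l x => l); try fdt.
have bd (M : pvm) (c r l x : M) : ple r l -> ple (ite (ldrop c l <> mZ /\ Q (ldrop c l) x) (ldrop c l) r) l.
  by move=> le; rewrite /ite; case: ifP => // _; apply: ldrop_ple.
have le (M : pvm) (c l x : M) : ple (F M c l x) l.
  move: M c l x; apply: uind2; [by pdt|by move=> M p x; rewrite F0; apply: ple0|].
  move=> M c i p x IH; case: (pselect (mS i c = mZ)) => [->|nz]; first by rewrite F0; apply: ple0.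
  by rewrite FS //; apply: bd.
by exists F; split=> // M i c p x nz; apply: FS => //; apply: bd.
Qed.

Definition lastr : F3 := sval (cid ex_lastr).
Lemma def_lastr : def3 lastr. Proof. by rewrite /lastr; case: cid => F []. Qed.
Lemma lastr0 (M : pvm) (l x : M) : lastr mZ l x = mZ.
Proof. by rewrite /lastr; case: cid => F []. Qed.
Lemma lastrS (M : pvm) i (c l x : M) : mS i c <> mZ -> lastr (mS i c) l x =
    ite (ldrop c l <> mZ /\ Q (ldrop c l) x) (ldrop c l) (lastr c l x).
Proof. by rewrite /lastr; case: cid => F [] /= _ _; apply. Qed.

Definition lastof (M : pvm) (l x : M) : M := lastr l l x.
Lemma def_lastof : def2 lastof.
Proof. by have d := def_lastr; rewrite /lastof; fdt. Qed.

Let phi (M : pvm) (l r x : M) : M := ite (r <> mZ) r (ite (l <> mZ /\ Q l x) l mZ).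

Let ldrop_snd (M : pvm) (c l : M) : ldrop c (psnd l) = psnd (ldrop c l).
Proof.
move: M c l; apply: uind1; [by pdt|by move=> M l; rewrite !ldrop0|].
move=> M c i l IH; case: (pselect (mS i c = mZ)) => [->|nz]; first by rewrite !ldrop0.
by rewrite !ldropS // IH.
Qed.

(** The recursion on the fuel meets the head of the list first and overwrites it by later hits. This
    turns it into a recursion on the list, where the head counts only if the tail has no hit. *)
Let lastr_rec (M : pvm) i (c l x : M) : mS i c <> mZ ->
  lastr (mS i c) l x = phi l (lastr c (psnd l) x) x.
Proof.
have dL := def_lastr.
move: M c l x i; suff H : forall (M : pvm) (c l x : M), lastr (mS true c) l x = phi l (lastr c (psnd l) x) x.
  move=> M c l x i nz; rewrite -H !lastrS //; exact: S1nz.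
apply: uind2; first by rewrite /phi; pdt.
  move=> M l x; rewrite lastrS ?lastr0 ?ldrop0; last exact: S1nz.
  by rewrite /phi (iteF _ _ (P := mZ <> mZ)).
move=> M c i l x IH; case: (pselect (mS i c = mZ)) => [e|nz].
  by have [_ cc] := S0nz e; rewrite e; rewrite cc in IH.
have S1 := @S1nz M.
have E : lastr (mS i c) l x = phi l (lastr c (psnd l) x) x.
  by rewrite lastrS //; rewrite lastrS in IH.
rewrite lastrS // E (lastrS (i := i) (psnd l)) // ldropS // ldrop_snd.
set d := psnd (ldrop c l); set r := lastr c (psnd l) x.
rewrite /phi; case: (pselect (d <> mZ /\ Q d x)) => h.
  by rewrite !(iteT _ _ h) (iteT _ _ (P := d <> mZ)) //; case: h.
by rewrite !(iteF _ _ h).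
Qed.

Let lastr_nil (M : pvm) (c x : M) : lastr c mZ x = mZ.
Proof.
have dL := def_lastr.
move: M c x; apply: uind1; [by pdt|by move=> M x; rewrite lastr0|].
move=> M c i x IH; case: (pselect (mS i c = mZ)) => [->|nz]; first by rewrite lastr0.
by rewrite lastr_rec // psnd0 IH /phi iteF // iteF // => -[].
Qed.

(* Any fuel at least as long as the list gives the same result. *)
Let lastr_fuel (M : pvm) (d l x : M) : ple l d -> lastr d l x = lastr l l x.
Proof.
move=> ld; have dL := def_lastr.
suff H k : lastr (msp d (msp l k)) (ldrop (msp l k) l) x = lastr (msp l (msp l k)) (ldrop (msp l k) l) x.
  by have := H l; rewrite msp_xx !msp0 ldrop0.
pose P (M : pvm) (k y x : M) := lastr (msp (psnd y) (msp (pfst y) k)) (ldrop (msp (pfst y) k) (pfst y)) x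
   = lastr (msp (pfst y) (msp (pfst y) k)) (ldrop (msp (pfst y) k) (pfst y)) x.
have := @rind2 P _ M (pair l d) x _ _ k; rewrite /P pfstE psndE; apply.
- by rewrite /P; pdt.
- by rewrite msp0 ldrop_all !lastr_nil.
- move=> {}k i IH; case: (pselect (mS i k = mZ)) => [e|nz].
    by have [_ cc] := S0nz e; rewrite e; rewrite cc in IH.
  have [[e1 e2]|[e [n1 e1 e2 e3]]] := msp_step l nz; first by rewrite e2; rewrite e1 in IH.
  rewrite e1; rewrite -!e3 in IH.
  have [j [m em]] := caseS (msp l k); rewrite em in IH n1 e2; rewrite halfS in e2; rewrite e2 in IH n1.
  rewrite ldropS // in IH; set u := ldrop e l in IH *.
  case: (pselect (u = mZ)) => [->|nu]; first by rewrite !lastr_nil.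
  have u1 : ple u (msp l e) by apply: ldrop_ple_msp.
  have nl : msp l e <> mZ by move=> h; rewrite h in u1; apply: nu; apply: ple_0.
  have nd : msp d e <> mZ.
    move=> h; apply: nl.
    exact: ple_trans ld h.
  have [i1 [m1 f1]] := caseS (msp d e); have [i2 [m2 f2]] := caseS (msp l e).
  rewrite f1 f2 !halfS in IH nd nl *; by rewrite !lastr_rec // IH.
Qed.

Lemma lastof0 (M : pvm) (x : M) : lastof mZ x = mZ.
Proof. exact: lastr0. Qed.

Lemma lastof_rec (M : pvm) (l x : M) : l <> mZ -> lastof l x =
  ite (lastof (psnd l) x <> mZ) (lastof (psnd l) x) (ite (Q l x) l mZ).
Proof.
move=> nl; rewrite /lastof; have [i [m em]] := caseS l.
have -> : lastr l l x = phi l (lastr m (psnd l) x) x.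
  by rewrite {1}em lastr_rec // -em.
rewrite lastr_fuel; last first.
  by have := psnd_ple nl; rewrite {2}em halfS.
rewrite /phi; congr ite; rewrite /ite; do 2 case: asboolP => //.
  by move=> q [].
by move=> q nq; case: nq.
Qed.
End LastOf.
#[export] Hint Extern 1 (def2 (lastof _)) => apply: def_lastof : fdb.

(** ** Final segments *)

Definition eqR : R2 := fun M a b => a = b.
Lemma rel_eqR : rel2 eqR. Proof. by rewrite /eqR; pdt. Qed.

(** Being a nonempty final segment of [l], as an open formula: the search for a final segment equal
    to [u] succeeds. *)
Definition suf (M : pvm) (u l : M) := u <> mZ /\ lastof rel_eqR l u <> mZ.
Lemma rel_suf : rel2 suf.
Proof. by rewrite /suf; pdt. Qed.
#[export] Hint Resolve rel_suf : fdb.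

Section Suffix.
Variable M : pvm.
Implicit Types l u w a x : M.

Lemma suf_nz u l : suf u l -> u <> mZ. Proof. by case. Qed.

Lemma suf0 u : ~ suf u mZ.
Proof. by case=> _; rewrite lastof0. Qed.

Lemma sufE u l : l <> mZ -> suf u l <-> u = l \/ suf u (psnd l).
Proof.
move=> nl; rewrite /suf lastof_rec //.
case: (pselect (lastof rel_eqR (psnd l) u <> mZ)) => h.
  rewrite iteT //; split=> [hh|[e|//]]; first by right.
  by rewrite e in h *.
rewrite iteF //; case: (pselect (l = u)) => [e|ne].
  by rewrite iteT //; split=> _; [left|split=> //; rewrite -e].
by rewrite iteF //; split=> [[]|[e|[_ /h]]]; last by []; [|case: ne].
Qed.

Lemma suf_refl l : l <> mZ -> suf l l.
Proof. by move=> nl; apply/sufE => //; left. Qed.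

Lemma suf_pair u a l : suf u (pair a l) <-> u = pair a l \/ suf u l.
Proof. by rewrite sufE ?psndE //; apply: pair_nz. Qed.
End Suffix.

Lemma suf_trans (M : pvm) (u w l : M) : suf u l -> suf w u -> suf w l.
Proof.
move: u w l => u w; apply: (@list_ind2 (fun M l u w => suf u l -> suf w u -> suf w l)).
- by pdt.
- by move=> /suf0.
- move=> l nl IH /(sufE _ nl)[<- //|h1] h2; apply/sufE => //; right; exact: IH.
Qed.

Lemma suf_tl (M : pvm) (u l : M) : suf u l -> psnd u <> mZ -> suf (psnd u) l.
Proof.
move=> ul nu; apply: suf_trans ul _; apply/sufE; first by move=> h; rewrite h psnd0 in nu.
by right; apply: suf_refl.
Qed.

Section LastOfTheory.
Variables (Q : R2) (dQ : rel2 Q).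

Lemma lastofP (M : pvm) (l x : M) : lastof dQ l x <> mZ ->
  [/\ suf (lastof dQ l x) l, Q (lastof dQ l x) x & lastof dQ (psnd (lastof dQ l x)) x = mZ].
Proof.
move=> h; suff [? [? ?]] : suf (lastof dQ l x) l /\ Q (lastof dQ l x) x /\
   lastof dQ (psnd (lastof dQ l x)) x = mZ by [].
move: l h; apply: (@list_ind2 (fun M l x _ => lastof dQ l x <> mZ -> suf (lastof dQ l x) l /\
  Q (lastof dQ l x) x /\ lastof dQ (psnd (lastof dQ l x)) x = mZ) _ M x mZ).
- by pdt.
- by rewrite lastof0.
- move=> l nl IH; rewrite lastof_rec //.
  case: (pselect (lastof dQ (psnd l) x <> mZ)) => h.
    rewrite iteT // => _; have [h1 h2] := IH h; split=> //; apply/sufE => //; by right.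
  rewrite iteF //; case: (pselect (Q l x)) => q; last by rewrite iteF.
  by rewrite iteT // => _; split; [apply: suf_refl|split=> //; exact: contrapT].
Qed.

Lemma lastof_none (M : pvm) (l x u : M) : lastof dQ l x = mZ -> suf u l -> ~ Q u x.
Proof.
move: l; apply: (@list_ind2 (fun M l x u => lastof dQ l x = mZ -> suf u l -> ~ Q u x)).
- by pdt.
- by move=> _ /suf0.
- move=> l nl IH; rewrite lastof_rec //.
  case: (pselect (lastof dQ (psnd l) x <> mZ)) => h; first by rewrite iteT.
  rewrite iteF //; case: (pselect (Q l x)) => q; first by rewrite iteT.
  by move=> _ /(sufE _ nl)[->//|]; apply: IH; apply: contrapT.
Qed.

Lemma lastof_suf (M : pvm) (l x u : M) : suf u l -> lastof dQ u x <> mZ ->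
  lastof dQ l x = lastof dQ u x.
Proof.
move: l; apply: (@list_ind2 (fun M l x u => suf u l -> lastof dQ u x <> mZ ->
  lastof dQ l x = lastof dQ u x)).
- by pdt.
- by move=> /suf0.
- by move=> l nl IH /(sufE _ nl)[->//|/IH{}IH] nu; rewrite lastof_rec // IH // iteT.
Qed.
End LastOfTheory.

Definition allsuf (Q : R2) : R2 := fun M l x => forall u, suf u l -> Q M u x.
(** The bounded quantifier has an open equivalent because [lastof] finds a counterexample if there
    is one. *)
Lemma rel_allsuf Q : rel2 Q -> rel2 (allsuf Q).
Proof.
move=> dQ; have dN : rel2 (fun M u x => ~ Q M u x) by pdt.
apply: (@pd_ext 2 (fun M x => lastof dN (x (v0 _)) (x (v1 _)) = mZ)); last by pdt.
move=> M x; split=> [h u ul|h].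
  by have := lastof_none h ul; apply: contrapT.
by apply: contrapT => /lastofP[/h].
Qed.
#[export] Hint Extern 1 (rel2 (allsuf _)) => apply: rel_allsuf : fdb.

(** ** The standard model *)

Lemma bitlenP n : n < 2 ^ bitlen n.
Proof. exact: up_logP. Qed.

Lemma bitlen_leq n k : (bitlen n <= k) = (n < 2 ^ k).
Proof.
apply/idP/idP => [h|h]; first by apply: leq_trans (bitlenP n) _; rewrite leq_exp2l.
exact: up_log_min.
Qed.

Lemma bitlen0 : bitlen 0 = 0. Proof. by []. Qed.

Lemma bitlenS (i : bool) n : n.*2 + i != 0 -> bitlen (n.*2 + i) = (bitlen n).+1.
Proof.
move=> nz; have b2 k : (n.*2 + i < 2 ^ k.+1) = (n < 2 ^ k).
  by rewrite expnS; case: i {nz}; lia.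
apply/eqP; rewrite eqn_leq bitlen_leq b2 bitlenP /=.
case e : (bitlen (n.*2 + i)) => [|k].
  by move: (bitlenP (n.*2 + i)); rewrite e expn0 ltnS leqn0 (negPf nz).
by rewrite ltnS bitlen_leq -b2 -e bitlenP.
Qed.

Definition natS : struct pvsym := @Struct pvsym nat pv_eval.

Lemma holdsE n (A : pvform n) x : holds A x <-> sat (M := natS) A x.
Proof.
have tE m (y : 'I_m -> nat) t : teval y t = ev (M := natS) y t.
  by elim: t => //= k f ts IH; congr pv_eval; apply/funext.
elim: A x => {n} [n|n t u|n A IA B IB|n A IA] x //=.
Qed.

Lemma nrec_fuel p g h y : y <= p -> notation_rec p g h y = notation_rec y g h y.
Proof.
suff H q : y <= p -> y <= q -> notation_rec p g h y = notation_rec q g h y.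
  by move=> yp; apply: H.
elim: p q y => [|p IH] [|q] [|y] //= yp yq.
by congr h; apply: IH; lia.
Qed.

Lemma nrecS g h y : 0 < y -> notation_rec y g h y = h y (notation_rec y./2 g h y./2).
Proof. by case: y => // y _ /=; congr h; rewrite nrec_fuel //; lia. Qed.

Lemma nat_defining n (A : pvform n) (x : 'I_n -> natS) : pv_defining A -> sat A x.
Proof.
have odd_b (b : bool) m : odd (m.*2 + b) = b by rewrite oddD odd_double; case: b.
have half_b (b : bool) m : (m.*2 + b)./2 = m by case: b; lia.
move=> d; case: n A / d x => n.
- by [].
- by move=> t u x /=; lia.
- by move=> i t x /=; rewrite half_b.
- by move=> t x /=; lia.
- by move=> t x /=; lia.
- by [].
- by move=> i t x /= h; rewrite bitlenS //; apply/eqP.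
- by move=> t x /=; rewrite bitlen0 expn0 divn1.
- move=> i t u x /= h; rewrite bitlenS; last exact/eqP.
  by rewrite expnS mulnC divnMA divn2.
- by move=> t x /=; rewrite addn0.
- move=> i j t u x; case: i; case: j => /=; move: (ev x t : nat) (ev x u : nat) => a b; lia.
- by move=> t x /=; rewrite muln0.
- by move=> i t u x; case: i => /=; move: (ev x t : nat) (ev x u : nat) => a b; nia.
- by move=> t x /=; rewrite bitlen0 muln0.
- by [].
- move=> i t x /= h; rewrite bitlenS; last exact/eqP.
  by rewrite (_ : bitlen 1 = 1) // !muln1 expnS mul2n addn0.
- move=> i t u x /= h; rewrite bitlenS; last exact/eqP.
  by rewrite (_ : bitlen 1 = 1) // muln1 mulnS addnC expnD.
- by [].
- by move=> i j t u ij x /=; case: i j ij => [] [] //= _; move: (ev x t : nat) (ev x u : nat) => a b;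
    rewrite (_ : (_ <= _) = (a <= b)) //; lia.
- move=> t u x; apply/sat_and.
  change (((ev x u <= ev x t)%N = 1 :> nat ->
     ((ev x t).*2 + 1 <= (ev x u).*2 + 0)%N = 0 :> nat) /\
    (~ (ev x u <= ev x t)%N = 1 :> nat ->
     ((ev x t).*2 + 1 <= (ev x u).*2 + 0)%N = 1 :> nat)).
  move: (ev x t : nat) (ev x u : nat) => a b.
  have -> : (a.*2 + 1 <= b.*2 + 0) = (a < b) by lia.
  by rewrite ltnNge; case: (b <= a).
- by [].
- by [].
- move=> k g h b ts x /=; rewrite scons0 /=; congr pv_eval.
  by apply/funext => j; rewrite sconsS.
- move=> k g h b i t ts f a c x.
  have E u s : pv_eval (pv_lrn g h b) (fun j => ev x (scons u s j)) =
    notation_rec (ev x u) (pv_eval g (fun j => ev x (s j))) (fun y r =>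
      let a := pv_eval (h (odd y)) (scons y./2 (scons r (fun j => ev x (s j)))) in
      let b := pv_eval b (scons y (fun j => ev x (s j))) in
      if bitlen a <= bitlen b then a else b) (ev x u).
    rewrite /= scons0; have -> // : (fun j : 'I_k => ev x (scons u s (lift ord0 j))) = (fun j => ev x (s j)).
    by apply/funext => j; rewrite sconsS.
  move=> nz; set y := (ev x t).*2 + i.
  have y0 : y <> 0 := nz.
  have fE : ev x (f (tS i t)) = if bitlen (ev x a) <= bitlen (ev x c) then ev x a else ev x c.
    rewrite {1}/f; cbn [ev]; rewrite -[sapp _ _]/(pv_eval (pv_lrn g h b) _) E.
    rewrite -[ev x (tS i t)]/y nrecS; last by lia.
    cbv zeta; rewrite odd_b half_b.
    have -> : pv_eval (h i) (scons (ev x t) (scons (notation_rec (ev x t)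
      (pv_eval g (fun j => ev x (ts j))) (fun y r =>
      if bitlen (pv_eval (h (odd y)) (scons y./2 (scons r (fun j => ev x (ts j))))) <=
         bitlen (pv_eval b (scons y (fun j => ev x (ts j))))
      then pv_eval (h (odd y)) (scons y./2 (scons r (fun j => ev x (ts j))))
      else pv_eval b (scons y (fun j => ev x (ts j)))) (ev x t)) (fun j => ev x (ts j)))) = ev x a.
      rewrite /a; cbn [ev]; rewrite -[RHS]/(pv_eval (h i) _); congr pv_eval.
      by rewrite (scons_comp (ev x)) (scons_comp (ev x)) /f; cbn [ev]; rewrite -E.
    have -> // : pv_eval b (scons y (fun j => ev x (ts j))) = ev x c.
    by rewrite /c; cbn [ev]; rewrite -[RHS]/(pv_eval b _) (scons_comp (ev x)).
  have mE : ev x (tmsp a c) = ev x a %/ 2 ^ bitlen (ev x c) by [].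
  apply/sat_and; split=> /= h0.
  + rewrite -[X in X = _]/(ev x (f (tS i t))) fE bitlen_leq.
    have {}h0 : ev x a %/ 2 ^ bitlen (ev x c) = 0 := h0.
    case: ifP => // /negbT; rewrite -leqNgt => le.
    by have := divn_gt0 (ev x a) (expn_gt0 2 (bitlen (ev x c))); rewrite h0 le.
  + rewrite -[X in X = _]/(ev x (f (tS i t))) fE bitlen_leq.
    by case: ifP => // lt; case: h0; apply: divn_small.
Qed.

Lemma nat_notind n (A : pvform n.+1) (T : theory) : (forall B, T B -> forall x, sat (M := natS) B x) ->
  T |- inst A tZ -> (forall i, T |- fimp A (inst_var A (tS i (tvar ord0)))) ->
  forall x, sat (M := natS) (alls A) x.
Proof.
move=> nT d0 dS x; apply/sat_alls => y.
have snd := @prov_sound pvsym (eq natS) T (fun A d M e => match e in _ = M return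
  forall x : 'I_0 -> M, sat A x with erefl => nT A d end).
have b z : sat (M := natS) A (scons 0 z).
  by have := snd _ _ _ d0 natS erefl z (fun B F => match F with end); rewrite sat_inst.
have s (i : bool) m z : sat (M := natS) A (scons m z) -> sat (M := natS) A (scons (m.*2 + i) z).
  have := snd _ _ _ (dS i) natS erefl (scons m z) (fun B F => match F with end).
  move/sat_imp; rewrite sat_inst_var => h /h.
  have -> // : ev (scons m z) (tS i (tvar ord0)) = m.*2 + i.
  by rewrite /= scons0.
rewrite -(scons_eta y); move: (y ord0) (fun i => _) => m z.
have [k] := ubnP m; elim: k m => // k IH m mk; case: (posnP m) => [->|m0]; first exact: b.
by rewrite -(odd_double_half m) addnC; apply: s; apply: IH; lia.
Qed.

Fixpoint nat_PV A (d : PV A) : forall x, sat (M := natS) A x :=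
  match d with
  | PV_def n A dA => fun x => proj2 (sat_alls A x) (fun y => nat_defining y dA)
  | PV_notind n A _ d0 dS =>
      nat_notind (fun _ h => h) (prov_mono nat_PV d0) (fun i => prov_mono nat_PV (dS i))
  end.

Definition natM : pvm := @Pvm natS nat_PV.

(** ** Numerals *)

Definition mnum (c : nat) (M : pvm) : M := iter c (@msucc M) mZ.

Lemma ev_num (M : pvm) n (x : 'I_n -> M) c : ev x (num c) = mnum c M.
Proof.
elim: c => [|c IH] /=; first by rewrite /mnum /mZ /=; congr sapp; apply: env0E.
by rewrite tnth_comp1 tnth1E IH.
Qed.

Lemma def_mnum c : def0 (mnum c).
Proof. by move=> n; exists (num c) => M x; rewrite ev_num. Qed.
#[export] Hint Resolve def_mnum : fdb.

Section Numerals.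
Variable M : pvm.
Notation num_ c := (mnum c M).

Lemma mnumS (i : bool) c : num_ (c.*2 + i) = mS i (num_ c).
Proof.
elim: c i => [|c IH] i.
  by case: i; rewrite /= ?S00 // -{1}[mZ]S00 succ0.
rewrite doubleS addSn addSn -addnS -addnS addnC !addSn.
have e : num_ (0 + c.*2) = mS false (num_ c) by rewrite -IH add0n addn0.
by case: i => /=; rewrite -/(num_ _) e succ0 succ1 ?succ0.
Qed.

Lemma mnum_half c : num_ c = mS (odd c) (num_ c./2).
Proof. by rewrite -mnumS addnC odd_double_half. Qed.

Lemma mnum_nz c : num_ c = mZ -> c = 0.
Proof.
have [k] := ubnP c; elim: k c => // k IH c ck; rewrite mnum_half => /S0nz[o /IH h].
by case: (posnP c) => // c0; have := odd_double_half c; rewrite o h; lia.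
Qed.

Lemma mnum_inj c d : num_ c = num_ d -> c = d.
Proof.
have [k] := ubnP c; elim: k c d => // k IH c d ck.
case: (posnP c) => [->|c0]; first by move=> /esym/mnum_nz.
rewrite mnum_half (mnum_half d) => /mS_inj[o /IH h].
by rewrite -(odd_double_half c) -(odd_double_half d) o h //; lia.
Qed.
End Numerals.

Lemma mS_nat i (c : natM) : mS i c = c.*2 + i :> nat. Proof. by rewrite /mS /ap1 /= scons0. Qed.
Lemma msucc_nat (c : natM) : msucc c = c.+1 :> nat. Proof. by rewrite /msucc /ap1 /= scons0. Qed.

(** The defining axioms reduce a value at numerals to values at shorter ones. They hold both in [M]
    and in [natM], so the two computations are carried out in parallel. *)
Lemma mnum_sapp (M : pvm) k (f : pvsym k) (x : 'I_k -> nat) :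
  sapp f (fun j => mnum (x j) M) = mnum (pv_eval f x) M.
Proof.
have e1 (y : 'I_1 -> nat) : (fun j => mnum (y j) M) = scons (mnum (y ord0) M) (@env0 M).
  by rewrite [LHS]env1E; apply/funext => i; case: (unliftP ord0 i) => [[]//|->]; rewrite scons0.
have e2 (y : 'I_2 -> nat) : (fun j => mnum (y j) M) =
    scons (mnum (y ord0) M) (scons (mnum (y ord_max) M) (@env0 M)).
  by rewrite (env2E y) (tnth_comp2 (fun c => mnum c M)) tnth2E.
have E1 (g : pvsym 1) (y : nat) : pv_eval g (scons y (@env0 nat)) = ap1 (M := natM) g y by [].
have n1 (g : pvsym 1) : (forall a : nat, ap1 g (mnum a M) = mnum (ap1 (M := natM) g a) M) ->
    forall y, sapp g (fun j => mnum (y j) M) = mnum (pv_eval g y) M.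
  move=> H y; rewrite e1 -/(ap1 g _) H; congr (mnum _ M); congr pv_eval.
  by rewrite [RHS]env1E; apply/funext => i; case: (unliftP ord0 i) => [[]//|->]; rewrite scons0.
have n2 (g : pvsym 2) : (forall a b : nat, ap2 g (mnum a M) (mnum b M) = mnum (ap2 (M := natM) g a b) M) ->
    forall y, sapp g (fun j => mnum (y j) M) = mnum (pv_eval g y) M.
  by move=> H y; rewrite e2 -/(ap2 g _ _) H; congr (mnum _ M); congr pv_eval; rewrite -tnth2E -env2E.
have mSn i (c : natM) : mS i (mnum c M) = mnum (mS i c) M by rewrite mS_nat mnumS.
have suc (c : natM) : msucc (mnum c M) = mnum (msucc c) M by rewrite msucc_nat.
have nat2 (P : nat -> Prop) : P 0 -> (forall i c, @mS i natM c <> (@mZ natM) -> P c -> P (@mS i natM c)) ->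
    forall c, P c.
  move=> P0 PS c; have [m] := ubnP c; elim: m c => // m IH c ck.
  case: (posnP c) => [->//|c0]; have := PS (odd c) c./2.
  rewrite mS_nat addnC odd_double_half; apply; last by apply: IH; lia.
  by move=> h; rewrite h in c0.
have nzM i (c : natM) : mS i c <> mZ -> mS i (mnum c M) <> mZ.
  by move=> h; rewrite mSn => /mnum_nz.
have two (c : nat) : exists i (c' : natM), c = @mS i natM c' /\ (c' <= c)%N /\ (0 < c -> c' < c)%N.
  by exists (odd c), c./2; rewrite mS_nat addnC odd_double_half; split=> //; lia.
have addn (a b : nat) : ap2 pv_add (mnum a M) (mnum b M) = mnum (ap2 (M := natM) pv_add a b) M.
  have [m] := ubnP (a + b); elim: m a b => // m IH a b kab.
  case: (posnP b) => [->|b0]; first by rewrite ax_add0 (ax_add0 (M := natM)).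
  have [i [a' [ea [la _]]]] := two a; have [j [b' [eb [_ /(_ b0) lb]]]] := two b.
  have IH' := IH a' b' ltac:(lia).
  rewrite ea eb -!mSn (ax_addS (M := M)) (ax_addS (M := natM)) IH'.
  by case: (i && j); rewrite ?suc mSn.
have mul a b : ap2 pv_mul (mnum a M) (mnum b M) = mnum (ap2 (M := natM) pv_mul a b) M.
  move: b; apply: nat2 => [|i c nz IH]; first by rewrite ax_mul0 (ax_mul0 (M := natM)).
  rewrite -mSn (ax_mulS (M := M)) (ax_mulS (M := natM)) IH.
  by case: i {nz}; rewrite ?mSn // addn.
have halfE (c : natM) : half (mnum c M) = mnum (half c) M.
  move: c; apply: nat2 => [|i c nz _]; first by rewrite half0 (half0 natM).
  by rewrite -mSn !halfS.
have mspE (a c : natM) : msp (mnum a M) (mnum c M) = mnum (msp a c) M.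
  move: c; apply: nat2 => [|i c nz IH]; first by rewrite msp0 (@msp0 natM).
  by rewrite -mSn (@mspS natM i a c nz) (mspS _ (nzM _ _ nz)) IH halfE.
elim: f x => {k} //.
- by move=> x; rewrite /= /mnum /= /mZ; congr sapp; apply: env0E.
- by move=> i; apply: n1 => a; exact: mSn.
- by apply: n1 => a; exact: halfE.
- by apply: n1 => a; exact: suc.
- apply: n1; apply: nat2 => [|i c nz IH]; first by rewrite ax_len0 (ax_len0 natM).
  by rewrite -mSn (ax_lenS nz) (ax_lenS (nzM _ _ nz)) IH suc.
- by apply: n2 => a b; exact: mspE.
- by apply: n2.
- by apply: n2.
- have s1 a : ap2 pv_smash (mnum a M) (mS true mZ) = mnum (ap2 (M := natM) pv_smash a (mS true mZ)) M.
    move: a; apply: nat2 => [|i c nz IH].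
      by rewrite ax_smash01 (ax_smash01 natM) -mSn.
    by rewrite -mSn (ax_smashS1 nz) (ax_smashS1 (nzM _ _ nz)) IH mSn.
  apply: n2 => a; apply: nat2 => [|i c nz IH].
    by rewrite ax_smash0 (ax_smash0 (M := natM)) -mSn.
  by rewrite -mSn (ax_smashS _ nz) (ax_smashS _ (nzM _ _ nz)) IH s1 mul.
(* The clause of the order for the final digits 1 and 0 exchanges the two arguments, so the
   induction is on their sum. *)
- apply: n2 => a b; have [m] := ubnP (a + b); elim: m a b => // m IH a b kab.
  case: (posnP a) => [->|a0]; first by rewrite ax_leq0 (ax_leq0 (M := natM)) -mSn.
  have [i [a' [ea [_ /(_ a0) la]]]] := two a; have [j [b' [eb [lb _]]]] := two b.
  have IH1 := IH a' b' ltac:(lia).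
  rewrite ea eb -!mSn; case ij : (i ==> j).
    by rewrite (ax_leqS (M := M)) // (ax_leqS (M := natM)).
  have -> : i = true by case: i ij {ea}.
  have -> : j = false by case: j ij {eb}; rewrite ?implybT.
  case: (posnP b') => [b0|b0].
    have [h1 _] := ax_leqS10 (mnum a' M) (mnum b' M); have [h2 _] := ax_leqS10 (M := natM) a' b'.
    rewrite b0 in h1 h2 *; rewrite h1 ?h2 //; first exact: (ax_leq0 (M := natM)).
    by rewrite ax_leq0.
  have IH2 := IH b' a' ltac:(by move: ea eb; rewrite !mS_nat; lia).
  have [h1 h1'] := ax_leqS10 (mnum a' M) (mnum b' M).
  have [h2 h2'] := ax_leqS10 (M := natM) a' b'.
  case: (pselect (ap2 (M := natM) pv_leq b' a' = mS true mZ)) => h.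
    by rewrite h1 ?h2 // IH2 h -mSn.
  rewrite h1' ?h2' -?mSn // IH2 => h'; apply: h.
  by apply: (@mnum_inj M); rewrite h' -mSn.
- by move=> n i x; rewrite ax_proj.
- move=> n k f IHf g IHg x; rewrite ax_comp /= -IHf; congr sapp.
  by apply/funext => j; rewrite IHg.
- move=> n g IHg h IHh b IHb x.
  have sc (y : nat) (z : 'I_n -> nat) : (fun j => mnum (scons y z j) M) =
    scons (mnum y M) (fun j => mnum (z j) M) by rewrite (scons_comp (fun c => mnum c M)).
  suff H y (z : 'I_n -> nat) : sapp (pv_lrn g h b) (fun j => mnum (scons y z j) M) =
    mnum (pv_eval (pv_lrn g h b) (scons y z)) M by rewrite -(scons_eta x); apply: H.
  move: z => {}x; rewrite sc; move: y; apply: nat2 => [|i y nz IH].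
    by rewrite ax_lrn0 IHg; congr (mnum _ M); exact: esym (@ax_lrn0 natM n g h b x).
  have [h1 h1'] := @ax_lrnS natM n g h b i y x nz.
  have [h2 h2'] := @ax_lrnS M n g h b i (mnum y M) (fun j => mnum (x j) M) (nzM _ _ nz).
  have eb : sapp b (scons (mS i (mnum y M)) (fun j => mnum (x j) M)) =
      mnum (pv_eval b (scons (mS i (M := natM) y) x)) M by rewrite mSn -sc IHb.
  have eh : sapp (h i) (scons (mnum y M) (scons (sapp (pv_lrn g h b) (scons (mnum y M) (fun j => mnum (x j) M)))
      (fun j => mnum (x j) M))) = mnum (pv_eval (h i) (scons y (scons (pv_eval (pv_lrn g h b) (scons y x)) x))) M.
    by rewrite IH -IHh !(scons_comp (fun c => mnum c M)).
  rewrite eb eh mspE in h2 h2'; rewrite -mSn.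
  case: (pselect (msp (M := natM) (pv_eval (h i) (scons y (scons (pv_eval (pv_lrn g h b) (scons y x)) x)))
    (pv_eval b (scons (mS i (M := natM) y) x)) = mZ)) => hh.
    by rewrite h2 ?hh //; congr (mnum _ M); exact: esym (h1 hh).
  rewrite h2'; first by congr (mnum _ M); exact: esym (h1' hh).
  by move=> /mnum_nz.
Qed.

Lemma ev_mnum (M : pvm) n (t : pvterm n) (x : 'I_n -> nat) :
  ev (fun j => mnum (x j) M) t = mnum (teval x t) M.
Proof.
elim: t => //= k f ts IH; rewrite -mnum_sapp; congr sapp; apply/funext => j; exact: IH.
Qed.

Lemma sat_mnum (M : pvm) n (A : pvform n) (x : 'I_n -> nat) : qf A ->
  sat (M := M) A (fun j => mnum (x j) M) <-> holds A x.
Proof.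
elim: A x => {n} [n|n t u|n A IA B IB|n A IA] x //=.
- by rewrite !ev_mnum; split=> [/mnum_inj|->].
- by move=> [/(IA x) -> /(IB x) ->].
Qed.

(** ** Successor and predecessor *)

Lemma ex_pred : exists F : F1, def1 F /\ forall (M : pvm),
  [/\ F M mZ = mZ, forall y : M, mS false y <> mZ -> F M (mS false y) = mS true (F M y)
    & forall y : M, F M (mS true y) = mS false y].
Proof.
have [|[]||F [dF F0 FS]] := @lrn1 (fun M a => mZ) (fun i M y r a => if i then mS false y else mS true r)
  (fun M c a => c); try fdt.
have le (M : pvm) (y a : M) : ple (F M y a) y.
  move: M y a; apply: uind1; [by pdt|by move=> M a; rewrite F0; apply: ple0|].
  move=> M y i a IH; case: (pselect (mS i y = mZ)) => [->|nz]; first by rewrite F0; apply: ple0.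
  have nb : msp (if i then mS false y else mS true (F M y a)) (mS i y) = mZ.
    by case: i nz => nz; apply: ple_S => //; apply: ple_xx.
  by rewrite FS //.
exists (fun M y => F M y mZ); split; first by fdt.
move=> M; split=> // y => [nz|]; rewrite FS //; try exact: S1nz; apply: ple_S => //; try exact: S1nz.
exact: ple_xx.
Qed.
Definition mpred : F1 := sval (cid ex_pred).
Lemma def_mpred : def1 mpred. Proof. by rewrite /mpred; case: cid => F []. Qed.
#[export] Hint Resolve def_mpred : fdb.

Lemma predE (M : pvm) : [/\ mpred (mZ : M) = mZ, forall y : M, mS false y <> mZ ->
  mpred (mS false y) = mS true (mpred y) & forall y : M, mpred (mS true y) = mS false y].
Proof. by rewrite /mpred; case: cid => F [_ h] /=; exact: h. Qed.

Lemma succ_nz (M : pvm) (y : M) : msucc y <> mZ.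
Proof.
move: M y; apply: uind0; [by pdt|by move=> M; rewrite -{1}S00 succ0; apply: S1nz|].
by move=> M y [] IH; rewrite ?succ0 ?succ1; [apply: mS_nz|apply: S1nz].
Qed.

Lemma succ_pred (M : pvm) (y : M) : y <> mZ -> msucc (mpred y) = y.
Proof.
move: M y; apply: uind0; [by pdt|by []|].
move=> M y i IH nz; have [p0 pS0 pS1] := predE M.
case: i nz => nz; first by rewrite pS1 succ0.
by rewrite pS0 // succ1 IH // => e; rewrite e S00 in nz.
Qed.

Lemma pred_succ (M : pvm) (y : M) : mpred (msucc y) = y.
Proof.
have [p0 pS0 pS1] := predE M.
move: y; apply: (@rind1 (fun M y _ => mpred (msucc y) = y) _ M mZ); first by pdt.
  by rewrite -{1}S00 succ0 pS1 S00.
move=> y [] IH; rewrite ?succ0 ?succ1 ?pS1 //.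
by rewrite pS0 ?IH //; apply: mS_nz; apply: succ_nz.
Qed.

Lemma leq_refl (M : pvm) (y : M) : ap2 pv_leq y y = one.
Proof.
move: M y; apply: uind0.
- by apply: pd_eq; [apply: (@fd_app2 _ (fun M => @ap2 M pv_leq)); [exact: def_ap2|fdt|fdt]|fdt].
- by move=> M; rewrite ax_leq0.
- by move=> M y i IH; rewrite ax_leqS //; case: i.
Qed.

(** * Ordinals in a model of PV *)

Class ptrep := Ptrep { oO : ordtuple; oal : wellorder; orep : ptime_representation oO oal }.

Definition cst := forall M : pvm, M.

Section Ordinals.
Context {P : ptrep}.

Definition odom (M : pvm) (a : M) : Prop := sat (M := M) (o_dom oO) (scons a (@env0 M)).
Definition olt (M : pvm) (a b : M) : Prop := sat (M := M) (o_lt oO) (scons a (scons b (@env0 M))).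
Definition ole (M : pvm) (a b : M) : Prop := olt a b \/ a = b.
Definition oadd (M : pvm) (a b : M) : M := ev (scons a (scons b (@env0 M))) (o_add oO).
Definition omul (M : pvm) (a b : M) : M := ev (scons a (scons b (@env0 M))) (o_mul oO).
Definition onat (M : pvm) (a : M) : M := ev (scons a (@env0 M)) (o_nat oO).
Definition ozero : cst := fun M => ev (@env0 M) (o_zero oO).
Definition oone : cst := fun M => ev (@env0 M) (o_one oO).
Definition oomega : cst := fun M => ev (@env0 M) (o_omega oO).

Let eta1 T (x : 'I_1 -> T) : scons (x (v0 _)) (@env0 _) = x.
Proof. by rewrite -[RHS]scons_eta; congr scons; apply: env0E. Qed.
Let eta2 T (x : 'I_2 -> T) : scons (x (v0 _)) (scons (x (v1 _)) (@env0 _)) = x.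
Proof.
by rewrite -[RHS]scons_eta; congr scons; rewrite -[RHS]scons_eta; congr scons; apply: env0E.
Qed.

Lemma rel_odom : rel1 odom.
Proof. by exists (o_dom oO); [exact: rep_dom_qf orep|move=> M x; rewrite /odom eta1]. Qed.
Lemma rel_olt : rel2 olt.
Proof. by exists (o_lt oO); [exact: rep_lt_qf orep|move=> M x; rewrite /olt eta2]. Qed.
Lemma rel_ole : rel2 ole.
Proof. have d := rel_olt; by rewrite /ole; pdt. Qed.
Lemma def_oadd : def2 oadd. Proof. by exists (o_add oO) => M x; rewrite /oadd eta2. Qed.
Lemma def_omul : def2 omul. Proof. by exists (o_mul oO) => M x; rewrite /omul eta2. Qed.
Lemma def_onat : def1 onat. Proof. by exists (o_nat oO) => M x; rewrite /onat eta1. Qed.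
Let def_closed (t : pvterm 0) : def0 (fun M => ev (@env0 M) t).
Proof.
move=> n; exists (twk n t) => M x; rewrite ev_tsubst; congr ev; exact: env0E.
Qed.
Lemma def_ozero : def0 ozero. Proof. exact: def_closed. Qed.
Lemma def_oone : def0 oone. Proof. exact: def_closed. Qed.
Lemma def_oomega : def0 oomega. Proof. exact: def_closed. Qed.

Section Facts.
Variable M : pvm.
Implicit Types b c d x y : M.

Lemma DomE n (y : 'I_n -> M) t : sat (Dom oO t) y <-> odom (ev y t).
Proof. by rewrite sat_fsubst tnth_comp1 tnth1E. Qed.
Lemma LtE n (y : 'I_n -> M) t u : sat (Lt oO t u) y <-> olt (ev y t) (ev y u).
Proof. by rewrite sat_fsubst tnth_comp2 tnth2E. Qed.
Lemma LeE n (y : 'I_n -> M) t u : sat (Le oO t u) y <-> ole (ev y t) (ev y u).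
Proof. by rewrite sat_or LtE. Qed.
Lemma AddE n (y : 'I_n -> M) t u : ev y (Add oO t u) = oadd (ev y t) (ev y u).
Proof. by rewrite ev_tsubst tnth_comp2 tnth2E. Qed.
Lemma MulE n (y : 'I_n -> M) t u : ev y (Mul oO t u) = omul (ev y t) (ev y u).
Proof. by rewrite ev_tsubst tnth_comp2 tnth2E. Qed.
Lemma NatE n (y : 'I_n -> M) t : ev y (Nat oO t) = onat (ev y t).
Proof. by rewrite ev_tsubst tnth_comp1 tnth1E. Qed.
Lemma ZeroE n (y : 'I_n -> M) : ev y (Zero oO n) = ozero M.
Proof. by rewrite ev_tsubst; congr ev; apply: env0E. Qed.
Lemma OneE n (y : 'I_n -> M) : ev y (One oO n) = oone M.
Proof. by rewrite ev_tsubst; congr ev; apply: env0E. Qed.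
Lemma OmegaE n (y : 'I_n -> M) : ev y (Omega oO n) = oomega M.
Proof. by rewrite ev_tsubst; congr ev; apply: env0E. Qed.

Lemma PV_sound n (A : pvform n) : PV |- A -> forall y : 'I_n -> M, sat A y.
Proof.
move=> d y; apply: (prov_sound (C := models PV) _ d) => //; last exact: pvmP.
by move=> B PB N NM z; apply: NM.
Qed.

Let x3 b c d := scons b (scons c (scons d (@env0 M))).
Let ev0 b c d : ev (x3 b c d) (v 0) = b.
Proof. by rewrite /x3 /= (_ : inord 0 = v0 _ :> 'I_3) ?scE //; apply/val_inj; rewrite /= inordK. Qed.
Let ev1 b c d : ev (x3 b c d) (v 1) = c.
Proof. by rewrite /x3 /= (_ : inord 1 = v1 _ :> 'I_3) ?scE //; apply/val_inj; rewrite /= inordK. Qed.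
Let ev2 b c d : ev (x3 b c d) (v 2) = d.
Proof. by rewrite /x3 /= (_ : inord 2 = v2 _ :> 'I_3) ?scE //; apply/val_inj; rewrite /= inordK. Qed.
Let ar : PV_ordinal_arithmetic oO := rep_arith orep.

Let sat_impE n (A B : pvform n) (y : 'I_n -> M) : sat (fimp A B) y <-> (sat A y -> sat B y).
Proof. by []. Qed.
Let sat_eqE n t u (y : 'I_n -> M) : sat (feq t u) y <-> ev y t = ev y u.
Proof. by []. Qed.
Let sE := (LeE, sat_or, sat_and, sat_neg, LtE, DomE, sat_impE, sat_eqE).
Let eE := (AddE, MulE, NatE, ZeroE, OneE, OmegaE, ev0, ev1, ev2).

Let ordfact b c d (A : pvform 3) :
  PV |- fimp (Dom oO (v 0)) (fimp (Dom oO (v 1)) (fimp (Dom oO (v 2)) A)) ->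
  odom b -> odom c -> odom d -> sat A (x3 b c d).
Proof.
move=> /PV_sound/(_ (x3 b c d)); rewrite !sat_impE !DomE !eE => h hb hc hd; exact: h.
Qed.

Lemma dom0 : odom (ozero M).
Proof. by have /DomE := PV_sound (dom_zero ar) (@env0 M); rewrite ZeroE. Qed.
Lemma dom1 : odom (oone M).
Proof. by have /DomE := PV_sound (dom_one ar) (@env0 M); rewrite OneE. Qed.
Lemma domw : odom (oomega M).
Proof. by have /DomE := PV_sound (dom_omega ar) (@env0 M); rewrite OmegaE. Qed.
Lemma dom_oadd b c : odom b -> odom c -> odom (oadd b c).
Proof. move=> hb hc; have := ordfact (dom_add ar) hb hc hb; by rewrite !sE !eE. Qed.
Lemma dom_omul b c : odom b -> odom c -> odom (omul b c).
Proof. move=> hb hc; have := ordfact (dom_mul ar) hb hc hb; by rewrite !sE !eE. Qed.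
Lemma olt_irr b : odom b -> ~ olt b b.
Proof. move=> hb; have := ordfact (lt_irr ar) hb hb hb; by rewrite !sE !eE. Qed.
Lemma olt_tr b c d : odom b -> odom c -> odom d -> olt b c -> olt c d -> olt b d.
Proof. move=> hb hc hd; have := ordfact (lt_tr ar) hb hc hd; by rewrite !sE !eE. Qed.
Lemma olt_tot b c : odom b -> odom c -> olt b c \/ b = c \/ olt c b.
Proof. move=> hb hc; have := ordfact (lt_tot ar) hb hc hb; rewrite !sE !eE; tauto. Qed.
Lemma ole0 b : odom b -> ole (ozero M) b.
Proof. move=> hb; have := ordfact (lt_min ar) hb hb hb; by rewrite !sE !eE. Qed.
Lemma olt_add1 b : odom b -> olt b (oadd b (oone M)).
Proof. move=> hb; have := ordfact (lt_add1 ar) hb hb hb; by rewrite !sE !eE. Qed.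
Lemma olt_disc b c : odom b -> odom c -> olt b c -> ole (oadd b (oone M)) c.
Proof. move=> hb hc; have := ordfact (lt_discrete ar) hb hc hb; by rewrite !sE !eE. Qed.
Lemma oaddA b c d : odom b -> odom c -> odom d -> oadd b (oadd c d) = oadd (oadd b c) d.
Proof. move=> hb hc hd; have := ordfact (add_assoc ar) hb hc hd; by rewrite !sE !eE. Qed.
Lemma omulD b c d : odom b -> odom c -> odom d -> omul b (oadd c d) = oadd (omul b c) (omul b d).
Proof. move=> hb hc hd; have := ordfact (mul_add ar) hb hc hd; by rewrite !sE !eE. Qed.
Lemma oadd0l b : odom b -> oadd (ozero M) b = b.
Proof. move=> hb; have := ordfact (add_zero_l ar) hb hb hb; by rewrite !sE !eE. Qed.
Lemma oadd0r b : odom b -> oadd b (ozero M) = b.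
Proof. move=> hb; have := ordfact (add_zero_r ar) hb hb hb; by rewrite !sE !eE. Qed.
Lemma omul1r b : odom b -> omul b (oone M) = b.
Proof. move=> hb; have := ordfact (mul_one_r ar) hb hb hb; by rewrite !sE !eE. Qed.
Lemma oadd_lt b c d : odom b -> odom c -> odom d -> olt c d -> olt (oadd b c) (oadd b d).
Proof. move=> hb hc hd; have := ordfact (add_lt ar) hb hc hd; by rewrite !sE !eE. Qed.
Lemma omul_lt b c d : odom b -> odom c -> odom d -> b <> ozero M -> olt c d -> olt (omul b c) (omul b d).
Proof. move=> hb hc hd; have := ordfact (mul_lt ar) hb hc hd; by rewrite !sE !eE. Qed.
Lemma oadd_le b c d : odom b -> odom c -> odom d -> ole b c -> ole (oadd b d) (oadd c d).
Proof. move=> hb hc hd; have := ordfact (add_le ar) hb hc hd; by rewrite !sE !eE. Qed.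

Lemma dom_onat x : odom (onat x).
Proof. by have := PV_sound (nat_dom ar) (x3 x x x); rewrite !sE !eE => -[]. Qed.
Lemma onat_lt_w x : olt (onat x) (oomega M).
Proof. by have := PV_sound (nat_dom ar) (x3 x x x); rewrite !sE !eE => -[]. Qed.
Lemma onat_succ x : olt (onat x) (onat (msucc x)).
Proof.
have := PV_sound (nat_lt ar) (x3 x (msucc x) x); rewrite !sE !eE; apply.
rewrite /tleq /tone /tS /tsucc /app2 /app1; cbn [ev]; rewrite tnth_comp2 tnth2E ev1; cbn [ev].
rewrite !(tnth_comp1 (ev _)) !tnth1E ev0.
have -> : ev (x3 x (msucc x) x) tZ = mZ by rewrite /mZ /=; congr sapp; apply: env0E.
exact: (leq_refl (msucc x)).
Qed.

Lemma ole_lt_tr b c d : odom b -> odom c -> odom d -> ole b c -> olt c d -> olt b d.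
Proof. by move=> hb hc hd [bc|-> //] cd; apply: olt_tr cd. Qed.
Lemma olt_le_tr b c d : odom b -> odom c -> odom d -> olt b c -> ole c d -> olt b d.
Proof. by move=> hb hc hd bc [cd|<- //]; apply: olt_tr cd. Qed.
Lemma ole_tr b c d : odom b -> odom c -> odom d -> ole b c -> ole c d -> ole b d.
Proof. by move=> hb hc hd [bc|-> //] cd; left; apply: olt_le_tr cd. Qed.
Lemma olt_nz b : odom b -> b <> ozero M -> olt (ozero M) b.
Proof. by move=> hb nz; case: (ole0 hb) => // /esym. Qed.
Lemma olt0 b : odom b -> ~ olt b (ozero M).
Proof. by move=> hb h; case: (olt_irr dom0); apply: ole_lt_tr (ole0 hb) h => //; apply: dom0. Qed.
Lemma oadd_le2 b c d : odom b -> odom c -> odom d -> ole c d -> ole (oadd b c) (oadd b d).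
Proof. by move=> hb hc hd [h|->]; [left; apply: oadd_lt|right]. Qed.
Lemma omul_le2 b c d : odom b -> odom c -> odom d -> b <> ozero M -> ole c d -> ole (omul b c) (omul b d).
Proof. by move=> hb hc hd nz [h|->]; [left; apply: omul_lt|right]. Qed.
Lemma ole_addr b c : odom b -> odom c -> ole b (oadd b c).
Proof.
move=> hb hc; rewrite -{1}(oadd0r hb); apply: oadd_le2 => //; [exact: dom0|exact: ole0].
Qed.
Lemma olt_addr b c : odom b -> odom c -> c <> ozero M -> olt b (oadd b c).
Proof.
move=> hb hc nz; rewrite -{1}(oadd0r hb); apply: oadd_lt => //; [exact: dom0|exact: olt_nz].
Qed.
Lemma one_nz_o : oone M <> ozero M.
Proof.
move=> e; have := olt_add1 dom0; rewrite e oadd0l; [exact: (olt_irr dom0)|exact: dom0].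
Qed.
Lemma oadd1_nz b : odom b -> oadd b (oone M) <> ozero M.
Proof.
move=> hb e; have := olt_add1 hb; rewrite e; exact: olt0.
Qed.
(** The lexicographic step of nested searches: a descent of the right factor pays for any remainder
    below the left one. *)
Lemma omul_succ_lt b c d e : odom b -> odom c -> odom d -> odom e -> olt e b -> olt c d ->
  olt (oadd (omul b c) e) (omul b d).
Proof.
move=> hb hc hd he eb cd; have h1 := dom1.
have nz : b <> ozero M by move=> e0; rewrite e0 in eb; case: (olt0 he eb).
apply: (@olt_le_tr _ (oadd (omul b c) b)); try by repeat (apply: dom_oadd || apply: dom_omul).
  by apply: oadd_lt => //; apply: dom_omul.
rewrite -{2}(omul1r hb) -omulD //; apply: omul_le2 => //; first exact: dom_oadd.
exact: olt_disc.
Qed.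
Lemma omul_nz b c : odom b -> odom c -> b <> ozero M -> c <> ozero M -> omul b c <> ozero M.
Proof.
move=> hb hc nb nc e; have := omul_lt hb dom0 hc nb (olt_nz hc nc); rewrite e.
by apply: olt0; apply: dom_omul => //; exact: dom0.
Qed.
End Facts.

(** A constant that is one and the same numeral in every model. Bounds of searches have this form
    because a program fixes its [beta] as a numeral. *)
Definition std (k : cst) := exists2 c, in_dom oO c & forall M, k M = mnum c M.

Lemma std_def0 k : std k -> def0 k.
Proof. by move=> [c _ e] n; apply: fd_ext (def_mnum c n) => M x; rewrite e. Qed.

Lemma std_dom k (M : pvm) : std k -> odom (k M).
Proof.
move=> [c hc ->]; rewrite /odom.
have -> : scons (mnum c M) (@env0 M) = (fun j => mnum (tnth [tuple c] j) M).
  by rewrite (tnth_comp1 (fun c => mnum c M)) tnth1E.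
by apply/sat_mnum => //; exact: rep_dom_qf orep.
Qed.

Lemma std_nat k c : (forall M, k M = mnum c M) -> odom (k natM) -> std k.
Proof.
move=> e; rewrite e => h; exists c => //; rewrite /in_dom holdsE; move: h.
rewrite /odom tnth1E; congr (sat _ (scons _ _)).
by elim: c {e} => // c IH; rewrite -[LHS]/(msucc (mnum c natM)) msucc_nat IH.
Qed.

Let std_closed (t : pvterm 0) : exists c, forall M : pvm, ev (@env0 M) t = mnum c M.
Proof.
exists (teval (@env0 nat) t) => M; rewrite -ev_mnum; congr ev; exact: env0E.
Qed.

Lemma std0 : std ozero.
Proof. by have [c e] := std_closed (o_zero oO); apply: (std_nat (c := c)) => //; exact: dom0. Qed.
Lemma std1 : std oone.
Proof. by have [c e] := std_closed (o_one oO); apply: (std_nat (c := c)) => //; exact: dom1. Qed.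
Lemma stdw : std oomega.
Proof. by have [c e] := std_closed (o_omega oO); apply: (std_nat (c := c)) => //; exact: domw. Qed.

Let std2 (t : pvterm 2) a b : exists c, forall M : pvm,
  ev (scons (mnum a M) (scons (mnum b M) (@env0 M))) t = mnum c M.
Proof.
exists (teval (tnth [tuple a; b]) t) => M; rewrite -ev_mnum; congr ev.
by rewrite (tnth_comp2 (fun c => mnum c M)) tnth2E.
Qed.

Lemma std_add k l : std k -> std l -> std (fun M => oadd (k M) (l M)).
Proof.
move=> sk sl; have [a _ ea] := sk; have [b _ eb] := sl.
have [c e] := std2 (o_add oO) a b; apply: (@std_nat _ c) => [M|].
  by rewrite -e ea eb.
by apply: dom_oadd; apply: std_dom.
Qed.

Lemma std_mul k l : std k -> std l -> std (fun M => omul (k M) (l M)).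
Proof.
move=> sk sl; have [a _ ea] := sk; have [b _ eb] := sl.
have [c e] := std2 (o_mul oO) a b; apply: (@std_nat _ c) => [M|].
  by rewrite -e ea eb.
by apply: dom_omul; apply: std_dom.
Qed.
End Ordinals.
#[export] Hint Resolve rel_odom rel_olt rel_ole def_oadd def_omul def_onat def_ozero def_oone
  def_oomega : fdb.
#[export] Hint Resolve dom0 dom1 domw dom_oadd dom_omul dom_onat std_dom std0 std1 stdw std_add std_mul : odb.
#[export] Hint Extern 1 (def0 _) => eapply std_def0; solve [eauto 6 with odb] : fdb.

(** * Tables of oracle answers

    A table is a list of entries [pair key (pair value extra)]. *)

Definition ekey (M : pvm) (u : M) := pfst (pfst u).
Definition evl (M : pvm) (u : M) := pfst (psnd (pfst u)).
Definition eex (M : pvm) (u : M) := psnd (psnd (pfst u)).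
Definition push (M : pvm) (q v e V : M) := pair (pair q (pair v e)) V.
Lemma def_ekey : def1 ekey. Proof. by rewrite /ekey; fdt. Qed.
Lemma def_evl : def1 evl. Proof. by rewrite /evl; fdt. Qed.
Lemma def_eex : def1 eex. Proof. by rewrite /eex; fdt. Qed.
Lemma def_push : def4 push. Proof. by rewrite /push; fdt. Qed.
#[export] Hint Resolve def_ekey def_evl def_eex def_push : fdb.

Definition keyR : R2 := fun M u q => ekey u = q.
Lemma rel_keyR : rel2 keyR. Proof. by rewrite /keyR; pdt. Qed.
(** The oldest entry for [q]. Later entries for the same key leave it in place, so pushing onto a
    table never changes an answer that has been given. *)
Definition ent (M : pvm) (V q : M) := lastof rel_keyR V q.
Definition reg (M : pvm) (V q : M) := ent V q <> mZ.
Definition look (M : pvm) (V q : M) := evl (ent V q).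
Lemma def_ent : def2 ent. Proof. by rewrite /ent; fdt. Qed.
#[export] Hint Resolve def_ent : fdb.
Lemma rel_reg : rel2 reg. Proof. by rewrite /reg; pdt. Qed.
Lemma def_look : def2 look. Proof. by rewrite /look; fdt. Qed.
#[export] Hint Resolve rel_reg def_look : fdb.

Section Tables.
Variable M : pvm.
Implicit Types (V u q v e : M).

Lemma ekeyE q v e V : ekey (push q v e V) = q. Proof. by rewrite /ekey /push !pfstE. Qed.
Lemma evlE q v e V : evl (push q v e V) = v. Proof. by rewrite /evl /push !pfstE psndE pfstE. Qed.
Lemma eexE q v e V : eex (push q v e V) = e. Proof. by rewrite /eex /push !pfstE !psndE. Qed.
Lemma psnd_push q v e V : psnd (push q v e V) = V. Proof. by rewrite /push psndE. Qed.
Lemma push_nz q v e V : push q v e V <> mZ. Proof. exact: pair_nz. Qed.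
Lemma suf_push u q v e V : suf u (push q v e V) <-> u = push q v e V \/ suf u V.
Proof. exact: suf_pair. Qed.

Lemma evl0 : evl (mZ : M) = mZ. Proof. by rewrite /evl pfst0 psnd0 pfst0. Qed.
Lemma reg0 q : ~ reg mZ q. Proof. by rewrite /reg /ent lastof0. Qed.
Lemma look_nreg V q : ~ reg V q -> look V q = mZ.
Proof. by move=> /contrapT h; rewrite /look h evl0. Qed.

Lemma ent_reg V q : reg V q -> [/\ suf (ent V q) V, ekey (ent V q) = q & ~ reg (psnd (ent V q)) q].
Proof. by move=> /lastofP[h1 h2 h3]; split=> // h; apply: h. Qed.

Lemma regP V q : reg V q <-> exists2 u, suf u V & ekey u = q.
Proof.
split=> [/ent_reg[? ? _]|[u uV e]]; first by exists (ent V q).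
by move=> h; apply: (lastof_none h uV).
Qed.

Lemma ent_suf V u q : suf u V -> reg u q -> ent V q = ent u q.
Proof. by move=> uV r; apply: lastof_suf. Qed.

Lemma look_suf V u q : suf u V -> reg u q -> look V q = look u q.
Proof. by move=> uV r; rewrite /look (ent_suf uV r). Qed.

Lemma ent_push q v e V q' : ent (push q v e V) q' =
  ite (reg V q') (ent V q') (ite (q = q') (push q v e V) mZ).
Proof.
rewrite /ent lastof_rec ?psnd_push; last exact: push_nz.
by congr ite; rewrite /keyR ekeyE.
Qed.

Lemma reg_push q v e V q' : reg (push q v e V) q' <-> reg V q' \/ q = q'.
Proof.
rewrite {1}/reg ent_push; case: (pselect (reg V q')) => r; first by rewrite iteT //; split=> // _; left.
rewrite iteF //; case: (pselect (q = q')) => e'.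
  by rewrite iteT //; split=> _; [right|exact: push_nz].
by rewrite iteF //; split=> // -[].
Qed.

Lemma look_push q v e V q' : reg V q' \/ q <> q' -> look (push q v e V) q' = look V q'.
Proof.
move=> h; rewrite /look ent_push; case: (pselect (reg V q')) => r; first by rewrite iteT.
rewrite iteF // iteF; last by case: h.
by rewrite evl0 -/(look V q') look_nreg.
Qed.

Lemma look_push_new q v e V : ~ reg V q -> look (push q v e V) q = v.
Proof. by move=> r; rewrite /look ent_push iteF // iteT // evlE. Qed.

Definition fits (F : M -> M) V := forall u, suf u V -> evl u = F (ekey u).

Lemma fits0 F : fits F mZ. Proof. by move=> u /suf0. Qed.
Lemma fits_look F V q : fits F V -> reg V q -> look V q = F q.
Proof. by move=> h /ent_reg[s k _]; rewrite /look h // k. Qed.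
End Tables.

Fixpoint tag (i : nat) (M : pvm) : M := if i is j.+1 then mS true (tag j M) else mZ.
(** Tag of the queries for values of [oexp], distinct from the tags of all oracles. *)
Definition te (M : pvm) : M := mS false (mS true mZ).
Lemma def_tag i : def0 (tag i).
Proof. by elim: i => [|i IH] n /=; fdt. Qed.
Lemma def_te : def0 te. Proof. by move=> n; rewrite /te; fdt. Qed.
#[export] Hint Resolve def_tag def_te : fdb.
Lemma tag_inj (M : pvm) i j : tag i M = tag j M -> i = j.
Proof.
elim: i j => [|i IH] [|j] //=; [by move=> /esym/S1nz|by move=> /S1nz|].
by move=> /mS_inj[_ /IH ->].
Qed.
Lemma te_tag (M : pvm) i : te M <> tag i M.
Proof.
case: i => [|i]; first by move=> /S0nz[_ /S1nz].
by move=> /mS_inj[].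
Qed.

(** ** Straight-line oracle programs

    A program is a list of queries [(i, h)]; the query with argument [h x W],
    where [W] is the table so far, is entered under the key [pair (tag (key i)) (h x W)]. *)

Section StraightLine.
Variables (I : Type) (key : I -> nat).

Definition qkey (M : pvm) (ih : I * F2) (x W : M) : M := pair (tag (key ih.1) M) (ih.2 M x W).

Fixpoint runs (M : pvm) (F : M -> M) (qs : seq (I * F2)) (x W W' : M) : Prop :=
  if qs is ih :: qs then exists e, runs F qs x (push (qkey ih x W) (F (qkey ih x W)) e W) W'
  else W' = W.

Lemma runs_cat (M : pvm) (F : M -> M) qs qs' (x W W' : M) :
  runs F (qs ++ qs') x W W' <-> exists2 W1, runs F qs x W W1 & runs F qs' x W1 W'.
Proof.
elim: qs W => [|ih qs IH] W /=.
  by split=> [h|[W1 -> //]]; exists W.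
split=> [[e /IH[W1 h1 h2]]|[W1 [e h1] h2]]; first by exists W1 => //; exists e.
by exists e; apply/IH; exists W1.
Qed.

Lemma runs_drop (M : pvm) (F : M -> M) qs (x W W' : M) :
  runs F qs x W W' -> iter (size qs) (@psnd M) W' = W.
Proof.
elim: qs W => [|ih qs IH] W //= [e /IH]; rewrite -iterS iterSr => h.
by rewrite -iterSr iterS h psnd_push.
Qed.

Lemma runs_reg (M : pvm) (F : M -> M) qs (x W W' : M) q : runs F qs x W W' -> reg W q -> reg W' q.
Proof. by elim: qs W => [|ih qs IH] W /= => [-> //|[e /IH h] r]; apply: h; apply/reg_push; left. Qed.
End StraightLine.

Lemma def_iter_psnd n : def1 (fun M => iter n (@psnd M)).
Proof.
elim: n => [|n IH]; first by rewrite /def1 /=; exact: fd_var.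
by rewrite /def1 /=; apply: (@fd_app1 _ psnd) IH; exact: def_psnd.
Qed.

Definition qsdef I (qs : seq (I * F2)) := forall ih, List.In ih qs -> def2 ih.2.

Lemma qsdef_cat I (qs qs' : seq (I * F2)) : qsdef qs -> qsdef qs' -> qsdef (qs ++ qs').
Proof. by move=> h h' ih /List.in_app_iff[/h|/h']. Qed.

Definition orc I (key : I -> nat) (M : pvm) (F : M -> M) : I -> M -> M :=
  fun i a => F (pair (tag (key i) M) a).

(** The queries of the arguments come before the query of the term itself. The value of an earlier
    argument is read off the table as it was then, recovered by dropping the entries of the later
    ones. *)
Lemma compile I (t : term (osym pvsym I) 1) : exists (qs : seq (I * F2)) (g : F2),
  [/\ qsdef qs, def2 g & forall (key : I -> nat) (M : pvm) (F : M -> M) x W W',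
   runs key F qs x W W' -> ev (M := ostruct (orc key F)) (fun _ => x) t = g M x W'].
Proof.
elim: t => [i|k f ts IH].
  by exists [::], (fun M x W => x); split=> //; fdt.
have [qs [gs [dqs dgs E]]] : exists (qs : seq (I * F2)) (gs : 'I_k -> F2),
    [/\ qsdef qs, forall j, def2 (gs j) & forall (key : I -> nat) (M : pvm) (F : M -> M) x W W',
     runs key F qs x W W' -> forall j, ev (M := ostruct (orc key F)) (fun _ => x) (ts j) = gs j M x W'].
  elim: k {f} ts IH => [|k IHk] ts IH.
    by exists [::], (fun _ M x W => x); split=> //; [move=> [] | move=> ? ? ? ? ? ? _ []].
  have [qs1 [gs1 [d1 dg1 E1]]] := IHk (fun j => ts (lift ord0 j)) (fun j => IH (lift ord0 j)).
  have [qs0 [g0 [d0 dg0 E0]]] := IH ord0.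
  exists (qs0 ++ qs1), (scons (fun M x W => g0 M x (iter (size qs1) (@psnd M) W)) gs1); split.
  - exact: qsdef_cat.
  - move=> j; case: (unliftP ord0 j) => [j'|] ->; rewrite ?sconsS ?scons0 //.
    have d := def_iter_psnd (size qs1).
    rewrite /def2; apply: (@fd_app2 _ g0) => //; first by fdt.
    by apply: (@fd_app1 _ (fun M => iter (size qs1) (@psnd M))) => //; fdt.
  - move=> key M F x W W' /runs_cat[W1 r0 r1] j.
    case: (unliftP ord0 j) => [j'|] ->; rewrite ?sconsS ?scons0; first exact: E1 r1 j'.
    by rewrite (E0 _ _ _ _ _ _ r0) (runs_drop r1).
case: f ts IH gs dgs E => [{}k f|i] ts _ gs dgs E.
  exists qs, (fun M x W => sapp f (fun j => gs j M x W)); split=> //.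
    have /choice[tt ttE] := dgs; exists (tapp f tt) => M x /=.
    by congr sapp; apply/funext => j; rewrite ttE.
  by move=> key M F x W W' r /=; congr sapp; apply/funext => j; rewrite (E _ _ _ _ _ _ r).
exists (qs ++ [:: (i, gs ord0)]), (fun M x W => evl W); split=> //; last 1 first.
- move=> key M F x W W' /runs_cat[W1 r [e /= ->]].
  by rewrite evlE /orc /qkey /= (E _ _ _ _ _ _ r).
- by apply: qsdef_cat => // ih [<-|[]] /=.
- by fdt.
Qed.

(** * Local search problems and the class [K] *)

Section LocalSearchClass.
Context {P : ptrep}.

(** Local search for all standard bounds at once, with inputs, states and outputs coded as single
    elements and with truth in all models in place of derivability. Descent is asked only where the
    invariant holds. *)
Definition sLS (A : R2) : Prop := exists b (i : F1) (G : R3) (q N : F3) (p : F2),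
 [/\ std b, [/\ def1 i, rel3 G, def3 q, def3 N & def2 p] &
  forall (M : pvm) (x : M), [/\ G M (b M) (i M x) x,
    forall g z, odom g -> g <> ozero M -> G M g z x ->
      [/\ odom (q M g z x), olt (q M g z x) g & G M (q M g z x) (N M g z x) x]
  & forall z, G M (ozero M) z x -> A M x (p M z x)]].

Lemma sLS_post (A A' : R2) (p : F2) : def2 p -> (forall (M : pvm) (x y : M), A M x y -> A' M x (p M x y)) ->
  sLS A -> sLS A'.
Proof.
move=> dp AA' [b [i [G [q [N [p0 [sb [di dG dq dN dp0] H]]]]]]].
exists b, i, G, q, N, (fun M z x => p M x (p0 M z x)); split=> //; first by split=> //; fdt.
by move=> M x; have [h1 h2 h3] := H M x; split=> // z /h3/AA'.
Qed.

Lemma sLS_pre (A : R2) (h : F1) : def1 h -> sLS A -> sLS (fun M x y => A M (h M x) y).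
Proof.
move=> dh [b [i [G [q [N [p0 [sb [di dG dq dN dp0] H]]]]]]].
exists b, (fun M x => i M (h M x)), (fun M g z x => G M g z (h M x)), (fun M g z x => q M g z (h M x)),
  (fun M g z x => N M g z (h M x)), (fun M z x => p0 M z (h M x)); split=> //.
  by split; (try by fdt); pdt.
Qed.

Lemma sLS_triv (A : R2) (p : F1) : def1 p -> (forall (M : pvm) (x : M), A M x (p M x)) -> sLS A.
Proof.
move=> dp H; exists ozero, (fun M x => x), (fun M g z x => True), (fun M g z x => ozero M),
  (fun M g z x => z), (fun M z x => p M x); split; first exact: std0.
  by split; (try by fdt); pdt.
by move=> M x; split=> // g z dg nz _; split=> //; [exact: dom0|exact: olt_nz].
Qed.

Lemma sLS_bind (A C : R2) : sLS A -> sLS C ->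
  sLS (fun M x u => A M x (pfst u) /\ C M (pair x (pfst u)) (psnd u)).
Proof.
move=> [b1 [i1 [G1 [q1 [N1 [p1 [sb1 [di1 dG1 dq1 dN1 dp1] H1]]]]]]].
move=> [b2 [i2 [G2 [q2 [N2 [p2 [sb2 [di2 dG2 dq2 dN2 dp2] H2]]]]]]].
(* The first search runs in phase [mZ] at the ordinals [B2 + g], the second in phase [one] at
   ordinals from [b2] down. The added one makes the change of phase a strict descent and keeps phase
   [mZ] away from the final ordinal; [z1] stores the final state of the first search. *)
pose (B2 := (fun M => oadd (b2 M) (oone M)) : cst).
have sB2 : std B2 by apply: std_add => //; exact: std1.
pose ph (M : pvm) (s : M) := pfst s.
pose gm (M : pvm) (s : M) := pfst (psnd s).
pose zz (M : pvm) (s : M) := pfst (psnd (psnd s)).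
pose z1 (M : pvm) (s : M) := psnd (psnd (psnd s)).
pose mk (M : pvm) (p g z z1 : M) := pair p (pair g (pair z z1)).
have dph : def1 ph by rewrite /ph; fdt.
have dgm : def1 gm by rewrite /gm; fdt.
have dzz : def1 zz by rewrite /zz; fdt.
have dz1 : def1 z1 by rewrite /z1; fdt.
have dmk : def4 mk by rewrite /mk; fdt.
have mkE (M : pvm) (a g z w : M) : [/\ ph M (mk M a g z w) = a, gm M (mk M a g z w) = g,
  zz M (mk M a g z w) = z & z1 M (mk M a g z w) = w].
  by rewrite /ph /gm /zz /z1 /mk !(psndE, pfstE).
pose inp (M : pvm) (s x : M) := pair x (p1 M (z1 M s) x).
have dinp : def2 inp by rewrite /inp; fdt.
pose (G := fun (M : pvm) (c s x : M) =>
  (ph M s = mZ /\ odom (gm M s) /\ c = oadd (B2 M) (gm M s) /\ G1 M (gm M s) (zz M s) x) \/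
  (ph M s = one /\ odom (gm M s) /\ c = gm M s /\ G1 M (ozero M) (z1 M s) x /\
     G2 M (gm M s) (zz M s) (inp M s x))).
pose (q := fun (M : pvm) (c s x : M) => ite (ph M s = mZ)
   (ite (gm M s = ozero M) (b2 M) (oadd (B2 M) (q1 M (gm M s) (zz M s) x)))
   (q2 M (gm M s) (zz M s) (inp M s x))).
pose (N := fun (M : pvm) (c s x : M) => ite (ph M s = mZ)
   (ite (gm M s = ozero M) (mk M one (b2 M) (i2 M (pair x (p1 M (zz M s) x))) (zz M s))
      (mk M mZ (q1 M (gm M s) (zz M s) x) (N1 M (gm M s) (zz M s) x) mZ))
   (mk M one (q2 M (gm M s) (zz M s) (inp M s x)) (N2 M (gm M s) (zz M s) (inp M s x)) (z1 M s))).
exists (fun M => oadd (B2 M) (b1 M)), (fun M x => mk M mZ (b1 M) (i1 M x) mZ), G, q, N,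
  (fun M s x => pair (p1 M (z1 M s) x) (p2 M (zz M s) (inp M s x))).
split; first exact: std_add.
  split.
  - by fdt.
  - by rewrite /G; pdt.
  - by rewrite /q; fdt.
  - by rewrite /N; fdt.
  - by fdt.
move=> M x; have [h1 h2 h3] := H1 M x.
have dB2 := std_dom M sB2; have db1 := std_dom M sb1; have db2 := std_dom M sb2.
split.
- have [e1 e2 e3 e4] := mkE M mZ (b1 M) (i1 M x) mZ.
  by rewrite /G; left; rewrite e1 e2 e3.
- move=> g s dg nz [[e [dgm' [eg hG]]]|[e [dgm' [eg [hG1 hG2]]]]]; rewrite /q /N.
    rewrite !(iteT _ _ e); case: (pselect (gm M s = ozero M)) => g0.
      rewrite !(iteT _ _ g0); split=> //.
        by rewrite eg g0 oadd0r //; apply: olt_add1.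
      have [e1 e2 e3 e4] := mkE M one (b2 M) (i2 M (pair x (p1 M (zz M s) x))) (zz M s).
      right; rewrite e1 e2 e3 e4; rewrite g0 in hG; do 4 split=> //.
      by rewrite /inp e4; have [] := H2 M (pair x (p1 M (zz M s) x)).
    rewrite !(iteF _ _ g0); have [k1 k2 k3] := h2 _ _ dgm' g0 hG; split=> //.
    + exact: dom_oadd.
    + by rewrite eg; apply: oadd_lt.
    + have [e1 e2 e3 e4] := mkE M mZ (q1 M (gm M s) (zz M s) x) (N1 M (gm M s) (zz M s) x) mZ.
      by left; rewrite e1 e2 e3.
  have ne : ph M s <> mZ by rewrite e; exact: one_nz.
  rewrite !(iteF _ _ ne); rewrite eg in nz.
  have [_ k2 _] := H2 M (inp M s x); have [l1 l2 l3] := k2 _ _ dgm' nz hG2; split=> //.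
    by rewrite eg.
  have [e1 e2 e3 e4] := mkE M one (q2 M (gm M s) (zz M s) (inp M s x)) (N2 M (gm M s) (zz M s) (inp M s x)) (z1 M s).
  by right; rewrite e1 e2 e3 e4 /inp e4.
- move=> s [[e [dgm' [eg hG]]]|[e [dgm' [eg [hG1 hG2]]]]].
    exfalso; have : ole (B2 M) (ozero M) by rewrite eg; apply: ole_addr.
    case; first by apply: olt0.
    exact: oadd1_nz.
  rewrite pfstE psndE; split; first exact: h3.
  by rewrite -eg in hG2; have [_ _] := H2 M (inp M s x); apply.
Qed.

Definition K (M : pvm) := forall A, rel2 A -> sLS A -> forall x : M, exists y, A M x y.

(** * Answering a straight-line program by local search *)

Section TableSearch.
Variables (I : Type) (key : I -> nat) (A : I -> R2).
Hypothesis sA : forall i, sLS (A i).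

(* [p] is the pair of the input and the current table. *)
Fixpoint tabs (qs : seq (I * F2)) : R2 := fun M p W' =>
  if qs is ih :: qs then
    let q := qkey key ih (pfst p) (psnd p) in
    exists v, [/\ reg (psnd p) q -> v = look (psnd p) q,
      ~ reg (psnd p) q -> A ih.1 (ih.2 M (pfst p) (psnd p)) v &
      tabs qs (pair (pfst p) (push q v mZ (psnd p))) W']
  else W' = psnd p.

Lemma sLS_tabs qs : qsdef qs -> sLS (tabs qs).
Proof.
elim: qs => [|ih qs IH] d; first by apply: (sLS_triv (p := psnd)) => //; fdt.
have dh := d ih (or_introl erefl).
have {}IH : sLS (tabs qs) by apply: IH => j ij; apply: d; right.
have dq : def1 (fun M p => qkey key ih (pfst p) (psnd p)) by rewrite /qkey; fdt.
pose A1 : R2 := fun M p v => [/\ reg (psnd p) (qkey key ih (pfst p) (psnd p)) ->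
    v = look (psnd p) (qkey key ih (pfst p) (psnd p)) &
   ~ reg (psnd p) (qkey key ih (pfst p) (psnd p)) -> A ih.1 (ih.2 M (pfst p) (psnd p)) v].
have s1 : sLS A1.
  have := sLS_pre (h := fun M p => ih.2 M (pfst p) (psnd p)) _ (sA ih.1).
  move=> /(_ ltac:(fdt)); apply: (sLS_post (p := fun M p v =>
    ite (reg (psnd p) (qkey key ih (pfst p) (psnd p)))
      (look (psnd p) (qkey key ih (pfst p) (psnd p))) v)).
    pose qk : F1 := fun M p => qkey key ih (pfst p) (psnd p).
    have dqk : def1 qk by [].
    rewrite -[def2 _]/(def2 (fun M p v => ite (reg (psnd p) (qk M p)) (look (psnd p) (qk M p)) v)).
    by fdt.
  by move=> M p v hA; split=> r; [rewrite iteT|rewrite iteF].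
pose qk : F1 := fun M p => qkey key ih (pfst p) (psnd p).
have dqk : def1 qk by [].
have s2 := sLS_pre (h := fun M pv => pair (pfst (pfst pv))
   (push (qk M (pfst pv)) (psnd pv) mZ (psnd (pfst pv)))) ltac:(fdt) IH.
apply: (sLS_post (p := fun M x u => psnd u)) (sLS_bind s1 s2); first by fdt.
move=> M x u [[h1 h2]]; rewrite !pfstE !psndE => h3.
by exists (pfst u); split.
Qed.

Definition tgood (is_ : seq I) (M : pvm) (W : M) := fits (look W) W /\
  forall i a, List.In i is_ -> reg W (pair (tag (key i) M) a) -> A i a (look W (pair (tag (key i) M) a)).

(** A repeated query gets its earlier answer, so the final table is the graph of a function and the
    run can be replayed with the oracle [look W']. Injectivity of [key] keeps the entries of
    different oracles apart. *)
Lemma tabs_good (is_ : seq I) qs :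
  (forall i j, List.In i is_ -> List.In j is_ -> key i = key j -> i = j) ->
  (forall ih, List.In ih qs -> List.In ih.1 is_) ->
  forall (M : pvm) (x W W' : M), tgood is_ W -> tabs qs (pair x W) W' ->
  [/\ tgood is_ W', forall q, reg W q -> reg W' q /\ look W' q = look W q & runs key (look W') qs x W W'].
Proof.
move=> kinj; elim: qs => [|ih qs IH] sub M x W W' [gW1 gW2].
  by rewrite /= psndE => ->; split.
rewrite /= pfstE psndE; set q := qkey _ _ _ _ => -[v [v1 v2 ht]].
have iin : List.In ih.1 is_ by apply: sub; left.
have lW q' : reg W q' -> look (push q v mZ W) q' = look W q' by move=> r; apply: look_push; left.
have vE : look (push q v mZ W) q = v.
  by case: (pselect (reg W q)) => r; [rewrite lW // v1|rewrite look_push_new].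
have [||gW' lW' rn] := IH _ M x (push q v mZ W) W' _ ht.
- by move=> j ij; apply: sub; right.
- split.
    move=> u /suf_push[->|uW]; first by rewrite evlE ekeyE vE.
    by rewrite lW; [apply: gW1|apply/regP; exists u].
  move=> i a ii /reg_push[r|e]; first by rewrite lW //; apply: gW2.
  case: (pselect (reg W q)) => r; first by rewrite -e lW // e; apply: gW2 => //; rewrite -e.
  have [/tag_inj/kinj ei ea] := pair_inj e; rewrite -e vE -ea -ei //.
  exact: v2.
have rp : reg (push q v mZ W) q by apply/reg_push; right.
split=> //.
  move=> q' r; have [|r1 r2] := lW' q'; first by apply/reg_push; left.
  by split=> //; rewrite r2 lW.
exists mZ; rewrite -/q; have [_ ->] := lW' q rp; by rewrite vE.
Qed.
End TableSearch.

(** In a model of PV with arbitrary functions as oracles, either some oracle gives a wrong answer or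
    the model is in [K] and [B] has a solution. Herbrand's theorem confines the witnesses to
    finitely many terms; if their queries are answered correctly by search, only the case of a
    solution remains. *)
Lemma K_sLS (B : R2) : rel2 B -> (forall M : pvm, K M -> forall x : M, exists y, B M x y) -> sLS B.
Proof.
move=> [bf qb bE] HK.
pose RA (A : pvform 2) : R2 := fun M x y => sat (M := M) A (scons x (scons y (@env0 M))).
have eta2 T (x : 'I_2 -> T) : scons (x (v0 _)) (scons (x (v1 _)) (@env0 _)) = x.
  by rewrite -[RHS]scons_eta; congr scons; rewrite -[RHS]scons_eta; congr scons; apply: env0E.
have bE' (M : pvm) (x y : M) : RA bf M x y <-> B M x y by rewrite /RA bE !scE.
pose I := {A : pvform 2 | qf A /\ sLS (RA A)}.
pose S := osym pvsym I.
pose sw : 'I_2 -> term S 2 := tnth [tuple tvar ord_max; tvar ord0].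
pose psi (j : option I) : formula S 2 :=
  if j is Some i then fneg (fsubst (fmap (@o_base pvsym I) (sval i))
     (tnth [tuple tvar ord0; app1 (o_orc i) (tvar ord0)]))
  else fsubst (fmap (@o_base pvsym I) bf) sw.
have psiN (M : pvm) f (x y : M) : sat (M := ostruct f) (psi None) (tnth [tuple y; x]) <-> B M x y.
  rewrite -bE' /psi sat_fsubst /sw tnth_comp2 sat_obase /RA -tnth2E.
  by rewrite -[ev _ (tvar ord_max)]/x.
have psiS (M : pvm) f (x y : M) i : sat (M := ostruct f) (psi (Some i)) (tnth [tuple y; x]) <->
    ~ RA (sval i) M y (f i y).
  rewrite /psi sat_neg sat_fsubst tnth_comp2 sat_obase /RA -tnth2E.
  by rewrite -[ev _ (tvar ord0)]/y -[ev _ (app1 _ _)]/(f i y).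
have [||l Hl] := @herbrand pvsym I (option I) PV psi PV_universal.
- by case=> [i|]; rewrite /psi; [split=> //|]; apply: qf_fsubst; apply/qf_fmap => //; case: (svalP i).
- move=> M f x MP; pose M' := Pvm MP.
  case: (pselect (exists i y, ~ RA (sval i) M' y (f i y))) => [[i [y h]]|nv].
    by exists (Some i), y; apply/(psiS M').
  have [|y By] := HK M' _ x; last by exists None, y; apply/(psiN M').
  move=> A [af qa aE] sA' a.
  have e : RA af = A.
    apply: functional_extensionality_dep => N; apply/funext => u; apply/funext => w; apply/propext.
    by rewrite /RA aE !scE.
  have si : qf af /\ sLS (RA af) by rewrite e.
  exists (f (exist _ af si) a); rewrite -e; apply: contrapT => h.
  by apply: nv; exists (exist _ af si), a.
pose AI (i : I) := RA (sval i).
(* The terms are evaluated one after the other. A term accusing oracle [i] is followed by a query to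
   [i] at its value, whose correct answer refutes the accusation; a term proposed for [B] is tested
   directly. *)
have [qs [p [dqs dp Hp]]] : exists (qs : seq (I * F2)) (p : F2), [/\ qsdef qs, def2 p &
   forall key (M : pvm) (F : M -> M) x W W', runs key F qs x W W' ->
   (forall i a, List.In i (map fst qs) -> reg W' (pair (tag (key i) M) a) -> AI i M a (orc key F i a)) ->
   (exists2 jt, List.In jt l & sat (M := ostruct (orc key F)) (psi jt.1)
      (tnth [tuple ev (M := ostruct (orc key F)) (fun _ => x) jt.2; x])) -> B M x (p M x W')].
  elim: l {Hl} => [|[j t] l [qs [p [dqs dp IH]]]].
    by exists [::], (fun M x W => x); split=> //; [fdt|move=> ? ? ? ? ? ? _ _ [jt []]].
  have [qt [g [dqt dg E]]] := compile t.
  case: j => [i|].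
    exists (qt ++ [:: (i, g)] ++ qs), p; split=> //.
      by apply: qsdef_cat => //; apply: qsdef_cat => // ih [<-|[]].
    move=> key M F x W W' /runs_cat[W1 r1 /runs_cat[W2 [e r2] r3]] hA [jt [<-|ij]] sj; last first.
      apply: (IH key M F x W2 W' r3); last by exists jt.
      by move=> i' a ii; apply: hA; rewrite map_cat; apply/List.in_app_iff; right; right.
    have /(psiS M (orc key F) x _ i) h := sj; rewrite (E _ _ _ _ _ _ r1) in h; case: h; apply: hA.
      by rewrite map_cat; apply/List.in_app_iff; right; left.
    apply: (runs_reg r3); rewrite r2; apply/reg_push; by right.
  exists (qt ++ qs), (fun M x W => ite (B M x (g M x (iter (size qs) (@psnd M) W)))
     (g M x (iter (size qs) (@psnd M) W)) (p M x W)); split.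
  - exact: qsdef_cat.
  - have d1 := def_iter_psnd (size qs); pose dr : F1 := fun M => iter (size qs) (@psnd M).
    have ddr : def1 dr by [].
    have dB : rel2 B by exists bf.
    rewrite -[def2 _]/(def2 (fun M x W => ite (B M x (g M x (dr M W))) (g M x (dr M W)) (p M x W))).
    by fdt.
  - move=> key M F x W W' /runs_cat[W1 r1 r2] hA ex.
    rewrite (runs_drop r2); case: (pselect (B M x (g M x W1))) => hB; first by rewrite iteT.
    rewrite iteF //; apply: (IH key M F x W1 W' r2).
      by move=> i' a ii; apply: hA; rewrite map_cat; apply/List.in_app_iff; right.
    case: ex => jt [<-|ij]; last by exists jt.
    by move=> /(psiN M (orc key F) x); rewrite /= (E _ _ _ _ _ _ r1).
(* The oracles are indexed by an arbitrary type; only those that are actually queried get numerical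
   keys, by their position in the program. *)
pose is_ : seq {classic I} := map fst qs.
pose key (i : I) : nat := index (i : {classic I}) is_.
have inE (i : I) (s : seq {classic I}) : List.In i s -> (i : {classic I}) \in s.
  by elim: s => //= j s IHs [->|/IHs]; rewrite inE ?eqxx // => ->; rewrite orbT.
have s0 := sLS_tabs key (A := AI) (fun i => proj2 (svalP i)) dqs.
have s1 := sLS_pre (h := fun M x => pair x mZ) ltac:(fdt) s0.
apply: (sLS_post dp _ s1) => M x W' ht.
have [|||[g1 g2] _ rn] := @tabs_good I key AI is_ qs _ _ M x mZ W' _ ht.
- move=> i j /inE ii /inE ij e.
  by rewrite -[LHS](nth_index (i : {classic I}) ii) -/(key i) e nth_index.
- by move=> ih iih; apply: List.in_map.
- by split=> [|i a _ /reg0 //]; exact: fits0.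
have := Hp key M (look W') x mZ W' rn; apply.
  by move=> i a ii r; apply: g2.
exact: (Hl M (orc key (look W')) x (pvmP (p := M))).
Qed.

(* One step of the outer search is an LS problem of ordinal [b1]; the product
   [(b1 + 1) . g + d] counts the inner steps of all the outer ones. *)
Lemma K_search (G : R3) (C : R2) (g0 : cst) : rel3 G -> rel2 C -> std g0 ->
  (forall M : pvm, K M -> forall g z x : M, odom g -> G M g z x ->
     (exists c, C M x c) \/ exists g' z', [/\ odom g', olt g' g & G M g' z' x]) ->
  forall M : pvm, K M -> forall g z x : M, odom g -> ole g (g0 M) -> G M g z x -> exists c, C M x c.
Proof.
move=> dG dC sg0 HK.
pose tg (M : pvm) (u : M) := pfst u.
pose tz (M : pvm) (u : M) := pfst (psnd u).
pose tx (M : pvm) (u : M) := psnd (psnd u).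
have dtg : def1 tg by rewrite /tg; fdt.
have dtz : def1 tz by rewrite /tz; fdt.
have dtx : def1 tx by rewrite /tx; fdt.
pose tri (M : pvm) (g z x : M) := pair g (pair z x).
have dtri : def3 tri by rewrite /tri; fdt.
have triE (M : pvm) (g z x : M) : [/\ tg M (tri M g z x) = g, tz M (tri M g z x) = z & tx M (tri M g z x) = x].
  by rewrite /tg /tz /tx /tri !(psndE, pfstE).
(* One step of the outer search as a search problem: the first component of the answer distinguishes
   a solution, marked [mZ], from a next state. The premises make it total, so [K_sLS] applies. *)
pose (R := (fun (M : pvm) (u y : M) => odom (tg M u) -> G M (tg M u) (tz M u) (tx M u) ->
  (pfst y = mZ /\ C M (tx M u) (psnd y)) \/
  (pfst y <> mZ /\ odom (tg M (psnd y)) /\ olt (tg M (psnd y)) (tg M u) /\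
    G M (tg M (psnd y)) (tz M (psnd y)) (tx M u))) : R2).
have dR : rel2 R by rewrite /R; pdt.
have [|b1 [i1 [G1 [q1 [N1 [p1 [sb1 [di1 dG1 dq1 dN1 dp1] H1]]]]]]] := K_sLS dR.
  move=> M KM u; rewrite /R; case: (pselect (odom (tg M u) /\ G M (tg M u) (tz M u) (tx M u))) => [[h1 h2]|h];
    last by exists mZ => h1 h2; case: h.
  have [[c hc]|[g' [z' [dg' lg' hG]]]] := HK M KM _ _ _ h1 h2.
    by exists (pair mZ c) => _ _; left; rewrite pfstE psndE.
  exists (pair one (tri M g' z' mZ)) => _ _; right; rewrite pfstE psndE.
  by have [-> -> _] := triE M g' z' mZ; split; [exact: one_nz|].
pose (B1 := (fun M => oadd (b1 M) (oone M)) : cst).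
have sB1 : std B1 by apply: std_add => //; exact: std1.
(* The summand [oone] on the left keeps all running states above [ozero], which is left for the
   finished phase. The factor [g0 + 1] puts the initial phase above all states with [g] up to
   [g0]. *)
pose (top := (fun M => oadd (oone M) (omul (B1 M) (oadd (g0 M) (oone M)))) : cst).
have stop : std top by apply: std_add; [exact: std1|apply: std_mul => //; apply: std_add => //; exact: std1].
pose (hyp := fun (M : pvm) (u : M) => odom (tg M u) /\ ole (tg M u) (g0 M) /\ G M (tg M u) (tz M u) (tx M u)).
have dhyp : rel1 hyp by rewrite /hyp; pdt.
pose (Q := (fun (M : pvm) (u c : M) => hyp M u -> C M (tx M u) c) : R2).
have dQ : rel2 Q by rewrite /Q; pdt.
suff sQ : sLS Q.
  move=> M KM g z x dg lg hG; have [c] := KM Q dQ sQ (tri M g z x).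
  have [e1 e2 e3] := triE M g z x; rewrite /Q /hyp e1 e2 e3 => hc; exists c; exact: hc.
pose ph (M : pvm) (s : M) := pfst s.
pose gg (M : pvm) (s : M) := pfst (psnd s).
pose zz (M : pvm) (s : M) := pfst (psnd (psnd s)).
pose dd (M : pvm) (s : M) := pfst (psnd (psnd (psnd s))).
pose ss (M : pvm) (s : M) := psnd (psnd (psnd (psnd s))).
have dph : def1 ph by rewrite /ph; fdt.
have dgg : def1 gg by rewrite /gg; fdt.
have dzz : def1 zz by rewrite /zz; fdt.
have ddd : def1 dd by rewrite /dd; fdt.
have dss : def1 ss by rewrite /ss; fdt.
pose run (M : pvm) (g z d s : M) := pair one (pair g (pair z (pair d s))).
have drun : def4 run by rewrite /run; fdt.
have runE (M : pvm) (g z d s : M) : [/\ ph M (run M g z d s) = one, gg M (run M g z d s) = g,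
  zz M (run M g z d s) = z, dd M (run M g z d s) = d & ss M (run M g z d s) = s].
  by rewrite /ph /gg /zz /dd /ss /run !(psndE, pfstE).
pose fin (M : pvm) (c : M) := pair (mS true one) c.
have dfin : def1 fin by rewrite /fin; fdt.
pose (ordv := fun (M : pvm) (g d : M) => oadd (oone M) (oadd (omul (B1 M) g) d)).
have dordv : def2 ordv by rewrite /ordv; fdt.
pose (inp := fun (M : pvm) (s u : M) => tri M (gg M s) (zz M s) (tx M u)).
have dinp : def2 inp by rewrite /inp; fdt.
pose (Gt := fun (M : pvm) (c s u : M) => hyp M u ->
  (ph M s = mZ /\ c = top M) \/
  (ph M s = mS true one /\ c = ozero M /\ C M (tx M u) (psnd s)) \/
  (ph M s = one /\ odom (gg M s) /\ odom (dd M s) /\ c = ordv M (gg M s) (dd M s) /\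
     G M (gg M s) (zz M s) (tx M u) /\ G1 M (dd M s) (ss M s) (inp M s u))).
pose (yy := fun (M : pvm) (s u : M) => p1 M (ss M s) (inp M s u)).
have dyy : def2 yy by rewrite /yy; fdt.
pose (q := fun (M : pvm) (c s u : M) => ite (hyp M u)
  (ite (ph M s = mZ) (ordv M (tg M u) (b1 M))
    (ite (dd M s <> ozero M) (ordv M (gg M s) (q1 M (dd M s) (ss M s) (inp M s u)))
      (ite (pfst (yy M s u) = mZ) (ozero M) (ordv M (tg M (psnd (yy M s u))) (b1 M)))))
  (ozero M)).
pose (N := fun (M : pvm) (c s u : M) =>
  (ite (ph M s = mZ) (run M (tg M u) (tz M u) (b1 M) (i1 M (tri M (tg M u) (tz M u) (tx M u))))
    (ite (dd M s <> ozero M) (run M (gg M s) (zz M s) (q1 M (dd M s) (ss M s) (inp M s u))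
         (N1 M (dd M s) (ss M s) (inp M s u)))
      (ite (pfst (yy M s u) = mZ) (fin M (psnd (yy M s u)))
        (run M (tg M (psnd (yy M s u))) (tz M (psnd (yy M s u))) (b1 M)
          (i1 M (tri M (tg M (psnd (yy M s u))) (tz M (psnd (yy M s u))) (tx M u)))))))).
exists top, (fun M u => mZ), Gt, q, N, (fun M s u => psnd s); split=> //.
  split.
  - by fdt.
  - by rewrite /Gt; pdt.
  - by rewrite /q; fdt.
  - by rewrite /N; fdt.
  - by fdt.
move=> M u; have d1 := @dom1 P M; have db1 := std_dom M sb1; have dB1 := std_dom M sB1.
have dg0 := std_dom M sg0; have dtop := std_dom M stop; have b1B1 : olt (b1 M) (B1 M) by apply: olt_add1.
have nB1 : B1 M <> ozero M by apply: oadd1_nz.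
have domv g d : odom g -> odom d -> odom (ordv M g d).
  by move=> hg hd; apply: dom_oadd => //; apply: dom_oadd => //; apply: dom_omul.
have nzv g d : odom g -> odom d -> ordv M g d <> ozero M.
  move=> hg hd e; have : ole (oone M) (ozero M).
    by rewrite -e; apply: ole_addr => //; apply: dom_oadd => //; apply: dom_omul.
  by case; [apply: olt0|apply: one_nz_o].
have n1 := @one_nz M.
have n2 : mS true (@one M) <> mZ by apply: S1nz.
have n12 : @one M <> mS true one by move=> /mS_inj[_ /esym].
split.
- by move=> hu; left; rewrite /ph pfst0.
- move=> c s dc nc hG; rewrite /q /N; case: (pselect (hyp M u)) => hu; last first.
    by rewrite iteF //; split=> //; [exact: dom0|exact: olt_nz].
  have [hu1 [hu2 hu3]] := hu; rewrite iteT //.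
  case: (hG hu) => [[e ec]|[[e [ec _]]|[e [hg [hd [ec [hG' hG1]]]]]]]; last first.
  + have np : ph M s <> mZ by rewrite e.
    rewrite !(iteF _ _ np); case: (pselect (dd M s <> ozero M)) => h0.
      rewrite !(iteT _ _ h0); have [_ k _] := H1 M (inp M s u); have [l1 l2 l3] := k _ _ hd h0 hG1.
      split; first exact: domv.
        rewrite ec; apply: oadd_lt => //; try by (apply: dom_oadd => //; apply: dom_omul).
        by apply: oadd_lt => //; apply: dom_omul.
      move=> _; right; right; set r := run M _ _ _ _.
      have [e1 e2 e3 e4 e5] := runE M (gg M s) (zz M s) (q1 M (dd M s) (ss M s) (inp M s u))
         (N1 M (dd M s) (ss M s) (inp M s u)).
      by rewrite /inp e1 e2 e3 e4 e5.
    rewrite !(iteF _ _ h0); move/contrapT: h0 => h0; rewrite h0 in hG1 ec.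
    have [_ _ k] := H1 M (inp M s u); have := k _ hG1.
    have [t1 t2 t3] := triE M (gg M s) (zz M s) (tx M u).
    rewrite /R /inp t1 t2 t3 => /(_ hg hG'); rewrite -/(inp M s u) -/(yy M s u).
    case=> [[y0 yC]|[y1 [y2 [y3 y4]]]].
      rewrite !(iteT _ _ y0); split; [exact: dom0|by apply: olt_nz|].
      by move=> _; right; left; rewrite /ph /fin pfstE psndE.
    rewrite !(iteF _ _ y1); split; first exact: domv.
      rewrite ec; have hm := dom_omul dB1 hg; apply: oadd_lt => //.
      - by apply: dom_oadd => //; apply: dom_omul.
      - by apply: dom_oadd => //; exact: dom0.
      - by rewrite oadd0r //; apply: omul_succ_lt.
    move=> _; right; right; set r := run M _ _ _ _.
    have [e1 e2 e3 e4 e5] := runE M (tg M (psnd (yy M s u))) (tz M (psnd (yy M s u))) (b1 M)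
          (i1 M (tri M (tg M (psnd (yy M s u))) (tz M (psnd (yy M s u))) (tx M u))).
    rewrite /inp e1 e2 e3 e4 e5; do 5 split=> //.
    by have [] := H1 M (tri M (tg M (psnd (yy M s u))) (tz M (psnd (yy M s u))) (tx M u)).
  + by rewrite ec in nc.
  + rewrite !(iteT _ _ e); split; first exact: domv.
      rewrite ec; have hg1 := dom_oadd dg0 d1; apply: oadd_lt => //.
      - by apply: dom_oadd => //; apply: dom_omul.
      - exact: dom_omul.
      - apply: omul_succ_lt => //; apply: ole_lt_tr hu2 _ => //; exact: olt_add1.
    move=> _; right; right.
    have [e1 e2 e3 e4 e5] := runE M (tg M u) (tz M u) (b1 M) (i1 M (tri M (tg M u) (tz M u) (tx M u))).
    rewrite /inp e1 e2 e3 e4 e5; do 5 split=> //.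
    by have [] := H1 M (tri M (tg M u) (tz M u) (tx M u)).
- move=> s hG hu; case: (hG hu) => [[e ec]|[[e [ec hc //]]|[e [hg [hd [ec _]]]]]].
    exfalso; move: ec; rewrite /top => ec.
    have hm : odom (omul (B1 M) (oadd (g0 M) (oone M))) by apply: dom_omul => //; apply: dom_oadd.
    have : ole (oone M) (ozero M) by rewrite ec; apply: ole_addr.
    by case; [apply: olt0|apply: one_nz_o].
  by case: (nzv _ _ hg hd).
Qed.
End LocalSearchClass.

(** * Primitive recursion in the models in [K] *)

(** Both arguments are built up from their leading digits at once. The pair [d] is a common bound on
    their lengths, and the shorter argument is padded by leading zeros, as [mS false mZ = mZ]. *)
Lemma dind (P : R2) : rel2 P -> forall M : pvm, P M mZ mZ ->
  (forall i j a b, P M a b -> P M (mS i a) (mS j b)) -> forall a b, P M a b.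
Proof.
move=> dP M P0 PS a b; pose d := pair a b.
have ad : ple a d by apply: ple_pair.
have bd : ple b d.
  have := psnd_ple (@pair_nz M a b); rewrite psndE => h.
  by apply: ple_trans h _; apply: ple_half; apply: ple_xx.
have := @rind1 (fun M c p => P M (msp (pfst p) (msp p c)) (msp (psnd p) (msp p c))) _ M d _ _ d.
rewrite /d pfstE psndE msp_xx !msp0; apply; first by pdt.
  by rewrite ad bd.
move=> c i IH; case: (pselect (mS i c = mZ)) => [e|nz].
  by have [_ cc] := S0nz e; rewrite e; rewrite cc in IH.
have [[e1 e2]|[e [n1 e1 e2 e3]]] := msp_step d nz; first by rewrite e2; rewrite e1 in IH.
rewrite e1; rewrite -!e3 in IH.
have [i1 [u eu]] := caseS (msp a e); have [i2 [w ew]] := caseS (msp b e).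
by rewrite eu ew in IH *; rewrite !halfS in IH; apply: PS.
Qed.

Definition madd (M : pvm) (a b : M) := ap2 pv_add a b.
Lemma def_madd : def2 madd. Proof. exact: def_ap2. Qed.
#[export] Hint Resolve def_madd : fdb.

Lemma madd_succ (M : pvm) (a b : M) :
  madd a (msucc b) = msucc (madd a b) /\ madd (msucc a) b = msucc (madd a b).
Proof.
move: a b; apply: (@dind (fun M a b => madd a (msucc b) = msucc (madd a b) /\
  madd (msucc a) b = msucc (madd a b)) _ M); first by pdt.
  have e : msucc (mZ : M) = mS true mZ by rewrite -{1}S00 succ0.
  by split; [rewrite /madd ax_add0 add0l|rewrite /madd !ax_add0].
move=> i j a b [IH1 IH2]; rewrite /madd in IH1 IH2 *.
by case: i; case: j; rewrite ?succ0 ?succ1 ?ax_addS /= ?succ0 ?succ1 ?IH1 ?IH2 ?succ0 ?succ1.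
Qed.

Section Kdefinable.
Context {P : ptrep}.

(** In the models in [K] the graph is an open relation up to a witness; elsewhere [F] is arbitrary.
    Values can thus be carried in the state of a search together with their witnesses, and
    [K_search] can argue about functions that are not polynomial-time. *)
Definition Kdef (F : F1) := exists2 H : R3, rel3 H &
  forall M : pvm, K M -> forall x r : M, (exists w, H M w r x) <-> r = F M x.

Lemma Kdef_pure F : def1 F -> Kdef F.
Proof.
move=> dF; exists (fun M w r x => r = F M x); first by pdt.
by move=> M _ x r; split=> [[]//|->]; exists mZ.
Qed.

Lemma Kdef_comp F G : Kdef F -> Kdef G -> Kdef (fun M x => F M (G M x)).
Proof.
move=> [H dH HE] [H' dH' HE'].
exists (fun M w r x => H' M (pfst w) (pfst (psnd w)) x /\ H M (psnd (psnd w)) r (pfst (psnd w))).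
  by pdt.
move=> M KM x r; split=> [[w [h1 h2]]|e].
  have e1 : pfst (psnd w) = G M x by apply/(HE' M KM); exists (pfst w).
  by apply/(HE M KM); rewrite -e1; exists (psnd (psnd w)).
have [w1 h1] := proj2 (HE' M KM x (G M x)) erefl; have [w2 h2] := proj2 (HE M KM _ r) e.
by exists (pair w1 (pair (G M x) w2)); rewrite !(pfstE, psndE).
Qed.

Lemma Kdef_pair F G : Kdef F -> Kdef G -> Kdef (fun M x => pair (F M x) (G M x)).
Proof.
move=> [H dH HE] [H' dH' HE'].
exists (fun M w r x => r = pair (pfst r) (psnd r) /\ H M (pfst w) (pfst r) x /\ H' M (psnd w) (psnd r) x).
  by pdt.
move=> M KM x r; split=> [[w [e [h1 h2]]]|->].
  rewrite e; congr pair; [apply/(HE M KM)|apply/(HE' M KM)]; by [exists (pfst w)|exists (psnd w)].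
have [w1 h1] := proj2 (HE M KM x _) erefl; have [w2 h2] := proj2 (HE' M KM x _) erefl.
by exists (pair w1 w2); rewrite !(pfstE, psndE).
Qed.

Lemma Kdef_app2 (F : F2) G G' : def2 F -> Kdef G -> Kdef G' -> Kdef (fun M x => F M (G M x) (G' M x)).
Proof.
move=> dF kG kG'.
have := @Kdef_comp (fun M p => F M (pfst p) (psnd p)) _ (Kdef_pure _) (Kdef_pair kG kG').
move=> /(_ ltac:(fdt)) [H dH HE]; exists H => // M KM x r.
by rewrite HE // pfstE psndE.
Qed.

Section PrimRec.
Variables (F D : F1) (HF HD : R3).
Hypotheses (dHF : rel3 HF) (dHD : rel3 HD).
Hypothesis HFE : forall M : pvm, K M -> forall x r : M, (exists w, HF w r x) <-> r = F x.
Hypothesis HDE : forall M : pvm, K M -> forall x r : M, (exists w, HD w r x) <-> r = D x.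

(* A computation of the recursion is a table with keys the recursion
   arguments, values the values, and witnesses as extra components. *)
Definition rloc (M : pvm) (u X : M) :=
  (ekey u = mZ /\ HF (eex u) (evl u) X) \/
  (ekey u <> mZ /\ psnd u <> mZ /\ ekey (psnd u) = mpred (ekey u) /\
   HD (eex u) (evl u) (pair (mpred (ekey u)) (pair (evl (psnd u)) X))).
Lemma rel_rloc : rel2 rloc. Proof. by rewrite /rloc; pdt. Qed.

Definition rhist (M : pvm) (w r x : M) :=
  w <> mZ /\ allsuf rloc w (psnd x) /\ ekey w = pfst x /\ evl w = r.
Lemma rel_rhist : rel3 rhist. Proof. by have d := rel_rloc; rewrite /rhist; pdt. Qed.

(** Induction along one computation, whose entries are compared with all entries of the other.
    Quantifying these by [allsuf] keeps the induction formula open. *)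
Lemma rhist_uniq (M : pvm) (X w w' : M) : K M -> allsuf rloc w X -> allsuf rloc w' X ->
  forall u', suf u' w' -> w <> mZ -> ekey u' = ekey w -> evl u' = evl w.
Proof.
move=> KM; have d := rel_rloc.
pose Q : R2 := fun M u' w => w <> mZ -> ekey u' = ekey w -> evl u' = evl w.
have dQ : rel2 Q by rewrite /Q; pdt.
move: w; apply: (@list_ind2 (fun M w w' X => allsuf rloc w X -> allsuf rloc w' X -> allsuf Q w' w) _ M w' X).
- by pdt.
- by move=> _ _ u' _ /(_ erefl).
- move=> w nw IH hw hw' u' su' _ e.
  have lw := hw w (suf_refl nw); have lu := hw' u' su'.
  case: lw => [[k h]|[nk [np [k h]]]]; case: lu => [[k' h']|[nk' [np' [k' h']]]].
  + have -> : evl u' = F X by apply/(HFE KM); exists (eex u').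
    by symmetry; apply/(HFE KM); exists (eex w).
  + by rewrite e k in nk'.
  + by rewrite -e k' in nk.
  + have hp : evl (psnd u') = evl (psnd w).
      apply: IH => //.
      * by move=> v vw; apply: hw; apply/sufE => //; right.
      * exact: suf_tl.
      * by rewrite k k' e.
    have -> : evl u' = D (pair (mpred (ekey u')) (pair (evl (psnd u')) X)).
      by apply/(HDE KM); exists (eex u').
    by symmetry; apply/(HDE KM); exists (eex w); rewrite e hp.
Qed.

Lemma rhist_fun (M : pvm) (w w' r r' x : M) : K M -> rhist w r x -> rhist w' r' x -> r = r'.
Proof.
move=> KM [nw [h [k e]]] [nw' [h' [k' e']]]; rewrite -e -e'.
by apply: (rhist_uniq KM h' h) => //; [apply: suf_refl|rewrite k k'].
Qed.

Lemma rhist_ex (M : pvm) (x : M) : K M -> exists w r, rhist w r x.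
Proof.
have d := rel_rloc.
(* Existence of a computation is not an open statement, so it is obtained by a search below omega:
   [pfst z] counts the steps that are left, and [psnd z] is the computation so far. *)
pose (G := fun (M : pvm) (g z x : M) => g = onat (pfst z) /\ psnd z <> mZ /\ allsuf rloc (psnd z) (psnd x) /\
   madd (ekey (psnd z)) (pfst z) = pfst x).
pose C : R2 := fun M x w => w <> mZ /\ allsuf rloc w (psnd x) /\ ekey w = pfst x.
move=> KM; suff [w [h1 [h2 h3]]] : exists w, C M x w by exists w, (evl w).
have [w0 h0] := proj2 (HFE KM (psnd x) _) erefl.
pose w := push mZ (F (psnd x)) w0 mZ.
apply: (@K_search P G C oomega _ _ stdw _ M KM (onat (pfst x)) (pair (pfst x) w)).
- by rewrite /G; pdt.
- by rewrite /C; pdt.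
- move=> {KM h0 w0 w} {}M KM g z {}x dg [eg [nz [hz ez]]].
  case: (pselect (pfst z = mZ)) => c0.
    by left; exists (psnd z); split=> //; split=> //; rewrite -ez c0 /madd ax_add0.
  right; exists (onat (mpred (pfst z))).
  pose a := pair (ekey (psnd z)) (pair (evl (psnd z)) (psnd x)).
  have [w1 h1] := proj2 (HDE KM a _) erefl.
  exists (pair (mpred (pfst z)) (push (msucc (ekey (psnd z))) (D a) w1 (psnd z))); split.
  + exact: dom_onat.
  + by rewrite eg -{2}(succ_pred c0); apply: onat_succ.
  + rewrite /G pfstE psndE; split=> //; split; first exact: push_nz.
    split; last by rewrite ekeyE (proj2 (madd_succ _ _)) -(proj1 (madd_succ _ _)) succ_pred.
    move=> u /suf_push[->|]; last exact: hz.
    right; rewrite ekeyE evlE eexE psnd_push pred_succ; split=> //; exact: succ_nz.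
- exact: dom_onat.
- left; exact: onat_lt_w.
- rewrite /G pfstE psndE; split=> //; split; first exact: push_nz; split.
    move=> u /suf_push[->|/suf0//]; left.
    by rewrite ekeyE evlE eexE.
  by rewrite ekeyE /madd add0l.
Qed.
End PrimRec.

Definition rec_eqs (F D R : F1) := forall M : pvm, K M -> forall X : M,
  R M (pair mZ X) = F M X /\ forall y, R M (pair (msucc y) X) = D M (pair y (pair (R M (pair y X)) X)).

Lemma Kdef_rec F D : Kdef F -> Kdef D -> exists2 R, Kdef R & rec_eqs F D R.
Proof.
move=> [HF dHF HFE] [HD dHD HDE]; pose H := rhist HF HD.
have dH : rel3 H by apply: rel_rhist.
have ex (M : pvm) : {R : M -> M | K M -> forall x, exists w, H M w (R x) x}.
  (* [Kdef] constrains a function only in the models in [K]; elsewhere any value will do. *)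
  case: (pselect (K M)) => KM; last by exists id.
  have /choice[R RE] : forall x : M, exists r w, H M w r x.
    by move=> x; have [w [r h]] := rhist_ex dHF dHD HFE HDE x KM; exists r, w.
  by exists R.
pose R : F1 := fun M => sval (ex M).
have RE (M : pvm) : K M -> forall x, exists w, H M w (R M x) x by rewrite /R; case: (ex M).
have RU (M : pvm) : K M -> forall w r x, H M w r x -> r = R M x.
  by move=> KM w r x h; have [w' h'] := RE M KM x; apply: (rhist_fun dHF dHD HFE HDE KM h h').
exists R.
  exists H => // M KM x r; split=> [[w h]|->]; last exact: RE.
  exact: RU h.
move=> M KM X; split=> [|y].
  have [w0 h0] := proj2 (HFE M KM X _) erefl.
  symmetry; apply: (RU M KM (push mZ (F M X) w0 mZ)); rewrite /H /rhist pfstE psndE ekeyE evlE.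
  split; first exact: push_nz; split=> //.
  by move=> u /suf_push[->|/suf0//]; left; rewrite ekeyE evlE eexE.
have [w [nw [hw [kw ew]]]] := RE M KM (pair y X); rewrite pfstE psndE in hw kw.
have [w1 h1] := proj2 (HDE M KM (pair y (pair (R M (pair y X)) X)) _) erefl.
symmetry; apply: (RU M KM (push (msucc y) (D M (pair y (pair (R M (pair y X)) X))) w1 w)).
rewrite /H /rhist pfstE psndE ekeyE evlE; split; first exact: push_nz; split=> //.
move=> u /suf_push[->|]; last exact: hw.
right; rewrite ekeyE evlE eexE psnd_push pred_succ ew; split=> //; exact: succ_nz.
Qed.

(** ** Models of PRA *)

Fixpoint enc n (M : pvm) : ('I_n -> M) -> M :=
  match n with
  | 0 => fun _ => mZ
  | m.+1 => fun x => pair (x ord0) (enc (fun i => x (lift ord0 i)))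
  end.

Lemma enc_scons n (M : pvm) (a : M) (x : 'I_n -> M) : enc (scons a x) = pair a (enc x).
Proof. by rewrite /= scons0; congr pair; congr enc; apply/funext => i; rewrite sconsS. Qed.

Fixpoint prj n : 'I_n -> F1 :=
  match n with
  | 0 => fun _ M p => p
  | m.+1 => fun i M p => if unlift ord0 i is Some j then prj j (psnd p) else pfst p
  end.

Lemma prjE n (M : pvm) (x : 'I_n -> M) i : prj i (enc x) = x i.
Proof.
elim: n x i => [|n IH] x i; first by case: i.
by rewrite /=; case: unliftP => [j|] -> /=; rewrite ?psndE ?pfstE // IH.
Qed.

Lemma def_prj n (i : 'I_n) : def1 (prj i).
Proof.
elim: n i => [|n IH] i; first by case: i.
rewrite /=; case: (unlift ord0 i) => [j|]; last by fdt.
by have d := IH j; fdt.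
Qed.

Lemma fd_enc m n (G : 'I_n -> Fn m) : (forall i, fd (G i)) -> @fd m (fun M x => enc (fun i => G i M x)).
Proof.
elim: n G => [|n IH] G dG /=; first by fdt.
by apply: (@fd_app2 _ pair); [exact: def_pair|exact: dG|apply: (IH (fun i => G (lift ord0 i)))].
Qed.

Lemma Kdef_enc n (G : 'I_n -> F1) : (forall i, Kdef (G i)) -> Kdef (fun M p => enc (fun i => G i M p)).
Proof.
elim: n G => [|n IH] G kG /=; first by apply: Kdef_pure; fdt.
by apply: Kdef_pair => //; apply: IH.
Qed.

(** The interpretation [pri] has to be a total definition before its values are known to be [Kdef].
    So a solution of the recursion equations is chosen if there is one, with the identity as
    default. *)
Definition prim (F D : F1) : F1 :=
  if pselect (exists R, Kdef R /\ rec_eqs F D R) is left h then sval (cid h) else fun M x => x.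

Lemma primP F D : Kdef F -> Kdef D -> Kdef (prim F D) /\ rec_eqs F D (prim F D).
Proof.
move=> kF kD; rewrite /prim; case: pselect => [h|nh]; first by case: cid.
by case: nh; have [R kR e] := Kdef_rec kF kD; exists R.
Qed.

Fixpoint pri n (f : prsym n) : F1 :=
  match f with
  | pr_pv _ f => fun M p => sapp f (fun i => prj i p)
  | pr_comp _ _ f g => fun M p => pri f (enc (fun j => pri (g j) p))
  | pr_rec _ g h => prim (pri g) (pri h)
  end.

Lemma Kdef_pri n (f : prsym n) : Kdef (pri f).
Proof.
elim: f => {n} [n f|n k f IHf g IHg|n g IHg h IHh] /=.
- apply: Kdef_pure; have /choice[tt ttE] := @def_prj n.
  by exists (tapp f tt) => M x /=; congr sapp; apply/funext => j; rewrite ttE.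
- by apply: (@Kdef_comp (pri f)) => //; apply: Kdef_enc.
- by have [] := primP IHg IHh.
Qed.

Definition prS (M : pvm) : struct prsym := @Struct prsym M (fun n f x => pri f (enc x)).

Lemma struct_ext S (M : struct S) (a : forall k, S k -> ('I_k -> M) -> M) :
  (forall k f x, a k f x = sapp f x) ->
  forall n, (forall (A : formula S n) x, sat (M := @Struct S M a) A x <-> sat (M := M) A x) /\
    (forall (t : term S n) (x : 'I_n -> M), ev (M := @Struct S M a) x t = ev (M := M) x t).
Proof.
move=> e n; have -> : a = @sapp S M.
  apply: functional_extensionality_dep => k; apply/funext => f; apply/funext => x; exact: e.
by case: M {a e}.
Qed.

Section PRstructure.
Variable M : pvm.

Lemma pr_red k (f : pvsym k) (x : 'I_k -> M) : sapp (s := reduct pr_pv (prS M)) f x = sapp (s := M) f x.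
Proof. by rewrite /=; congr sapp; apply/funext => i; rewrite prjE. Qed.

Lemma sat_pr n (A : pvform n) (x : 'I_n -> M) : sat (M := prS M) (fmap pr_pv A) x <-> sat (M := M) A x.
Proof. by rewrite sat_fmap; exact: (proj1 (struct_ext pr_red n)). Qed.

Lemma ev_pr n (t : pvterm n) (x : 'I_n -> M) : ev (M := prS M) x (tmap pr_pv t) = ev (M := M) x t.
Proof. by rewrite ev_tmap; exact: (proj2 (struct_ext pr_red n)). Qed.
End PRstructure.

Lemma Kdef_term n (t : prterm n) : exists2 F : F1, Kdef F &
  forall (M : pvm) (x : 'I_n -> M), ev (M := prS M) x t = F M (enc x).
Proof.
elim: t => [i|k f ts IH].
  exists (prj i); first by apply: Kdef_pure; apply: def_prj.
  by move=> M x; rewrite prjE.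
have /choice[G GE] : forall j, exists F : F1, Kdef F /\
    forall (M : pvm) (x : 'I_n -> M), ev (M := prS M) x (ts j) = F M (enc x).
  by move=> j; have [F] := IH j; exists F.
exists (fun M p => pri f (enc (fun j => G j M p))).
  by apply: (@Kdef_comp (pri f)); [apply: Kdef_pri|apply: Kdef_enc => j; case: (GE j)].
move=> M x /=; congr (pri f (enc _)); apply/funext => j; by have [_ ->] := GE j.
Qed.

Lemma Kdef_form n (A : prform n) : qf A -> exists2 F : F1, Kdef F &
  forall (M : pvm) (x : 'I_n -> M), sat (M := prS M) A x <-> F M (enc x) = mZ.
Proof.
elim: A => {n} [n|n t u|n A IA B IB|//] /= qA.
- exists (fun M _ => one); first by apply: Kdef_pure; fdt.
  by move=> M x; split=> // /one_nz.
- have [F kF FE] := Kdef_term t; have [G kG GE] := Kdef_term u.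
  exists (fun M p => eqt (F M p) (G M p)); first by apply: (@Kdef_app2 eqt) => //; exact: def_eqt.
  by move=> M x; rewrite FE GE eqtP.
- have [F kF FE] := IA (proj1 qA); have [G kG GE] := IB (proj2 qA).
  exists (fun M p => cond (F M p) (G M p) mZ).
    apply: (@Kdef_app2 (fun M a b => cond a b mZ)) => //; by fdt.
  move=> M x; rewrite FE GE; case: (pselect (F M (enc x) = mZ)) => [e|n']; rewrite ?e ?cond0 ?cond1 //.
  by split=> // h; apply: h.
Qed.

Definition Kvalid n (A : prform n) := forall M : pvm, K M -> forall x, sat (M := prS M) A x.

Lemma Kvalid_prov (T : prform 0 -> Prop) n (A : prform n) : (forall B, T B -> Kvalid B) ->
  T |- A -> Kvalid A.
Proof.
move=> TK d M KM x; apply: (prov_sound (C := fun N => exists2 M, N = prS M & K M) _ d) => //; last by exists M.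
by move=> B TB N [M' -> KM'] y; apply: TK.
Qed.

Lemma prZ (M : pvm) n (x : 'I_n -> M) : ev (M := prS M) x (app0 n (pr_pv pv_zero)) = mZ.
Proof. by rewrite /= /mZ; congr sapp; apply: env0E. Qed.

Lemma ev_app1 S (M : struct S) n (x : 'I_n -> M) (f : S 1) t :
  ev x (app1 f t) = sapp f (scons (ev x t) (@env0 M)).
Proof. by rewrite -tnth1E -(tnth_comp1 (ev x)). Qed.

Lemma prsucc (M : pvm) n (x : 'I_n -> M) t :
  ev (M := prS M) x (app1 (pr_pv pv_succ) t) = msucc (ev (M := prS M) x t).
Proof.
by rewrite ev_app1; exact: (@pr_red M).
Qed.

Lemma Kvalid_rec0 n k (g : prsym k) h (ts : 'I_k -> prterm n) (M : pvm) : K M -> forall x : 'I_n -> M,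
  sat (M := prS M) (feq (tapp (pr_rec g h) (scons (app0 n (pr_pv pv_zero)) ts)) (tapp g ts)) x.
Proof.
move=> KM x; cbn [sat]; cbn [ev]; rewrite (scons_comp (ev _)) prZ -!/(prS M) /= -/(enc (scons mZ _)).
have [_ e] := primP (Kdef_pri g) (Kdef_pri h); have [e0 _] := e M KM (enc (fun i => ev (M := prS M) x (ts i))).
by rewrite -e0 -enc_scons.
Qed.

Lemma Kvalid_recS n k (g : prsym k) h (t : prterm n) (ts : 'I_k -> prterm n) (M : pvm) : K M ->
  forall x : 'I_n -> M,
  sat (M := prS M) (feq (tapp (pr_rec g h) (scons (app1 (pr_pv pv_succ) t) ts))
    (tapp h (scons t (scons (tapp (pr_rec g h) (scons t ts)) ts)))) x.
Proof.
move=> KM x; cbn [sat]; cbn [ev].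
have E u f : sapp (s := prS M) f (fun j => ev (M := prS M) x (scons u ts j)) =
   pri f (pair (ev (M := prS M) x u) (enc (fun i => ev (M := prS M) x (ts i)))).
  by rewrite (scons_comp (ev _)) -enc_scons.
rewrite !E prsucc !(scons_comp (ev _)).
have [_ e] := primP (Kdef_pri g) (Kdef_pri h); have [_ eS] := e M KM (enc (fun i => ev (M := prS M) x (ts i))).
rewrite [LHS]eS -[sapp _ _]/(pri h (enc _)) !enc_scons; cbn [ev].
by rewrite E.
Qed.

Lemma Kvalid_ind n (A : prform n.+1) : qf A -> Kvalid (inst A (app0 n (pr_pv pv_zero))) ->
  Kvalid (fimp A (inst_var A (app1 (pr_pv pv_succ) (tvar ord0)))) -> Kvalid (alls A).
Proof.
move=> qA b s M KM x; apply/sat_alls => {x} x.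
have base (N : pvm) : K N -> forall z, sat (M := prS N) A (scons mZ z).
  by move=> KN z; have := b N KN z; rewrite sat_inst prZ.
have step (N : pvm) : K N -> forall y z, sat (M := prS N) A (scons y z) -> sat (M := prS N) A (scons (msucc y) z).
  move=> KN y z; have := s N KN (scons y z) => /sat_imp; rewrite sat_inst_var prsucc.
  by cbn [ev]; rewrite scons0.
have [F kF FE] := Kdef_form qA; have [H dH HE] := kF.
apply: contrapT => nA; rewrite -(scons_eta x) FE enc_scons in nA.
pose ienc : F1 := fun M X => enc (fun i : 'I_n => prj i X).
have dienc : def1 ienc.
  by apply: (@fd_enc 1 n (fun i M x => prj i (x (v0 0)))) => i; apply: def_prj.
(* Descent from a counterexample: a state is an argument at which [A] fails, with the nonzero value
   of [F] and a witness for it, and a step goes to the predecessor. The search has no solutions, so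
   [K_search] gives a contradiction. The equation for [X] says that it codes a tuple, to which [FE]
   applies. *)
pose (G := fun (M : pvm) (g z X : M) => g = onat (pfst z) /\ X = ienc M X /\
   H M (psnd (psnd z)) (pfst (psnd z)) (pair (pfst z) X) /\ pfst (psnd z) <> mZ).
set y := x ord0 in nA; set X := enc _ in nA.
have [w hw] := proj2 (HE M KM (pair y X) _) erefl.
have [||||||c []] := @K_search P G (fun M _ _ => False) oomega _ _ stdw _ M KM (onat y) (pair y (pair (F M (pair y X)) w)) X.
- by rewrite /G; pdt.
- by pdt.
- move=> N KN g z Z dg [eg [eZ [h1 h2]]]; right.
  have e1 : pfst (psnd z) = F N (pair (pfst z) Z) by apply/(HE N KN); exists (psnd (psnd z)).
  rewrite e1 in h2; pose zz : 'I_n -> N := fun i => prj i Z.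
  have FE' a : F N (pair a Z) = mZ <-> sat (M := prS N) A (scons a zz).
    by rewrite FE enc_scons {1}eZ.
  case: (pselect (pfst z = mZ)) => c0.
    by exfalso; apply: h2; rewrite c0; apply/FE'; apply: base.
  have nf : F N (pair (mpred (pfst z)) Z) <> mZ.
    move=> /FE' h; apply: h2; apply/FE'; rewrite -(succ_pred c0); exact: step.
  have [w' hw'] := proj2 (HE N KN (pair (mpred (pfst z)) Z) _) erefl.
  exists (onat (mpred (pfst z))), (pair (mpred (pfst z)) (pair (F N (pair (mpred (pfst z)) Z)) w')); split.
  + exact: dom_onat.
  + by rewrite eg -{2}(succ_pred c0); apply: onat_succ.
  + by rewrite /G !(pfstE, psndE).
- exact: dom_onat.
- left; exact: onat_lt_w.
- rewrite /G !(pfstE, psndE); split; first by []. split; last by [].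
  by rewrite /ienc /X; congr enc; apply/funext => i; rewrite prjE.
Qed.

Fixpoint PRA_Kvalid A (d : PRA A) : Kvalid A :=
  match d with
  | PRA_PV A h => fun M _ x => proj2 (sat_pr A x) (pvmP (p := M) h x)
  | PRA_comp n k l f g ts => fun M _ x => proj2 (sat_alls (feq (tapp (pr_comp f g) ts)
        (tapp f (fun j => tapp (g j) ts))) x) (fun y => erefl)
  | PRA_rec0 n k g h ts => fun M KM x => proj2 (sat_alls _ x) (fun y => Kvalid_rec0 g h ts KM y)
  | PRA_recS n k g h t ts => fun M KM x => proj2 (sat_alls _ x) (fun y => Kvalid_recS g h t ts KM y)
  | PRA_qfind n A qA d0 dS => Kvalid_ind qA
      (Kvalid_prov (fun _ h => h) (prov_mono PRA_Kvalid d0))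
      (Kvalid_prov (fun _ h => h) (prov_mono PRA_Kvalid dS))
  end.

(** ** The function [omega ^ x] *)

Definition oexp (M : pvm) (a : M) : M := pri (o_exp oO) (pair a mZ).

Lemma Kdef_oexp : Kdef oexp.
Proof.
apply: (@Kdef_comp (pri (o_exp oO)) (fun M a => pair a mZ)); first exact: Kdef_pri.
by apply: Kdef_pure; fdt.
Qed.

Section ExpFacts.
Variables (M : pvm) (KM : K M).
Let ex : PRA_exponentiation oO := rep_exp orep.
Let x2 (b c : M) := scons b (scons c (@env0 M)).
Let fact (A : prform 2) b c : PRA |- A -> sat (M := prS M) A (x2 b c).
Proof. by move=> d; apply: (Kvalid_prov PRA_Kvalid d). Qed.
Let ev0 b c : ev (M := prS M) (x2 b c) (v 0) = b.
Proof. by rewrite /x2 /= (_ : inord 0 = v0 _ :> 'I_2) ?scE //; apply/val_inj; rewrite /= inordK. Qed.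
Let ev1 b c : ev (M := prS M) (x2 b c) (v 1) = c.
Proof. by rewrite /x2 /= (_ : inord 1 = v1 _ :> 'I_2) ?scE //; apply/val_inj; rewrite /= inordK. Qed.
Let DomR n (x : 'I_n -> M) t : sat (M := prS M) (fsubst1 (fmap pr_pv (o_dom oO)) t) x <->
  odom (ev (M := prS M) x t).
Proof. by rewrite sat_fsubst tnth_comp1 tnth1E sat_pr. Qed.
Let LtR n (x : 'I_n -> M) t u : sat (M := prS M) (fsubst2 (fmap pr_pv (o_lt oO)) t u) x <->
  olt (ev (M := prS M) x t) (ev (M := prS M) x u).
Proof. by rewrite sat_fsubst tnth_comp2 tnth2E sat_pr. Qed.
Let AddR n (x : 'I_n -> M) t u : ev (M := prS M) x (tsubst2 (tmap pr_pv (o_add oO)) t u) =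
  oadd (ev (M := prS M) x t) (ev (M := prS M) x u).
Proof. by rewrite ev_tsubst tnth_comp2 tnth2E ev_pr. Qed.
Let MulR n (x : 'I_n -> M) t u : ev (M := prS M) x (tsubst2 (tmap pr_pv (o_mul oO)) t u) =
  omul (ev (M := prS M) x t) (ev (M := prS M) x u).
Proof. by rewrite ev_tsubst tnth_comp2 tnth2E ev_pr. Qed.
Let ExpR n (x : 'I_n -> M) t : ev (M := prS M) x (app1 (o_exp oO) t) = oexp (ev (M := prS M) x t).
Proof. by rewrite ev_app1 /oexp /= scons0. Qed.
Let impE n (A B : prform n) (y : 'I_n -> M) : sat (M := prS M) (fimp A B) y <->
  (sat (M := prS M) A y -> sat (M := prS M) B y).
Proof. by []. Qed.
Let eqE n t u (y : 'I_n -> M) : sat (M := prS M) (feq t u) y <->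
  ev (M := prS M) y t = ev (M := prS M) y u.
Proof. by []. Qed.
Let rE := (DomR, LtR, impE, eqE).
Let tE := (ExpR, AddR, MulR, ev0, ev1).

Implicit Types b c : M.
Lemma dom_oexp b : odom b -> odom (oexp b).
Proof. by have := fact b b (exp_dom ex); rewrite !rE !tE. Qed.
Lemma oexp_lt b c : odom b -> odom c -> olt b c -> olt (oexp b) (oexp c).
Proof. by have := fact b c (exp_lt ex); rewrite !rE !tE. Qed.
Lemma oexp_add b c : odom b -> odom c -> oexp (oadd b c) = omul (oexp b) (oexp c).
Proof. by have := fact b c (exp_add ex); rewrite !rE !tE. Qed.
Lemma oexp0 : oexp (ozero M) = oone M.
Proof.
have := Kvalid_prov PRA_Kvalid (exp_zero ex) KM (@env0 M); rewrite eqE ExpR !ev_pr.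
by rewrite ZeroE OneE.
Qed.
Lemma oexp_le b c : odom b -> odom c -> ole b c -> ole (oexp b) (oexp c).
Proof. by move=> hb hc [h|->]; [left; apply: oexp_lt|right]. Qed.
Lemma oexp_nz b : odom b -> oexp b <> ozero M.
Proof.
move=> hb e; have := oexp_le (@dom0 P M) hb (ole0 hb); rewrite e oexp0; case; first by apply: olt0; exact: dom1.
exact: one_nz_o.
Qed.
End ExpFacts.

(** A counterexample starts the descending sequence [b], [oexp b], [oexp (oexp b)] and so on, as
    [oexp] is strictly monotone. The bound [k] makes this a search along a standard ordinal, without
    solutions. *)
Lemma ole_oexp (M : pvm) (b : M) (k : cst) : K M -> std k -> odom b -> ole b (k M) -> ole b (oexp b).
Proof.
move=> KM sk hb bk; apply: contrapT => h.
have lt : olt (oexp b) b.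
  by case: (olt_tot hb (dom_oexp KM hb)) => [l|[e|//]]; case: h; [left|right].
have [H dH HE] := Kdef_oexp.
pose (G := fun (M : pvm) (g z X : M) => H M (psnd z) (pfst z) g /\ olt (pfst z) g).
have [w hw] := proj2 (HE M KM b _) erefl.
have [||||c []] := @K_search P G (fun M _ _ => False) k _ _ sk _ M KM b (pair (oexp b) w) mZ hb bk.
- by rewrite /G; pdt.
- by pdt.
- move=> N KN g z X dg [h1 h2]; right.
  have e : pfst z = oexp g by apply/(HE N KN); exists (psnd z).
  have de := dom_oexp KN dg; rewrite e in h2.
  have [w' hw'] := proj2 (HE N KN (oexp g) _) erefl.
  exists (oexp g), (pair (oexp (oexp g)) w'); split=> //.
  by rewrite /G pfstE psndE; split=> //; apply: oexp_lt.
- by rewrite /G pfstE psndE.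
Qed.

(** ** The standard model is in [K] *)

(** The isomorphism [rep_iso] carries the well-foundedness of the ordinal over to the elements of O
    in the standard model. *)
Lemma natM_wf (Q : natM -> Prop) :
  (forall a, odom a -> (forall b, odom b -> olt b a -> Q b) -> Q a) -> forall a, odom a -> Q a.
Proof.
have idE (a : nat) : in_dom oO a <-> odom (a : natM).
  by rewrite /in_dom holdsE /odom tnth1E.
move=> H; have [f _ fE] := rep_iso orep.
have wf : well_founded (@std_lt oO).
  move=> x; have [y ey] : exists y, y = f x by exists (f x).
  elim: (wo_wf y) x ey => {}y _ IH x ey; constructor=> x' /fE h.
  by apply: IH erefl; rewrite ey.
move=> a /idE ha; rewrite -[a]/(sval (exist _ a ha)).
elim: (wf (exist _ a ha)) => {ha} {}a _ IH; apply: H; first exact/idE/(svalP a).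
move=> b /idE hb hba; rewrite -[b]/(sval (exist _ b hb)); apply: IH.
by rewrite /std_lt holdsE /= tnth2E.
Qed.

Lemma K_natM : K natM.
Proof.
move=> A _ [b [i [G [q [N [p [sb _ H]]]]]]] x; have [h1 h2 h3] := H natM x.
suff h : forall g, @odom P natM g -> forall z, G natM g z x -> exists y, A natM x y.
  exact: (h (b natM) (std_dom natM sb) _ h1).
apply: natM_wf => g dg IH z hG; case: (pselect (g = ozero natM)) => [e|nz].
  by rewrite e in hG; exists (p natM z x); apply: h3.
by have [k1 k2 k3] := h2 g z dg nz hG; apply: (IH (q natM g z x)) k3.
Qed.

Lemma mnum_natM c : mnum c natM = c.
Proof. by elim: c => // c IH; rewrite -[LHS]/(msucc (mnum c natM)) msucc_nat IH. Qed.

(** The value is computed in the standard model, which is in [K], together with a witness for the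
    graph. The graph is open, so it holds of the same numerals in every model. *)
Lemma std_oexp k : std k -> exists2 k' : cst, std k' & forall M, K M -> oexp (k M) = k' M.
Proof.
move=> sk; have [c hc ck] := sk; have [H [A qA AE] HE] := Kdef_oexp.
pose d : nat := oexp (k natM); exists (fun M => mnum d M).
  apply: (@std_nat P _ d) => //; rewrite mnum_natM /d; apply: dom_oexp; [exact: K_natM|exact: std_dom].
move=> M KM; have [w hw] := proj2 (HE natM K_natM (k natM) _) erefl.
symmetry; apply/(HE M KM); exists (mnum w M).
have e (N : pvm) (a b e : N) : H N a b e <-> sat (M := N) A (scons a (scons b (scons e (@env0 N)))).
  by rewrite AE !scE.
move/e: hw; rewrite e ck ck mnum_natM -/d.
have eN : scons (mnum w M) (scons (mnum d M) (scons (mnum c M) (@env0 M))) =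
    (fun j => mnum (scons w (scons d (scons c (@env0 nat))) j) M).
  rewrite !(scons_comp (fun c => mnum c M)); do 3 congr scons; exact: env0E.
have ed : d = oexp (c : natM) by rewrite /d ck mnum_natM.
by rewrite eN -ed => h; apply: (proj2 (sat_mnum M (scons w (scons d (scons c (@env0 nat)))) qA)); rewrite holdsE.
Qed.
End Kdefinable.

(** * Minimization oracles *)

Notation oterm := (term (osym pvsym nat)).
Notation oform := (formula (osym pvsym nat)).

Definition oS (M : pvm) (F : M -> M) : struct (osym pvsym nat) := ostruct (orc id F).

Fixpoint oidx (I : nat -> Prop) n (t : oterm n) : Prop :=
  if t is tapp k f ts then (forall j, oidx I (ts j)) /\ (if f is o_orc l then I l else True) else True.

(** All queries made while [t] is evaluated with the answers in [V] are registered in [V]. The value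
    then does not depend on the default answer [mZ] and persists in extensions of [V]. *)
Fixpoint treg (M : pvm) (V : M) n (x : 'I_n -> M) (t : oterm n) : Prop :=
  if t is tapp k f ts then (forall j, treg V x (ts j)) /\
    match f in osym _ _ k return ('I_k -> oterm n) -> Prop with
    | o_base _ _ => fun _ => True
    | o_orc i => fun ts => reg V (pair (tag i M) (ev (M := oS (look V)) x (ts ord0)))
    end ts
  else True.

Lemma treg_ext (I : nat -> Prop) (M : pvm) (V V' : M) n (x : 'I_n -> M) (t : oterm n) : oidx I t ->
  (forall j a, I j -> reg V (pair (tag j M) a) -> reg V' (pair (tag j M) a) /\
     look V' (pair (tag j M) a) = look V (pair (tag j M) a)) ->
  treg V x t -> treg V' x t /\ ev (M := oS (look V')) x t = ev (M := oS (look V)) x t.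
Proof.
move=> + H; elim: t => //= k f ts IH [h1 h2] [r1 r2].
have {}IH j := IH j (h1 j) (r1 j).
case: f ts {h1 r1} IH h2 r2 => [{}k f|l] ts IH h2 r2.
  split; first by split=> // j; have [] := IH j.
  by rewrite /=; congr sapp; apply/funext => j; have [_ ->] := IH j.
rewrite /= /orc; have [_ e] := IH ord0; have [h3 h4] := H _ _ h2 r2.
by rewrite e; split=> //; split=> // j; have [] := IH j.
Qed.

Lemma pd_all n k (Q : 'I_k -> forall M : pvm, ('I_n -> M) -> Prop) : (forall j, pd (Q j)) ->
  @pd n (fun M x => forall j, Q j M x).
Proof.
elim: k Q => [|k IH] Q dQ.
  by apply: (@pd_ext _ (fun M x => True)) => [M x|]; [split=> // _ []|exact: pd_True].
apply: (@pd_ext _ (fun M x => Q ord0 M x /\ forall j, Q (lift ord0 j) M x)) => [M x|].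
  split=> [[h1 h2] j|h]; last by split.
  by case: (unliftP ord0 j) => [j'|] ->.
by apply: pd_and => //; apply: IH.
Qed.

Lemma def_oev (t : oterm 1) : def2 (fun M V p => ev (M := oS (look V)) (fun _ => p) t).
Proof.
elim: t => [i|k f ts IH] /=; first by fdt.
case: f ts IH => [{}k f|l] ts IH /=.
  have /choice[tt ttE] := IH; exists (tapp f tt) => M x /=.
  by congr sapp; apply/funext => j; rewrite ttE.
have d := IH ord0; rewrite /orc /def2; apply: (@fd_app2 _ look); [exact: def_look|by fdt|].
by apply: (@fd_app2 _ pair); [exact: def_pair|fdt|exact: d].
Qed.

Lemma rel_treg (t : oterm 1) : rel2 (fun M V p => treg V (fun _ => p) t).
Proof.
elim: t => [i|k f ts IH] /=; first by pdt.
rewrite /rel2; apply: pd_and; first exact: pd_all.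
case: f ts IH => [{}k f|l] ts IH /=; first exact: pd_True.
have d := def_oev (ts ord0).
apply: (@pd_app2 _ reg); [exact: rel_reg|by fdt|].
by apply: (@fd_app2 _ pair); [exact: def_pair|fdt|apply: (@fd_app2 _ _ _ _ d); fdt].
Qed.

Section MinimizationSearch.
Context {P : ptrep}.

(* The oracle is asked, at [s], for a value [u] minimizing the ordinal
   [d (u, s) <= sb], which is computed with oracles of smaller index. *)
Record spec := Spec { sd : oterm 1; sb : cst }.

Definition dv s (M : pvm) (F : M -> M) (p : M) := ev (M := oS F) (fun _ => p) (sd s).
Definition dvl s (M : pvm) (V p : M) := dv s (look V) p.
Definition cert s (M : pvm) (V p : M) := treg V (fun _ => p) (sd s).

Definition spec_ok i (s : spec) : Prop :=
  [/\ std (sb s), oidx (fun l => l < i) (sd s) &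
   forall (M : pvm) (F : M -> M) (p : M), odom (dv s F p) /\ ole (dv s F p) (sb s M)].

Definition ext (M : pvm) (V V1 : M) := forall q, reg V q -> reg V1 q /\ look V1 q = look V q.

Lemma ext_push (M : pvm) (q v e V : M) : ext V (push q v e V).
Proof. by move=> q' r; split; [apply/reg_push; left|rewrite look_push //; left]. Qed.

Lemma cert_ext i s (M : pvm) (V V' p : M) : spec_ok i s ->
  (forall j a, j < i -> reg V (pair (tag j M) a) -> reg V' (pair (tag j M) a) /\
     look V' (pair (tag j M) a) = look V (pair (tag j M) a)) ->
  cert s V p -> cert s V' p /\ dvl s V' p = dvl s V p.
Proof. by move=> [_ hi _] H c; apply: treg_ext hi H c. Qed.

Lemma def_dvl s : def2 (dvl s). Proof. exact: def_oev. Qed.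
Lemma rel_cert s : rel2 (cert s). Proof. exact: rel_treg. Qed.
#[local] Hint Resolve def_dvl rel_cert : fdb.

(** From c . 0 = c . (0 + 0) = c . 0 + c . 0, since adding a nonzero ordinal on the right is
    strictly increasing. *)
Lemma omul0r (M : pvm) (c : M) : odom c -> omul c (ozero M) = ozero M.
Proof.
move=> dc; have d0 := @dom0 P M; have dm := dom_omul dc d0; apply: contrapT => nz.
have := olt_addr dm dm nz; rewrite -omulD // oadd0r //; exact: olt_irr.
Qed.

Variables (sp : nat -> spec) (B : R2).
Hypothesis spP : forall i, spec_ok i (sp i).

(** The two [cert] conditions make a violation checkable from the table alone: every query that
    enters the two ordinals has been asked. *)
Definition viol i (M : pvm) (V u s : M) : Prop :=
  let q := pair (tag i M) s in
  [/\ reg V q, cert (sp i) V (pair u s), cert (sp i) V (pair (look V q) s) &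
   olt (dvl (sp i) V (pair u s)) (dvl (sp i) V (pair (look V q) s))].

Definition good n (M : pvm) (V x o : M) : Prop :=
  (pfst o = te M /\ B x (psnd o)) \/
  exists2 i, i < n & pfst o = tag i M /\ viol i V (pfst (psnd o)) (psnd (psnd o)).

(** Only the queries for [oexp] have to be answered truthfully. The answers of the minimization
    oracles may be anything, as long as repeated queries are answered alike. *)
Definition ok (M : pvm) (V : M) : Prop := forall u, suf u V ->
  evl u = look V (ekey u) /\
  (pfst (ekey u) = te M -> odom (psnd (ekey u)) -> evl u = oexp (psnd (ekey u))).

Definition lower n (M : pvm) (q : M) := pfst q = te M \/ exists2 i, i < n & pfst q = tag i M.

(* A search with ordinal [pfst z]; [iI x z V] is its invariant and [iQ x z V]
   its next query, where [V] is the table of answers received so far. *)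
Record ils n := Ils {
  iI : R3; iH : R3; iQ : F3; iN : F3; iO : F3; iz : F1; ik : cst;
  il_def : [/\ rel3 iI, rel3 iH & std ik] /\ [/\ def3 iQ, def3 iN, def3 iO & def1 iz];
  il_init : forall (M : pvm) (x : M), K M -> iI x (iz x) mZ /\ pfst (iz x) = ik M;
  il_dom : forall (M : pvm) (x z V : M), K M -> iI x z V -> odom (pfst z);
  il_halt : forall (M : pvm) (x z V : M), K M -> ok V -> iI x z V -> iH x z V -> good n V x (iO x z V);
  il_step : forall (M : pvm) (x z V : M), K M -> ok V -> iI x z V -> ~ iH x z V ->
    lower n (iQ x z V) /\ forall a e, let V1 := push (iQ x z V) a e V in
      ok V1 -> iI x (iN x z V1) V1 /\ olt (pfst (iN x z V1)) (pfst z) }.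

Lemma ok0 (M : pvm) : ok (mZ : M). Proof. by move=> u /suf0. Qed.

Lemma ok_suf (M : pvm) (V u : M) : ok V -> suf u V -> ok u.
Proof.
move=> h uV w wu; have [h1 h2] := h w (suf_trans uV wu); split=> //.
by rewrite h1; apply: look_suf => //; apply/regP; exists w.
Qed.

Lemma ok_push (M : pvm) (q a e V : M) : ok V -> (reg V q -> a = look V q) ->
  (pfst q = te M -> odom (psnd q) -> a = oexp (psnd q)) -> ok (push q a e V).
Proof.
move=> oV h1 h2 u /suf_push[->|uV].
  rewrite ekeyE evlE; split=> //; case: (pselect (reg V q)) => r.
    by rewrite look_push; [apply: h1|left].
  by rewrite look_push_new.
have [k1 k2] := oV u uV; split=> //.
by rewrite look_push //; left; apply/regP; exists u.
Qed.

(** * Removal of the oracle of largest index *)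

Section Step.
Variables (n : nat) (T : ils n.+1).
(** With E = omega ^ (b3 . g), a state in phase [one] has the ordinal acc + E . b2. Adding an entry
    of rank c up to [b] leads to acc + E . (c + 1), at most acc + E . b1, so [b2] makes the step
    strict. From b2 < b3 <= omega ^ b3 it follows that E . b2 is below omega ^ (b3 . g') for g < g'.
    Finally [k1] lies above the initial g, whose E is not yet known at the start. *)
Let b := sb (sp n).
Let b1 : cst := fun M => oadd (b M) (oone M).
Let b2 : cst := fun M => oadd (b1 M) (oone M).
Let b3 : cst := fun M => oadd (b2 M) (oone M).
Let k1 : cst := fun M => oadd (ik T M) (oone M).
Variable k' : cst.
Hypothesis sk' : std k'.
Hypothesis k'E : forall M, K M -> oexp (omul (b3 M) (k1 M)) = k' M.

Let sb0 : std b. Proof. by have [] := spP n. Qed.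
Let sb1 : std b1. Proof. by apply: std_add => //; exact: std1. Qed.
Let sb2 : std b2. Proof. by apply: std_add => //; exact: std1. Qed.
Let sb3 : std b3. Proof. by apply: std_add => //; exact: std1. Qed.
Let sk1 : std k1. Proof. by have [[_ _ s] _] := il_def T; apply: std_add => //; exact: std1. Qed.

Let db0 := std_def0 sb0.
Let db1 := std_def0 sb1.
Let db2 := std_def0 sb2.
Let db3 := std_def0 sb3.
Let dk1 := std_def0 sk1.
Let dk' := std_def0 sk'.

Definition gkey (M : pvm) (g : M) := pair (te M) (omul (b3 M) g).
Let dgkey : def1 gkey. Proof. by rewrite /gkey; fdt. Qed.

(** The second alternative serves the initial state: the value at [k1] is the standard constant
    [k'], so it requires no query. *)
Definition expv (M : pvm) (V g E : M) := (reg V (gkey g) /\ look V (gkey g) = E) \/ (g = k1 M /\ E = k' M).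
Let dexpv : rel3 expv. Proof. by rewrite /expv; pdt. Qed.

Lemma expv_ext (M : pvm) (V V1 g E : M) : ext V V1 -> expv V g E -> expv V1 g E.
Proof. by move=> h [[r e]|]; [left; have [? ->] := h _ r|right]. Qed.

Lemma expvE (M : pvm) (V g E : M) : K M -> ok V -> odom g -> expv V g E -> E = oexp (omul (b3 M) g).
Proof.
move=> KM oV dg [[r e]|[-> ->]]; last by rewrite k'E.
have [s k _] := ent_reg r; have [_] := oV _ s; rewrite -/(look V (gkey g)) k e /gkey pfstE psndE; apply=> //.
by apply: dom_omul => //; exact: std_dom.
Qed.

(** E . b2 < E . omega ^ b3 = omega ^ (b3 . (g + 1)), because b2 < b3 <= omega ^ b3. *)
Lemma expgap (M : pvm) (g g' : M) : K M -> odom g -> odom g' -> olt g g' ->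
  olt (omul (oexp (omul (b3 M) g)) (b2 M)) (oexp (omul (b3 M) g')).
Proof.
move=> KM dg dg' lt; have h2 := std_dom M sb2; have h3 := std_dom M sb3; have h1 := @dom1 P M.
have hm := dom_omul h3 dg; have hm' := dom_omul h3 dg'; have he := dom_oexp KM hm.
have h3e := dom_oexp KM h3.
apply: (@olt_le_tr _ _ _ (omul (oexp (omul (b3 M) g)) (oexp (b3 M)))).
- exact: dom_omul.
- exact: dom_omul.
- exact: dom_oexp.
- apply: omul_lt => //; first exact: oexp_nz.
  apply: (@olt_le_tr _ _ _ (b3 M)) => //; first exact: olt_add1.
  by apply: (ole_oexp KM sb3) => //; right.
- rewrite -oexp_add //; apply: oexp_le => //; first exact: dom_oadd.
  have -> : oadd (omul (b3 M) g) (b3 M) = omul (b3 M) (oadd g (oone M)) by rewrite omulD // omul1r.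
  apply: omul_le2 => //; first exact: dom_oadd; first exact: oadd1_nz.
  exact: olt_disc.
Qed.

(* The extra component of an entry of the inner table: the ordinal accumulated
   up to it and, for the first answer to a query to oracle [n], the state [z]
   that asked it, the value [omega ^ (b3 . pfst z)] and the rank of the answer. *)
Definition mkx (M : pvm) (ac z E r : M) := pair ac (pair z (pair E r)).
Definition acc (M : pvm) (u : M) := ite (u = mZ) (ozero M) (pfst (eex u)).
Definition ez (M : pvm) (u : M) := pfst (psnd (eex u)).
Definition eE (M : pvm) (u : M) := pfst (psnd (psnd (eex u))).
Definition er (M : pvm) (u : M) := psnd (psnd (psnd (eex u))).
Let dmkx : def4 mkx. Proof. by rewrite /mkx; fdt. Qed.
Let dacc : def1 acc. Proof. by rewrite /acc; fdt. Qed.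
Let dez : def1 ez. Proof. by rewrite /ez; fdt. Qed.
Let deE : def1 eE. Proof. by rewrite /eE; fdt. Qed.
Let der : def1 er. Proof. by rewrite /er; fdt. Qed.

Lemma accE (M : pvm) (q v ac z E r V : M) : acc (push q v (mkx ac z E r) V) = ac.
Proof. by rewrite /acc iteF ?eexE ?pfstE //; exact: push_nz. Qed.
Lemma ezE (M : pvm) (q v ac z E r V : M) : ez (push q v (mkx ac z E r) V) = z.
Proof. by rewrite /ez eexE psndE pfstE. Qed.
Lemma eEE (M : pvm) (q v ac z E r V : M) : eE (push q v (mkx ac z E r) V) = E.
Proof. by rewrite /eE eexE !psndE pfstE. Qed.
Lemma erE (M : pvm) (q v ac z E r V : M) : er (push q v (mkx ac z E r) V) = r.
Proof. by rewrite /er eexE !psndE. Qed.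
Definition exE := (accE, ezE, eEE, erE, ekeyE, evlE, psnd_push).

(** The initial guess gets the maximal rank [b] without evaluation of its ordinal; a corrected
    answer has its exact ordinal as rank. Here [V] is the outer table, which answers the oracles of
    smaller index. *)
Definition rank (M : pvm) (u V : M) :=
  er u = b M \/ (cert (sp n) V (pair (evl u) (psnd (ekey u))) /\
                 er u = dvl (sp n) V (pair (evl u) (psnd (ekey u)))).

Definition first (M : pvm) (u X : M) :=
  (iI T (pfst X) (ez u) (psnd u) /\ ~ iH T (pfst X) (ez u) (psnd u) /\
   ekey u = iQ T (pfst X) (ez u) (psnd u)) /\
  expv (psnd X) (pfst (ez u)) (eE u) /\
  odom (er u) /\ ole (er u) (b M) /\ rank u (psnd X) /\
  acc u = oadd (acc (psnd u)) (omul (eE u) (er u)).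

(** The entries of the inner table are of three kinds: answers copied from the outer table, repeated
    queries to oracle [n], and first queries to oracle [n]. Only the last kind adds to the
    accumulated ordinal. *)
Definition loc (M : pvm) (u X : M) := odom (acc u) /\
  ((pfst (ekey u) <> tag n M /\ reg (psnd X) (ekey u) /\ look (psnd X) (ekey u) = evl u /\
      acc u = acc (psnd u)) \/
   (pfst (ekey u) = tag n M /\ reg (psnd u) (ekey u) /\ evl u = look (psnd u) (ekey u) /\
      acc u = acc (psnd u)) \/
   (pfst (ekey u) = tag n M /\ ~ reg (psnd u) (ekey u) /\ first u X)).

Let drank : rel2 rank.
Proof. by rewrite /rank; pdt. Qed.
Let dfirst : rel2 first.
Proof. by have [[d1 d2 _] [d3 _ _ _]] := il_def T; rewrite /first; pdt. Qed.
Let dloc : rel2 loc. Proof. by rewrite /loc; pdt. Qed.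

Lemma rank_ext (M : pvm) (u V V1 : M) : ext V V1 -> rank u V -> rank u V1.
Proof.
move=> h [e|[c e]]; [by left|right]; rewrite e.
by have [? ->] := cert_ext (spP n) (fun j a _ => h (pair (tag j M) a)) c.
Qed.

Lemma loc_ext (M : pvm) (u x V V1 : M) : ext V V1 -> loc u (pair x V) -> loc u (pair x V1).
Proof.
move=> h [da H]; split=> //; rewrite /first !(pfstE, psndE) in H *.
case: H => [[h1 [h2 [h3 h4]]]|[?|[h1 [h2 [h3 [h4 [h5 [h6 [h7 h8]]]]]]]]].
- by left; have [r ->] := h _ h2.
- by right; left.
- right; right; split=> //; split=> //; split=> //; split; first exact: expv_ext h4.
  by split=> //; split=> //; split=> //; apply: rank_ext h7.
Qed.

Section InModel.
Variables (M : pvm) (KM : K M) (x V V' : M).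
Hypotheses (oV' : ok V') (LV : allsuf loc V (pair x V')).

Lemma tl_suf u : suf u V -> psnd u = mZ \/ suf (psnd u) V.
Proof.
move=> uV; case: (pselect (psnd u = mZ)) => e; [by left|right].
exact: suf_tl.
Qed.

Lemma dom_acc u : u = mZ \/ suf u V -> odom (acc u).
Proof. by case=> [->|/LV[]//]; rewrite /acc iteT //; exact: dom0. Qed.

Lemma ent_rec (u q : M) : u <> mZ -> ent u q =
  ite (reg (psnd u) q) (ent (psnd u) q) (ite (ekey u = q) u mZ).
Proof. exact: lastof_rec. Qed.

Lemma low_look q : pfst q <> tag n M -> reg V q -> reg V' q /\ look V' q = look V q.
Proof.
move=> nq r; have [s k _] := ent_reg r; have [_ H] := LV s; rewrite psndE k in H.
by case: H => [[_ [r' [-> _]]]|[[e _]|[e _]]].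
Qed.

Lemma inner_ok : ok V.
Proof.
move=> u uV; have nu := suf_nz uV; have ru : reg u (ekey u) by apply/regP; exists u => //; exact: suf_refl.
have -> : look V (ekey u) = look u (ekey u) by apply: look_suf.
have [_ H] := LV uV; rewrite psndE in H.
case: H => [[nt [r [e _]]]|[[t [r [-> _]]]|[t [r _]]]].
- have [s k _] := ent_reg r; have [h1 h2] := oV' s; rewrite k -[evl _]/(look V' (ekey u)) e in h1 h2.
  split=> //; have [s2 k2 _] := ent_reg ru; have [_ H2] := LV (suf_trans uV s2).
  rewrite psndE k2 in H2; case: H2 => [[_ [_ [e2 _]]]|[[t _]|[t _]]] //.
  by rewrite /look -e2 e.
- split; first by rewrite /look [in RHS]ent_rec // iteT.
  by rewrite t => /esym/te_tag.
- split; first by rewrite /look [in RHS]ent_rec // iteF // iteT.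
  by rewrite t => /esym/te_tag.
Qed.

Lemma first_facts u X : suf u V -> first u X -> iI T x (ez u) (psnd u) -> psnd X = V' ->
  [/\ odom (pfst (ez u)), odom (eE u), eE u <> ozero M & eE u = oexp (omul (b3 M) (pfst (ez u)))].
Proof.
move=> uV [_ [h _]] hI e; rewrite e in h; have d := il_dom KM hI.
have hE := expvE KM oV' d h; have hm : odom (omul (b3 M) (pfst (ez u))) by apply: dom_omul => //; exact: std_dom.
by split=> //; rewrite hE; [apply: dom_oexp|apply: oexp_nz].
Qed.

Lemma acc_step u : suf u V -> ole (acc (psnd u)) (acc u).
Proof.
move=> uV; have [_ [[_ [_ [_ ->]]]|[[_ [_ [_ ->]]]|[_ [_ h]]]]] := LV uV; try by right.
have [[hI _] [_ [dr [_ [_ ->]]]]] := h; rewrite pfstE in hI.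
have [_ dE _ _] := first_facts uV h hI (psndE _ _).
by apply: ole_addr; [apply: dom_acc; apply: tl_suf|apply: dom_omul].
Qed.
End InModel.

(** For the moment when the table is cut back to [u]: the entries cut off can only have raised the
    accumulated ordinal. *)
Lemma acc_mono (M : pvm) (x V V' u : M) : K M -> ok V' -> allsuf loc V (pair x V') -> suf u V -> ole (acc u) (acc V).
Proof.
move=> KM oV' LV uV; move: V LV uV.
apply: (@list_ind2 (fun M V X u => allsuf loc V X -> suf u V -> ole (acc u) (acc V)) _ M (pair x V') u).
- by pdt.
- by move=> _ /suf0.
- move=> V nV IH LV uV; have V1 := suf_refl nV.
  case: (proj1 (sufE u nV) uV) => [->|uV1]; first by right.
  have L1 : allsuf loc (psnd V) (pair x V') by move=> w wV; apply: LV; apply/sufE => //; right.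
  have d := dom_acc LV; apply: (@ole_tr _ _ _ (acc (psnd V))); try by apply: d; right => //; apply/sufE => //; right.
  + by apply: d; apply: tl_suf V1.
  + exact: IH.
  + exact: (acc_step KM oV' LV).
Qed.

Definition st (M : pvm) (mu ph z w : M) := pair mu (pair ph (pair z w)).
Definition sph (M : pvm) (s : M) := pfst (psnd s).
Definition sz (M : pvm) (s : M) := pfst (psnd (psnd s)).
Definition sV (M : pvm) (s : M) := pfst (psnd (psnd (psnd s))).
Definition sgp (M : pvm) (s : M) := pfst (psnd (psnd (psnd (psnd s)))).
Definition sE (M : pvm) (s : M) := psnd (psnd (psnd (psnd (psnd s)))).
Let dst : def4 st. Proof. by rewrite /st; fdt. Qed.
Let dsph : def1 sph. Proof. by rewrite /sph; fdt. Qed.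
Let dsz : def1 sz. Proof. by rewrite /sz; fdt. Qed.
Let dsV : def1 sV. Proof. by rewrite /sV; fdt. Qed.
Let dsgp : def1 sgp. Proof. by rewrite /sgp; fdt. Qed.
Let dsE : def1 sE. Proof. by rewrite /sE; fdt. Qed.
Lemma stE (M : pvm) (mu ph z V g E : M) : let s := st mu ph z (pair V (pair g E)) in
  [/\ pfst s = mu, sph s = ph, sz s = z & [/\ sV s = V, sgp s = g & sE s = E]].
Proof. by rewrite /sph /sz /sV /sgp /sE /st !(psndE, pfstE). Qed.

(* In phase [mZ] the search asks for [omega ^ (b3 . pfst z)]; in phase [one] it
   simulates a step of [T]. *)
Definition sI (M : pvm) (x s V' : M) := odom (pfst s) /\ iI T x (sz s) (sV s) /\ allsuf loc (sV s) (pair x V') /\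
  ((sph s = mZ /\ odom (sgp s) /\ olt (pfst (sz s)) (sgp s) /\ expv V' (sgp s) (sE s) /\
      pfst s = oadd (acc (sV s)) (sE s)) \/
   (sph s = one /\ expv V' (pfst (sz s)) (sE s) /\
      pfst s = oadd (acc (sV s)) (omul (sE s) (b2 M)))).

Definition sH (M : pvm) (x s V' : M) := sph s = one /\ iH T x (sz s) (sV s) /\
  pfst (iO T x (sz s) (sV s)) <> tag n M.

(** A step that uses no outside answer, namely a correction or a query to oracle [n], must still ask
    something; it asks for [oexp] of [ozero]. *)
Definition sQ (M : pvm) (x s V' : M) := ite (sph s <> one) (gkey (pfst (sz s)))
  (ite (~ iH T x (sz s) (sV s) /\ pfst (iQ T x (sz s) (sV s)) <> tag n M)
     (iQ T x (sz s) (sV s)) (pair (te M) (ozero M))).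

(* A new query to oracle [n] is answered by [mZ], the value of [look] on
   unregistered keys. *)
Definition nQ (M : pvm) (x s V1 : M) :=
  let V := sV s in let q := iQ T x (sz s) V in
  push q (ite (pfst q = tag n M) (look V q) (evl V1))
    (mkx (ite (pfst q = tag n M /\ ~ reg V q) (oadd (acc V) (omul (sE s) (b M))) (acc V)) (sz s) (sE s) (b M)) V.

(* The table is cut back to the first answer to the query at which [T] found
   a violation, and the answer is improved. *)
Definition nB (M : pvm) (x s : M) :=
  let V := sV s in let o := psnd (iO T x (sz s) V) in
  let w := ent V (pair (tag n M) (psnd o)) in
  let r := dvl (sp n) V (pair (pfst o) (psnd o)) in
  push (pair (tag n M) (psnd o)) (pfst o)
    (mkx (oadd (acc (psnd w)) (omul (eE w) r)) (ez w) (eE w) r) (psnd w).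

(** [T] moves on from the state stored at the head of [V2]. Its new ordinal has a value E that is
    still to be asked for; until then the old E, kept with its ordinal, stands in for it. *)
Definition adv (M : pvm) (x V2 : M) := st (oadd (acc V2) (eE V2)) mZ (iN T x (ez V2) V2)
  (pair V2 (pair (pfst (ez V2)) (eE V2))).

Definition sN (M : pvm) (x s V1 : M) := ite (sph s <> one)
  (st (oadd (acc (sV s)) (omul (evl V1) (b2 M))) one (sz s) (pair (sV s) (pair mZ (evl V1))))
  (adv x (ite (iH T x (sz s) (sV s)) (nB x s) (nQ x s V1))).

Lemma s_def : [/\ rel3 sI, rel3 sH & std k'] /\ [/\ def3 sQ, def3 sN,
   def3 (fun M x s V' => iO T x (sz s) (sV s)) &
   def1 (fun M x => st (k' M) mZ (iz T x) (pair mZ (pair (k1 M) (k' M))))].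
Proof.
have [[d1 d2 d3] [d4 d5 d6 d7]] := il_def T.
have dadv : def2 adv by rewrite /adv; fdt.
have dnQ : def3 nQ by rewrite /nQ; fdt.
have dnB : def2 nB by rewrite /nB; fdt.
do 2 split=> //.
- by rewrite /sI; pdt.
- by rewrite /sH; pdt.
- by rewrite /sQ; fdt.
- by rewrite /sN; fdt.
- by fdt.
- by fdt.
Qed.

(** The evidence for a violation of index [i] involves only oracles up to [i], and for these the
    inner table repeats the outer one. *)
Lemma viol_low (M : pvm) (x V V' u s : M) i : allsuf loc V (pair x V') -> i < n ->
  viol i V u s -> viol i V' u s.
Proof.
move=> LV lin [r c1 c2 lt].
have H j a : j < n -> reg V (pair (tag j M) a) -> reg V' (pair (tag j M) a) /\
     look V' (pair (tag j M) a) = look V (pair (tag j M) a).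
  move=> lj; apply: (low_look LV); rewrite pfstE => /tag_inj e; by rewrite e ltnn in lj.
have H' j a (lj : j < i) := H j a (ltn_trans lj lin).
have [r' e] := H i s lin r; have [c1' e1] := cert_ext (spP i) H' c1.
by have [c2' e2] := cert_ext (spP i) H' c2; split=> //; rewrite ?e ?e1 ?e2.
Qed.

Lemma adv_ok (M : pvm) (x z q v ac E r V0 V' : M) : K M -> ok V' -> let V2 := push q v (mkx ac z E r) V0 in
  ok V0 -> iI T x z V0 -> ~ iH T x z V0 -> q = iQ T x z V0 -> ok V2 -> expv V' (pfst z) E ->
  allsuf loc V2 (pair x V') -> sI x (adv x V2) V' /\ pfst (adv x V2) = oadd ac E.
Proof.
move=> KM oV' V2 o0 I0 H0 eq o2 hE L2; have [_ S] := il_step KM o0 I0 H0.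
have [|I2 lt2] := S v (mkx ac z E r); first by rewrite -eq.
rewrite -eq -/V2 in I2 lt2; rewrite /adv /V2 !exE -/V2.
have [e1 e2 e3 [e4 e5 e6]] := stE (oadd ac E) mZ (iN T x z V2) V2 (pfst z) E.
have dz := il_dom KM I0; have dac : odom ac.
  by have [] := L2 V2 (suf_refl (@push_nz _ _ _ _ _)); rewrite exE.
have dE : odom E.
  rewrite (expvE KM oV' dz hE); apply: dom_oexp => //; apply: dom_omul => //; exact: std_dom.
split=> //; split; first by rewrite e1; apply: dom_oadd.
split; first by rewrite e3 e4.
split; first by rewrite e4.
by left; rewrite e1 e2 e3 e4 e5 e6 /V2 !exE.
Qed.

Lemma step_ils : ils n.
Proof.
have hb (M : pvm) : odom (b M) by apply: std_dom.
have hb1 (M : pvm) : odom (b1 M) by apply: std_dom.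
have hb2 (M : pvm) : odom (b2 M) by apply: std_dom.
have sI_dom (M : pvm) (x s V' : M) : K M -> ok V' -> sI x s V' ->
    [/\ odom (acc (sV s)), odom (sE s), sE s <> ozero M & odom (pfst s)].
  move=> KM oV' [ds [hI [hL hp]]]; have dz := il_dom KM hI.
  have da : odom (acc (sV s)).
    apply: (dom_acc hL); case: (pselect (sV s = mZ)) => e; [by left|right; exact: suf_refl].
  have aux g : odom g -> expv V' g (sE s) -> odom (sE s) /\ sE s <> ozero M.
    move=> dg /(expvE KM oV' dg) ->; have dm : odom (omul (b3 M) g) by apply: dom_omul => //; exact: std_dom.
    by split; [apply: dom_oexp|apply: oexp_nz].
  by case: hp => [[_ [dg [_ [he e]]]]|[_ [he e]]]; [have [] := aux _ dg he|have [] := aux _ dz he].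
apply: (Ils s_def).
- move=> M x KM; have [e1 e2 e3 [e4 e5 e6]] := stE (k' M) mZ (iz T x) mZ (k1 M) (k' M).
  split=> //; have [hI ek] := il_init T x KM; have dk : odom (ik T M) by rewrite -ek; apply: il_dom hI.
  split; first by rewrite e1; apply: std_dom.
  split; first by rewrite e3 e4.
  split; first by rewrite e4 => u /suf0.
  left; rewrite e1 e2 e3 e4 e5 e6; do 2 split=> //; first exact: std_dom.
  split; first by rewrite ek; apply: olt_add1.
  split; first by right.
  by rewrite /acc iteT // oadd0l //; apply: std_dom.
- by move=> M x s V' _ [].
- move=> M x s V' KM oV' [_ [hI [hL _]]] [_ [hH ho]].
  have oV := inner_ok oV' hL; case: (il_halt KM oV hI hH) => [?|[i li [ei vi]]]; [by left|right].
  have lin : i < n.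
    by move: li; rewrite ltnS leq_eqVlt => /orP[/eqP ein|//]; rewrite ein in ei.
  by exists i => //; split=> //; exact: (viol_low hL lin vi).
- move=> M x s V' KM oV' hs nH; have [_ [hI [hL hp]]] := hs.
  have [da dE nE ds] := sI_dom M x s V' KM oV' hs.
  have oV := inner_ok oV' hL; have dz := il_dom KM hI.
  split.
    rewrite /sQ; case: (pselect (sph s <> one)) => h1.
      by rewrite iteT //; left; rewrite /gkey pfstE.
    rewrite iteF //; case: (pselect (~ iH T x (sz s) (sV s) /\ pfst (iQ T x (sz s) (sV s)) <> tag n M)) => h2.
      rewrite iteT //; case: h2 => hH hq; have [[?|[i li ei]] _] := il_step KM oV hI hH; [by left|right].
      exists i => //; move: li; rewrite ltnS leq_eqVlt => /orP[/eqP ein|//]; by rewrite ein in ei.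
    by rewrite iteF //; left; rewrite pfstE.
  move=> a e V1 oV1; have E1 : ext V' V1 by apply: ext_push.
  have hL1 : allsuf loc (sV s) (pair x V1) by move=> u /hL; apply: loc_ext.
  have headE : evl V1 = a by rewrite evlE.
  have [hd hte] : a = look V1 (sQ x s V') /\
      (pfst (sQ x s V') = te M -> odom (psnd (sQ x s V')) -> a = oexp (psnd (sQ x s V'))).
    by have := oV1 V1 (suf_refl (@push_nz _ _ _ _ _)); rewrite evlE ekeyE.
  have hr : reg V1 (sQ x s V') by apply/reg_push; right.
  case: hp => [[ph [dg [lt [he mu]]]]|[ph [he mu]]].
    (* Phase [mZ]: the answer is the value E for the new ordinal of [T], and E . b2 is below the old
       E by [expgap]. *)
    have h1 : sph s <> one by rewrite ph => /esym; exact: one_nz.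
    rewrite /sN iteT // headE; rewrite /sQ iteT // in hd hr.
    have [e1 e2 e3 [e4 e5 e6]] := stE (oadd (acc (sV s)) (omul a (b2 M))) one (sz s) (sV s) mZ a.
    have hx : expv V1 (pfst (sz s)) a by left.
    have ea := expvE KM oV1 dz hx; have es := expvE KM oV' dg he.
    have dea : odom (omul a (b2 M)).
      apply: dom_omul => //; rewrite ea; apply: dom_oexp => //; apply: dom_omul => //; exact: std_dom.
    split.
      split; first by rewrite e1; apply: dom_oadd.
      split; first by rewrite e3 e4.
      split; first by rewrite e4.
      by right; rewrite e1 e2 e3 e4 e6.
    by rewrite e1 mu; apply: oadd_lt => //; rewrite ea es; apply: expgap.
  have h1 : ~ (sph s <> one) by rewrite ph.
  have he1 := expv_ext E1 he.
  (* If [T] has halted although [sH] fails, its output refutes an answer of oracle [n], which is now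
     corrected. Otherwise a query of [T] is simulated. *)
  rewrite /sN iteF //; case: (pselect (iH T x (sz s) (sV s))) => hH.
    have ho : pfst (iO T x (sz s) (sV s)) = tag n M by apply: contrapT => ho; apply: nH.
    rewrite iteT // /nB; set o := psnd (iO _ _ _ _); set q := pair (tag n M) (psnd o).
    have [r c1 c2 ltv] : viol n (sV s) (pfst o) (psnd o).
      case: (il_halt KM oV hI hH) => [[e' _]|[i li [ei vi]]]; first by rewrite ho in e'; case: (te_tag (esym e')).
      by rewrite ho in ei; rewrite -(tag_inj ei) in vi.
    set w := ent (sV s) q; have [sw kw nw] := ent_reg r; rewrite -/q -/w in sw kw nw.
    set rn := dvl (sp n) (sV s) (pair (pfst o) (psnd o)) in ltv *.
    have fw : first w (pair x V1).
      by have [_] := hL1 w sw; rewrite kw pfstE => -[[]//|[[_ []]|[_ [_]]]].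
    have [[iw [hw qw]] [xw [drw [rwb [rkw aw]]]]] := fw; rewrite !(pfstE, psndE) in iw hw qw xw rkw.
    have [dzw dEw nEw _] := first_facts KM oV1 sw fw iw (psndE _ _).
    have [_ _ hsg] := spP n.
    have [drn rnb] : odom rn /\ ole rn (b M) by apply: hsg.
    have [dr0 r0b] := hsg M (look (sV s)) (pair (look (sV s) q) (psnd o)).
    have low j c : j < n -> reg (sV s) (pair (tag j M) c) -> reg V1 (pair (tag j M) c) /\
       look V1 (pair (tag j M) c) = look (sV s) (pair (tag j M) c).
      move=> lj; apply: (low_look hL1); rewrite pfstE => /tag_inj ej; by rewrite ej ltnn in lj.
    (* An initial guess has rank [b], which bounds the refuted ordinal. A corrected answer has this
       ordinal as its rank, evaluated with the same answers of the lower oracles. *)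
    have ltr : olt rn (er w).
      case: rkw => [->|[_ ->]]; first exact: olt_le_tr ltv r0b.
      by rewrite kw psndE; have [_ ->] := cert_ext (spP n) low c2.
    have tV0 : psnd w = mZ \/ suf (psnd w) (sV s) by apply: tl_suf sw.
    have dV0 : odom (acc (psnd w)) by apply: (dom_acc hL1).
    have oV0 : ok (psnd w) by case: tV0 => [->|/(ok_suf oV)//]; exact: ok0.
    have dm : odom (omul (eE w) rn) by apply: dom_omul.
    have [||||hs1 ->] := @adv_ok M x (ez w) q (pfst o) (oadd (acc (psnd w)) (omul (eE w) rn)) (eE w) rn (psnd w) V1 KM oV1 oV0 iw hw.
    - by rewrite -qw.
    - by apply: ok_push => //; rewrite pfstE => /esym/te_tag.
    - exact: xw.
    - move=> u /suf_push[->|u0]; last first.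
        by apply: hL1; apply: (suf_trans sw); apply/sufE; [exact: (suf_nz sw)|right].
      split; rewrite !exE; first exact: dom_oadd.
      right; right; rewrite pfstE; split=> //; split=> //.
      have eqw : q = iQ T x (ez w) (psnd w) by rewrite -qw kw.
      rewrite /first /rank !exE !(pfstE, psndE); split=> //; split=> //; split=> //; split=> //.
      by split=> //; right; have [? ->] := cert_ext (spP n) low c1.
    split=> //; have d1 := @dom1 P M.
    (* With acc' and E taken at [w], the new ordinal acc' + E . (rn + 1) is at most acc' + E . er w,
       which is the accumulated ordinal at [w] and hence at most that of the whole table; the
       current state exceeds the latter by a nonzero term. *)
    have -> : oadd (oadd (acc (psnd w)) (omul (eE w) rn)) (eE w) = oadd (acc (psnd w)) (omul (eE w) (oadd rn (oone M))).
      by rewrite omulD // omul1r // oaddA.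
    have dE2 : odom (omul (sE s) (b2 M)) by apply: dom_omul.
    have drn1 := dom_oadd drn d1; have dmr := dom_omul dEw drw; have dmn := dom_omul dEw drn1.
    apply: (@ole_lt_tr _ _ _ (acc w)) => //.
    - exact: dom_oadd.
    - by apply: (dom_acc hL1); right.
    - by rewrite aw; apply: oadd_le2 => //; apply: omul_le2 => //; apply: olt_disc.
    apply: (@ole_lt_tr _ _ _ (acc (sV s))) => //.
    - by apply: (dom_acc hL1); right.
    - exact: (acc_mono KM oV1 hL1).
    - rewrite mu; apply: olt_addr => //; apply: omul_nz => //; exact: oadd1_nz.
  rewrite iteF // /nQ; set q := iQ T x (sz s) (sV s).
  set v := ite (pfst q = tag n M) _ _; set ac := ite _ _ _; have d1 := @dom1 P M.
  have [vn vl] : (pfst q = tag n M -> v = look (sV s) q) /\ (pfst q <> tag n M ->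
      [/\ v = look V1 q, reg V1 q & (pfst q = te M -> odom (psnd q) -> v = oexp (psnd q))]).
    split=> h; rewrite /v; first by rewrite iteT.
    have eQ : sQ x s V' = q by rewrite /sQ iteF // iteT.
    by rewrite eQ in hd hr hte; rewrite iteF // headE.
  (* The coefficient is [b] for a first query to oracle [n] and [ozero] for every other query; in
     both cases c + 1 <= b1 < b2. *)
  have [c [dc cb eac]] : exists c, [/\ odom c, ole c (b M) & ac = oadd (acc (sV s)) (omul (sE s) c)].
    rewrite /ac; case: (pselect (pfst q = tag n M /\ ~ reg (sV s) q)) => h; [rewrite iteT //|rewrite iteF //].
      by exists (b M); split=> //; right.
    exists (ozero M); split; [exact: dom0|exact: ole0|].
    by rewrite omul0r // oadd0r.
  have dac : odom ac by rewrite eac; apply: dom_oadd => //; apply: dom_omul.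
  have [|||hs1 ->] := @adv_ok M x (sz s) q v ac (sE s) (b M) (sV s) V1 KM oV1 oV hI hH erefl.
  - apply: ok_push => // [r|ht hd'].
      case: (pselect (pfst q = tag n M)) => [/vn//|nq]; have [-> _ _] := vl nq.
      by have [] := low_look hL1 nq r.
    case: (pselect (pfst q = tag n M)) => [hn|/vl[_ _ ->]//].
    by rewrite ht in hn; case: (te_tag hn).
  - exact: he1.
  - move=> u /suf_push[->|/hL1//]; split; rewrite !exE //.
    case: (pselect (pfst q = tag n M)) => hn; last first.
      have [-> r1 _] := vl hn; left; rewrite psndE; do 3 split=> //.
      by rewrite /ac iteF // => -[].
    right; case: (pselect (reg (sV s) q)) => r; [left|right; do 2 split=> //].
      by do 2 split=> //; rewrite vn // /ac iteF // => -[].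
    rewrite /first /rank !exE !(pfstE, psndE); split=> //; split=> //; split=> //; split; first by right.
    by split; [left|rewrite /ac iteT].
  split=> //; rewrite mu eac.
  have -> : oadd (oadd (acc (sV s)) (omul (sE s) c)) (sE s) = oadd (acc (sV s)) (omul (sE s) (oadd c (oone M))).
    by rewrite omulD // omul1r // oaddA //; apply: dom_omul.
  have dc1 := dom_oadd dc d1.
  apply: oadd_lt => //; try exact: dom_omul; apply: omul_lt => //.
  by apply: (@ole_lt_tr _ _ _ (b1 M)) => //; [apply: oadd_le|apply: olt_add1].
Qed.
End Step.

(** * Removal of all oracles *)

Lemma ils_down n : ils n.+1 -> ils n.
Proof.
move=> T; have [[_ _ sk] _] := il_def T; have [sb0 _ _] := spP n; have s1 := @std1 P.
pose (c := fun M => omul (oadd (oadd (oadd (sb (sp n) M) (oone M)) (oone M)) (oone M)) (oadd (ik T M) (oone M))).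
have sc : std c by apply: std_mul; repeat apply: std_add.
by have /cid2[k' sk' k'E] := std_oexp sc; exact: (step_ils sk' k'E).
Qed.

(** For [n = 0] the only queries left are those for [oexp]. In models in [K] they have true answers
    with witnesses for the graph, which are kept as extra components of the table; so [K_search]
    makes [B] total in [K], and [K_sLS] turns this into a local search. *)
Lemma ils_sLS n : rel2 B -> ils n -> sLS B.
Proof.
move=> dB; elim: n => [T|n IH T]; last by apply: IH; apply: ils_down.
have [[d1 d2 sk] [d3 d4 d5 d6]] := il_def T; have [H dH HE] := Kdef_oexp.
pose (wl := fun (M : pvm) (u X : M) => pfst (ekey u) = te M /\ H M (eex u) (evl u) (psnd (ekey u))).
have dwl : rel2 wl by rewrite /wl; pdt.
pose (G := fun (M : pvm) (g z x : M) => pfst (pfst z) = g /\ iI T x (pfst z) (psnd z) /\ allsuf wl (psnd z) mZ).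
apply: K_sLS => // M KM x; have [hI ek] := il_init T x KM.
apply: (@K_search P G B (ik T) _ dB sk _ M KM (ik T M) (pair (iz T x) mZ)).
- by rewrite /G; pdt.
- move=> {}M {}KM g z {hI ek} {}x dg [eg [hI hw]].
  have fV : fits (fun q => oexp (psnd q)) (psnd z).
    by move=> u /hw[_ h]; apply/(HE M KM); exists (eex u).
  have oV : ok (psnd z).
    move=> u uV; split; last by move=> _ _; exact: fV.
    by rewrite (fits_look fV) ?fV //; apply/regP; exists u.
  case: (pselect (iH T x (pfst z) (psnd z))) => hH.
    by left; case: (il_halt KM oV hI hH) => [[_ ?]|[]//]; exists (psnd (iO T x (pfst z) (psnd z))).
  right; have [[te|[]//] hs] := il_step KM oV hI hH.
  set q := iQ T x (pfst z) (psnd z) in te hs.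
  have [w hq] := proj2 (HE M KM (psnd q) _) erefl.
  have [|hI1 lt] := hs (oexp (psnd q)) w.
    by apply: ok_push => // r; rewrite (fits_look fV).
  set V1 := push _ _ _ _ in hI1 lt.
  exists (pfst (iN T x (pfst z) V1)), (pair (iN T x (pfst z) V1) V1); split.
  + exact: il_dom hI1.
  + by rewrite -eg.
  + rewrite /G !(pfstE, psndE); split=> //; split=> // u /suf_push[->|/hw//].
    by rewrite /wl ekeyE evlE eexE.
- exact: std_dom.
- by right.
- by rewrite /G !(pfstE, psndE); split=> //; split=> // u /suf0.
Qed.
End MinimizationSearch.

(** ** Searches that follow a straight-line program *)

Lemma ext_trans (M : pvm) (V V1 V2 : M) : ext V V1 -> ext V1 V2 -> ext V V2.
Proof. by move=> h h' q /h[r <-]; have [] := h' _ r. Qed.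

Lemma runs_ext I (key : I -> nat) (M : pvm) (F : M -> M) qs (x W W' : M) : runs key F qs x W W' -> ext W W'.
Proof.
elim: qs W => [|ih qs IH] W /= => [-> q //|[e /IH h]].
by apply: ext_trans h; apply: ext_push.
Qed.

(** The queries of [t], arguments first. In contrast to [compile], arguments are evaluated with
    [look] in the table reached so far, whatever the positions of their entries. *)
Fixpoint qof (t : oterm 1) : seq (nat * F2) :=
  if t is tapp k f ts then
    flatten [seq qof (ts j) | j <- enum 'I_k] ++
    match f in osym _ _ k return ('I_k -> oterm 1) -> seq (nat * F2) with
    | o_base _ _ => fun _ => [::]
    | o_orc i => fun ts => [:: (i, fun M x W => ev (M := oS (look W)) (fun _ => x) (ts ord0))]
    end ts
  else [::].

Lemma In_mem (T : eqType) (s : seq T) j : j \in s -> List.In j s.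
Proof. by elim: s => //= a s IH; rewrite inE => /orP[/eqP ->|/IH]; [left|right]. Qed.

Lemma runs_flatten (M : pvm) (F : M -> M) (T : Type) (q : T -> seq (nat * F2)) s (x W W' : M) :
  runs id F (flatten [seq q j | j <- s]) x W W' ->
  forall j, List.In j s -> exists W1 W2, runs id F (q j) x W1 W2 /\ ext W2 W'.
Proof.
elim: s W => //= j0 s IH W /runs_cat[W1 r1 r2] j [<-|/(IH _ r2)//].
by exists W, W1; split=> //; apply: runs_ext r2.
Qed.

Lemma qsdef_flatten (T : Type) (q : T -> seq (nat * F2)) s : (forall j, qsdef (q j)) ->
  qsdef (flatten [seq q j | j <- s]).
Proof. by move=> h; elim: s => //= j s IH; apply: qsdef_cat. Qed.

Lemma qsdef_cons I (ih : I * F2) qs : qsdef (ih :: qs) -> def2 ih.2 /\ qsdef qs.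
Proof. by move=> h; split=> [|j jq]; apply: h; [left|right]. Qed.

Lemma qsdef_qof t : qsdef (qof t).
Proof.
elim: t => [i|k f ts IH]; first by case.
rewrite [qof _]/=; apply: qsdef_cat; first exact: qsdef_flatten.
case: f ts {IH} => [{}k f|l] ts //= ih [<-|[]] /=.
have := def_oev (ts ord0) => d.
by rewrite /def2; apply: (@fd_app2 _ _ _ _ d); fdt.
Qed.

Lemma oidxT n (t : oterm n) : oidx (fun=> True) t.
Proof. by elim: t => //= k f ts IH; split=> //; case: f {IH}. Qed.

Lemma qof_treg (t : oterm 1) (M : pvm) (F : M -> M) (x W W' V : M) :
  runs id F (qof t) x W W' -> ext W' V -> treg V (fun _ => x) t.
Proof.
elim: t W W' V => //= k f ts IH W W' V /runs_cat[W1 /runs_flatten r1 r2] e2.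
have {}IH V1 : ext W1 V1 -> forall j, treg V1 (fun _ => x) (ts j).
  move=> e1 j; have [|W2 [W3 [r3 e3]]] := r1 j; first by apply: In_mem; rewrite mem_enum.
  by apply: IH r3 _; apply: ext_trans e1.
have e1 := ext_trans (runs_ext r2) e2; split; first exact: IH.
case: f ts {r1} IH r2 => [{}k f|l] ts IH //= [e E2]; subst W'.
have [_ ->] := treg_ext (oidxT (ts ord0)) (fun j a _ => e1 _) (IH W1 (fun q r => conj r erefl) ord0).
by have [] := e2 (pair (tag l M) (ev (M := oS (look W1)) (fun _ => x) (ts ord0))); first by apply/reg_push; right.
Qed.

Section StraightLineSearch.
Context {P : ptrep}.

(* [rq] lists the queries in reverse order. *)
Fixpoint isrun (rq : seq (nat * F2)) (M : pvm) (x V : M) : Prop :=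
  if rq is ih :: rq then
    V = push (qkey id ih x (psnd V)) (evl V) (eex V) (psnd V) /\ isrun rq x (psnd V)
  else V = mZ.

Lemma rel_isrun rq : qsdef rq -> rel2 (isrun rq).
Proof.
elim: rq => [|ih rq IH]; first by move=> _; rewrite /isrun; pdt.
by move=> /qsdef_cons[dh /IH{}IH]; rewrite /= /qkey; pdt.
Qed.

Lemma isrun_runs rq (M : pvm) (F : M -> M) (x V : M) : isrun rq x V -> fits F V -> runs id F (rev rq) x mZ V.
Proof.
elim: rq V => [|ih rq IH] V //= [e r] f.
have nV : V <> mZ by rewrite e; exact: push_nz.
rewrite rev_cons -cats1; apply/runs_cat; exists (psnd V).
  by apply: IH => // u uV; apply: f; apply/sufE => //; right.
exists (eex V); rewrite /= {1}e; congr push.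
by rewrite f; [congr F; rewrite [in LHS]e ekeyE|apply: suf_refl].
Qed.

(** A finite disjunction over the positions in the program, hence open: [psnd z] is the number of
    queries that are left, and the table records a run of those already asked. *)
Fixpoint bI rq qs (M : pvm) (x z V : M) : Prop :=
  (psnd z = mnum (size qs) M /\ isrun rq x V) \/ (if qs is ih :: qs then bI (ih :: rq) qs x z V else False).

Lemma rel_bI rq qs : qsdef rq -> qsdef qs -> rel3 (bI rq qs).
Proof.
elim: qs rq => [|ih qs IH] rq dr dq /=; have d := rel_isrun dr; first by pdt.
have [dh {}dq] := qsdef_cons dq.
have {}IH : rel3 (bI (ih :: rq) qs) by apply: IH => // j [<-//|/dr].
by pdt.
Qed.

Lemma bIP rq qs (M : pvm) (x z V : M) : bI rq qs x z V <->
  exists qs1 qs2, [/\ qs = qs1 ++ qs2, psnd z = mnum (size qs2) M & isrun (catrev qs1 rq) x V].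
Proof.
elim: qs rq => [|ih qs IH] rq /=.
  split=> [[[e r]|//]|[[|? ?] [[|? ?] [// _ e r]]]]; last by left.
  by exists [::], [::].
rewrite IH; split=> [[[e r]|[qs1 [qs2 [-> e r]]]]|[[|j qs1] [qs2 [eq e r]]]].
- by exists [::], (ih :: qs).
- by exists (ih :: qs1), qs2.
- by left; rewrite /= in eq; rewrite -eq in e.
- by right; exists qs1, qs2; case: eq r => -> ->.
Qed.

Fixpoint bQ qs (M : pvm) (x z V : M) : M :=
  if qs is ih :: qs then ite (psnd z = mnum (size qs).+1 M) (qkey id ih x V) (bQ qs x z V) else mZ.

Lemma def_bQ qs : qsdef qs -> def3 (bQ qs).
Proof.
elim: qs => [|ih qs IH]; first by move=> _; rewrite /bQ; fdt.
by move=> /qsdef_cons[dh /IH{}IH]; rewrite /= /qkey; fdt.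
Qed.

Lemma bQE qs1 ih qs2 (M : pvm) (x z V : M) : psnd z = mnum (size qs2).+1 M ->
  bQ (qs1 ++ ih :: qs2) x z V = qkey id ih x V.
Proof.
move=> e; elim: qs1 => [|j qs1 IH] /=; first by rewrite iteT.
by rewrite iteF // e => h; have := @mnum_inj M _ _ (h : mnum _ M = mnum _.+1 M); rewrite size_cat /=; lia.
Qed.

Variables (sp : nat -> spec) (B : R2) (n : nat) (qs : seq (nat * F2)) (O : F2).
Hypotheses (dqs : qsdef qs) (ltq : forall ih, List.In ih qs -> ih.1 < n) (dO : def2 O).
Hypothesis HO : forall (M : pvm) (x V : M), ok V -> runs id (look V) qs x mZ V -> good sp B n V x (O x V).

Lemma straight_ils : ils sp B n.
Proof.
pose (k := fun M => onat (mnum (size qs) M)).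
have sk : std k.
  apply: (@std_nat P k (teval (tnth [tuple size qs]) (o_nat oO))) => [M|]; last exact: dom_onat.
  by rewrite -ev_mnum (tnth_comp1 (fun c => mnum c M)) tnth1E.
pose (I := fun (M : pvm) (x z V : M) => pfst z = onat (psnd z) /\ bI [::] qs x z V).
have dI : rel3 I by have d := @rel_bI [::] qs (fun _ h => match h with end) dqs; rewrite /I; pdt.
have dQ := def_bQ dqs.
apply: (@Ils P sp B n I (fun M x z V => psnd z = mZ) (bQ qs)
  (fun M x z V => pair (onat (mpred (psnd z))) (mpred (psnd z))) (fun M x z V => O x V)
  (fun M x => pair (onat (mnum (size qs) M)) (mnum (size qs) M)) k).
- split; split=> //; try (by pdt); by fdt.
- move=> M x KM; rewrite /I !(pfstE, psndE); do 2 split=> //; apply/bIP; exists [::], qs.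
  by rewrite psndE.
- by move=> M x z V KM [-> _]; exact: dom_onat.
- move=> M x z V KM oV [ez /bIP[qs1 [qs2 [eqs e r]]]] z0; apply: HO => //.
  have q2 : qs2 = [::].
    by case: qs2 e {eqs} => //= j qs2; rewrite z0 => /esym/succ_nz.
  rewrite q2 cats0 in eqs; rewrite eqs -[qs1]revK; apply: isrun_runs => //.
  by move=> u /oV[].
- move=> M x z V KM oV [ez /bIP[qs1 [[|ih qs2] [eqs e r]]]] nz; first by case: nz.
  have -> : bQ qs x z V = qkey id ih x V by rewrite eqs bQE.
  split.
    right; exists ih.1; last by rewrite /qkey pfstE.
    by apply: ltq; rewrite eqs; apply/List.in_app_iff; right; left.
  move=> a w V1 oV1; rewrite pfstE; split; last first.
    by rewrite ez -{2}(succ_pred nz); apply: onat_succ.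
  split; first by rewrite pfstE psndE.
  apply/bIP; exists (rcons qs1 ih), qs2; split; first by rewrite cat_rcons.
    by rewrite psndE e -[mnum _ _]/(msucc (mnum (size qs2) M)) pred_succ.
  rewrite catrevE cats0 in r; rewrite catrevE cats0 rev_rcons.
  by split; rewrite /V1 psnd_push // evlE eexE.
Qed.
End StraightLineSearch.

(** * Elimination of quantifiers by minimization oracles *)

Definition ofd I n (G : forall M : pvm, (M -> M) -> ('I_n -> M) -> M) :=
  exists2 t : oterm n, oidx I t & forall (M : pvm) (F : M -> M) x, ev (M := oS F) x t = G M F x.

Lemma ofd_mono (I I' : nat -> Prop) n G : (forall i, I i -> I' i) -> @ofd I n G -> @ofd I' n G.
Proof.
move=> h [t it e]; exists t => //; elim: t it {e} => //= k f ts IH [h1 h2].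
by split=> [j|]; [apply: IH|case: f h2 {IH h1} => //= l /h].
Qed.

Lemma oidx_base I n (t : pvterm n) : oidx I (tmap (@o_base pvsym nat) t).
Proof. by elim: t. Qed.

Lemma oidx_tsubst I n m (s : 'I_n -> oterm m) (t : oterm n) : (forall j, oidx I (s j)) -> oidx I t ->
  oidx I (tsubst s t).
Proof. by move=> hs; elim: t => //= k f ts IH [h1 h2]; split=> // j; apply: IH. Qed.

Lemma ofd_fd I n (G : forall M : pvm, ('I_n -> M) -> M) : fd G -> ofd I (fun M F x => G M x).
Proof.
move=> [t e]; exists (tmap (@o_base pvsym nat) t); first exact: oidx_base.
by move=> M F x; rewrite ev_obase e.
Qed.

Lemma ofd_comp I n m (H : forall M : pvm, (M -> M) -> ('I_n -> M) -> M)
  (G : 'I_n -> forall M : pvm, (M -> M) -> ('I_m -> M) -> M) : ofd I H -> (forall j, ofd I (G j)) ->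
  ofd I (fun M F x => H M F (fun j => G j M F x)).
Proof.
move=> [t it e] hG; have /choice[s sE] : forall j, exists s : oterm m, oidx I s /\
  forall (M : pvm) (F : M -> M) x, ev (M := oS F) x s = G j M F x by move=> j; have [s] := hG j; exists s.
exists (tsubst s t); first by apply: oidx_tsubst => // j; have [] := sE j.
move=> M F x; rewrite ev_tsubst e; congr (H M F _); apply/funext => j; by have [_ ->] := sE j.
Qed.

Lemma ofd_app1 I (f : F1) m G : def1 f -> @ofd I m G -> ofd I (fun M F x => f M (G M F x)).
Proof. by move=> df dG; apply: (@ofd_comp _ _ _ _ (fun _ => G) (ofd_fd _ df)). Qed.

Lemma ofd_app2 I (f : F2) m G G' : def2 f -> @ofd I m G -> @ofd I m G' ->
  ofd I (fun M F x => f M (G M F x) (G' M F x)).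
Proof.
move=> df dG dG'.
have := @ofd_comp I 2 m (fun M F x => f M (x (v0 1)) (x (v1 0))) (scons G (scons G' (@env0 _))) (ofd_fd _ df).
case=> [j|t it e].
  case: (unliftP ord0 j) => [j'|] ->; rewrite ?sconsS ?scons0 //.
  by case: (unliftP ord0 j') => [[]//|] ->; rewrite scons0.
by exists t => // M F x; rewrite e !scE.
Qed.

Lemma ofd_var I n (i : 'I_n) : ofd I (fun M F x => x i).
Proof. by exists (tvar i). Qed.

Lemma ofd_orc (I : nat -> Prop) n l G : I l -> @ofd I n G ->
  ofd I (fun M F x => F (pair (tag l M) (G M F x))).
Proof.
move=> Il [t it e]; exists (tapp (o_orc l) (fun _ => t)) => // M F x.
by rewrite -e.
Qed.

Lemma ofd_scons I n m H (G : forall M : pvm, (M -> M) -> ('I_m -> M) -> M)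
   (G' : 'I_n -> forall M : pvm, (M -> M) -> ('I_m -> M) -> M) : ofd I H -> ofd I G -> (forall j, ofd I (G' j)) ->
  ofd I (fun M F x => H M F (scons (G M F x) (fun j => G' j M F x))).
Proof.
move=> dH dG dG'; have [j|t it e] := @ofd_comp I _ _ H (scons G G') dH.
  by case: (unliftP ord0 j) => [j'|] ->; rewrite ?sconsS ?scons0.
exists t => // M F x; rewrite e; congr (H M F _); apply/funext => j.
by case: (unliftP ord0 j) => [j'|] ->; rewrite ?sconsS ?scons0.
Qed.

Section Translation.
Context {P : ptrep}.

(** Fills the indices beyond a list of specifications. Its ordinal is constantly zero, so none of
    its answers can be refuted. *)
Definition sp0 : spec := Spec (tmap (@o_base pvsym nat) (twk 1 (o_zero oO))) ozero.
Definition spL (L : seq spec) i := nth sp0 L i.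
Definition lt_ N i := i < N.

Lemma sp0_ok i : spec_ok i sp0.
Proof.
split; [exact: std0|exact: oidx_base|].
move=> M F p; have -> : dv sp0 F p = ozero M by rewrite /dv /= ev_obase; apply: ZeroE.
by split; [exact: dom0|right].
Qed.

Definition Lok L := forall i, spec_ok i (spL L i).

Lemma Lok_nil : Lok [::]. Proof. by move=> i; rewrite /spL nth_nil; exact: sp0_ok. Qed.

Definition nov L (M : pvm) (F : M -> M) := forall i, i < size L -> forall u s,
  ~ olt (dv (spL L i) F (pair u s)) (dv (spL L i) F (pair (F (pair (tag i M) s)) s)).

Lemma nov_cat L L1 (M : pvm) (F : M -> M) : nov (L ++ L1) F -> nov L F.
Proof.
move=> h i li u s; have := h i _ u s; rewrite /spL nth_cat li; apply.
by rewrite size_cat ltn_addr.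
Qed.

Lemma new_oracle L D (k : cst) : Lok L -> ofd (lt_ (size L)) D -> std k ->
  (forall (M : pvm) F (p : 'I_1 -> M), odom (D M F p) /\ ole (D M F p) (k M)) ->
  exists s, Lok (L ++ [:: s]) /\ forall (M : pvm) (F : M -> M), nov (L ++ [:: s]) F -> forall u x : M,
    ~ olt (D M F (fun _ => pair u x)) (D M F (fun _ => pair (F (pair (tag (size L) M) x)) x)).
Proof.
move=> okL [t it e] sk hD; exists (Spec t k); split.
  move=> i; rewrite /spL nth_cat; case: ltnP => li; first by have := okL i; rewrite /spL.
  case: (ltnP (size L) i) => li'.
    by rewrite nth_default; [exact: sp0_ok|rewrite /=; lia].
  have -> : i = size L by lia.
  by rewrite subnn; split=> // M F p; rewrite /dv /= e.
move=> M F h u x; have := h (size L) _ u x; rewrite /spL nth_cat ltnn subnn /= /dv /= !e; apply.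
by rewrite size_cat /= addn1.
Qed.

Definition denc n (G : forall M : pvm, (M -> M) -> ('I_n.+1 -> M) -> M) (M : pvm) (F : M -> M) (p : 'I_1 -> M) : M :=
  G M F (scons (pfst (p ord0)) (fun j => prj j (psnd (p ord0)))).

Lemma ofd_denc I n G : @ofd I n.+1 G -> ofd I (denc G).
Proof.
move=> dG; apply: ofd_scons => // [|j]; apply: ofd_app1; try exact: def_pfst; try exact: ofd_var.
  exact: def_prj.
by apply: ofd_app1; [exact: def_psnd|exact: ofd_var].
Qed.

Lemma dencE n (G : forall M : pvm, (M -> M) -> ('I_n.+1 -> M) -> M) (M : pvm) (F : M -> M) (u : M) (x : 'I_n -> M) :
  denc G F (fun _ => pair u (enc x)) = G M F (scons u x).
Proof.
by rewrite /denc pfstE; congr (G M F (scons u _)); apply/funext => j; rewrite psndE prjE.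
Qed.

Lemma ofd_enc I n : ofd I (fun M F (x : 'I_n -> M) => enc x).
Proof.
elim: n => [|n IH]; first by rewrite /=; apply: (@ofd_fd _ _ (fun M x => mZ)); fdt.
apply: (@ofd_app2 _ pair); [exact: def_pair|exact: ofd_var|].
exact: (@ofd_comp _ _ _ _ (fun (j : 'I_n) M F x => x (lift ord0 j)) IH (fun j => ofd_var _ _)).
Qed.

Lemma lt_cat (L L1 : seq spec) i : lt_ (size L) i -> lt_ (size (L ++ L1)) i.
Proof. by rewrite /lt_ size_cat => h; rewrite ltn_addr. Qed.

Definition decides L n (A : pvform n) (G : forall M : pvm, (M -> M) -> ('I_n -> M) -> M) :=
  forall (M : pvm) (F : M -> M), nov L F -> forall x : 'I_n -> M, sat (M := M) A x <-> G M F x = mZ.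

(** New specifications are appended to [L], so each one refers only to oracles with smaller index
    and the meaning of the earlier ones is preserved; a list can then be extended for one formula
    after another. *)
Lemma translation n (A : pvform n) L : Lok L -> exists L1, Lok (L ++ L1) /\
  exists2 G, ofd (lt_ (size (L ++ L1))) G & decides (L ++ L1) A G.
Proof.
elim: A L => {n} [n|n t u|n A IA B IB|n A IA] L okL.
- exists [::]; rewrite cats0; split=> //; exists (fun M F x => one).
    by apply: (@ofd_fd _ _ (fun M x => one)); fdt.
  by move=> M F _ x; split=> // /one_nz.
- exists [::]; rewrite cats0; split=> //; exists (fun (M : pvm) F x => eqt (ev (M := M) x t) (ev (M := M) x u)).
    by apply: (@ofd_app2 _ eqt); [exact: def_eqt|apply: ofd_fd; exists t|apply: ofd_fd; exists u].
  by move=> M F _ x; rewrite eqtP.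
- have [L1 [ok1 [G dG GE]]] := IA L okL; have [L2 [ok2 [G' dG' GE']]] := IB _ ok1.
  exists (L1 ++ L2); rewrite catA; split=> //; exists (fun M F x => cond (G M F x) (G' M F x) mZ).
    apply: (@ofd_app2 _ (fun M a b => cond a b mZ)) => //; first by fdt.
    exact: ofd_mono (@lt_cat _ _) dG.
  move=> M F h x; have hA := GE M F (nov_cat h) x; have hB := GE' M F h x; rewrite /= hA hB.
  case: (pselect (G M F x = mZ)) => [e|n']; rewrite ?e ?cond0 ?cond1 //.
  by split=> // hh; apply: hh.
- have [L1 [ok1 [G dG GE]]] := IA L okL; have d0 := @dom0 P; have d1 := @dom1 P.
  (* Minimizing the truth value of the body, 1 where it holds and 0 where it fails, produces a
     counterexample if there is one. The universal formula is thus decided by testing its body at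
     the answer. *)
  pose (h := fun (M : pvm) (a : M) => ite (a = mZ) (oone M) (ozero M)).
  have dh : def1 h by rewrite /h; fdt.
  have [||s [oks sE]] := @new_oracle (L ++ L1) (fun M F p => h M (denc G F p)) oone ok1 _ (@std1 P).
  + by apply: ofd_app1 => //; apply: ofd_denc.
  + move=> M F p; rewrite /h; case: (pselect (denc G F p = mZ)) => e; [rewrite iteT //|rewrite iteF //].
      by split=> //; right.
    by split=> //; apply: ole0.
  exists (L1 ++ [:: s]); rewrite catA; split=> //.
  exists (fun M F x => G M F (scons (F (pair (tag (size (L ++ L1)) M) (enc x))) x)).
    apply: ofd_scons => [||j]; last exact: ofd_var.
      exact: ofd_mono (@lt_cat _ _) dG.
    by apply: ofd_orc; [rewrite /lt_ !size_cat /=; lia|exact: ofd_enc].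
  move=> M F hn x; split=> [hA|e a]; first by apply/(GE M F (nov_cat hn)); apply: hA.
  apply/(GE M F (nov_cat hn)); apply: contrapT => na; have := sE M F hn a (enc x).
  rewrite !dencE /h iteF // iteT //; apply.
  by apply: olt_nz => //; exact: one_nz_o.
Qed.

(** Common core of the two induction schemes: for an [h] that is the ordinal of [u] where [A] fails
    and maximal where [A] holds, the answer [u0] is a least counterexample. *)
Lemma minimum n (A : pvform n.+1) (h : F2) (k : cst) L : Lok L -> def2 h -> std k ->
  (forall (M : pvm) (a u : M), odom (h M a u) /\ ole (h M a u) (k M)) ->
  exists L1, Lok (L ++ L1) /\ forall (M : pvm) (F : M -> M), nov (L ++ L1) F -> forall x : 'I_n -> M,
    exists (c : M -> M) (u0 : M), (forall u, sat (M := M) A (scons u x) <-> c u = mZ) /\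
      forall u, ~ olt (h M (c u) u) (h M (c u0) u0).
Proof.
move=> okL dh sk hk; have [L1 [ok1 [G dG GE]]] := translation A okL.
have [||s [oks sE]] := @new_oracle (L ++ L1) (fun M F p => h M (denc G F p) (pfst (p ord0))) k ok1 _ sk.
- apply: ofd_app2 => //; first exact: ofd_denc.
  by apply: ofd_app1; [exact: def_pfst|exact: ofd_var].
- by move=> M F p; apply: hk.
exists (L1 ++ [:: s]); rewrite catA; split=> // M F hn x.
exists (fun u => G M F (scons u x)), (F (pair (tag (size (L ++ L1)) M) (enc x))); split.
  by move=> u; apply: GE; apply: nov_cat hn.
by move=> u; have := sE M F hn u (enc x); rewrite !dencE !pfstE.
Qed.

Lemma ev_tZ (M : pvm) n (x : 'I_n -> M) : ev (M := M) x tZ = mZ.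
Proof. by rewrite /= /mZ; congr sapp; apply: env0E. Qed.

Lemma induction_ok n (A : pvform n.+1) L : Lok L -> exists L1, Lok (L ++ L1) /\
  forall (M : pvm) (F : M -> M), nov (L ++ L1) F -> forall x : 'I_n -> M,
    sat (M := M) (fimp (inst A tZ) (fimp (fall (fimp A (inst_var A (tsucc (tvar ord0))))) (fall A))) x.
Proof.
move=> okL; pose (h := fun (M : pvm) (a u : M) => ite (a = mZ) (oomega M) (onat u)).
have [||L1 [ok1 H]] := @minimum n A h oomega L okL _ (@stdw P).
- by rewrite /h; fdt.
- move=> M a u; rewrite /h; case: (pselect (a = mZ)) => e; [rewrite iteT //|rewrite iteF //].
    by split; [exact: domw|right].
  by split; [exact: dom_onat|left; exact: onat_lt_w].
exists L1; split=> // M F hn x; have [c [u0 [cE cm]]] := H M F hn x; cbn [sat].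
rewrite sat_inst ev_tZ => base step a; apply/cE; apply: contrapT => na.
have {}step u : c u = mZ -> c (msucc u) = mZ.
  move=> /cE/(step u)/sat_inst_var; rewrite /tsucc ev_app1; cbn [ev]; rewrite scons0 => hA.
  exact/cE.
have n0 : c u0 <> mZ.
  by move=> e; apply: (cm a); rewrite /h iteF // iteT //; exact: onat_lt_w.
have nz : u0 <> mZ by move=> e; apply: n0; rewrite e; apply/cE.
have n1 : c (mpred u0) <> mZ by move=> /step; rewrite succ_pred.
by apply: (cm (mpred u0)); rewrite /h !iteF // -{2}(succ_pred nz); apply: onat_succ.
Qed.

Lemma v0E (M : pvm) n a (y : 'I_n -> M) : ev (M := M) (scons a y) (v 0) = a.
Proof.
by rewrite /v; cbn [ev]; rewrite (_ : inord 0 = ord0) ?scons0 //; apply/val_inj; rewrite /= inordK.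
Qed.
Lemma v1E (M : pvm) n a b (y : 'I_n -> M) : ev (M := M) (scons a (scons b y)) (v 1) = b.
Proof.
rewrite /v; cbn [ev]; rewrite (_ : inord 1 = lift ord0 ord0) ?sconsS ?scons0 //.
by apply/val_inj; rewrite /= inordK.
Qed.

Lemma ti_sat (M : pvm) n (A : pvform n.+1) beta (x : 'I_n -> M) : sat (M := M) (ti_formula oO beta A) x <->
  ((forall g : M, odom g -> olt g (mnum beta M) ->
     (forall d : M, odom d -> olt d g -> sat (M := M) A (scons d x)) -> sat (M := M) A (scons g x)) ->
   forall g : M, odom g -> olt g (mnum beta M) -> sat (M := M) A (scons g x)).
Proof.
have eA (d g : M) : sat (M := M) (fsubst A (scons (v 0) (fun i => tvar (lift ord0 (lift ord0 i))))) (scons d (scons g x))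
     <-> sat (M := M) A (scons d x).
  rewrite sat_fsubst (scons_comp (ev (M := M) (scons d (scons g x)))) v0E.
  suff -> : (fun i => ev (M := M) (scons d (scons g x)) (tvar (lift ord0 (lift ord0 i)))) = x by [].
  by apply/funext => i; cbn [ev]; rewrite !sconsS.
have num0 m (y : 'I_m -> M) : ev (M := M) y (num beta) = mnum beta M by apply: ev_num.
rewrite /ti_formula; cbn [sat]; split=> H prog g.
  have := H _ g; rewrite DomE LtE num0 v0E; apply=> {}g.
  rewrite DomE LtE num0 v0E => hg lg IH; apply: prog => // d hd ld.
  by have := IH d; rewrite DomE LtE v1E !v0E eA; apply.
rewrite DomE LtE num0 v0E; apply: H => {}g hg lg IH.
have := prog g; rewrite DomE LtE num0 v0E; apply=> // d; rewrite DomE LtE v1E !v0E eA; exact: IH.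
Qed.

Lemma ti_ok n (A : pvform n.+1) beta L : in_dom oO beta -> Lok L -> exists L1, Lok (L ++ L1) /\
  forall (M : pvm) (F : M -> M), nov (L ++ L1) F -> forall x : 'I_n -> M, sat (M := M) (ti_formula oO beta A) x.
Proof.
move=> hb okL; pose (k := (fun M => mnum beta M) : cst); have sk : std k by exists beta.
have dk := std_def0 sk.
(* Elements outside O or not below [beta] get the maximal value as well, so a minimizer below it is
   a counterexample in the range of the scheme. *)
pose (h := fun (M : pvm) (a u : M) => ite (a <> mZ /\ odom u /\ olt u (k M)) u (k M)).
have [||L1 [ok1 H]] := @minimum n A h k L okL _ sk.
- by rewrite /h; fdt.
- move=> M a u; rewrite /h; have dkM := std_dom M sk.
  case: (pselect (a <> mZ /\ odom u /\ olt u (k M))) => e; [rewrite iteT //|rewrite iteF //].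
    by case: e => _ [? ?]; split=> //; left.
  by split=> //; right.
exists L1; split=> // M F hn x; have [c [u0 [cE cm]]] := H M F hn x; apply/ti_sat => prog g dg lg.
have dkM := std_dom M sk; apply/cE; apply: contrapT => ng.
have [n0 [d0 l0]] : c u0 <> mZ /\ odom u0 /\ olt u0 (k M).
  apply: contrapT => nu; apply: (cm g); rewrite /h iteT // iteF //.
apply: n0; apply/cE; apply: prog => // d dd ld; apply/cE; apply: contrapT => nd; apply: (cm d).
have ldk : olt d (k M) by apply: olt_tr ld l0.
rewrite /h iteT // iteT //; split=> //; apply: contrapT => hh; apply: (cm g).
by rewrite /h iteT // iteF // => -[].
Qed.

Lemma axiom_ok (C : pvform 0) L : PA_TI oO C -> Lok L -> exists L1, Lok (L ++ L1) /\
  forall (M : pvm) (F : M -> M), nov (L ++ L1) F -> forall x, sat (M := M) C x.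
Proof.
move=> [[{}C hC|n A]|[beta hb [n A]]] okL.
- by exists [::]; rewrite cats0; split=> // M F _ x; apply: pvmP.
- have [L1 [ok1 H]] := induction_ok A okL; exists L1; split=> // M F hn x.
  by apply/sat_alls => y; apply: H hn _.
- have [L1 [ok1 H]] := ti_ok A hb okL; exists L1; split=> // M F hn x.
  by apply/sat_alls => y; apply: H hn _.
Qed.
End Translation.

Lemma prov_finite S (T : formula S 0 -> Prop) n (Ga : seq (formula S n)) A : prov T Ga A ->
  exists2 l : seq (formula S 0), (forall B, List.In B l -> T B) & prov (fun B => List.In B l) Ga A.
Proof.
have mono l l' m (G : seq (formula S m)) C : prov (fun B => List.In B l) G C -> (forall B, List.In B l -> List.In B l') ->
    prov (fun B => List.In B l') G C by move=> d s; apply: prov_mono s _ _ _ d.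
elim=> {n Ga A}.
- by move=> n Ga A TA; exists [:: A] => [B [<-//|[]]|]; apply: prov_thy; left.
- by move=> n Ga A h; exists [::] => //; apply: prov_hyp.
- by move=> n Ga A B _ [l lT d]; exists l => //; apply: prov_impI.
- move=> n Ga A B _ [l lT d] _ [l' lT' d']; exists (l ++ l') => [C /List.in_app_iff[/lT|/lT']//|].
  apply: (prov_impE (A := A)); [apply: mono d _ | apply: mono d' _] => C h; apply/List.in_app_iff; by [left|right].
- by move=> n Ga A _ [l lT d]; exists l => //; apply: prov_raa.
- by move=> n Ga A _ [l lT d]; exists l => //; apply: prov_allI.
- by move=> n Ga A t _ [l lT d]; exists l => //; apply: prov_allE.
- by move=> n Ga t; exists [::] => //; apply: prov_refl.
- move=> n Ga A t u _ [l lT d] _ [l' lT' d']; exists (l ++ l') => [C /List.in_app_iff[/lT|/lT']//|].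
  apply: (prov_eq (t := t)); [apply: mono d _ | apply: mono d' _] => C h; apply/List.in_app_iff; by [left|right].
Qed.

(** * From oracles that may be refuted to local search *)

Section Elimination.
Context {P : ptrep}.

Lemma theorem_ok (C : pvform 0) : PA_TI oO |- C -> exists2 L, Lok L &
  forall (M : pvm) (F : M -> M), nov L F -> forall x, sat (M := M) C x.
Proof.
move=> /prov_finite[l lT d].
suff [L okL H] : exists2 L, @Lok P L & forall (M : pvm) (F : M -> M), @nov P L M F -> forall B, List.In B l -> forall x, sat (M := M) B x.
  exists L => // M F hn x.
  by apply: (prov_sound (C := fun N => N = M :> struct _) _ d) => // B hB N -> y; apply: H hn _ hB y.
elim: l lT {d} => [|B l IH] lT; first by exists [::]; [exact: Lok_nil|].
have [|L okL H] := IH; first by move=> C' h; apply: lT; right.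
have [L1 [ok1 H1]] := axiom_ok (lT B (or_introl erefl)) okL.
exists (L ++ L1) => // M F hn B' [<-|h] x; first exact: H1 hn x.
by apply: H (nov_cat hn) _ h x.
Qed.

Lemma treg_tsubst (M : pvm) (V : M) n m (s : 'I_n -> oterm m) (x : 'I_m -> M) (t : oterm n) :
  treg V x (tsubst s t) -> treg V (fun j => ev (M := oS (look V)) x (s j)) t.
Proof.
elim: t => //= k f ts IH [h1 h2]; split=> [j|]; first exact: IH.
by case: f ts {IH h1} h2 => //= l ts; rewrite ev_tsubst.
Qed.

Lemma index_bound (qs : seq (nat * F2)) : exists m, forall ih, List.In ih qs -> ih.1 < m.
Proof.
elim: qs => [|j qs [m h]]; first by exists 0.
by exists (maxn j.1.+1 m) => ih [<-|/h]; rewrite leq_max ?leqnn // => ->; rewrite orbT.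
Qed.

Lemma rel2_char (Q : R2) : rel2 Q -> exists2 C : F2, def2 C & forall (M : pvm) (a b : M), Q M a b <-> C M a b = mZ.
Proof.
move=> /pd_char[C [t tE] CE]; exists (fun M a b => C M (scons a (scons b (@env0 M)))).
  exists t => M x; rewrite tE; congr (C M _); rewrite -[LHS]scons_eta; congr scons.
  by rewrite -[LHS]scons_eta; congr scons; apply: env0E.
by move=> M a b; rewrite -CE !scE.
Qed.

Definition outp (jt : option nat * oterm 1) (M : pvm) (x V : M) : M :=
  let w := ev (M := oS (look V)) (fun _ => x) jt.2 in
  if jt.1 is Some i then pair (tag i M) (pair (pfst w) (psnd w)) else pair (te M) w.

Lemma def_outp jt : def2 (outp jt).
Proof.
have d : def2 (fun M x V => ev (M := oS (look V)) (fun _ => x) jt.2).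
  by rewrite /def2; apply: (@fd_app2 _ _ _ _ (def_oev jt.2)); fdt.
rewrite /outp; case: jt.1 d => [i|] d; pose (w := fun (M : pvm) (x V : M) => ev (M := oS (look V)) (fun _ => x) jt.2).
  by have dw : def2 w := d; rewrite -/w; have := (_ : def2 (fun M x V => pair (tag i M) (pair (pfst (w M x V)) (psnd (w M x V))))); apply; fdt.
by have dw : def2 w := d; have := (_ : def2 (fun M x V => pair (te M) (w M x V))); apply; fdt.
Qed.

Section OraclePairs.
Variables (tp : pvterm 2) (tf ts : pvterm 1).
Hypothesis tpE : forall (M : pvm) x, ev (M := M) x tp = pair (x (v0 1)) (x (v1 0)).
Hypothesis tfE : forall (M : pvm) x, ev (M := M) x tf = pfst (x (v0 0)).
Hypothesis tsE : forall (M : pvm) x, ev (M := M) x ts = psnd (x (v0 0)).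
Definition opair n (a b : oterm n) := tsubst (scons a (scons b (@env0 _))) (tmap (@o_base pvsym nat) tp).
Definition ofst n (a : oterm n) := tsubst (fun _ => a) (tmap (@o_base pvsym nat) tf).
Definition osnd n (a : oterm n) := tsubst (fun _ => a) (tmap (@o_base pvsym nat) ts).
Lemma ev_opair (M : pvm) (F : M -> M) n x (a b : oterm n) :
  ev (M := oS F) x (opair a b) = pair (ev (M := oS F) x a) (ev (M := oS F) x b).
Proof. by rewrite ev_tsubst ev_obase tpE !scE. Qed.
Lemma ev_ofst (M : pvm) (F : M -> M) n x (a : oterm n) : ev (M := oS F) x (ofst a) = pfst (ev (M := oS F) x a).
Proof. by rewrite ev_tsubst ev_obase tfE. Qed.
Lemma ev_osnd (M : pvm) (F : M -> M) n x (a : oterm n) : ev (M := oS F) x (osnd a) = psnd (ev (M := oS F) x a).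
Proof. by rewrite ev_tsubst ev_obase tsE. Qed.

(** Evaluating these terms registers all that [viol] asks for: the ordinals of the proposed value
    and of the oracle's answer, and the refuted query itself. *)
Definition needs L (jt : option nat * oterm 1) : seq (oterm 1) :=
  if jt.1 is Some i then
    let s := osnd jt.2 in let o := tapp (o_orc i) (fun _ => s) in
    [:: tsubst (fun _ => opair (ofst jt.2) s) (sd (spL L i)); tsubst (fun _ => opair o s) (sd (spL L i)); o]
  else [::].

Lemma needs_viol L i t (M : pvm) (x V : M) : let w := ev (M := oS (look V)) (fun _ => x) t in
  (forall t', List.In t' (needs L (Some i, t)) -> treg V (fun _ => x) t') ->
  olt (dv (spL L i) (look V) (pair (pfst w) (psnd w)))
      (dv (spL L i) (look V) (pair (look V (pair (tag i M) (psnd w))) (psnd w))) ->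
  viol (spL L) i V (pfst w) (psnd w).
Proof.
move=> w h lt; split=> //.
- have [_] := h _ (or_intror (or_intror (or_introl erefl))); by rewrite ev_osnd.
- have := treg_tsubst (h _ (or_introl erefl)); rewrite /cert; congr treg.
  by apply/funext => j; rewrite ev_opair ev_ofst ev_osnd.
- have := treg_tsubst (h _ (or_intror (or_introl erefl))); rewrite /cert; congr treg.
  by apply/funext => j; rewrite ev_opair ev_osnd /= /orc ev_osnd.
Qed.
End OraclePairs.

Fixpoint choose (l : seq (F2 * F2)) (M : pvm) (x V : M) : M :=
  if l is tf :: l then ite (tf.1 M x V = mZ) (tf.2 M x V) (choose l x V) else mZ.

Lemma def_choose l : (forall tf, List.In tf l -> def2 tf.1 /\ def2 tf.2) -> def2 (choose l).
Proof.
elim: l => [|tf l IH] h; first by rewrite /choose; fdt.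
have [d1 d2] := h tf (or_introl erefl); have d3 := IH (fun j jl => h j (or_intror jl)).
by rewrite /=; fdt.
Qed.

Lemma chooseP l (Q : forall M : pvm, M -> M -> M -> Prop) (M : pvm) (x V : M) :
  (forall tf, List.In tf l -> tf.1 M x V = mZ -> Q M x V (tf.2 M x V)) ->
  (exists2 tf, List.In tf l & tf.1 M x V = mZ) -> Q M x V (choose l x V).
Proof.
elim: l => [|tf l IH] h /= [j]; first by [].
case: (pselect (tf.1 M x V = mZ)) => e; first by rewrite iteT // => _ _; apply: h => //; left.
by rewrite iteF // => -[<-//|jl ej]; apply: IH; [move=> j' h'; apply: h; right|exists j].
Qed.

(** For arbitrary oracle functions, some element solves [B] or some pair refutes an answer;
    Herbrand's theorem confines these witnesses to finitely many terms. A straight-line program asks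
    what is required to check every possible refutation, and [choose] outputs the first candidate
    that passes its test. *)
Lemma oracle_sLS (B : R2) L : rel2 B -> Lok L ->
  (forall (M : pvm) (F : M -> M), nov L F -> forall x : M, exists y, B M x y) -> sLS B.
Proof.
move=> dB okL H; have [CB dCB CBE] := rel2_char dB; have [C dC CE] := rel2_char (@rel_olt P).
have [tp tpE] := def_pair; have [tf tfE] := def_pfst; have [ts tsE] := def_psnd.
pose T : nat -> Prop := fun=> True; pose J := option 'I_(size L).
pose (Gj := fun (j : J) (M : pvm) (F : M -> M) (z : 'I_2 -> M) =>
  let w := z (v0 1) in
  if j is Some i then C M (dv (spL L i) F (pair (pfst w) (psnd w)))
                         (dv (spL L i) F (pair (F (pair (tag i M) (psnd w))) (psnd w)))
  else CB M (z (v1 0)) w).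
have dGj j : ofd T (Gj j).
  have dw f : def1 f -> @ofd T 2 (fun M F z => f M (z (v0 1))) by move=> df; apply: ofd_app1 => //; exact: ofd_var.
  case: j => [i|]; rewrite /Gj; last by apply: ofd_app2 => //; exact: ofd_var.
  have dd G : @ofd T 2 G -> ofd T (fun M F z => dv (spL L i) F (G M F z)).
    move=> dG; apply: (@ofd_comp T 1 2 (fun M F p => dv (spL L i) F (p ord0)) (fun _ => G)) => //.
    exists (sd (spL L i)); first exact: oidxT.
    by move=> M F p; rewrite /dv; congr ev; apply/funext => q; rewrite (ord1 q).
  apply: ofd_app2 => //; apply: dd; apply: (@ofd_app2 _ pair); try exact: def_pair; try (apply: dw; first [exact: def_pfst|exact: def_psnd]).
  by apply: ofd_orc => //; apply: dw; exact: def_psnd.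
have /choice[pt ptE] : forall j, exists t : oterm 2, forall (M : pvm) (F : M -> M) z, ev (M := oS F) z t = Gj j M F z.
  by move=> j; have [t _ e] := dGj j; exists t.
pose psi j : oform 2 := feq (pt j) (tmap (@o_base pvsym nat) tZ).
have [||l Hl] := @herbrand pvsym nat J PV psi PV_universal.
- by [].
- move=> M0 f x0 hM; pose M := Pvm hM.
  (* Any family of oracle functions arises from a single function on tagged queries; its values at
     other queries are immaterial. *)
  pose F (q : M) : M := if pselect (exists i, pfst q = tag i M) is left h then f (sval (cid h)) (psnd q) else q.
  have eF : orc id F = f.
    apply/funext => i; apply/funext => a; rewrite /orc /F psndE pfstE; case: pselect => [h|[]]; last by exists i.
    by case: cid => /= i' e; rewrite (@tag_inj M i i' e).
  have zE y : tnth [tuple y; x0] = scons y (scons x0 (@env0 M)) by exact: tnth2E.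
  suff [j [y e]] : exists j y, Gj j M F (scons y (scons x0 (@env0 M))) = mZ.
    exists j, y; rewrite /psi; cbn [sat]; rewrite ev_obase (ev_tZ (M := M)) zE -eF.
    by have := ptE j M F (scons y (scons x0 (@env0 M))); rewrite e.
  case: (pselect (nov L F)) => [/H/(_ x0)[y hy]|nn].
    by exists None, y; rewrite /Gj !scE; apply/CBE.
  move/existsNP: nn => [i /not_implyP[li /existsNP[u /existsNP[s /contrapT hv]]]].
  exists (Some (Ordinal li)), (pair u s); rewrite /Gj !scE pfstE psndE; exact: (proj1 (CE M _ _) hv).
pose jn (jt : J * oterm 1) : option nat * oterm 1 := (omap val jt.1, jt.2).
pose test (jt : J * oterm 1) : F2 := fun M x V => ev (M := oS (look V)) (fun _ => x) (tsubst (tnth [tuple jt.2; tvar ord0]) (pt jt.1)).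
have testE jt (M : pvm) (x V : M) : test jt M x V = Gj jt.1 M (look V) (scons (ev (M := oS (look V)) (fun _ => x) jt.2) (scons x (@env0 M))).
  rewrite /test ev_tsubst (tnth_comp2 (ev (M := oS (look V)) (fun _ => x))) tnth2E.
  exact: ptE.
have dtest jt : def2 (test jt) by rewrite /def2; apply: (@fd_app2 _ _ _ _ (def_oev _)); fdt.
pose tns := flatten [seq needs tp tf ts L (jn jt) | jt <- l].
pose qs := flatten [seq qof t | t <- tns].
have [m hm] := index_bound qs.
pose cl := [seq (test jt, outp (jn jt)) | jt <- l].
(* The number of oracles exceeds both the indices that are queried and those, below [size L], whose
   answers may be refuted. *)
apply: (@ils_sLS P (spL L) B okL (maxn (size L) m) dB).
apply: (@straight_ils P (spL L) B _ qs (choose cl)).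
- by apply: qsdef_flatten => t; exact: qsdef_qof.
- by move=> ih /hm h; rewrite leq_max h orbT.
- apply: def_choose => tf' /List.in_map_iff[jt [<- _]]; split; [exact: dtest|exact: def_outp].
- move=> M x V oV r.
  have tr t : List.In t tns -> treg V (fun _ => x) t.
    by move=> ht; have [W1 [W2 [r1 e1]]] := runs_flatten r ht; apply: qof_treg r1 e1.
  apply: (@chooseP cl (fun M x V o => good (spL L) B (maxn (size L) m) V x o)).
    move=> tf' /List.in_map_iff[jt [<- jl]] /=; rewrite testE.
    have trj t : List.In t (needs tp tf ts L (jn jt)) -> treg V (fun _ => x) t.
      move=> ht; apply: tr; rewrite /tns; elim: (l) jl => //= a l' IH [ea|jl]; apply/List.in_app_iff; [by left; rewrite ea|right].
      exact: IH.
    case: jt {jl} trj => [[i|] t] trj; rewrite /Gj !scE /= /outp /= => e; last first.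
      by left; rewrite pfstE psndE; split=> //; apply/CBE.
    right; exists i; first by rewrite leq_max ltn_ord.
    rewrite !(pfstE, psndE); split=> //; apply: (needs_viol tpE tfE tsE trj); exact/CE.
  have [jt jl] := Hl M (orc id (look V)) x (pvmP (p := M)).
  rewrite /psi; cbn [sat]; rewrite ev_obase (ev_tZ (M := M)) => e.
  exists (test jt, outp (jn jt)); first by apply/List.in_map_iff; exists jt.
  by rewrite /= testE -ptE -tnth2E.
Qed.
End Elimination.

(** * Search problems and local search programs *)

Lemma fcat_comp T U m n (h : T -> U) (f : 'I_m -> T) (g : 'I_n -> T) :
  (fun i => h (fcat f g i)) = fcat (fun i => h (f i)) (fun i => h (g i)).
Proof. by apply/funext => i; rewrite /fcat; case: split. Qed.

Lemma fcatl T m n (f : 'I_m -> T) (g : 'I_n -> T) i : fcat f g (lshift n i) = f i.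
Proof. by rewrite /fcat -[lshift n i]/(unsplit (inl i)) unsplitK. Qed.

Lemma fcatr T m n (f : 'I_m -> T) (g : 'I_n -> T) i : fcat f g (rshift m i) = g i.
Proof. by rewrite /fcat -[rshift m i]/(unsplit (inr i)) unsplitK. Qed.

Definition fdv m n (e : forall M : pvm, ('I_m -> M) -> 'I_n -> M) := forall i, fd (fun M x => e M x i).

Lemma fdv_scons m n F (e : forall M : pvm, ('I_m -> M) -> 'I_n -> M) : fd F -> fdv e ->
  fdv (fun M x => scons (F M x) (e M x)).
Proof.
move=> dF de i; case: (unliftP ord0 i) => [j|] ->.
  by apply: fd_ext (de j) => M x; rewrite sconsS.
by apply: fd_ext dF => M x; rewrite scons0.
Qed.

Lemma fdv_fcat m n k (e : forall M : pvm, ('I_m -> M) -> 'I_n -> M) (e' : forall M : pvm, ('I_m -> M) -> 'I_k -> M) :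
  fdv e -> fdv e' -> fdv (fun M x => fcat (e M x) (e' M x)).
Proof. by move=> de de' i; rewrite /fcat; case: split. Qed.

Lemma fdv_prj m n F : @fd m F -> @fdv m n (fun M x i => prj i (F M x)).
Proof. by move=> dF i; apply: fd_app1 => //; exact: def_prj. Qed.

Lemma fd_ev m n (e : forall M : pvm, ('I_m -> M) -> 'I_n -> M) t : fdv e -> fd (fun M x => ev (M := M) (e M x) t).
Proof.
move=> /choice[s sE]; exists (tsubst s t) => M x; rewrite ev_tsubst; congr ev.
by apply/funext => i; rewrite sE.
Qed.

Lemma pd_sat m n (e : forall M : pvm, ('I_m -> M) -> 'I_n -> M) (A : pvform n) : qf A -> fdv e ->
  pd (fun M x => sat (M := M) A (e M x)).
Proof.
move=> qA /choice[s sE]; exists (fsubst A s); first exact: qf_fsubst.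
move=> M x; rewrite sat_fsubst (_ : (fun i => _) = e M x) //.
by apply/funext => i; rewrite sE.
Qed.

Lemma PV_qf n (A : pvform n) : qf A -> (forall (M : pvm) x, sat (M := M) A x) -> PV |- A.
Proof.
move=> qA H; apply: qf_completeness => //; first exact: PV_universal.
by move=> M hM x; apply: (H (Pvm hM)).
Qed.

Lemma sat_impE S (M : struct S) n (A B : formula S n) (x : 'I_n -> M) :
  sat (fimp A B) x = (sat A x -> sat B x).
Proof. by []. Qed.

Section Conversion.
Context {P : ptrep}.
Variables (n m : nat) (A : pvform (m + n)).
Hypothesis qA : qf A.

(** [prj] decodes every element, so inputs and outputs range over all elements, without a condition
    of being a code. *)
Definition coded (M : pvm) (x y : M) :=
  sat (M := M) A (fcat (fun j : 'I_m => prj j y) (fun i : 'I_n => prj i x)).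

Lemma rel_coded : rel2 coded.
Proof. by apply: pd_sat => //; apply: fdv_fcat; apply: fdv_prj; exact: fd_var. Qed.

Lemma provable_sLS : PA_TI oO |- alls (exs A) -> sLS coded.
Proof.
move=> /theorem_ok[L okL H]; apply: (oracle_sLS rel_coded okL) => M F hn x.
have := H M F hn (@env0 M) => /sat_alls/(_ (fun i => prj i x))/sat_exs[y hy].
exists (enc y); rewrite /coded; move: hy; congr (sat _ (fcat _ _)).
by apply/funext => j; rewrite prjE.
Qed.

Lemma sLS_program : sLS coded -> exists2 beta, in_dom oO beta & inhabited (LS_program oO beta A).
Proof.
move=> [b [i [G [q [N [p [[c hc bE] [di dG dq dN dp] H]]]]]]]; exists c => //.
pose C := (1 + n).+1; pose zi : 'I_C := lift ord0 (lshift n ord0).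
pose (X := fun (M : pvm) (y : 'I_C -> M) => enc (fun j : 'I_n => y (lift ord0 (rshift 1 j)))).
have dX : fd X by apply: fd_enc => j; exact: fd_var.
(* A program must descend from every state, even where its invariant fails; there [q] is replaced by
   zero. *)
pose (q' := fun (M : pvm) (g z x : M) => ite (odom (q M g z x) /\ olt (q M g z x) g) (q M g z x) (ozero M)).
have dq' : def3 q' by rewrite /q'; fdt.
have dv (j : 'I_C) : fd (fun M y => y j) by exact: fd_var.
have [Gf qG GE] := pd_app3 dG (dv ord0) (dv zi) dX.
have [tN NE] := fd_app3 dN (dv ord0) (dv zi) dX.
have [tq qE] := fd_app3 dq' (dv ord0) (dv zi) dX.
have dx : @fd n (fun M x => enc x) by apply: (@fd_enc n n (fun j M x => x j)) => j; exact: fd_var.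
have [ti iE] := fd_app1 di dx.
have /choice[tp pE] : forall j : 'I_m, exists t : pvterm (1 + n), forall (M : pvm) y,
    ev (M := M) y t = prj j (p M (y (lshift n ord0)) (enc (fun i => y (rshift 1 i)))).
  move=> j; apply: (fd_app1 (def_prj j)); apply: (fd_app2 dp); first exact: fd_var.
  by apply: fd_enc => l; exact: fd_var.
have qD k (t : pvterm k) : qf (Dom oO t) by apply: qf_fsubst; exact: rep_dom_qf orep.
have qL k (t u : pvterm k) : qf (Lt oO t u) by apply: qf_fsubst; exact: rep_lt_qf orep.
have eX (M : pvm) (g z : M) (x : 'I_n -> M) : [/\ scons g (fcat (fun _ : 'I_1 => z) x) zi = z,
    X M (scons g (fcat (fun _ : 'I_1 => z) x)) = enc x & scons g (fcat (fun _ : 'I_1 => z) x) ord0 = g].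
  split; rewrite ?scons0 // /zi ?sconsS ?fcatl //.
  by congr enc; apply/funext => j; rewrite sconsS fcatr.
constructor; apply: (@LSProgram oO c n m A 1 (fun _ => ti) Gf (fun _ => tN) tq tp qG).
- apply: PV_qf => [|M x]; first exact: qf_fsubst.
  rewrite sat_fsubst (scons_comp (ev (M := M) x)) (fcat_comp (ev (M := M) x)) ev_num iE GE.
  have [-> -> ->] := eX M (mnum c M) (i M (enc x)) x.
  by rewrite -bE; have [] := H M (enc x).
- apply: PV_qf => [|M y]; first by do ![split=> //].
  rewrite sat_impE sat_impE DomE sat_neg sat_and DomE LtE qE; cbn [sat]; cbn [ev]; rewrite ZeroE /q' => dg nz.
  set qq := q M _ _ _; case: (pselect (odom qq /\ olt qq (y ord0))) => h; [rewrite iteT //|rewrite iteF //].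
  by split; [exact: dom0|exact: olt_nz].
- apply: PV_qf => [|M y]; first by do ![split=> //]; exact: qf_fsubst.
  rewrite sat_impE sat_impE DomE sat_neg sat_impE; cbn [sat]; cbn [ev]; rewrite ZeroE GE => dg nz hG.
  rewrite sat_fsubst (scons_comp (ev (M := M) y)) (fcat_comp (ev (M := M) y)) qE NE GE.
  have [-> -> ->] := eX M (q' M (y ord0) (y zi) (X M y)) (N M (y ord0) (y zi) (X M y)) (fun j => y (lift ord0 (rshift 1 j))).
  have [_ h _] := H M (X M y); have [h1 h2 h3] := h _ _ dg nz hG.
  by rewrite /q' iteT.
- apply: PV_qf => [|M y]; first by split; exact: qf_fsubst.
  rewrite sat_impE !sat_fsubst (scons_comp (ev (M := M) y)) ZeroE GE (fcat_comp (ev (M := M) y)).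
  rewrite (_ : X M _ = enc (fun j => y (rshift 1 j))); last by congr enc; apply/funext => j; rewrite sconsS.
  rewrite /zi sconsS scons0 => hG; have [_ _ /(_ _ hG)] := H M (enc (fun j => y (rshift 1 j))).
  rewrite /coded; congr (sat A (fcat _ _)); apply/funext => j; first by rewrite pE.
  by rewrite prjE.
Qed.

Lemma program_sLS beta : in_dom oO beta -> LS_program oO beta A -> sLS coded.
Proof.
move=> hb [k i G N q p qG h1 h2 h3 h4].
pose (e := fun (M : pvm) (g z x : M) => scons g (fcat (fun j : 'I_k => prj j z) (fun j : 'I_n => prj j x))).
have de : fdv (fun (M : pvm) (y : 'I_3 -> M) => e M (y (v0 2)) (y (v1 1)) (y (v2 0))).
  by apply: fdv_scons; [exact: fd_var|apply: fdv_fcat; apply: fdv_prj; exact: fd_var].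
exists (fun M => mnum beta M), (fun (M : pvm) (x : M) => enc (fun j => ev (M := M) (fun l => prj l x) (i j))),
  (fun (M : pvm) (g z x : M) => sat (M := M) G (e M g z x)), (fun (M : pvm) (g z x : M) => ev (M := M) (e M g z x) q),
  (fun (M : pvm) (g z x : M) => enc (fun j => ev (M := M) (e M g z x) (N j))),
  (fun (M : pvm) (z x : M) => enc (fun j => ev (M := M) (fcat (fun j : 'I_k => prj j z) (fun j : 'I_n => prj j x)) (p j))).
split; first by exists beta.
  split.
  - by apply: fd_enc => j; apply: fd_ev; apply: fdv_prj; exact: fd_var.
  - exact: pd_sat.
  - exact: fd_ev.
  - by apply: fd_enc => j; apply: fd_ev.
  - by apply: fd_enc => j; apply: fd_ev; apply: fdv_fcat; apply: fdv_prj; exact: fd_var.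
move=> M x; pose px := fun l : 'I_n => prj l x; split.
- have := PV_sound h1 px; rewrite sat_fsubst (scons_comp (ev (M := M) px)) (fcat_comp (ev (M := M) px)) ev_num /e.
  congr (sat G (scons _ (fcat _ _))); apply/funext => j; by rewrite prjE.
- move=> g z dg nz hG; set y := e M g z x; have y0 : y ord0 = g by rewrite /y /e scons0.
  have H2 := PV_sound h2 y; have H3 := PV_sound h3 y.
  have dy : sat (M := M) (Dom oO (tvar ord0)) y by rewrite DomE; cbn [ev]; rewrite y0.
  have ny : sat (M := M) (fneg (feq (tvar ord0) (Zero oO _))) y.
    by rewrite sat_neg; cbn [sat]; rewrite ZeroE; cbn [ev]; rewrite y0.
  have := sat_imp (sat_imp H2 dy) ny; rewrite sat_and DomE LtE; cbn [ev]; rewrite y0 => -[k1 k2]; split=> //.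
  have := sat_imp (sat_imp (sat_imp H3 dy) ny) hG.
  rewrite sat_fsubst (scons_comp (ev (M := M) y)) (fcat_comp (ev (M := M) y)) /e.
  congr (sat G (scons _ (fcat _ _))); apply/funext => j; first by rewrite prjE.
  by cbn [ev]; rewrite /y /e sconsS fcatr.
- move=> z hG; pose y := fcat (fun j : 'I_k => prj j z) px.
  have := PV_sound h4 y; rewrite sat_impE !sat_fsubst (scons_comp (ev (M := M) y)) ZeroE => /(_ hG).
  rewrite (fcat_comp (ev (M := M) y)) /coded; congr (sat A (fcat _ _)); apply/funext => j; first by rewrite prjE.
  by cbn [ev]; rewrite /y fcatr.
Qed.
End Conversion.

(** * Provability of the totality of local search *)

Section Derivations.
Variables (S : nat -> Type) (T : formula S 0 -> Prop).

Lemma prov_gen n (A : formula S n) : T |- A -> T |- alls A.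
Proof. by elim: n A => //= n IH A d; apply: IH; apply: prov_allI. Qed.

Lemma prov_subst n (G : seq (formula S n)) A m (s : 'I_n -> term S m) :
  prov T G A -> prov T (map (fun B => fsubst B s) G) (fsubst A s).
Proof.
have inst_s k l (X : formula S k.+1) t (r : 'I_k -> term S l) :
    fsubst (inst X t) r = inst (fsubst X (up r)) (tsubst r t).
  by rewrite inst_up /inst fsubst_comp; congr fsubst; rewrite scons_comp.
move=> d; elim: d m s => {n G A}.
- move=> n G A TA m s; rewrite /fwk fsubst_comp (env0E (fun i => _) (tnth [tuple])); exact: prov_thy.
- by move=> n G A h m s; apply: prov_hyp; exact: (List.in_map (fun B => fsubst B s) _ _ h).
- by move=> n G A B _ IH m s; apply: prov_impI; apply: IH.
- by move=> n G A B _ IH _ IH' m s; apply: prov_impE (IH m s) (IH' m s).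
- by move=> n G A _ IH m s; apply: prov_raa; apply: IH.
- move=> n G A _ IH m s; apply: prov_allI; move: (IH _ (up s)); congr prov.
  rewrite -!map_comp; apply: eq_map => B /=; rewrite /fshift !fsubst_comp; congr fsubst.
  by apply/funext => i; rewrite /= /up sconsS.
- by move=> n G A t _ IH m s; rewrite inst_s; apply: prov_allE; apply: IH.
- by move=> n G t m s; apply: prov_refl.
- move=> n G A t u _ IH _ IH' m s; move: (IH m s) (IH' m s); rewrite !inst_s; exact: prov_eq.
Qed.

Lemma prov_exI n (G : seq (formula S n)) A t : prov T G (inst A t) -> prov T G (fex A).
Proof.
move=> d; apply: prov_impI; apply: prov_impE (prov_wk _ d).
exact: (prov_allE t (prov_hyp0 _ _ _)).
Qed.

Lemma prov_exsI m n k (G : seq (formula S k)) (A : formula S (m + n)) (s : 'I_m -> term S k) r :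
  prov T G (fsubst A (fcat s r)) -> prov T G (fsubst (exs A) r).
Proof.
elim: m A s => [|m IH] A s; first by rewrite fcat0.
rewrite fcatS => d; apply: (IH (fex A) (fun j => s (lift ord0 j))).
by apply: (@prov_exI _ _ (fsubst A (up _)) (s ord0)); rewrite inst_up.
Qed.
End Derivations.

Lemma sat_up S (M : struct S) n k (X : formula S n.+1) (s : 'I_n -> term S k) a (y : 'I_k -> M) :
  sat (fsubst X (up s)) (scons a y) <-> sat X (scons a (fun i => ev y (s i))).
Proof. by rewrite sat_fsubst ev_up. Qed.

Lemma ev_sh S (M : struct S) n a (y : 'I_n -> M) :
  (fun i => ev (scons a y) (tvar (S := S) (lift ord0 i))) = y.
Proof. by apply/funext => i; exact: sconsS. Qed.

Section LocalSearchProvable.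
Context {P : ptrep}.
Let T := PA_TI oO.

Lemma PA_qf n (G : seq (pvform n)) (A : pvform n) : qf A -> (forall (M : pvm) x, sat (M := M) A x) -> prov T G A.
Proof.
move=> qA H; apply: (@prov_weak _ _ _ [::]) => //; apply: prov_mono (PV_qf qA H).
by move=> B hB; left; apply: PA_PV.
Qed.

(* Transfinite induction on [g] for [forall z, ~ G g z x], under the assumption
   that [x] has no solution. *)
Lemma sLS_provable (B : R2) : rel2 B -> sLS B -> exists By : pvform 2,
  [/\ qf By, (forall (M : pvm) z, sat (M := M) By z <-> B M (z (v1 0)) (z (v0 1))) & T |- fex By].
Proof.
move=> dB [b [i [G [q [N [p [sb [di dG dq dN dp] H]]]]]]].
(* The scheme concludes only about ordinals strictly below its bound, so it is used for [b + 1] in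
   order to reach [b]. *)
have [c hc bE] := sb; have [c' hc' bE'] := std_add sb (@std1 P).
have [By qB ByE] : rel2 (fun M y x => B M x y) by pdt.
(* In this order of the variables, [z] is the one bound in [D], and [g] then becomes the induction
   variable. *)
have [Gz qG GzE] : rel3 (fun M z g x => G M g z x) by pdt.
have [tq tqE] : def3 (fun M z g x => q M g z x) by fdt.
have [tN tNE] : def3 (fun M z g x => N M g z x) by fdt.
have [tp tpE] : def3 (fun M z g x => p M z x) by fdt.
have [ti tiE] := di.
exists By; split=> //; pose D : pvform 2 := fall (fneg Gz).
have qD k (t : pvterm k) : qf (Dom oO t) by apply: qf_fsubst; exact: rep_dom_qf orep.
have qL k (t u : pvterm k) : qf (Lt oO t u) by apply: qf_fsubst; exact: rep_lt_qf orep.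
pose sh k : 'I_k -> pvterm k.+1 := fun i => tvar (lift ord0 i).
pose rho : 'I_2 -> pvterm 3 := scons (v 0) (fun i => tvar (lift ord0 (lift ord0 i))).
pose HB : pvform 1 := fall (fneg By).
pose (dm := Dom oO (v 0) : pvform 2); pose (lm := Lt oO (v 0) (num c') : pvform 2).
pose (IH := fall (fimp (Dom oO (v 0)) (fimp (Lt oO (v 0) (v 1)) (fsubst D rho))) : pvform 2).
have ax : prov T [:: HB] (ti_formula oO c' D).
  suff axE (F : pvform 1) : T (alls F) -> prov T [:: HB] F by apply: axE; right; exists c'.
  by move=> TF; rewrite -[F]fsubst_id; apply: prov_alls; apply: prov_thy.
have prog : prov T [:: HB] (fall (fimp dm (fimp lm (fimp IH D)))).
  apply: prov_allI; do 3 apply: prov_impI; apply: prov_allI; apply: prov_impI.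
  set Ga := (_ :: _ : seq (pvform 3)).
  have hG : prov T Ga Gz by apply: prov_hyp; left.
  have hI : prov T Ga (fshift IH) by apply: prov_hyp; right; left.
  have hd : prov T Ga (fshift dm) by apply: prov_hyp; do 3 right; left.
  have hH : prov T Ga (fshift (fshift HB)) by apply: prov_hyp; do 4 right; left.
  pose Y := inst (fsubst (fsubst By (up (@sh 1))) (up (@sh 2))) tp.
  have hY : prov T Ga (fneg Y) := prov_allE tp hH.
  pose (d1 := inst (fsubst (Dom oO (v 0)) (up (@sh 2))) tq).
  pose (l1 := inst (fsubst (Lt oO (v 0) (v 1)) (up (@sh 2))) tq).
  have hq : prov T Ga (fimp d1 (fimp l1 (inst (fsubst (fsubst D rho) (up (@sh 2))) tq))) := prov_allE tq hI.
  pose g1 := inst (fsubst (fsubst (fsubst Gz (up rho)) (up (up (@sh 2)))) (up (scons tq tvar))) tN.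
  have hg : prov T Ga (fimp d1 (fimp l1 (fneg g1))).
    do 2 apply: prov_impI.
    have hh : prov T (l1 :: d1 :: Ga) (inst (fsubst (fsubst D rho) (up (@sh 2))) tq).
      by apply: prov_impE (prov_hyp0 _ _ _); apply: prov_impE (prov_hyp1 _ _ _ _); do 2 apply: prov_wk.
    exact: (prov_allE tN hh).
  (* All quantified assumptions have been instantiated by terms for the next ordinal, the next state
     and the output. What remains is an open implication, which is derivable because it holds in all
     models of PV. *)
  suff hf : prov T Ga (fimp (fshift dm) (fimp Gz (fimp (fimp d1 (fimp l1 (fneg g1))) (fimp (fneg Y) fbot)))).
    exact: prov_impE (prov_impE (prov_impE (prov_impE hf hd) hG) hg) hY.
  apply: PA_qf => [|M y].
    have q1 : qf (fshift dm) by apply: qf_fsubst; exact: qD.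
    have q2 : qf d1 by do 2 apply: qf_fsubst; exact: qD.
    have q3 : qf l1 by do 2 apply: qf_fsubst; exact: qL.
    have q4 : qf g1 by do 4 apply: qf_fsubst.
    have q5 : qf Y by do 3 apply: qf_fsubst.
    by do ![split].
  rewrite -(scons_eta y); move: (y ord0) (fun j => y (lift ord0 j)) => z {}y.
  rewrite -(scons_eta y); move: (y ord0) (fun j => y (lift ord0 j)) => g {}y.
  rewrite -(scons_eta y); move: (y ord0) (fun j => y (lift ord0 j)) => x {}y.
  set w := scons z _.
  have etq : ev (M := M) w tq = q M g z x by rewrite tqE /w !scE.
  have etN : ev (M := M) w tN = N M g z x by rewrite tNE /w !scE.
  have etp : ev (M := M) w tp = p M z x by rewrite tpE /w !scE.
  have e1 : sat (M := M) (fshift dm) w <-> odom g by rewrite /w sat_fshift DomE v0E.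
  have e2 : sat (M := M) Gz w <-> G M g z x by rewrite GzE /w !scE.
  have e3 : sat (M := M) d1 w <-> odom (q M g z x) by rewrite sat_inst sat_up DomE v0E etq.
  have e4 : sat (M := M) l1 w <-> olt (q M g z x) g by rewrite sat_inst sat_up LtE v0E etq /w ev_sh v1E.
  have e5 : sat (M := M) Y w <-> B M x (p M z x).
    by rewrite sat_inst sat_up etp /w ev_sh sat_up ev_sh ByE !scE.
  have e6 : sat (M := M) g1 w <-> G M (q M g z x) (N M g z x) x.
    rewrite sat_inst sat_up (scons_comp (ev (M := M) w)) etN etq (_ : (fun i => ev w (tvar i)) = w) //.
    rewrite sat_fsubst ev_up ev_up /w ev_sh sat_up /rho (scons_comp (ev (M := M) _)) v0E GzE !scE.
    by cbn [ev]; rewrite !sconsS scons0.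
  cbn [sat fneg]; rewrite e1 e2 e3 e4 e5 e6 => dg hGg hg' nB.
  have [_ h2 h3] := H M x; case: (pselect (g = ozero M)) => [e|nz].
    by apply: nB; apply: h3; rewrite -e.
  by have [k1 k2 k3] := h2 g z dg nz hGg; apply: hg'.
apply: prov_impI.
have hD : prov T [:: HB] (fimp (inst dm (num c)) (fimp (inst lm (num c)) (inst D (num c)))) :=
  prov_allE (num c) (prov_impE ax prog).
have h1 : prov T [:: HB] (inst dm (num c)).
  apply: PA_qf => [|M x]; first by apply: qf_fsubst; exact: qD.
  by rewrite sat_inst DomE v0E ev_num -bE; apply: std_dom.
have h2 : prov T [:: HB] (inst lm (num c)).
  apply: PA_qf => [|M x]; first by apply: qf_fsubst; exact: qL.
  rewrite sat_inst LtE v0E !ev_num -bE -bE'; apply: olt_add1; exact: std_dom.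
pose g0 := inst (fsubst Gz (up (scons (num c) tvar))) ti.
have h3 : prov T [:: HB] (fneg g0) := prov_allE ti (prov_impE (prov_impE hD h1) h2).
apply: prov_impE h3 _; apply: PA_qf => [|M x]; first by do 2 apply: qf_fsubst.
rewrite sat_inst sat_up (scons_comp (ev (M := M) x)) ev_num -bE GzE !scE tiE.
rewrite /v2 !sconsS; cbn [ev].
by have [] := H M (x (v0 0)).
Qed.

(** [By] speaks about codes: its input is replaced by a term for [enc x], and the outputs are the
    projections of its single witness. *)
Lemma sLS_total n m (A : pvform (m + n)) : qf A -> sLS (coded A) -> T |- alls (exs A).
Proof.
move=> qA sA; have [By [qB ByE d]] := sLS_provable (rel_coded qA) sA; apply: prov_gen.
have dx : @fd n (fun M x => enc x) by apply: (@fd_enc n n (fun j M x => x j)) => j; exact: fd_var.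
have [tx txE] := dx; have /choice[tj tjE] := fun j : 'I_m => def_prj j.
pose sh : 'I_n -> pvterm n.+1 := fun i => tvar (lift ord0 i).
apply: prov_raa; set nA := fneg (exs A).
have hx : prov T [:: nA] (fneg (fall (fneg (fsubst By (up (fun _ => tx)))))).
  by apply: (@prov_weak _ _ _ [::]) => //; exact: (prov_subst (fun _ => tx) d).
apply: prov_impE hx _; apply: prov_allI; apply: prov_impI.
set X := fsubst By _; have hA : prov T [:: X; fshift nA] (fneg (fsubst (exs A) sh)) by apply: prov_hyp1.
apply: prov_impE hA _; apply: (@prov_exsI _ _ _ _ _ _ _ (fun j => tsubst (fun _ => tvar ord0) (tj j))).
apply: prov_impE (prov_hyp0 _ _ _); apply: PA_qf => [|M y]; first by split; exact: qf_fsubst.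
rewrite -(scons_eta y) sat_impE sat_up ByE scE /v1 sconsS txE /coded sat_fsubst (fcat_comp (ev (M := M) _)).
rewrite ev_sh; move: (y ord0) (fun j => y (lift ord0 j)) => a {}y.
congr (sat A (fcat _ _)); apply/funext => j; last by rewrite prjE.
by rewrite ev_tsubst tjE; cbn [ev]; rewrite scons0.
Qed.
End LocalSearchProvable.

Theorem theorem4p16 (alpha : wellorder) (O : ordtuple) :
  ptime_representation O alpha ->
  (forall (n m : nat) (A : pvform (m + n)),
     TSP (PA_TI O) A <-> exists2 beta : nat, in_dom O beta & LS O beta A) /\
  (forall (n m : nat) (A : pvform (m + n)),
     TFNP (PA_TI O) A <-> exists2 beta : nat, in_dom O beta & PLS O beta A).
Proof.
move=> rep; pose P := Ptrep rep.
have main n m (A : pvform (m + n)) : TSP (PA_TI O) A <-> exists2 beta, in_dom O beta & LS O beta A.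
  split=> [[qA d]|[beta hb [qA [prg]]]].
    by have [beta hb h] := sLS_program qA (@provable_sLS P n m A qA d); exists beta.
  by split=> //; apply: (@sLS_total P) => //; apply: program_sLS hb prg.
split=> // n m A; split=> [[[qA d] bd]|[beta hb [ls [_ bd]]]]; last by split=> //; apply/main; exists beta.
have [beta hb ls] := proj1 (main n m A) (conj qA d); exists beta => //; split=> //; split=> //; split=> //.
(* The bounds on the outputs are common to both classes, so only totality in the standard model is
   left to show. *)
have tot (x : 'I_n -> natM) : exists y : 'I_m -> natM, sat (M := natM) A (fcat y x).
  have [y hy] := @K_natM P _ (@rel_coded n m A qA) (@provable_sLS P n m A qA d) (enc x).
  exists (fun j => prj j y); move: hy; rewrite /coded; congr (sat A (fcat _ _)).
  by apply/funext => j; rewrite prjE.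
rewrite -[alls (exs A)]fsubst_id (env0E tvar (tnth [tuple])); apply: prov_thy.
rewrite /ThN holdsE; apply/sat_alls => x; apply/sat_exs; exact: tot.
Qed.
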